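(* Let $M$ be a simply-connected smooth $n$-manifold, let $g$ be a complete Riemannian metric on $M$, and let $\eta$ be a closed non-zero $1$-form on $M$ which is parallel with respect to $g$, i.e. $\nabla\eta=0$, where $\nabla$ is the Levi-Civita connection of $g$. Then for every $0\leq k\leq n$ the space $\mathcal{H}^{k}_{(2)}(M)$ of $L^{2}$-harmonic $k$-forms on $(M,g)$ is trivial, i.e. $\mathcal{H}^{k}_{(2)}(M)=\{0\}$.
   Context: Simply-connected manifolds are in particular connected. $\Omega^{k}(M)$ denotes the smooth real $k$-forms on $M$, and $\Omega^{k}_{(2)}(M)=\{\alpha\in\Omega^{k}(M):\int_{M}|\alpha|^{2}\,d\mathrm{Vol}<\infty\}$, with pointwise norm and volume induced by $g$. $d$ is the exterior derivative and $\delta:\Omega^{k+1}(M)\to\Omega^{k}(M)$ its formal adjoint with respect to the $L^2$ inner product of $g$. The space of $L^2$-harmonic $k$-forms is $$\mathcal{H}^{k}_{(2)}(M)=\{\alpha\in\Omega^{k}_{(2)}(M): d\alpha=0,\ \delta\alpha=0\}.$$ *)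

(* Defs.v *)
(* Smooth manifolds, differential forms and Riemannian geometry in classical
   tensor calculus: a tensor field is a family of component functions, one for
   each chart of an atlas, subject to the usual transformation law on overlaps
   of charts. *)
From HB Require Import structures.
From mathcomp Require Import all_boot all_order all_algebra all_fingroup.
From mathcomp Require Import all_classical all_reals all_analysis.

Set Implicit Arguments.
Unset Strict Implicit.
Unset Printing Implicit Defensive.

Import Order.TTheory GRing.Theory Num.Theory.
Import numFieldNormedType.Exports.

Local Open Scope classical_set_scope.
Local Open Scope ring_scope.

Section calculus_on_Rn.
Context {R : realType} {n : nat}.

Definition partial (l : 'I_n) (f : 'rV[R]_n -> R) : 'rV[R]_n -> R :=
  fun x => 'D_(delta_mx 0 l) f x.

Definition iter_partial (s : seq 'I_n) (f : 'rV[R]_n -> R) : 'rV[R]_n -> R :=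
  foldr partial f s.

(* Meant for open U: partial derivatives of every order exist and are
   continuous on U. *)
Definition smooth_on (U : set 'rV[R]_n) (f : 'rV[R]_n -> R) : Prop :=
  forall (s : seq 'I_n) (x : 'rV[R]_n), U x ->
    {for x, continuous (iter_partial s f)} /\
    forall l, derivable (iter_partial s f) x (delta_mx 0 l).

End calculus_on_Rn.

(* Integral over R^n with respect to Lebesgue measure, as an iterated integral;
   only used for nonnegative Borel functions, where Tonelli's theorem makes it
   the integral against n-dimensional Lebesgue measure. *)
Fixpoint integral_Rn {R : realType} (n : nat) : ('rV[R]_n -> \bar R) -> \bar R :=
  match n with
  | 0 => fun f => f 0
  | n'.+1 => fun f =>
      (\int[lebesgue_measure]_(t in [set: R])
         @integral_Rn R n' (fun y : 'rV[R]_n' => f (row_mx (t%:M : 'rV[R]_1) y)))%E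
  end.

(* A smooth n-manifold without boundary, given by a (not necessarily maximal)
   smooth atlas; chart i is the homeomorphism coord i from the open set dom i
   onto an open subset of R^n, with inverse param i. The choice chart_at of a
   chart around each point only serves to write down pointwise quantities that
   do not depend on it. *)
Record smooth_manifold (R : realType) (n : nat) (M : topologicalType) := {
  chart : Type;
  dom : chart -> set M;
  coord : chart -> M -> 'rV[R]_n;
  param : chart -> 'rV[R]_n -> M;
  chart_at : M -> chart;
  mem_chart_at : forall p, dom (chart_at p) p;
  dom_open : forall i, open (dom i);
  image_open : forall i, open (coord i @` dom i);
  coordK : forall i p, dom i p -> param i (coord i p) = p;
  coord_continuous : forall i, {within dom i, continuous (coord i)};
  param_continuous : forall i,
    {within coord i @` dom i, continuous (param i)};
  transition_smooth : forall i j (l : 'I_n),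
    smooth_on (coord i @` (dom i `&` dom j))
              (fun x => coord j (param i x) 0 l);
  manifold_hausdorff : hausdorff_space M;
  manifold_second_countable : @second_countable M
}.

Section manifold.
Context {R : realType} {n : nat} {M : ptopologicalType}.
Variable A : smooth_manifold R n M.

Local Notation chart := (chart A).
Local Notation dom := (@dom _ _ _ A).
Local Notation coord := (@coord _ _ _ A).
Local Notation param := (@param _ _ _ A).
Local Notation chart_at := (@chart_at _ _ _ A).

Definition pderiv (i : chart) (a : 'I_n) (f : M -> R) (p : M) : R :=
  partial a (f \o param i) (coord i p).

Definition smooth_in (i : chart) (f : M -> R) : Prop :=
  smooth_on (coord i @` dom i) (f \o param i).

(* Entry (a, b) is the derivative of the b-th coordinate of chart j along the
   a-th coordinate of chart i. *)
Definition jac (i j : chart) (p : M) : 'M[R]_n :=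
  \matrix_(a < n, b < n) pderiv i a (fun q => coord j q 0 b) p.

(** Differential forms *)

(* w i p I is the component of w at p in the chart i with (not necessarily
   increasing) multi-index I, i.e. the value of w on the coordinate vector
   fields of indices I 0, ..., I (k-1). *)
Definition components (k : nat) := chart -> M -> {ffun 'I_k -> 'I_n} -> R.

Definition zero_form (k : nat) : components k := fun _ _ _ => 0.

(* The components vanish outside the domain of the chart, so that equality of
   forms is equality of components. *)
Definition Omega (k : nat) : set (components k) :=
  [set w | [/\
    (forall i p (I : {ffun 'I_k -> 'I_n}), ~ dom i p -> w i p I = 0),
    (forall i (I : {ffun 'I_k -> 'I_n}), smooth_in i (fun p => w i p I)),
    (forall i p (I : {ffun 'I_k -> 'I_n}) (s : {perm 'I_k}),
       w i p [ffun l => I (s l)] = (-1) ^+ s * w i p I) &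
    (forall i j p (I : {ffun 'I_k -> 'I_n}), dom i p -> dom j p ->
       w i p I = \sum_(J : {ffun 'I_k -> 'I_n})
                   w j p J * \prod_(l < k) jac i j p (I l) (J l))]].

Definition ext_deriv (k : nat) (w : components k) : components k.+1 :=
  fun i p I =>
    if p \in dom i then
      \sum_(l < k.+1) (-1) ^+ l *
        pderiv i (I l) (fun q => w i q [ffun m => I (lift l m)]) p
    else 0.

Definition compactly_supported (k : nat) (w : components k) : Prop :=
  exists2 K : set M, compact K & forall i p I, ~ K p -> w i p I = 0.

(** Riemannian metrics *)

(* g i p is the matrix of the metric in the coordinate frame of the chart i. *)
Definition riemannian_metric (g : chart -> M -> 'M[R]_n) : Prop :=
  [/\ (forall i a b, smooth_in i (fun p => g i p a b)),
      (forall i p, dom i p -> (g i p)^T = g i p),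
      (forall i p (v : 'rV[R]_n), dom i p -> v != 0 ->
         0 < (v *m g i p *m v^T) 0 0) &
      (forall i j p, dom i p -> dom j p ->
         g i p = jac i j p *m g j p *m (jac i j p)^T)].

Variable g : chart -> M -> 'M[R]_n.

(* Christoffel symbols of the Levi-Civita connection; c is the upper index. *)
Definition christoffel (i : chart) (p : M) (c a b : 'I_n) : R :=
  2^-1 * \sum_(e < n) invmx (g i p) c e *
    (pderiv i a (fun q => g i q b e) p + pderiv i b (fun q => g i q a e) p
     - pderiv i e (fun q => g i q a b) p).

Definition nabla (w : components 1) (i : chart) (p : M) (a b : 'I_n) : R :=
  pderiv i a (fun q => w i q [ffun=> b]) p
  - \sum_(c < n) christoffel i p c a b * w i p [ffun=> c].

Definition parallel (w : components 1) : Prop :=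
  forall i p a b, dom i p -> nabla w i p a b = 0.

Definition velocity (c : R -> M) (i : chart) (t : R) : 'rV[R]_n :=
  \row_l derive1 (fun s => coord i (c s) 0 l) t.

Definition C1_curve (c : R -> M) : Prop :=
  continuous c /\
  forall i t l, dom i (c t) ->
    derivable (fun s => coord i (c s) 0 l) t 1 /\
    {for t, continuous (fun s => velocity c i s 0 l)}.

Definition speed (c : R -> M) (t : R) : R :=
  let i := chart_at (c t) in
  let v := velocity c i t in
  Num.sqrt ((v *m g i (c t) *m v^T) 0 0).

Definition length (c : R -> M) : \bar R :=
  (\int[lebesgue_measure]_(t in `[0%R, 1%R]) (speed c t)%:E)%E.

(* A piecewise C^1 curve can be reparametrized so as to come to rest at its
   corners, hence C^1 curves yield the usual Riemannian distance. *)
Definition riemannian_dist (p q : M) : \bar R :=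
  ereal_inf [set length c | c in [set c | [/\ C1_curve c, c 0 = p & c 1 = q]]].

Definition complete_metric : Prop :=
  forall u : nat -> M,
    (forall e : R, 0 < e -> exists N, forall k m, (N <= k)%N -> (N <= m)%N ->
       (riemannian_dist (u k) (u m) < e%:E)%E) ->
    exists p, forall e : R, 0 < e -> exists N, forall k, (N <= k)%N ->
       (riemannian_dist (u k) p < e%:E)%E.

(* The Riemannian volume is the unique Borel measure on M given in every chart
   by the density sqrt (det g) with respect to Lebesgue measure; no orientation
   is involved. *)
Definition riemannian_volume
    (vol : {measure set (g_sigma_algebraType (@open M)) -> \bar R}) : Prop :=
  forall i (B : set (g_sigma_algebraType (@open M))),
    measurable B -> B `<=` dom i ->
    vol B = integral_Rn (fun x : 'rV[R]_n =>
      if x \in coord i @` B then (Num.sqrt (\det (g i (param i x))))%:E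
      else 0%E).

(* The division by k! accounts for summing over all multi-indices: the exterior
   products of an orthonormal coframe are orthonormal. *)
Definition form_dot (k : nat) (v w : components k) (p : M) : R :=
  let i := chart_at p in
  (k`!%:R)^-1 *
  \sum_(I : {ffun 'I_k -> 'I_n}) \sum_(J : {ffun 'I_k -> 'I_n})
    v i p I * w i p J * \prod_(l < k) invmx (g i p) (I l) (J l).

Variable vol : {measure set (g_sigma_algebraType (@open M)) -> \bar R}.

Definition L2_Omega (k : nat) : set (components k) :=
  [set w | @Omega k w /\
           (\int[vol]_(p in [set: M]) (form_dot w w p)%:E < +oo)%E].

(* delta w = v, where delta is the formal adjoint of d for the L^2 product. *)
Definition codifferential (k : nat) (w : components k.+1) (v : components k)
    : Prop :=
  Omega v /\
  forall b : components k, Omega b -> compactly_supported b ->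
    (\int[vol]_(p in [set: M]) (form_dot (ext_deriv b) w p)%:E =
     \int[vol]_(p in [set: M]) (form_dot b v p)%:E)%E.

(* delta vanishes on functions. *)
Definition coclosed (k : nat) : components k -> Prop :=
  match k with
  | 0 => fun _ => True
  | k'.+1 => fun w => codifferential w (@zero_form k')
  end.

Definition L2_harmonic (k : nat) : set (components k) :=
  [set w | [/\ @L2_Omega k w, ext_deriv w = @zero_form k.+1 & coclosed w]].

End manifold.

Definition path_connected {R : realType} (M : topologicalType) : Prop :=
  forall p q : M, exists c : R -> M,
    [/\ {within `[0, 1], continuous c}, c 0 = p & c 1 = q].

(* H s is a homotopy, relative to the endpoints, from c to a constant loop. *)
Definition null_homotopic {R : realType} (M : topologicalType) (c : R -> M)
    : Prop :=
  exists H : R * R -> M,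
    [/\ {within `[0, 1] `*` `[0, 1], continuous H},
        (forall t, `[0, 1]%classic t -> H (0, t) = c t),
        (forall t, `[0, 1]%classic t -> H (1, t) = c 0) &
        (forall s, `[0, 1]%classic s -> H (s, 0) = c 0 /\ H (s, 1) = c 0)].

Definition simply_connected {R : realType} (M : topologicalType) : Prop :=
  @path_connected R M /\
  forall c : R -> M, {within `[0, 1], continuous c} -> c 0 = c 1 ->
    null_homotopic c.

(* Main.v *)
(* Let X be the vector field dual to eta. As eta is parallel, X is Killing,
   divergence-free and of constant length, so L_X = d i_X acts on closed forms,
   <., .> obeys the Leibniz rule for L_X, and X(F) integrates to 0 for every
   compactly supported smooth function F. Completeness provides cutoff functions
   chi with arbitrarily small gradient (Hopf-Rinow, then smoothing of the
   distance cutoff).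

   Let alpha be an L^2-harmonic form. Testing coclosedness against
   i_X d(chi^2 i_X alpha) gives, after an integration by parts along X, that the
   integral of <d(chi^2 i_X alpha), L_X alpha> vanishes; this bounds the integral
   of chi^2 |L_X alpha|^2 by a multiple of sup |d chi|^2, hence L_X alpha = 0 and
   X |alpha|^2 = 0. By simple connectedness eta = df, so that X f = |eta|^2 is a
   positive constant. For a bounded increasing function h, here the logistic one,
   integrating X(h(f) chi^2 |alpha|^2) bounds the integral of
   h'(f) chi^2 |alpha|^2 by a multiple of sup |d chi|, hence alpha = 0. *)
From HB Require Import structures.
From mathcomp Require Import all_boot all_order all_algebra all_fingroup.
From mathcomp Require Import all_classical all_reals all_analysis.
From mathcomp Require Import measurable_realfun ring lra zify.
Require Import Defs.

Set Implicit Arguments.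
Unset Strict Implicit.
Unset Printing Implicit Defensive.

Import Order.TTheory GRing.Theory Num.Theory.
Import numFieldNormedType.Exports.

Local Open Scope classical_set_scope.
Local Open Scope ring_scope.

(** * Smooth functions on R^n *)

(** The harmonic form [alpha] has no compact support, so coclosedness can be tested only on cutoffs
    of it. The weight is [chi ^+ 2] because its differential keeps one factor [chi], which Young's
    inequality can absorb. The form [theta] being exact, [L_X theta] is [d i_X theta], and
    [i_X theta] is an admissible test form. Nothing bounds the primitive [f], whence a bounded
    function of it whose derivative vanishes nowhere.

    No bound on the geometry at infinity is available, yet the gradient bound of the cutoffs has to
    be uniform. The distance tent is therefore smoothed by interpolation in orthonormal frames, on a
    scale that may depend on the point, with a constant that depends on the dimension only.
    Distances are handled through [reach]: C^1 paths of speed at most one that rest near both ends,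
    so that they can be joined and cut while staying C^1.

    The homotopies supplied by simple connectedness are merely continuous, so [eta] cannot be pulled
    back along them; local primitives are composed with them instead and glued. *)

Section differentiability_from_partials.
Context {R : realType}.

Lemma cvg_sumr {T : Type} {F : set_system T} {FF : Filter F} {I : Type}
    (r : seq I) (P : pred I) (f : I -> T -> R) (a : I -> R) :
  (forall i, P i -> f i x @[x --> F] --> a i) ->
  \sum_(i <- r | P i) f i x @[x --> F] --> \sum_(i <- r | P i) a i.
Proof. by move=> fa; apply: cvg_big => //; exact: add_continuous. Qed.

Lemma near_forall {T : Type} {I : finType} {F : set_system T} {FF : Filter F}
    (P : I -> T -> Prop) :
  (forall i, \forall y \near F, P i y) -> \forall y \near F, forall i, P i y.
Proof. exact: filter_forall. Qed.

Lemma differentiable_unique (V W : normedModType R) (f : V -> W)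
    (df : {linear V -> W}) (x : V) :
  continuous df ->
  (forall e : R, 0 < e ->
     \forall h \near 0, `|f (h + x) - f x - df h| <= e * `|h|) ->
  differentiable f x /\ 'd f x = df :> (V -> W).
Proof.
move=> dfc H.
have E : f \o shift x = cst (f x) + df +o_ 0 id.
  by apply/eqaddoP => e e0; near do rewrite /= opprD addrA; apply: H.
have D := diff_unique dfc E.
by split => //; apply/diff_locallyP; rewrite D.
Unshelve. all: by end_near. Qed.

Lemma is_derive_line (V : normedModType R) (f : V -> R) (x v : V) (t : R) :
  derivable f (x + t *: v) v ->
  is_derive t 1 (fun s => f (x + s *: v)) ('D_v f (x + t *: v)).
Proof.
move=> df.
have E : (fun h => h^-1 *: (((fun s => f (x + s *: v)) \o shift t) (h *: 1)
             - f (x + t *: v)))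
       = (fun h => h^-1 *: ((f \o shift (x + t *: v)) (h *: v) - f (x + t *: v))).
  apply/funext => h /=; congr (_ *: (f _ - _)).
  by rewrite scalerDl addrCA /GRing.scale /= mulr1.
by apply: DeriveDef; rewrite /derivable /derive E.
Qed.

(** Brings directional derivatives down to one real variable, where [is_derive1_comp] applies. *)
Lemma is_derive_lineP (V W : normedModType R) (g : V -> W) (x v : V) (dg : W) :
  is_derive (0 : R) (1 : R) (fun s : R => g (s *: v + x)) dg <->
  is_derive x v g dg.
Proof.
have E : (fun h : R => h^-1 *: ((g \o shift x) (h *: v) - g x)) =
  (fun h : R => h^-1 *: (((fun s : R => g (s *: v + x)) \o shift 0) (h *: 1)
             - g (0 *: v + x))).
  by apply/funext => s /=; rewrite scale0r add0r addr0 [_%:A]mulr1.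
by split=> -[H1 H2]; split; move: H1 H2; rewrite /derivable /derive E.
Qed.

Lemma rV_norm_le {n} (x : 'rV[R]_n) (c : R) :
  0 <= c -> (forall l, `|x 0 l| <= c) -> `|x| <= c.
Proof.
move=> c0 H; rewrite /Num.Def.normr /= mx_normrE bigmax_le // => -[i l] _ /=.
by rewrite ord1.
Qed.

Lemma rV_coord_le {n} (x : 'rV[R]_n) l : `|x 0 l| <= `|x|.
Proof.
rewrite {2}/Num.Def.normr /= mx_normrE.
exact: (le_bigmax _ (fun ij : 'I_1 * 'I_n => `|x ij.1 ij.2|) (0, l)).
Qed.

Lemma nbhs_rVP {n} (x : 'rV[R]_n) (P : set 'rV[R]_n) :
  nbhs x P <-> exists2 d, 0 < d & forall y, `|y - x| < d -> P y.
Proof.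
split=> [|[d d0 H]].
  rewrite nbhs_nearE => /nbhs_normP[d d0 H]; exists d => // y yd.
  by apply: H; rewrite /= distrC.
by rewrite nbhs_nearE; apply/nbhs_normP; exists d => // y /=; rewrite distrC => /H.
Qed.

Lemma delta_mx_coord {n} (l j : 'I_n) :
  (delta_mx 0 l : 'rV[R]_n) 0 j = (j == l)%:R.
Proof. by rewrite mxE eqxx. Qed.

Context {n : nat}.
Implicit Types (f : 'rV[R]_n -> R) (x h : 'rV[R]_n).

Definition linear_form (c : 'I_n -> R) : 'rV[R]_n -> R :=
  fun h => \sum_j h 0 j * c j.

Fact linear_form_is_linear c : linear (linear_form c).
Proof.
move=> a u v; rewrite /linear_form scaler_sumr -big_split /=.
by apply: eq_bigr => j _; rewrite !mxE mulrDl -mulrA.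
Qed.
HB.instance Definition _ c :=
  GRing.isLinear.Build R _ R _ (linear_form c) (linear_form_is_linear c).

Lemma linear_form_continuous c : continuous (linear_form c).
Proof.
move=> h; rewrite /continuous_at /linear_form.
apply: (@cvg_sumr _ (nbhs h)) => j _.
by apply: cvgMl; exact: matrix_normedtype.coord_continuous.
Qed.

(* Telescoping over the coordinates, with the mean value theorem in each. *)
Lemma partials_increment f x (e d : R) :
  0 <= e ->
  (forall y, `|y - x| < d -> forall l, derivable f y (delta_mx 0 l) /\
     `|partial l f y - partial l f x| <= e) ->
  forall h, `|h| < d ->
  `|f (x + h) - f x - linear_form (fun l => partial l f x) h|
    <= n%:R * e * `|h|.
Proof.
move=> e0 H' h hd.
have H w : `|w| < d -> forall l, derivable f (x + w) (delta_mx 0 l) /\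
     `|partial l f (x + w) - partial l f x| <= e.
  by move=> wd; apply: H'; rewrite addrAC subrr add0r.
(* The point [hk k] keeps the first [k] coordinates of [h]: consecutive points differ in one
   coordinate, and none leaves the ball of radius [|h|]. *)
pose hk k : 'rV[R]_n := \row_j (if (j < k)%N then h 0 j else 0).
have hkle k c (l : 'I_n) : 0 <= c <= 1 -> (k = l :> nat) ->
    `|hk k + c *: (h 0 l *: delta_mx 0 l)| <= `|h|.
  move=> /andP[c0 c1] kl; apply: rV_norm_le => // j; rewrite !mxE eqxx /=.
  have [jl|jl] := eqVneq j l.
    rewrite jl kl ltnn add0r mulr1 normrM (ger0_norm c0).
    by apply: le_trans (rV_coord_le h l); rewrite ler_piMl.
  by rewrite mulr0 mulr0 addr0; case: ifP => _; rewrite ?normr0 ?rV_coord_le.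
have hkS k (l : 'I_n) : (k = l :> nat) ->
    hk k.+1 = hk k + h 0 l *: delta_mx 0 l.
  move=> kl; apply/rowP => j; rewrite !mxE eqxx /= ltnS leq_eqVlt kl.
  rewrite -(inj_eq val_inj) /=.
  by case: ltngtP => jl; rewrite ?mulr0 ?addr0 // add0r mulr1; congr (h 0 _); apply/val_inj.
have K k : (k <= n)%N -> `|f (x + hk k) - f x -
    \sum_(j < n | (j < k)%N) h 0 j * partial j f x| <= k%:R * e * `|h|.
  elim: k => [_|k IH kn].
    rewrite big_pred0 // subr0 (_ : hk 0%N = 0); last by apply/rowP => j; rewrite !mxE.
    by rewrite addr0 subrr normr0 !mul0r.
  pose l := Ordinal kn.
  rewrite (hkS k l erefl) (bigD1 l) /=; last by rewrite ltnS.
  rewrite (eq_bigl (fun j : 'I_n => (j < k)%N)); last first.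
    move=> j; rewrite ltnS ltn_neqAle andbC; congr (_ && _).
  have dl (t : R) : 0 <= t <= 1 ->
    is_derive t (1 : R) (fun s : R => f (x + hk k + (s * h 0 l) *: delta_mx 0 l))
      (partial l f (x + hk k + (t * h 0 l) *: delta_mx 0 l) * h 0 l).
    move=> t01.
    have D : derivable f (x + hk k + (t * h 0 l) *: delta_mx 0 l) (delta_mx 0 l).
      rewrite -addrA; apply: (H _ _ l).1.
      by rewrite -scalerA (le_lt_trans (hkle _ _ _ t01 _)).
    apply: (@is_derive1_comp R (fun s => f (x + hk k + s *: delta_mx 0 l))
              (fun s => s * h 0 l) t).
      exact: is_derive_line D.
    by apply: is_derive_eq; rewrite /GRing.scale /= mulr1 mulr0 add0r.
  have [c c01 Ec] := @MVT_segment R _ _ 0 1 ler01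
      (fun t t01 => dl t (subset_itv_oo_cc t01))
      (@derivable_within_continuous R R _ `[0, 1]
         (fun t t01 => @ex_derive _ _ _ _ _ _ _ (dl t t01))).
  rewrite mul1r mul0r scale0r addr0 subr0 mulr1 -addrA in Ec.
  have -> : f (x + (hk k + h 0 l *: delta_mx 0 l)) - f x -
     (h 0 l * partial l f x + \sum_(j < n | (j < k)%N) h 0 j * partial j f x) =
    (f (x + hk k) - f x - \sum_(j < n | (j < k)%N) h 0 j * partial j f x) +
    (partial l f (x + hk k + (c * h 0 l) *: delta_mx 0 l) - partial l f x) * h 0 l.
    by rewrite mulrBl -Ec; ring.
  have -> : k.+1%:R * e * `|h| = k%:R * e * `|h| + e * `|h|.
    by rewrite -natr1; ring.
  apply: le_trans (ler_normD _ _) _; apply: lerD; first exact: IH (ltnW kn).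
  rewrite normrM ler_pM // ?rV_coord_le //; rewrite -addrA; apply: (H _ _ l).2.
  rewrite -scalerA (le_lt_trans (hkle _ _ _ _ _)) //.
have := K n (leqnn n).
rewrite (_ : hk n = h); last by apply/rowP => j; rewrite !mxE ltn_ord.
by congr (`|_ - _| <= _); apply: eq_bigl => j; rewrite ltn_ord.
Qed.

Lemma partials_differential f x :
  (forall l, \forall y \near x, derivable f y (delta_mx 0 l)) ->
  (forall l, {for x, continuous (partial l f)}) ->
  differentiable f x /\ 'd f x = linear_form (fun l => partial l f x) :> (_ -> _).
Proof.
move=> Hd Hc.
apply: (differentiable_unique (@linear_form_continuous _)) => e e0.
(* Absorbs the factor [n] of [partials_increment]; the successor keeps the quotient meaningful in
   dimension 0. *)
pose e' := e / (n.+1)%:R.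
have e'0 : 0 < e' by rewrite divr_gt0.
have : \forall y \near x, forall l, derivable f y (delta_mx 0 l) /\
     `|partial l f y - partial l f x| <= e'.
  apply: (@near_forall _ 'I_n (nbhs x) _ (fun l y => derivable f y (delta_mx 0 l) /\
     `|partial l f y - partial l f x| <= e')) => l; near=> y; split; first by near: y; exact: Hd.
  by rewrite distrC; near: y; have /cvgrPdist_le/(_ _ e'0) := Hc l.
rewrite -nbhs_nearE => /nbhs_rVP[d d0 Hd'].
have H := @partials_increment f x e' d (ltW e'0) _.
have : nbhs (0 : 'rV[R]_n) (fun h => `|h| < d).
  by apply/nbhs_rVP; exists d => // z; rewrite subr0.
apply: filterS => h hd; rewrite /= [h + x]addrC.
apply: le_trans (H _ h _) _.
- by move=> y yd; exact: Hd'.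
- exact: hd.
- rewrite ler_wpM2r // /e' mulrCA ler_piMr ?(ltW e0) //.
  by rewrite ler_pdivrMr // mul1r ler_nat.
Unshelve. all: by end_near. Qed.

(** Derivability of [c] in the single direction [v] says nothing about its differential on [V].
    Restricted to the line through [t], [c] becomes a function of one real variable, where derivable
    and differentiable coincide, and the chain rule for differentials applies. *)
Lemma is_derive_rV_comp (V : normedModType R) f (c : V -> 'rV[R]_n) (t v : V)
    (dc : 'I_n -> R) :
  (forall l, \forall y \near c t, derivable f y (delta_mx 0 l)) ->
  (forall l, {for c t, continuous (partial l f)}) ->
  (forall l, is_derive t v (fun s => c s 0 l) (dc l)) ->
  is_derive t v (fun s => f (c s)) (\sum_l dc l * partial l f (c t)).
Proof.
move=> Hd Hc Dc.
have [df ddf] := partials_differential Hd Hc.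
have Dct : derivable c t v.
  by apply/derivable_mxP => i j; rewrite (ord1 i); apply: ex_derive.
pose c1 (h : R) := c (h *: v + t).
have c10 : c1 0 = c t by rewrite /c1 scale0r add0r.
have dc1 : differentiable c1 0.
  by apply/derivable1_diffP; apply/(derivable1P c t v).1.
have dfc : differentiable f (c1 0) by rewrite c10.
have E (g : V -> R) : 'D_v g t = 'D_1 (fun h : R => g (h *: v + t)) 0.
  rewrite /derive; suff -> : (fun h : R => h^-1 *: ((g \o shift t) (h *: v) - g t)) =
      (fun h : R => h^-1 *: (((fun h : R => g (h *: v + t)) \o shift 0) (h *: 1) -
         g (0 *: v + t))) by [].
    apply/funext => h /=.
  by rewrite addr0 scale0r add0r [_%:A]mulr1.
apply: DeriveDef.
  apply/derivable1P; apply/derivable1_diffP.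
  exact: (differentiable_comp dc1 dfc).
rewrite E -[LHS]/('D_1 (f \o c1) 0) deriveE; last exact: differentiable_comp.
rewrite diff_comp //= c10 ddf /linear_form.
apply: eq_bigr => l _; congr (_ * _).
rewrite -deriveE // -(@derive_val _ _ _ _ _ _ _ (Dc l)) E.
have D1 : derivable c1 0 1 by apply/derivable1_diffP.
by rewrite (derive_mx D1) mxE.
Qed.

End differentiability_from_partials.

Section smooth_functions.
Context {R : realType} {n : nat}.
Implicit Types (f g : 'rV[R]_n -> R) (U V : set 'rV[R]_n) (x : 'rV[R]_n).

(** Closure under products and composition is proved by induction on the order; the quantification
    over lists of indices in [smooth_on] does not lend itself to that, since the derivatives of a
    product are sums. *)
Fixpoint Ck (k : nat) U f : Prop :=
  (forall x, U x -> {for x, continuous f}) /\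
  match k with
  | 0 => True
  | k'.+1 => forall l, (forall x, U x -> derivable f x (delta_mx 0 l)) /\
                       Ck k' U (partial l f)
  end.

Lemma smooth_on_sub U V f : V `<=` U -> smooth_on U f -> smooth_on V f.
Proof. by move=> VU fU s x /VU; exact: fU. Qed.

Lemma smooth_on_continuous U f x : smooth_on U f -> U x -> {for x, continuous f}.
Proof. by move=> fU Ux; have [] := fU [::] x Ux. Qed.

Lemma smooth_on_derivable U f x l :
  smooth_on U f -> U x -> derivable f x (delta_mx 0 l).
Proof. by move=> fU Ux; have [_ /(_ l)] := fU [::] x Ux. Qed.

Lemma smooth_on_partial U f l : smooth_on U f -> smooth_on U (partial l f).
Proof. by move=> fU s x Ux; have := fU (rcons s l) x Ux; rewrite /iter_partial foldr_rcons. Qed.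

Lemma smooth_onP U f : smooth_on U f <-> forall k, Ck k U f.
Proof.
split=> [fU k|H s].
  elim: k f fU => [|k IH] f fU.
    by split=> // x; exact: smooth_on_continuous.
  split=> [x|l]; first exact: smooth_on_continuous.
  split=> [x|]; first exact: smooth_on_derivable.
  by apply: IH; exact: smooth_on_partial.
(* Lists are taken apart from the end because the last index is the derivative taken first. *)
elim/last_ind: s f H => [f H x Ux|s l IH f H].
  by have [fc /(_ _)H1] := H 1%N; split; [exact: fc|move=> l; exact: (H1 l).1].
rewrite /iter_partial foldr_rcons => x Ux; apply: (IH (partial l f)) => // k.
by have [_ /(_ l)[]] := H k.+1.
Qed.

Lemma Ck_continuous k U f x : Ck k U f -> U x -> {for x, continuous f}.
Proof. by case: k => [|k] [fc _] Ux; exact: fc. Qed.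

Lemma CkW k U f : Ck k.+1 U f -> Ck k U f.
Proof.
elim: k f => [|k IH] f [fc fd]; first by split.
by split=> // l; have [fd1 fd2] := fd l; split=> //; exact: IH.
Qed.

Lemma near_open_eq {T : topologicalType} {S : Type} (W : set T) (a b : T -> S) y :
  open W -> (forall z, W z -> a z = b z) -> W y -> {near y, a =1 b}.
Proof.
move=> Wo ab Wy; have : nbhs y W by exact: open_nbhs_nbhs.
by apply: filterS => z Wz; exact: ab.
Qed.

Lemma partial_eq U f g l x : open U -> (forall y, U y -> f y = g y) -> U x ->
  partial l f x = partial l g x.
Proof. by move=> Uo fg Ux; apply: near_eq_derive; exact: near_open_eq fg Ux. Qed.

Lemma continuous_eq_on {T S : topologicalType} (W : set T) (a b : T -> S) y :
  open W -> (forall z, W z -> a z = b z) -> W y ->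
  {for y, continuous a} -> {for y, continuous b}.
Proof.
move=> Wo ab Wy ac; have E := near_open_eq Wo ab Wy.
rewrite /prop_for /continuous_at -(ab _ Wy); apply: cvg_trans ac.
exact: near_eq_cvg.
Qed.

Lemma Ck_eq k U f g : open U -> (forall x, U x -> f x = g x) -> Ck k U f -> Ck k U g.
Proof.
move=> Uo; elim: k f g => [|k IH] f g fg [fc fd].
  by split=> // x Ux; exact: continuous_eq_on fg Ux (fc x Ux).
split=> [x Ux|l]; first exact: continuous_eq_on fg Ux (fc x Ux).
have [fd1 fd2] := fd l; split=> [x Ux|].
  by apply: near_eq_derivable (fd1 x Ux); exact: near_open_eq fg Ux.
by apply: IH fd2 => x Ux; exact: partial_eq fg Ux.
Qed.

Lemma smooth_on_eq U f g : open U -> (forall x, U x -> f x = g x) ->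
  smooth_on U f -> smooth_on U g.
Proof. by move=> Uo fg /smooth_onP H; apply/smooth_onP => k; exact: Ck_eq (H k). Qed.

Lemma Ck_cst k U (c : R) : Ck k U (cst c).
Proof.
elim: k c => [|k IH] c; first by split=> // x _; exact: cst_continuous.
split=> [x _|l]; first exact: cst_continuous.
split=> [x _|]; first exact: derivable_cst.
by rewrite (_ : partial l _ = cst 0) //; apply/funext => x; rewrite /partial derive_cst.
Qed.

Lemma Ck_add k U f g : open U -> Ck k U f -> Ck k U g -> Ck k U (fun x => f x + g x).
Proof.
move=> Uo; elim: k f g => [|k IH] f g [fc fd] [gc gd].
  by split=> // x Ux; exact: (cvgD (fc x Ux) (gc x Ux)).
split=> [x Ux|l]; first by exact: (cvgD (fc x Ux) (gc x Ux)).
have [fd1 fd2] := fd l; have [gd1 gd2] := gd l.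
split=> [x Ux|]; first by apply: derivableD; [exact: fd1|exact: gd1].
apply: Ck_eq Uo _ (IH _ _ fd2 gd2) => x Ux.
by rewrite /partial -deriveD //; [exact: fd1|exact: gd1].
Qed.

Lemma Ck_mul k U f g : open U -> Ck k U f -> Ck k U g -> Ck k U (fun x => f x * g x).
Proof.
move=> Uo; elim: k f g => [|k IH] f g cf cg; have [fc fd] := cf; have [gc gd] := cg.
  by split=> // x Ux; exact: (cvgM (fc x Ux) (gc x Ux)).
split=> [x Ux|l]; first by exact: (cvgM (fc x Ux) (gc x Ux)).
have [fd1 fd2] := fd l; have [gd1 gd2] := gd l.
split=> [x Ux|]; first by apply: derivableM; [exact: fd1|exact: gd1].
apply: (Ck_eq (f := fun x => f x * partial l g x + g x * partial l f x)) => //.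
  move=> x Ux; rewrite [RHS]/partial.
  by rewrite (@deriveM _ _ f g x) //; [exact: fd1|exact: gd1].
by apply: Ck_add => //; apply: IH => //; exact: CkW.
Qed.

Lemma Ck_sum k U (I : Type) (r : seq I) (P : pred I) (F : I -> 'rV[R]_n -> R) :
  open U -> (forall i, P i -> Ck k U (F i)) ->
  Ck k U (fun x => \sum_(i <- r | P i) F i x).
Proof.
move=> Uo FU; elim: r => [|i r IH].
  by rewrite (_ : (fun x => _) = cst 0); [exact: Ck_cst|apply/funext => x; rewrite big_nil].
case Pi: (P i).
  rewrite (_ : (fun x => _) = fun x => F i x + \sum_(j <- r | P j) F j x).
    by apply: Ck_add => //; exact: FU.
  by apply/funext => x; rewrite big_cons Pi.
rewrite (_ : (fun x => _) = fun x => \sum_(j <- r | P j) F j x) //.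
by apply/funext => x; rewrite big_cons Pi.
Qed.

Lemma Ck_coord k U (j : 'I_n) : Ck k U (fun x => x 0 j).
Proof.
have D x l : is_derive x (delta_mx 0 l) (fun y : 'rV[R]_n => y 0 j) (j == l)%:R.
  apply/is_derive_lineP.
  rewrite (_ : (fun s => _) = fun s : R => s * (j == l)%:R + x 0 j); last first.
    by apply/funext => s; rewrite !mxE eqxx.
  by apply: is_derive_eq; rewrite /GRing.scale /= mulr1 mulr0 addr0 add0r.
case: k => [|k]; first by split=> // x _; exact: matrix_normedtype.coord_continuous.
split=> [x _|l]; first exact: matrix_normedtype.coord_continuous.
split=> [x _|]; first exact: (@ex_derive _ _ _ _ _ _ _ (D x l)).
rewrite (_ : partial l _ = cst (j == l)%:R); first exact: Ck_cst.
by apply/funext => x; exact: (@derive_val _ _ _ _ _ _ _ (D x l)).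
Qed.

(* S is stable under derivation on D, which lets the induction trade h for h'. *)
Lemma Ck_comp1 (D : set R) (S : set (R -> R)) k U f (h : R -> R) :
  (forall a, S a -> exists2 b, S b & forall t, D t -> is_derive t (1 : R) a (b t)) ->
  open U -> (forall x, U x -> D (f x)) -> Ck k U f -> S h ->
  Ck k U (fun x => h (f x)).
Proof.
move=> SD Uo fD; elim: k h => [|k IH] h cf Sh; have [h' Sh' hh'] := SD h Sh.
  split=> // x Ux; have fc : {for x, continuous f} by exact: cf.1.
  apply: continuous_comp => //; apply/differentiable_continuous/derivable1_diffP.
  by have [] := hh' _ (fD _ Ux).
have [fc fd] := cf.
have hfd x l : U x -> is_derive x (delta_mx 0 l) (fun x => h (f x)) (h' (f x) * partial l f x).
  move=> Ux; have dh := hh' _ (fD _ Ux); have df := (fd l).1 _ Ux.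
  apply/is_derive_lineP.
  have df1 := (is_derive_lineP _ _ _ _).2 (derivableP df).
  have dh1 : is_derive (f (0 *: delta_mx 0 l + x)) (1:R) h (h' (f x)).
    by rewrite scale0r add0r.
  exact: @is_derive1_comp _ h (fun s : R => f (s *: delta_mx 0 l + x)) 0 _ _ dh1 df1.
split=> [x Ux|l].
  apply: continuous_comp; first exact: fc.
  apply/differentiable_continuous/derivable1_diffP.
  by have [] := hh' _ (fD _ Ux).
split=> [x Ux|]; first by have [] := hfd x l Ux.
apply: (Ck_eq (f := fun x => h' (f x) * partial l f x)) => //.
  by move=> x Ux; rewrite /partial; have [_ ->] := hfd x l Ux.
apply: Ck_mul => //; last exact: (fd l).2.
by apply: IH => //; exact: CkW.
Qed.

End smooth_functions.

Section smooth_class.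
Context {R : realType} {n : nat}.
Implicit Types (f g : 'rV[R]_n -> R) (U V : set 'rV[R]_n).

(* Sealing the infinitely nested condition keeps it out of unification. *)
Record Cinf U f : Prop := Cinf_of_smooth { smooth_of_Cinf : smooth_on U f }.

Lemma CinfP U f : Cinf U f <-> forall k, Ck k U f.
Proof. by split=> [[/smooth_onP]|H] //; split; apply/smooth_onP. Qed.

Lemma Cinf_sub U V f : V `<=` U -> Cinf U f -> Cinf V f.
Proof. by move=> VU [fU]; split; exact: smooth_on_sub fU. Qed.

Lemma Cinf_continuous U f x : Cinf U f -> U x -> {for x, continuous f}.
Proof. by case=> fU Ux; exact: smooth_on_continuous fU Ux. Qed.

Lemma Cinf_derivable U f x l : Cinf U f -> U x -> derivable f x (delta_mx 0 l).
Proof. by case=> fU Ux; exact: smooth_on_derivable fU Ux. Qed.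

Lemma Cinf_partial U f l : Cinf U f -> Cinf U (partial l f).
Proof. by case=> fU; split; exact: smooth_on_partial fU. Qed.

Lemma Cinf_eq U f g : open U -> (forall x, U x -> f x = g x) -> Cinf U f -> Cinf U g.
Proof. by move=> Uo fg [fU]; split; exact: smooth_on_eq fU. Qed.

End smooth_class.

Section smooth_closure.
Context {R : realType}.

Lemma rV_cvg {T : Type} {F : set_system T} {FF : Filter F} {n : nat}
    (c : T -> 'rV[R]_n) (y : 'rV[R]_n) :
  (forall j, c t 0 j @[t --> F] --> y 0 j) -> c t @[t --> F] --> y.
Proof.
move=> H; apply/cvgrPdist_le => e e0.
have : \forall t \near F, forall j, `|y 0 j - c t 0 j| <= e.
  by apply: near_forall => j; have /cvgrPdist_le/(_ _ e0) := H j.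
apply: filterS => t Ht; apply: rV_norm_le; first exact: ltW.
by move=> l; rewrite !mxE.
Qed.

Lemma Ck_comp {m n : nat} k (U : set 'rV[R]_m) (V : set 'rV[R]_n)
    (Phi : 'rV[R]_m -> 'rV[R]_n) f :
  open U -> open V -> (forall x, U x -> V (Phi x)) ->
  (forall j, Ck k U (fun x => Phi x 0 j)) -> Ck k V f ->
  Ck k U (fun x => f (Phi x)).
Proof.
move=> Uo Vo UV; elim: k f => [|k IH] f cP cf.
  split=> // x Ux; apply: continuous_comp; last exact: cf.1 (UV _ Ux).
  by apply: (@rV_cvg _ (nbhs x)) => j; exact: (cP j).1.
have [fc fd] := cf.
have hfd x l : U x -> is_derive x (delta_mx 0 l) (fun x => f (Phi x))
    (\sum_j partial l (fun x => Phi x 0 j) x * partial j f (Phi x)).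
  move=> Ux; apply: is_derive_rV_comp => j.
  - have : nbhs (Phi x) V by apply: open_nbhs_nbhs; split=> //; exact: UV.
    by apply: filterS => y Vy; exact: (fd j).1.
  - by apply: Ck_continuous (fd j).2 _; exact: UV.
  - by apply: derivableP; exact: ((cP j).2 l).1.
split=> [x Ux|l].
  apply: continuous_comp; last exact: fc (UV _ Ux).
  by apply: (@rV_cvg _ (nbhs x)) => j; exact: (cP j).1.
split=> [x Ux|]; first by have [] := hfd x l Ux.
apply: (Ck_eq (f := fun x => \sum_j partial l (fun x => Phi x 0 j) x * partial j f (Phi x))) => //.
  by move=> x Ux; rewrite /partial; have [_ ->] := hfd x l Ux.
apply: Ck_sum => // j _; apply: Ck_mul => //; first exact: ((cP j).2 l).2.
by apply: IH; [move=> i; exact: CkW|exact: (fd j).2].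
Qed.

Context {n : nat}.
Implicit Types (f g : 'rV[R]_n -> R) (U V : set 'rV[R]_n).

Lemma Cinf_cst U (c : R) : Cinf U (cst c).
Proof. by apply/CinfP => k; exact: Ck_cst. Qed.

Lemma Cinf_coord U j : Cinf U (fun x => x 0 j).
Proof. by apply/CinfP => k; exact: Ck_coord. Qed.

Lemma Cinf_add U f g : open U -> Cinf U f -> Cinf U g ->
  Cinf U (fun x => f x + g x).
Proof. by move=> Uo /CinfP cf /CinfP cg; apply/CinfP => k; exact: Ck_add. Qed.

Lemma Cinf_mul U f g : open U -> Cinf U f -> Cinf U g ->
  Cinf U (fun x => f x * g x).
Proof. by move=> Uo /CinfP cf /CinfP cg; apply/CinfP => k; exact: Ck_mul. Qed.

Lemma Cinf_opp U f : open U -> Cinf U f -> Cinf U (fun x => - f x).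
Proof.
move=> Uo fU; apply: (@Cinf_eq _ _ U (fun x => cst (-1) x * f x) _ Uo).
  by move=> x _; rewrite mulN1r.
exact: (Cinf_mul Uo (Cinf_cst U (-1)) fU).
Qed.

Lemma Cinf_sub1 U f : open U -> Cinf U f -> Cinf U (fun x => 1 - f x).
Proof.
move=> Uo fU.
exact: (Cinf_add Uo (Cinf_cst U 1) (Cinf_opp Uo fU)).
Qed.

Lemma Cinf_sum U (I : Type) (r : seq I) (P : pred I) (F : I -> 'rV[R]_n -> R) :
  open U -> (forall i, P i -> Cinf U (F i)) ->
  Cinf U (fun x => \sum_(i <- r | P i) F i x).
Proof.
move=> Uo FU; apply/CinfP => k; apply: Ck_sum => // i Pi.
by have /CinfP := FU i Pi; apply.
Qed.

Lemma Cinf_prod U (I : Type) (r : seq I) (P : pred I) (F : I -> 'rV[R]_n -> R) :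
  open U -> (forall i, P i -> Cinf U (F i)) ->
  Cinf U (fun x => \prod_(i <- r | P i) F i x).
Proof.
move=> Uo FU; elim: r => [|i r IH].
  rewrite (_ : (fun x => _) = cst 1); first exact: Cinf_cst.
  by apply/funext => x; rewrite big_nil.
case Pi: (P i).
  rewrite (_ : (fun x => _) = fun x => F i x * \prod_(j <- r | P j) F j x).
    exact: (Cinf_mul Uo (FU i Pi) IH).
  by apply/funext => x; rewrite big_cons Pi.
rewrite (_ : (fun x => _) = fun x => \prod_(j <- r | P j) F j x) //.
by apply/funext => x; rewrite big_cons Pi.
Qed.

Lemma Cinf_comp {m : nat} (W : set 'rV[R]_m) U (Phi : 'rV[R]_m -> 'rV[R]_n) f :
  open W -> open U -> (forall x, W x -> U (Phi x)) ->
  (forall j, Cinf W (fun x => Phi x 0 j)) -> Cinf U f ->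
  Cinf W (fun x => f (Phi x)).
Proof.
move=> Wo Uo WU cP /CinfP cf; apply/CinfP => k.
by apply: Ck_comp Wo Uo WU _ (cf k) => j; have /CinfP := cP j; exact.
Qed.

Lemma Cinf_comp1 (D : set R) (S : set (R -> R)) U f (h : R -> R) :
  (forall a, S a -> exists2 b, S b & forall t, D t -> is_derive t (1 : R) a (b t)) ->
  open U -> (forall x, U x -> D (f x)) -> Cinf U f -> S h ->
  Cinf U (fun x => h (f x)).
Proof.
move=> SD Uo fD /CinfP cf Sh; apply/CinfP => k.
exact: Ck_comp1 SD Uo fD (cf k) Sh.
Qed.

Lemma Cinf_expR U f : open U -> Cinf U f -> Cinf U (fun x => expR (f x)).
Proof.
move=> Uo fU; apply: (@Cinf_comp1 setT [set expR]) Uo _ fU _ => // a ->.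
by exists expR => // t _; exact: is_derive_expR.
Qed.

(** The functions [c * t ^- k] form a family stable under derivation away from 0, as [Cinf_comp1]
    requires. *)
Lemma Cinf_inv U f : open U -> (forall x, U x -> f x != 0) ->
  Cinf U f -> Cinf U (fun x => (f x)^-1).
Proof.
move=> Uo f0 fU.
apply: (@Cinf_comp1 [set t | t != 0]
  [set a | exists (c : R) (k : nat), a = fun t => c * t ^- k] U f
  (fun t => t^-1)) Uo f0 fU _ => [_ [c [k ->]]|]; last first.
  by exists 1, 1%N; apply/funext => t; rewrite mul1r.
exists (fun t => c * - k%:R * t ^- k.+1); first by exists (c * - k%:R), k.+1.
move=> t /= t0.
have tk0 : t ^+ k != 0 by rewrite expf_neq0.
have dX : is_derive t (1 : R) (fun t : R => t ^+ k) (k%:R * t ^+ k.-1).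
  apply: DeriveDef; first exact: exprn_derivable.
  by rewrite exp_derive /GRing.scale /= mulr1.
have dV := @realfun.is_deriveV R (fun t => t ^+ k) t _ 1 tk0 dX.
have dM : is_derive t (1 : R) (c \*: (fun y : R => (y ^+ k)^-1)) _ := is_deriveZ c dV.
apply: (is_derive_eq dM); rewrite /GRing.scale /= -mulrA; congr (_ * _).
case: k tk0 {dX dV dM} => [|k] tk0; first by rewrite !mul0r oppr0 mulr0 mul0r.
by rewrite !exprS /=; field; rewrite t0 expf_neq0.
Qed.

Lemma partial_shift f (w : 'rV[R]_n) (v : 'rV[R]_n) x (df : R) :
  is_derive (x + w) v f df -> is_derive x v (fun y => f (y + w)) df.
Proof.
move=> /is_derive_lineP H; apply/is_derive_lineP.
by rewrite (_ : (fun s => _) = (fun s : R => f (s *: v + (x + w)))) //;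
   apply/funext => s; rewrite addrA.
Qed.

Lemma mvt_line f (x v : 'rV[R]_n) (h : R) : 0 <= h ->
  (forall t, 0 <= t <= h -> derivable f (x + t *: v) v) ->
  exists2 c, 0 <= c <= h & f (x + h *: v) - f x = h * 'D_v f (x + c *: v).
Proof.
move=> h0 H.
have dl t : 0 <= t <= h -> is_derive t 1 (fun s => f (x + s *: v)) ('D_v f (x + t *: v)).
  by move=> th; apply: is_derive_line; exact: H.
have [c ch Ec] := @MVT_segment R _ _ 0 h h0
    (fun t t01 => dl t (subset_itv_oo_cc t01))
    (@derivable_within_continuous R R _ `[0, h]
       (fun t t01 => @ex_derive _ _ _ _ _ _ _ (dl t t01))).
by exists c; [exact: ch|rewrite subr0 scale0r addr0 in Ec; rewrite Ec mulrC].
Qed.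

(** The symmetry in [a] and [b] is the reason why mixed derivatives commute. *)
Definition second_diff f x (h : R) a b : R :=
  f (x + h *: delta_mx 0 a + h *: delta_mx 0 b) - f (x + h *: delta_mx 0 a)
  - f (x + h *: delta_mx 0 b) + f x.

Lemma second_diffC f x h a b : second_diff f x h a b = second_diff f x h b a.
Proof.
by rewrite /second_diff [in LHS](addrAC x) [in LHS](addrAC (f _)).
Qed.

(** Two mean value theorems: one in direction [a] for the increment of [f] in direction [b], then
    one in direction [b] for [partial a f]. *)
Lemma second_difference f x (d h : R) (a b : 'I_n) :
  0 <= h -> h + h < d ->
  (forall y, `|y - x| < d -> derivable f y (delta_mx 0 a) /\
      derivable (partial a f) y (delta_mx 0 b)) ->
  exists2 p, `|p - x| <= h + h &
    second_diff f x h a b = h * (h * partial b (partial a f) p).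
Proof.
move=> h0 hd H.
have dn l : `|delta_mx 0 l : 'rV[R]_n| <= 1.
  by apply: rV_norm_le => // j; rewrite delta_mx_coord; case: eqP; rewrite ?normr1 ?normr0.
have nrm c l : 0 <= c <= h -> `|c *: (delta_mx 0 l : 'rV[R]_n)| <= h.
  by move=> /andP[c0 ch]; rewrite normrZ ger0_norm // (le_trans _ ch) // ler_piMr.
have nrm2 c c' l l' : 0 <= c <= h -> 0 <= c' <= h ->
  `|x + c *: (delta_mx 0 l : 'rV[R]_n) + c' *: delta_mx 0 l' - x| <= h + h.
  move=> ch ch'; rewrite -[x + _ + _]addrA [x + _]addrC addrK (le_trans (ler_normD _ _)) //.
  by apply: lerD; exact: nrm.
have nrm1 c l : 0 <= c <= h -> `|x + c *: (delta_mx 0 l : 'rV[R]_n) - x| < d.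
  move=> ch; rewrite addrAC subrr add0r (le_lt_trans (nrm _ _ ch)) //.
  by apply: le_lt_trans hd; rewrite lerDl.
have hh : 0 <= h <= h by rewrite h0 lexx.
pose F y := f (y + h *: delta_mx 0 b) - f y.
have dF t : 0 <= t <= h -> is_derive (x + t *: delta_mx 0 a) (delta_mx 0 a) F
   (partial a f (x + t *: delta_mx 0 a + h *: delta_mx 0 b) - partial a f (x + t *: delta_mx 0 a)).
  move=> th; apply: is_deriveB.
    apply: partial_shift; apply: derivableP; apply: (H _ _).1.
    by apply: le_lt_trans hd; exact: nrm2.
  by apply: derivableP; apply: (H _ _).1; exact: nrm1.
have [c ch Ec] := @mvt_line F x (delta_mx 0 a) h h0
  (fun t th => @ex_derive _ _ _ _ _ _ _ (dF t th)).
have [c' ch' Ec'] := @mvt_line (partial a f) (x + c *: delta_mx 0 a) (delta_mx 0 b) h h0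
  (fun t th => (H _ (le_lt_trans (nrm2 _ _ _ _ ch th) hd)).2).
exists (x + c *: delta_mx 0 a + c' *: delta_mx 0 b); first exact: nrm2.
rewrite -Ec' -(@derive_val _ _ _ _ _ _ _ (dF c ch)) -Ec /F /second_diff; ring.
Qed.

Lemma dist_half (u v p q e : R) :
  p = q -> `|v - p| <= e / 2 -> `|u - q| <= e / 2 -> `|u - v| <= e.
Proof.
by move=> <- vp up; rewrite -(subrKA p) (splitr e) (le_trans (ler_normD _ _)) //
  lerD // distrC.
Qed.

(** The same second difference is a value of each mixed derivative, at two possibly different points
    close to [x]; continuity of both mixed derivatives does the rest. *)
Lemma partial_comm U f x a b : open U -> Cinf U f -> U x ->
  partial a (partial b f) x = partial b (partial a f) x.
Proof.
move=> Uo fU Ux; apply/eqP; rewrite -subr_eq0 -normr_le0; apply/ler_addgt0Pr => e e0.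
rewrite add0r.
have e20 : 0 < e / 2 by rewrite divr_gt0.
have cont l l' : {for x, continuous (partial l (partial l' f))}.
  by apply: Cinf_continuous Ux; do 2 apply: Cinf_partial.
have /cvgrPdist_le/(_ _ e20) C1 := cont a b.
have /cvgrPdist_le/(_ _ e20) C2 := cont b a.
have NU : nbhs x U by exact: open_nbhs_nbhs.
have C := @filterI _ (nbhs x) (nbhs_filter x) _ _ NU
  (@filterI _ (nbhs x) (nbhs_filter x) _ _ C1 C2).
move/nbhs_rVP : C => [d d0 Hd].
have Hd1 y : `|y - x| < d -> U y by move=> yd; exact: (Hd y _).1.
pose h := d / 4.
have h0 : 0 < h by rewrite divr_gt0.
have hd : h + h < d by rewrite /h; lra.
have D l l' : exists2 p, `|p - x| <= h + h & _ := @second_difference f x d h l l' (ltW h0) hd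
  (fun y yd => conj (@Cinf_derivable _ _ U f y l fU (Hd1 _ yd))
     (@Cinf_derivable _ _ U _ y l' (@Cinf_partial _ _ U f l fU) (Hd1 _ yd))).
have [p px Ep] := D a b; have [q qx Eq] := D b a.
have E : partial b (partial a f) p = partial a (partial b f) q.
  have : h * (h * partial b (partial a f) p) = h * (h * partial a (partial b f) q).
    exact: (etrans (esym Ep) (etrans (second_diffC _ _ _ _ _) Eq)).
  by move=> /(mulfI (lt0r_neq0 h0)) /(mulfI (lt0r_neq0 h0)).
have [_ [_ Hp]] := Hd p (le_lt_trans px hd).
have [_ [Hq _]] := Hd q (le_lt_trans qx hd).
exact: dist_half E Hp Hq.
Qed.

End smooth_closure.

(** * Flat functions and the smooth step *)

Section bump.
Context {R : realType}.
Implicit Types (p : {poly R}) (t : R).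

(** All derivatives of exp(-1/t), extended by 0, have the shape P(1/t) exp(-1/t). The polynomial
    parameter makes the family stable under derivation. *)
Definition flat_fun p (t : R) : R :=
  if 0 < t then p.[t^-1] * expR (- t^-1) else 0.

(** This is [1 + x <= expR x] at [x = y / m], raised to the power [m]. *)
Lemma pow_le_expR (m : nat) (y : R) : 0 <= y -> y ^+ m <= m%:R ^+ m * expR y.
Proof.
move=> y0; case: m => [|m]; first by rewrite !expr0 mul1r (le_trans _ (expR_ge1Dx _)) // lerDl.
have m0 : 0 < m.+1%:R :> R by [].
have -> : expR y = expR (y / m.+1%:R) ^+ m.+1.
  by rewrite -expRM_natl; congr expR; field; rewrite lt0r_neq0.
rewrite -exprMn; apply: lerXn2r; rewrite ?nnegrE ?mulr_ge0 ?expR_ge0 //.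
rewrite mulrC -ler_pdivrMr //; apply: le_trans (expR_ge1Dx _); by rewrite lerDr.
Qed.

(** Decay of order two at 0 makes the difference quotient of [flat_fun p] at 0 tend to 0. *)
Lemma poly_expR_le p : exists2 C, 0 <= C &
  forall t, 0 < t -> `|p.[t^-1] * expR (- t^-1)| <= C * t ^+ 2.
Proof.
exists (\sum_(i < size p) `|p`_i| * (i.+2%:R ^+ i.+2)).
  by apply: sumr_ge0 => i _; rewrite mulr_ge0.
move=> t t0; rewrite normrM (ger0_norm (expR_ge0 _)) horner_coef.
rewrite mulr_suml; apply: (@le_trans _ _ ((\sum_(i < size p) `|p`_i| * t^-1 ^+ i) * expR (- t^-1))).
  rewrite ler_wpM2r ?expR_ge0 //; apply: le_trans (ler_norm_sum _ _ _) _.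
  by apply: ler_sum => i _; rewrite normrM (ger0_norm (_ : 0 <= t^-1 ^+ i)) // exprn_ge0 // invr_ge0 ltW.
rewrite mulr_suml; apply: ler_sum => i _.
rewrite -[_ * _ * expR _]mulrA -[leRHS]mulrA ler_wpM2l //.
have ti : 0 <= t^-1 by rewrite invr_ge0 ltW.
rewrite expRN ler_pdivrMr ?expR_gt0 //.
have E : t^-1 ^+ i = t^-1 ^+ i.+2 * t ^+ 2.
  by rewrite -addn2 exprD -mulrA -exprMn mulVf ?expr1n ?mulr1 // lt0r_neq0.
have t2 : 0 <= t ^+ 2 by rewrite exprn_ge0 // ltW.
rewrite {}E [leRHS]mulrAC; apply: ler_wpM2r => //.
by have := pow_le_expR i.+2 ti.
Qed.

(** With s = 1/t, so that ds/dt = -s^2, the derivative of P(s) exp(-s) is (P - P')(s) s^2 exp(-s).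
    At 0 the quadratic bound of [poly_expR_le] decides. *)
Lemma is_derive_flat_fun p t :
  is_derive t (1 : R) (flat_fun p) (flat_fun ((p - p^`()) * 'X^2) t).
Proof.
have [t0|t0|->] := ltgtP t 0.
- have E : {near t, cst (0 : R) =1 flat_fun p}.
    have : nbhs t [set y : R | y < 0] by exact: lt_nbhsl.
    by apply: filterS => y /= y0; rewrite /flat_fun ltNge (ltW y0).
  rewrite {2}/flat_fun ltNge (ltW t0) /=.
  exact: near_eq_is_derive E (is_derive_cst _ _ _).
- have E : {near t, (fun y : R => p.[y^-1] * expR (- y^-1)) =1 flat_fun p}.
    have : nbhs t [set y : R | 0 < y] by exact: lt_nbhsr.
    by apply: filterS => y /= y0; rewrite /flat_fun y0.
  apply: near_eq_is_derive E _.
  have tn0 : t != 0 by rewrite lt0r_neq0.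
  have dV : is_derive t (1 : R) (fun y : R => y^-1) (- t ^- 2).
    have := @realfun.is_deriveV R id t _ 1 tn0 (is_derive_id _ _).
    by rewrite /GRing.scale /= mulr1.
  have dp : is_derive t (1:R) (fun y : R => p.[y^-1]) (p^`().[t^-1] * - t ^- 2).
    have dh : is_derive t^-1 (1 : R) (horner p) p^`().[t^-1].
      have -> : p^`().[t^-1] = 'D_1 (horner p) (t^-1).
        by rewrite -derive1E -(congr1 (@^~ (t^-1)) (derivE p)).
      exact: (derivableP (@derivable_horner R p t^-1)).
    exact: (is_derive1_comp dh dV).
  have de : is_derive t (1:R) (fun y : R => expR (- y^-1)) (expR (- t^-1) * t ^- 2).
    apply: (@is_derive1_comp _ expR (fun y : R => - y^-1)).
    by have := is_deriveN dV; rewrite opprK.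
  have dM := is_deriveM dp de.
  apply: (is_derive_eq dM).
  rewrite /flat_fun t0 /GRing.scale /= hornerM hornerXn hornerD hornerN exprVn; ring.
- rewrite {2}/flat_fun ltxx.
  have [C C0 HC] := poly_expR_le p.
  have H : (fun h : R => h^-1 *: ((flat_fun p \o shift 0) (h *: (1 : R)) - flat_fun p 0)) @ 0^' --> (0 : R).
    apply/cvgrPdist_le => e e0.
    have : \forall h \near (0 : R)^', `|h| <= e / (C + 1) .
      apply: nbhs_dnbhs; apply/nbhs_normP; exists (e / (C + 1)).
        by rewrite /= divr_gt0 // ltr_wpDl.
      by move=> z /=; rewrite sub0r normrN => /ltW.
    apply: filterS => h hle.
    rewrite sub0r normrN /= addr0 [_%:A]mulr1 {2}/flat_fun ltxx subr0 /flat_fun.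
    case: ifPn => h0; last by rewrite scaler0 normr0 ltW.
    rewrite normrZ normfV (gtr0_norm h0) ler_pdivrMl // (le_trans (HC _ h0)) //.
    rewrite expr2 mulrCA ler_wpM2l ?(ltW h0) //.
    rewrite (gtr0_norm h0) ler_pdivlMr ?ltr_wpDl // in hle.
    by apply: le_trans hle; rewrite mulrC ler_wpM2l ?(ltW h0) // lerDl.
  by apply: DeriveDef; [apply/cvg_ex; exists 0|exact/cvg_lim].
Unshelve. all: by end_near. Qed.

Definition flat : R -> R := flat_fun 1.

Lemma flat_gt0 t : 0 < t -> 0 < flat t.
Proof. by move=> t0; rewrite /flat /flat_fun t0 hornerC mul1r expR_gt0. Qed.

Lemma flat_eq0 t : t <= 0 -> flat t = 0.
Proof. by move=> t0; rewrite /flat /flat_fun ltNge t0. Qed.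

Lemma flat_ge0 t : 0 <= flat t.
Proof. by have [/flat_eq0 ->|/flat_gt0/ltW] := leP t 0. Qed.

Lemma Cinf_flat {n : nat} (U : set 'rV[R]_n) f : open U -> Cinf U f ->
  Cinf U (fun x => flat (f x)).
Proof.
move=> Uo fU.
apply: (@Cinf_comp1 _ _ setT [set a | exists p, a = flat_fun p]) Uo _ fU _ => //.
  by move=> _ [p ->]; exists (flat_fun ((p - p^`()) * 'X^2)) => [|t _]; [eexists|exact: is_derive_flat_fun].
by exists 1.
Qed.

Definition smooth_step (t : R) : R := flat t / (flat t + flat (1 - t)).

Lemma smooth_step_den t : 0 < flat t + flat (1 - t).
Proof.
have [t0|t0] := ltP 0 t; first by rewrite ltr_pwDl ?flat_gt0 ?flat_ge0.
by rewrite ltr_wpDl ?flat_ge0 // flat_gt0 // subr_gt0; lra.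
Qed.

Lemma smooth_step_ge0 t : 0 <= smooth_step t.
Proof. by rewrite divr_ge0 ?flat_ge0 // ltW // smooth_step_den. Qed.

Lemma smooth_step_le1 t : smooth_step t <= 1.
Proof. by rewrite ler_pdivrMr ?smooth_step_den // mul1r lerDl flat_ge0. Qed.

Lemma smooth_step0 t : t <= 0 -> smooth_step t = 0.
Proof. by move=> t0; rewrite /smooth_step flat_eq0 // mul0r. Qed.

Lemma smooth_step_homo : {homo smooth_step : s t / s <= t}.
Proof.
have flat_homo s t : s <= t -> flat s <= flat t.
  move=> st; have [s0|s0] := leP s 0; first by rewrite flat_eq0 // flat_ge0.
  have t0 := lt_le_trans s0 st.
  by rewrite /flat /flat_fun s0 t0 !hornerC !mul1r ler_expR lerN2 lef_pV2.
(* After cross multiplication the term [flat s * flat t] is common to both sides and cancels. *)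
move=> s t st; rewrite /smooth_step ler_pdivrMr ?smooth_step_den //.
rewrite mulrAC ler_pdivlMr ?smooth_step_den // !mulrDr [flat t * flat s]mulrC lerD2l.
by apply: ler_pM; rewrite ?flat_ge0 //; apply: flat_homo => //; rewrite lerD2l lerN2.
Qed.

Lemma smooth_step1 t : 1 <= t -> smooth_step t = 1.
Proof.
move=> t1; rewrite /smooth_step (flat_eq0 (_ : 1 - t <= 0)) ?subr_le0 //.
by rewrite addr0 divff // lt0r_neq0 // flat_gt0 // (lt_le_trans ltr01).
Qed.

Lemma Cinf_step {n : nat} (U : set 'rV[R]_n) f : open U -> Cinf U f ->
  Cinf U (fun x => smooth_step (f x)).
Proof.
move=> Uo fU; have f1 := Cinf_sub1 Uo fU.
have d1 : Cinf U (fun x => flat (f x) + flat (1 - f x)).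
  exact: (Cinf_add Uo (Cinf_flat Uo fU) (Cinf_flat Uo f1)).
have d0 x : U x -> flat (f x) + flat (1 - f x) != 0.
  by rewrite lt0r_neq0 // smooth_step_den.
exact: (Cinf_mul Uo (Cinf_flat Uo fU) (Cinf_inv Uo d0 d1)).
Qed.

(** The bound [S] enters every gradient constant below. It exists because the derivative is
    continuous and vanishes off the unit interval; adding 1 to the maximum makes it positive. *)
Lemma smooth_step_derive : exists2 S : R, 0 < S &
  exists2 ds : R -> R, (forall t, is_derive t (1 : R) smooth_step (ds t)) &
    [/\ continuous ds, forall t, `|ds t| <= S & forall t, t <= 0 \/ 1 <= t -> ds t = 0].
Proof.
pose fl' := flat_fun ((1 - 1^`()) * 'X^2).
have d1 t : is_derive t (1:R) flat (fl' t) by exact: is_derive_flat_fun.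
have d2 t : is_derive t (1:R) (fun t => flat (1 - t)) (- fl' (1 - t)).
  have dd : is_derive t (1:R) (fun t : R => 1 - t) (-1).
    by apply: is_derive_eq; rewrite add0r mulrN1.
  by have := @is_derive1_comp _ flat (fun t : R => 1 - t) t _ _ (d1 _) dd; rewrite mulrN1.
pose D t := flat t + flat (1 - t).
have dD t : is_derive t (1:R) D (fl' t - fl' (1 - t)) by exact: is_deriveD.
have D0 t : D t != 0 by rewrite lt0r_neq0 // smooth_step_den.
pose ds t := fl' t / D t - flat t * (D t ^- 2 * (fl' t - fl' (1 - t))).
have dds t : is_derive t (1:R) smooth_step (ds t).
  have dV := @realfun.is_deriveV R D t _ 1 (D0 t) (dD t).
  apply: (is_derive_eq (is_deriveM (d1 t) dV)).
  by rewrite /ds /GRing.scale /=; ring.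
have fl0 t : t <= 0 -> fl' t = 0 by move=> t0; rewrite /fl' /flat_fun ltNge t0.
have ds0 t : t <= 0 \/ 1 <= t -> ds t = 0.
  case=> [t0|t1]; first by rewrite /ds fl0 // flat_eq0 // !mul0r subr0.
  have t10 : 1 - t <= 0 by rewrite subr_le0.
  rewrite /ds (fl0 (1 - t)) // subr0 /D (flat_eq0 t10) addr0.
  have : flat t != 0 by rewrite lt0r_neq0 // flat_gt0 // (lt_le_trans ltr01).
  by move=> ft; field.
have dc : continuous ds.
  have c1 : continuous flat by move=> t; apply/differentiable_continuous/derivable1_diffP; have [] := d1 t.
  have c2 : continuous fl' by move=> t; apply/differentiable_continuous/derivable1_diffP; have [] := is_derive_flat_fun ((1 - 1^`()) * 'X^2) t.
  have c3 : continuous D by move=> t; apply/differentiable_continuous/derivable1_diffP; have [] := dD t.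
  have c4 : continuous (fun t => fl' (1 - t)).
    move=> t; apply: (@continuous_comp _ _ _ (fun t : R => 1 - t) fl'); last exact: c2.
    by apply: cvgB; [exact: cvg_cst|exact: cvg_id].
  move=> t; have i3 : (fun t => (D t)^-1) @ t --> (D t)^-1 by apply: cvgV => //; exact: c3.
  have i4 : (fun t => D t ^- 2) @ t --> D t ^- 2.
    by apply: cvgV; [rewrite expf_neq0|apply: (cvgM (c3 t) (c3 t))].
  exact: (cvgB (cvgM (c2 t) i3) (cvgM (c1 t) (cvgM i4 (cvgB (c2 t) (c4 t))))).
have [c _ Hc] := @EVT_max R (fun t => `|ds t|) 0 1 ler01
  (continuous_subspaceT (fun t => cvg_norm (dc t))).
exists (`|ds c| + 1); first by rewrite ltr_wpDl.
exists ds => //; split=> // t.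
have [t0|t0] := leP t 0; first by rewrite ds0 ?normr0 ?addr_ge0 //; left.
have [t1|t1] := leP 1 t; first by rewrite ds0 ?normr0 ?addr_ge0 //; right.
by rewrite (le_trans (Hc t _)) ?lerDl // in_itv /= !ltW.
Qed.

End bump.

(** * Smooth functions on a manifold *)

Section manifold_calculus.
Context {R : realType} {n : nat} {M : ptopologicalType}.
Variable A : smooth_manifold R n M.

Local Notation chart := (chart A).
Local Notation dom := (@dom _ _ _ A).
Local Notation coord := (@coord _ _ _ A).
Local Notation param := (@param _ _ _ A).
Local Notation chart_at := (@chart_at _ _ _ A).

Implicit Types (i j : chart) (p q : M) (u v : M -> R) (W : set M).

Lemma within_open_continuous {T S : topologicalType} (U : set T) (f : T -> S) x :
  open U -> {within U, continuous f} -> U x -> {for x, continuous f}.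
Proof.
move=> Uo cf Ux; have := cf x.
rewrite /prop_for /continuous_at /= => H B /H /=.
move=> HB; have {}HB : within U (nbhs x) (f @^-1` B).
  by rewrite (nbhs_subspace_in Ux).
have NU : nbhs x U by exact: open_nbhs_nbhs.
by apply: filterS2 NU HB => y Uy; apply.
Qed.

Definition codom i : set 'rV[R]_n := coord i @` dom i.

Lemma coord_cont i p : dom i p -> {for p, continuous (coord i)}.
Proof. by apply: within_open_continuous; [exact: dom_open|exact: coord_continuous]. Qed.

Lemma param_cont i x : codom i x -> {for x, continuous (param i)}.
Proof. by apply: within_open_continuous; [exact: image_open|exact: param_continuous]. Qed.

Lemma codom_coord i p : dom i p -> codom i (coord i p).
Proof. by exists p. Qed.

Lemma dom_param i x : codom i x -> dom i (param i x).
Proof. by move=> [p ip <-]; rewrite coordK. Qed.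

Lemma paramK i x : codom i x -> coord i (param i x) = x.
Proof. by move=> [p ip <-]; rewrite coordK. Qed.

Lemma coord_imageE i W : coord i @` (dom i `&` W) = codom i `&` param i @^-1` W.
Proof.
apply/seteqP; split=> [_ [p [ip Wp] <-]|x [ix Wx]].
  by split; [exists p|rewrite /= coordK].
by exists (param i x); [split=> //; exact: dom_param|exact: paramK].
Qed.

Lemma coord_image_open i W : open W -> open (coord i @` (dom i `&` W)).
Proof.
move=> Wo; rewrite coord_imageE openE => x [ix Wx]; apply: filterI.
  by apply: open_nbhs_nbhs; split => //; exact: image_open.
by apply: (param_cont ix); apply: open_nbhs_nbhs.
Qed.

Lemma coord_preimage_open i (U : set 'rV[R]_n) :
  open U -> open (dom i `&` coord i @^-1` U).
Proof.
move=> Uo; rewrite openE => p [ip Up]; apply: filterI.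
  by apply: open_nbhs_nbhs; split => //; exact: dom_open.
by apply: (coord_cont ip); apply: open_nbhs_nbhs.
Qed.

(** All charts are quantified over, so that changing charts is free; the set [W] lets one notion
    cover both smoothness on a chart domain and smoothness on [M]. *)
Record sm (W : set M) (u : M -> R) : Prop := Sm
  { sm_Cinf : forall i, Cinf (coord i @` (dom i `&` W)) (u \o param i) }.

Lemma sm_sub W W' u : W' `<=` W -> sm W u -> sm W' u.
Proof.
move=> WW [H]; split=> i; apply: Cinf_sub (H i).
by move=> _ [p [ip /WW Wp] <-]; exists p.
Qed.

Lemma sm_eq W u v : open W -> (forall p, W p -> u p = v p) -> sm W u -> sm W v.
Proof.
move=> Wo uv [H]; split=> i; apply: Cinf_eq (H i); first exact: coord_image_open.
by move=> _ [p [ip Wp] <-]; rewrite /= coordK //; exact: uv.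
Qed.

Lemma sm_local W u :
  (forall p, W p -> exists2 W', W' p & sm W' u) -> sm W u.
Proof.
move=> H; split=> i; split=> s _ [p [ip Wp] <-].
have [W' W'p [/(_ i)[H']]] := H p Wp.
by apply: H'; exists p.
Qed.

Lemma sm_union W W' u : sm W u -> sm W' u -> sm (W `|` W') u.
Proof. by move=> H H'; apply: sm_local => p [Wp|Wp]; [exists W|exists W']. Qed.

Lemma sm_cst W (c : R) : sm W (cst c).
Proof. by split=> i; exact: Cinf_cst. Qed.

Lemma sm_add W u v : open W -> sm W u -> sm W v -> sm W (fun p => u p + v p).
Proof. by move=> Wo [uW] [vW]; split=> i; exact: (Cinf_add (coord_image_open Wo) (uW i) (vW i)). Qed.

Lemma sm_mul W u v : open W -> sm W u -> sm W v -> sm W (fun p => u p * v p).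
Proof. by move=> Wo [uW] [vW]; split=> i; exact: (Cinf_mul (coord_image_open Wo) (uW i) (vW i)). Qed.

Lemma sm_opp W u : open W -> sm W u -> sm W (fun p => - u p).
Proof. by move=> Wo [uW]; split=> i; exact: (Cinf_opp (coord_image_open Wo) (uW i)). Qed.

Lemma sm_subr W u v : open W -> sm W u -> sm W v -> sm W (fun p => u p - v p).
Proof. by move=> Wo uW vW; exact: (sm_add Wo uW (sm_opp Wo vW)). Qed.

Lemma sm_sum W (I : Type) (r : seq I) (P : pred I) (F : I -> M -> R) :
  open W -> (forall l, P l -> sm W (F l)) ->
  sm W (fun p => \sum_(l <- r | P l) F l p).
Proof.
move=> Wo FW; split=> i.
apply: (@Cinf_sum _ _ _ _ _ _ (fun l => F l \o param i)); first exact: coord_image_open.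
by move=> l Pl; have [] := FW l Pl.
Qed.

Lemma sm_prod W (I : Type) (r : seq I) (P : pred I) (F : I -> M -> R) :
  open W -> (forall l, P l -> sm W (F l)) ->
  sm W (fun p => \prod_(l <- r | P l) F l p).
Proof.
move=> Wo FW; split=> i.
apply: (@Cinf_prod _ _ _ _ _ _ (fun l => F l \o param i)); first exact: coord_image_open.
by move=> l Pl; have [] := FW l Pl.
Qed.

Lemma sm_inv W u : open W -> (forall p, W p -> u p != 0) -> sm W u ->
  sm W (fun p => (u p)^-1).
Proof.
move=> Wo u0 [uW]; split=> i; apply: (Cinf_inv (coord_image_open Wo) _ (uW i)).
by move=> _ [p [ip Wp] <-]; rewrite /= coordK //; exact: u0.
Qed.

Lemma sm_expR W u : open W -> sm W u -> sm W (fun p => expR (u p)).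
Proof. by move=> Wo [uW]; split=> i; exact: (Cinf_expR (coord_image_open Wo) (uW i)). Qed.

Lemma sm_step W u : open W -> sm W u -> sm W (fun p => smooth_step (u p)).
Proof. by move=> Wo [uW]; split=> i; exact: (Cinf_step (coord_image_open Wo) (uW i)). Qed.

Lemma sm_derivable W u i p a : sm W u -> W p -> dom i p ->
  derivable (u \o param i) (coord i p) (delta_mx 0 a).
Proof. by move=> [uW] Wp ip; apply: Cinf_derivable (uW i) _; exists p. Qed.

Lemma sm_continuous W u p : sm W u -> W p -> {for p, continuous u}.
Proof.
move=> [uW] Wp; set i := chart_at p.
have ip : dom i p := @mem_chart_at _ _ _ A p.
have uc : {for p, continuous ((u \o param i) \o coord i)}.
  apply: continuous_comp; first exact: coord_cont.
  by apply: Cinf_continuous (uW i) _; exists p.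
apply: continuous_eq_on (@dom_open _ _ _ A i) _ ip uc => q iq.
by rewrite /= coordK.
Qed.

(** Compatibility of the atlas enters here: the expression in another chart is the given one
    composed with a transition map. *)
Lemma sm_chart W i u : open W -> W `<=` dom i ->
  Cinf (coord i @` (dom i `&` W)) (u \o param i) -> sm W u.
Proof.
move=> Wo Wi H; split=> j.
have Vo : open (coord j @` (dom j `&` W)) by exact: coord_image_open.
apply: (@Cinf_eq _ _ _ (fun x => (u \o param i) (coord i (param j x)))) => //.
  move=> _ [p [jp Wp] <-]; rewrite /= coordK // coordK //; exact: Wi.
apply: (Cinf_comp Vo (coord_image_open Wo) _ _ H).
  move=> _ [p [jp Wp] <-]; exists p; last by rewrite coordK.
  by split=> //; exact: Wi.
move=> l; apply: (@Cinf_sub _ _ (coord j @` (dom j `&` dom i))).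
  by move=> _ [p [jp Wp] <-]; exists p => //; split=> //; exact: Wi.
by split; exact: transition_smooth.
Qed.

Lemma smooth_in_sm i u : smooth_in i u -> sm (dom i) u.
Proof.
move=> ui; apply: (@sm_chart _ i) => //; first exact: dom_open.
by rewrite setIid; split.
Qed.

Lemma sm_smooth_in i u : sm (dom i) u -> smooth_in i u.
Proof. by move=> [/(_ i)]; rewrite setIid => -[]. Qed.

Lemma sm_coord i a : sm (dom i) (fun p => coord i p 0 a).
Proof.
apply: (@sm_chart _ i) => //; first exact: dom_open.
apply: (@Cinf_eq _ _ _ (fun x => x 0 a)).
- by apply: coord_image_open; exact: dom_open.
- by move=> _ [p [ip _] <-]; rewrite /= coordK.
- exact: Cinf_coord.
Qed.

Lemma sm_pderiv W i a u : open W -> sm W u -> sm (dom i `&` W) (pderiv i a u).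
Proof.
move=> Wo [uW]; apply: (@sm_chart _ i).
- by apply: openI => //; exact: dom_open.
- by move=> p [].
rewrite setIA setIid.
apply: (Cinf_eq _ _ (Cinf_partial a (uW i))); first exact: coord_image_open.
by move=> _ [p [ip Wp] <-]; rewrite /pderiv /= coordK.
Qed.

Lemma pderiv_eq W i a u v p : open W -> (forall q, W q -> u q = v q) ->
  dom i p -> W p -> pderiv i a u p = pderiv i a v p.
Proof.
move=> Wo uv ip Wp.
apply: (@partial_eq _ _ (coord i @` (dom i `&` W))); first exact: coord_image_open.
  by move=> _ [q [iq Wq] <-]; rewrite /= coordK //; exact: uv.
by exists p.
Qed.

Lemma pderiv_cst i a (c : R) p : pderiv i a (cst c) p = 0.
Proof. exact: derive_cst. Qed.

Lemma is_derive_pderiv W i a u p : sm W u -> W p -> dom i p ->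
  is_derive (coord i p) (delta_mx 0 a) (u \o param i) (pderiv i a u p).
Proof. by move=> uW Wp ip; apply: derivableP; exact: sm_derivable uW Wp ip. Qed.

Lemma pderivD W i a u v p : sm W u -> sm W v -> W p -> dom i p ->
  pderiv i a (fun q => u q + v q) p = pderiv i a u p + pderiv i a v p.
Proof.
move=> uW vW Wp ip.
exact: (deriveD (sm_derivable uW Wp ip) (sm_derivable vW Wp ip)).
Qed.

Lemma pderivB W i a u v p : sm W u -> sm W v -> W p -> dom i p ->
  pderiv i a (fun q => u q - v q) p = pderiv i a u p - pderiv i a v p.
Proof.
move=> uW vW Wp ip.
exact: (deriveB (sm_derivable uW Wp ip) (sm_derivable vW Wp ip)).
Qed.

Lemma pderivM W i a u v p : sm W u -> sm W v -> W p -> dom i p ->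
  pderiv i a (fun q => u q * v q) p = pderiv i a u p * v p + u p * pderiv i a v p.
Proof.
move=> uW vW Wp ip; rewrite addrC [pderiv i a u p * _]mulrC.
have := deriveM (sm_derivable uW Wp ip) (sm_derivable vW Wp ip).
by rewrite /pderiv /partial /= coordK.
Qed.

Lemma pderivZ W i a (c : R) u p : sm W u -> W p -> dom i p ->
  pderiv i a (fun q => c * u q) p = c * pderiv i a u p.
Proof.
move=> uW Wp ip; rewrite (pderivM a (sm_cst W c) uW Wp ip).
by rewrite pderiv_cst mul0r add0r.
Qed.

Lemma pderiv_sum W i a (I : Type) (r : seq I) (P : pred I) (F : I -> M -> R) p :
  open W -> (forall l, P l -> sm W (F l)) -> W p -> dom i p ->
  pderiv i a (fun q => \sum_(l <- r | P l) F l q) p =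
  \sum_(l <- r | P l) pderiv i a (F l) p.
Proof.
move=> Wo FW Wp ip; elim: r => [|l r IH].
  rewrite big_nil (_ : (fun q => _) = cst 0) ?pderiv_cst //.
  by apply/funext => q; rewrite big_nil.
rewrite big_cons; case: (boolP (P l)) => Pl; last first.
  by rewrite -IH; congr (pderiv i a _ p); apply/funext => q; rewrite big_cons (negbTE Pl).
rewrite -IH -(pderivD a (FW l Pl) (sm_sum r Wo FW) Wp ip).
by congr (pderiv i a _ p); apply/funext => q; rewrite big_cons Pl.
Qed.

Lemma pderiv_prod W i a (I : finType) (F : I -> M -> R) p :
  open W -> (forall l, sm W (F l)) -> W p -> dom i p ->
  pderiv i a (fun q => \prod_l F l q) p =
  \sum_l pderiv i a (F l) p * \prod_(m | m != l) F m p.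
Proof.
move=> Wo FW Wp ip.
suff H (r : seq I) : uniq r -> pderiv i a (fun q => \prod_(l <- r) F l q) p =
  \sum_(l <- r) pderiv i a (F l) p * \prod_(m <- r | m != l) F m p.
  exact: H (index_enum_uniq I).
elim: r => [_|l r IH /= /andP[lr ur]].
  rewrite big_nil (_ : (fun q => _) = cst 1) ?pderiv_cst //.
  by apply/funext => q; rewrite big_nil.
have E : (fun q => \prod_(l0 <- l :: r) F l0 q) = (fun q => F l q * \prod_(l0 <- r) F l0 q).
  by apply/funext => q; rewrite big_cons.
rewrite E (pderivM a (FW l) (sm_prod r Wo (fun m _ => FW m)) Wp ip) (IH ur) big_cons.
congr (_ + _).
  rewrite big_cons eqxx /=; congr (_ * _); rewrite big_seq_cond [RHS]big_seq_cond.
  by apply: eq_bigl => m; rewrite andbT; case: eqP => [->|]; rewrite ?(negbTE lr) ?andbT.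
rewrite mulr_sumr big_seq [RHS]big_seq; apply: eq_bigr => m mr.
rewrite big_cons; have -> : l != m by apply: contraNneq lr => ->.
by rewrite mulrCA.
Qed.

Lemma pderiv_comp1 W i a u (h : R -> R) (dh : R) p :
  sm W u -> W p -> dom i p -> is_derive (u p) (1 : R) h dh ->
  pderiv i a (fun q => h (u q)) p = dh * pderiv i a u p.
Proof.
move=> uW Wp ip Dh; have /is_derive_lineP Du := is_derive_pderiv a uW Wp ip.
have Dh' : is_derive ((u \o param i) (0 *: delta_mx 0 a + coord i p)) (1 : R) h dh.
  by rewrite scale0r add0r /= coordK.
have D := (is_derive_lineP (fun x => h ((u \o param i) x)) _ _ _).1
  (@is_derive1_comp _ h _ 0 _ _ Dh' Du).
exact: (@derive_val _ _ _ _ _ _ _ D).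
Qed.

Lemma pderiv_coord i a b p : dom i p ->
  pderiv i a (fun q => coord i q 0 b) p = (b == a)%:R.
Proof.
move=> ip; rewrite /pderiv.
rewrite (@partial_eq _ _ (codom i) _ (fun x => x 0 b)).
- have D : is_derive (coord i p) (delta_mx 0 a) (fun y : 'rV[R]_n => y 0 b) (b == a)%:R.
    apply/is_derive_lineP.
    rewrite (_ : (fun s => _) = fun s : R => s * (b == a)%:R + coord i p 0 b); last first.
      by apply/funext => s; rewrite !mxE eqxx.
    by apply: is_derive_eq; rewrite /GRing.scale /= mulr1 mulr0 addr0 add0r.
  exact: (@derive_val _ _ _ _ _ _ _ D).
- exact: image_open.
- by move=> y iy; rewrite /= paramK.
- exact: codom_coord.
Qed.

Lemma pderiv_chain W i j a u p : open W -> sm W u -> W p -> dom i p -> dom j p ->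
  pderiv i a u p = \sum_b jac i j p a b * pderiv j b u p.
Proof.
move=> Wo uW Wp ip jp.
have [uj] := uW; have {}uj := uj j.
have Vo : open (coord j @` (dom j `&` W)) by exact: coord_image_open.
rewrite {1}/pderiv.
rewrite (@partial_eq _ _ (coord i @` (dom i `&` (dom j `&` W))) _
   (fun x => (u \o param j) (coord j (param i x)))); last 3 first.
- by apply: coord_image_open; apply: openI => //; exact: dom_open.
- by move=> _ [q [iq [jq Wq]] <-]; rewrite /= coordK // coordK.
- by exists p.
have jE : coord j (param i (coord i p)) = coord j p by rewrite coordK.
have Np : nbhs (coord j (param i (coord i p))) (coord j @` (dom j `&` W)).
  by apply: open_nbhs_nbhs; split => //; rewrite jE; exists p.
have D := @is_derive_rV_comp _ _ _ (u \o param j) (fun x => coord j (param i x))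
  (coord i p) (delta_mx 0 a) (fun b => jac i j p a b).
suff [_ H] : is_derive (coord i p) (delta_mx 0 a)
    (fun x => (u \o param j) (coord j (param i x)))
    (\sum_b jac i j p a b * pderiv j b u p) by [].
have -> : \sum_b jac i j p a b * pderiv j b u p =
    \sum_b jac i j p a b * partial b (u \o param j) (coord j (param i (coord i p))).
  by apply: eq_bigr => b _; rewrite jE.
apply: D.
- by move=> b; apply: filterS Np => y; exact: Cinf_derivable uj.
- by move=> b; apply: Cinf_continuous (Cinf_partial b uj) _; rewrite jE; exists p.
- move=> b; rewrite mxE; exact: is_derive_pderiv (sm_coord j b) jp ip.
Qed.

Lemma pderivC W i a b u p : open W -> sm W u -> W p -> dom i p ->
  pderiv i a (pderiv i b u) p = pderiv i b (pderiv i a u) p.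
Proof.
move=> Wo uW Wp ip; have [ui] := uW.
have Vo : open (coord i @` (dom i `&` W)) by exact: coord_image_open.
have E c d : pderiv i c (pderiv i d u) p = partial c (partial d (u \o param i)) (coord i p).
  rewrite {1}/pderiv; apply: (partial_eq c Vo); last by exists p.
  by move=> _ [q [iq Wq] <-]; rewrite /pderiv /= coordK.
by rewrite !E; apply: (partial_comm _ _ Vo (ui i)); exists p.
Qed.

Lemma jac_id i p : dom i p -> jac i i p = 1%:M.
Proof. by move=> ip; apply/matrixP => a b; rewrite !mxE pderiv_coord // eq_sym. Qed.

Lemma jac_mul i j l p : dom i p -> dom j p -> dom l p ->
  jac i j p *m jac j l p = jac i l p.
Proof.
move=> ip jp lp; apply/matrixP => a b; rewrite !mxE.
rewrite (pderiv_chain a (@dom_open _ _ _ A l) (sm_coord l b) lp ip jp).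
by apply: eq_bigr => c _; rewrite !mxE.
Qed.

Lemma sm_jac i j a b : sm (dom i `&` dom j) (fun p => jac i j p a b).
Proof.
apply: (@sm_eq _ (pderiv i a (fun q => coord j q 0 b))).
- by apply: openI; exact: dom_open.
- by move=> p _; rewrite mxE.
- by apply: sm_pderiv; [exact: dom_open|exact: sm_coord].
Qed.

(** The symmetry that makes the exterior derivative independent of the chart, through
    [exterior_transition]. *)
Lemma pderiv_jacC i j a b c p : dom i p -> dom j p ->
  pderiv i a (fun q => jac i j q b c) p = pderiv i b (fun q => jac i j q a c) p.
Proof.
move=> ip jp.
have E d e : pderiv i d (fun q => jac i j q e c) p = pderiv i d (pderiv i e (fun q => coord j q 0 c)) p.
  by congr (pderiv i d _ p); apply/funext => q; rewrite mxE.
by rewrite !E (pderivC _ _ (@dom_open _ _ _ A j) (sm_coord j c) jp ip).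
Qed.

End manifold_calculus.

(** * Bump functions and finite covers *)

Section bumps_and_covers.
Context {R : realType} {n : nat} {M : ptopologicalType}.
Variable A : smooth_manifold R n M.

Local Notation chart := (chart A).
Local Notation dom := (@dom _ _ _ A).
Local Notation coord := (@coord _ _ _ A).
Local Notation param := (@param _ _ _ A).
Local Notation chart_at := (@chart_at _ _ _ A).

Implicit Types (i j : chart) (p q : M) (u v : M -> R) (W : set M).

Lemma manifold_compact_closed (K : set M) : compact K -> closed K.
Proof. by apply: compact_closed; exact: manifold_hausdorff A. Qed.

Lemma sm_extend W (K : set M) u : closed K -> K `<=` W -> sm A W u ->
  (forall p, ~ K p -> u p = 0) -> sm A setT u.
Proof.
move=> Kc KW uW u0.
have -> : setT = W `|` ~` K.
  by apply/seteqP; split=> // p _; have [Kp|] := pselect (K p); [left; exact: KW|right].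
apply: sm_union => //; apply: (sm_eq (closed_openC Kc) _ (sm_cst A (~` K) 0)) => p.
by move=> Kp; rewrite u0.
Qed.

Lemma closed_cube_compact (x : 'rV[R]_n) (r : R) : compact [set y | `|y - x| <= r].
Proof.
have -> : [set y | `|y - x| <= r] = [set v : 'rV[R]_n | forall l, `[x 0 l - r, x 0 l + r]%classic (v 0 l)]
   `&` [set y | `|y - x| <= r].
  apply/seteqP; split=> [y yr|y []//]; split=> // l /=; rewrite in_itv /=.
  have := le_trans (rV_coord_le (y - x) l) yr; rewrite !mxE ler_norml => /andP[h1 h2].
  by apply/andP; split; lra.
apply: compact_closedI; first by apply: (@rV_compact R n (fun l => `[x 0 l - r, x 0 l + r]%classic)) => l; exact: segment_compact.
have c : continuous (fun y : 'rV[R]_n => `|y - x|).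
  by move=> y; exact: (cvg_norm (cvgB (@cvg_id _ (nbhs y)) (@cvg_cst _ x _ (nbhs y) _))).
by have /continuous_closedP/(_ _ (@closed_le R r)) := c.
Qed.

(** The support is asked to lie in one chart domain as well, so that arguments localized by [psi]
    can be carried out in coordinates. *)
Lemma bump_exists p W : open W -> W p -> exists psi : M -> R,
  [/\ sm A setT psi, (forall q, 0 <= psi q <= 1),
    (exists W', [/\ open W', W' p & forall q, W' q -> psi q = 1]) &
    exists K, [/\ compact K, K `<=` W, K `<=` dom (chart_at p) & forall q, ~ K q -> psi q = 0]].
Proof.
move=> Wo Wp; set i := chart_at p.
have ip : dom i p := @mem_chart_at _ _ _ A p.
pose x := coord i p.
have /nbhs_rVP[d d0 Hd] : nbhs x (coord i @` (dom i `&` W)).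
  by apply: open_nbhs_nbhs; split; [exact: coord_image_open|exists p].
pose r := d / 3; have r0 : 0 < r by rewrite divr_gt0.
pose C : set 'rV[R]_n := [set y | `|y - x| <= 2 * r].
have Cd y : C y -> (coord i @` (dom i `&` W)) y.
  by move=> Cy; apply: Hd; apply: le_lt_trans Cy _; rewrite /r; lra.
pose K := param i @` C.
have KW q : K q -> dom i q /\ W q.
  by move=> [y Cy <-]; have [q' [iq' Wq'] <-] := Cd y Cy; rewrite coordK.
have Kc : compact K.
  apply: continuous_compact; last exact: closed_cube_compact.
  apply: continuous_in_subspaceT => y; rewrite inE => Cy.
  by apply: param_cont; have [q' [iq' Wq'] <-] := Cd y Cy; exists q'.
(* A factor is 1 when the coordinate is within [r] of that of [p] and 0 when it is [2 * r] or more
   away; squaring replaces the absolute value, which is not smooth. *)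
pose f q : R := \prod_(a < n) smooth_step (2 - (r^-1 * (coord i q 0 a - x 0 a)) ^+ 2).
pose psi q : R := if q \in dom i then f q else 0.
have fsm : sm A (dom i) f.
  apply: (@sm_prod _ _ _ A (dom i) _ _ _
     (fun a q => smooth_step (2 - (r^-1 * (coord i q 0 a - x 0 a)) ^+ 2))) => [|a _].
    exact: dom_open.
  have io : open (dom i) by exact: dom_open.
  have s1 : sm A (dom i) (fun q => r^-1 * (coord i q 0 a - x 0 a)).
    apply: (sm_mul io (sm_cst A _ (r^-1))).
    exact: (sm_subr io (sm_coord i a) (sm_cst A _ (x 0 a))).
  by apply: sm_step => //; apply: (sm_subr io (sm_cst A _ 2)); exact: (sm_mul io s1 s1).
have f01 q : 0 <= f q <= 1.
  apply/andP; split; first by apply: prodr_ge0 => a _; exact: smooth_step_ge0.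
  apply: (@le_trans _ _ (\prod_(a < n) 1)); last by rewrite big1.
  by apply: ler_prod => a _; rewrite smooth_step_ge0 smooth_step_le1.
have psi0 q : ~ K q -> psi q = 0.
  move=> Kq; rewrite /psi; case: ifPn => //; rewrite inE => iq.
  have [a Ha] : exists a, 2 * r < `|coord i q 0 a - x 0 a|.
    apply: contrapT => /forallNP H; apply: Kq; exists (coord i q); last exact: coordK.
    apply: rV_norm_le; first by rewrite mulr_ge0 // ltW.
    by move=> l; rewrite !mxE leNgt; apply/negP; exact: H.
  rewrite /f (bigD1 a) //= smooth_step0 ?mul0r // subr_le0.
  have h2 : 2 <= `|r^-1 * (coord i q 0 a - x 0 a)|.
    by rewrite normrM gtr0_norm ?invr_gt0 // ler_pdivlMl // mulrC ltW // mulrC.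
  rewrite -real_normK ?num_real //; apply: le_trans (_ : 2 ^+ 2 <= _).
    by rewrite expr2; lra.
  by rewrite lerXn2r // nnegrE.
exists psi; split.
- apply: (@sm_extend (dom i) K) => //; first exact: manifold_compact_closed.
    by move=> q /KW[].
  apply: sm_eq (@dom_open _ _ _ A i) _ fsm => q iq.
  by rewrite /psi mem_set.
- by move=> q; rewrite /psi; case: ifP => _; rewrite ?lexx ?ler01.
- exists (dom i `&` coord i @^-1` [set y | `|y - x| < r]); split.
  + apply: coord_preimage_open; rewrite openE => y /= yr; apply/nbhs_rVP.
    exists (r - `|y - x|); first by rewrite subr_gt0.
    move=> z zy; rewrite /= -(subrKA y) (le_lt_trans (ler_normD _ _)) //.
    by rewrite -ltrBrDr.
  + by split => //=; rewrite subrr normr0.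
  + move=> q [iq /= qr]; rewrite /psi mem_set // /f big1 // => a _.
    rewrite smooth_step1 //.
    have h1 : `|r^-1 * (coord i q 0 a - x 0 a)| <= 1.
      rewrite normrM gtr0_norm ?invr_gt0 // mulrC ler_pdivrMr // mul1r.
      apply: le_trans (ltW qr); have := rV_coord_le (coord i q - x) a.
      by rewrite !mxE.
    have : (r^-1 * (coord i q 0 a - x 0 a)) ^+ 2 <= 1.
      by rewrite -real_normK ?num_real // exprn_ile1.
    by lra.
- by exists K; split=> // q /KW[].
Qed.

(** The centres come as a list because the later gluing arguments are inductions on it. *)
Lemma finite_cover (K : set M) (U : M -> set M) : compact K ->
  (forall p, K p -> open (U p) /\ U p p) ->
  exists s : seq M, (forall p, p \in s -> K p) /\ forall p, K p -> exists2 q, q \in s & U q p.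
Proof.
move=> Kc HU; move: Kc; rewrite compact_cover => /(_ M K U) [].
- by move=> p /HU[].
- by move=> p Kp; exists p => //; have [] := HU p Kp.
move=> D DK KD; exists (finmap.enum_fset D); split=> [p pD|p /KD[q qD Uq]].
  by have := DK p pD; rewrite inE.
by exists q.
Qed.

End bumps_and_covers.

(** * Tensors in components *)

Section multi_indices.
Context {n : nat}.

Definition insert k (l : 'I_k.+1) (c : 'I_n) (K : {ffun 'I_k -> 'I_n}) :
  {ffun 'I_k.+1 -> 'I_n} := [ffun m => oapp K c (unlift l m)].

Definition omit k (l : 'I_k.+1) (I : {ffun 'I_k.+1 -> 'I_n}) :
  {ffun 'I_k -> 'I_n} := [ffun m => I (lift l m)].

Definition permute k (s : 'S_k) (I : {ffun 'I_k -> 'I_n}) :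
  {ffun 'I_k -> 'I_n} := [ffun l => I (s l)].

Lemma insert_at k l c (K : {ffun 'I_k -> 'I_n}) : insert l c K l = c.
Proof. by rewrite ffunE unlift_none. Qed.

Lemma insert_lift k l c (K : {ffun 'I_k -> 'I_n}) m : insert l c K (lift l m) = K m.
Proof. by rewrite ffunE liftK. Qed.

Lemma omit_insert k (l : 'I_k.+1) c (K : {ffun 'I_k -> 'I_n}) : omit l (insert l c K) = K.
Proof. by apply/ffunP => m; rewrite ffunE insert_lift. Qed.

Lemma insert_omit k (l : 'I_k.+1) (I : {ffun 'I_k.+1 -> 'I_n}) : insert l (I l) (omit l I) = I.
Proof. by apply/ffunP => m; rewrite ffunE; case: unliftP => [m'|] -> //=; rewrite ffunE. Qed.

Lemma big_insert (R : Type) (idx : R) (op : Monoid.com_law idx) k (l : 'I_k.+1)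
    (F : {ffun 'I_k.+1 -> 'I_n} -> R) :
  \big[op/idx]_I F I = \big[op/idx]_(c < n) \big[op/idx]_K F (insert l c K).
Proof.
rewrite pair_bigA /= (reindex (fun z : 'I_n * {ffun 'I_k -> 'I_n} => insert l z.1 z.2)) //=.
exists (fun I : {ffun 'I_k.+1 -> 'I_n} => (I l, omit l I)) => [[c K] _|I _] /=.
  by rewrite insert_at omit_insert.
exact: insert_omit.
Qed.

Lemma big_ord_lift (R : Type) (idx : R) (op : Monoid.com_law idx) k (l : 'I_k.+1)
    (F : 'I_k.+1 -> R) :
  \big[op/idx]_m F m = op (F l) (\big[op/idx]_(m < k) F (lift l m)).
Proof.
rewrite (bigD1 l) //=; congr (op _ _).
rewrite (reindex_omap (lift l) (unlift l)) /= => [|m ml]; last first.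
  by case: unliftP ml => [m' ->|->] //=; rewrite eqxx.
by apply: eq_bigl => m; rewrite liftK eqxx andbT eq_sym neq_lift.
Qed.

Lemma permuteM k (s t : 'S_k) I : permute s (permute t I) = permute (s * t)%g I.
Proof. by apply/ffunP => l; rewrite !ffunE permM. Qed.

Lemma omit_permute k (s : 'S_k) (l : 'I_k.+1) I :
  omit ord0 (permute (lift_perm ord0 l s) I) = permute s (omit l I).
Proof. by apply/ffunP => m; rewrite !ffunE lift_perm_lift. Qed.

End multi_indices.

Section arrays.
Context {R : numFieldType} {n : nat}.
Implicit Types (P Q G : 'M[R]_n).

Definition array k := {ffun 'I_k -> 'I_n} -> R.

(** The transformation law of covariant tensors under the change of frame [P], exactly as in the
    last condition of [Omega]. *)
Definition tact P k (w : array k) : array k :=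
  fun I => \sum_J w J * \prod_l P (I l) (J l).

(** With [G] the inverse metric this is [form_dot] before the division by [k!]. *)
Definition tdot G k (v w : array k) : R :=
  \sum_I \sum_J v I * w J * \prod_l G (I l) (J l).

Definition alternating k (w : array k) :=
  forall I (s : 'S_k), w (permute s I) = (-1) ^+ s * w I.

Lemma tact_mul P Q k (w : array k) : tact P (tact Q w) = tact (P *m Q) w.
Proof.
apply/funext => I; rewrite /tact.
transitivity (\sum_(J : {ffun 'I_k -> 'I_n}) \sum_(K : {ffun 'I_k -> 'I_n}) w K * \prod_l (P (I l) (J l) * Q (J l) (K l))).
  apply: eq_bigr => J _; rewrite mulr_suml; apply: eq_bigr => K _.
  by rewrite big_split /= -mulrA; congr (_ * _); exact: mulrC.
rewrite exchange_big /=; apply: eq_bigr => K _; rewrite -mulr_sumr; congr (_ * _).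
rewrite -(bigA_distr_bigA (fun l b => P (I l) b * Q b (K l))).
by apply: eq_bigr => l _; rewrite mxE.
Qed.

Lemma tact1 k (w : array k) : tact 1%:M w = w.
Proof.
apply/funext => I; rewrite /tact (bigD1 I) //= [X in _ + X]big1 ?addr0 => [|J JI].
  by rewrite big1 ?mulr1 // => l _; rewrite mxE eqxx.
have [l lJ] : exists l, J l != I l.
  by apply/existsP; apply: contraR JI => /existsPn H; apply/eqP/ffunP => l; apply/eqP; have := H l; rewrite negbK.
by rewrite (bigD1 l) //= mxE eq_sym (negbTE lJ) mul0r mulr0.
Qed.

Lemma tdotE G k (v w : array k) : tdot G v w = \sum_I v I * tact G w I.
Proof.
apply: eq_bigr => I _; rewrite mulr_sumr; apply: eq_bigr => J _.
by rewrite mulrA.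
Qed.

Lemma tact_adjoint P k (v u : array k) :
  \sum_I tact P v I * u I = \sum_I v I * tact P^T u I.
Proof.
rewrite /tact; under eq_bigr do rewrite mulr_suml.
rewrite exchange_big /=; apply: eq_bigr => J _; rewrite mulr_sumr.
apply: eq_bigr => I _; rewrite -mulrA; congr (_ * _); rewrite mulrC; congr (_ * _).
by apply: eq_bigr => l _; rewrite mxE.
Qed.

Lemma tdot_tact G P k (v w : array k) :
  tdot G (tact P v) (tact P w) = tdot (P^T *m G *m P) v w.
Proof. by rewrite !tdotE tact_adjoint !tact_mul. Qed.

(** Passage to an orthonormal frame: after the change of frame by the transpose of [Q] the product
    is Euclidean. *)
Lemma tdot_square Q k (v w : array k) :
  tdot (Q *m Q^T) v w = \sum_I tact Q^T v I * tact Q^T w I.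
Proof. by rewrite tdotE -tact_mul -[in LHS](trmxK Q) -tact_adjoint trmxK. Qed.

Lemma tdotC G k (v w : array k) : G^T = G -> tdot G v w = tdot G w v.
Proof.
move=> GT; rewrite /tdot exchange_big /=; apply: eq_bigr => J _; apply: eq_bigr => I _.
by rewrite [v I * _]mulrC; congr (_ * _); apply: eq_bigr => l _; rewrite -[in LHS]GT mxE.
Qed.

Lemma tdotDl G k (u v w : array k) :
  tdot G (fun I => u I + v I) w = tdot G u w + tdot G v w.
Proof. by rewrite !tdotE -big_split; apply: eq_bigr => I _; rewrite mulrDl. Qed.

Lemma tdotZl G k c (v w : array k) : tdot G (fun I => c * v I) w = c * tdot G v w.
Proof. by rewrite !tdotE mulr_sumr; apply: eq_bigr => I _; rewrite mulrA. Qed.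

(** Exterior product of the 1-form [xi] with an alternating [b], with the signs of [ext_deriv] and
    no factorials. *)
Definition wedge1 (xi : 'I_n -> R) k (b : array k) : array k.+1 :=
  fun I => \sum_(l < k.+1) (-1) ^+ l * (xi (I l) * b (omit l I)).

Definition contract (X : 'rV[R]_n) k (w : array k.+1) : array k :=
  fun K => \sum_c X 0 c * w (insert ord0 c K).

(** Naturality of this product, and of [contract] in [contract_tact], allows both to be estimated in
    an orthonormal frame. *)
Lemma tact_wedge1 P xi k (b : array k) :
  tact P (wedge1 xi b) = wedge1 (fun a => \sum_c P a c * xi c) (tact P b).
Proof.
apply/funext => I; rewrite /tact /wedge1.
under eq_bigr do rewrite mulr_suml.
rewrite exchange_big /=; apply: eq_bigr => l _.
rewrite (big_insert _ l) mulr_suml mulr_sumr; apply: eq_bigr => c _.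
rewrite !mulr_sumr; apply: eq_bigr => K _.
rewrite insert_at omit_insert (big_ord_lift _ l) /= insert_at.
under [X in _ * (_ * X) = _]eq_bigr do rewrite insert_lift.
rewrite (eq_bigr (fun m => P (omit l I m) (K m))); last by move=> m _; rewrite ffunE.
by ring.
Qed.

Lemma contract_tact P (X : 'rV[R]_n) k (w : array k.+1) :
  contract X (tact P w) = tact P (contract (X *m P) w).
Proof.
apply/funext => K; rewrite /tact /contract.
under [RHS]eq_bigr do rewrite mulr_suml.
rewrite [RHS]exchange_big /=.
under eq_bigr => c _ do rewrite (big_insert _ ord0) mulr_sumr.
rewrite exchange_big /=; apply: eq_bigr => b _.
under [RHS]eq_bigr do rewrite mxE mulr_suml mulr_suml.
rewrite [RHS]exchange_big /=; apply: eq_bigr => c _.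
rewrite mulr_sumr; apply: eq_bigr => L _.
rewrite (big_ord_lift _ ord0) /= !insert_at.
under [X in _ * (_ * (_ * X)) = _]eq_bigr do rewrite !insert_lift.
by ring.
Qed.

Lemma alternating_contract X k (w : array k.+1) :
  alternating w -> alternating (contract X w).
Proof.
move=> aw K s; rewrite /contract mulr_sumr; apply: eq_bigr => c _.
have -> : insert ord0 c (permute s K) = permute (lift_perm ord0 ord0 s) (insert ord0 c K).
  apply/ffunP => m; rewrite ffunE [RHS]ffunE.
  case: unliftP => [m'|] ->; first by rewrite lift_perm_lift insert_lift /= ffunE.
  by rewrite lift_perm_id insert_at.
by rewrite aw odd_lift_perm /= mulrCA.
Qed.

(** A permutation of [k.+1] letters amounts to its value at [ord0] together with a permutation of
    the remaining [k] letters. *)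
Lemma sum_lift_perm k (F : 'S_k.+1 -> R) :
  \sum_s F s = \sum_l \sum_(s : 'S_k) F (lift_perm ord0 l s).
Proof.
rewrite (partition_big (fun s : 'S_k.+1 => s ord0) predT) //=.
apply: eq_bigr => l _; rewrite (reindex (lift_perm ord0 l)) /=; last first.
  (* The residual permutation: [ord0] is deleted from the source and [s ord0] from the target. The
     default of [odflt] is never reached, by injectivity of [s]. *)
  pose u (s : 'S_k.+1) m := odflt m (unlift (s ord0) (s (lift ord0 m))).
  have uK (s : 'S_k.+1) m : lift (s ord0) (u s m) = s (lift ord0 m).
    rewrite /u; have := neq_lift ord0 m.
    by rewrite -(inj_eq (@perm_inj _ s)) => /unlift_some[? ? ->].
  have u_inj s : injective (u s).
    by move=> m m' E; apply/(@lift_inj _ ord0)/(@perm_inj _ s); rewrite -!uK E.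
  exists (fun s => perm (u_inj s)) => [s _|s /eqP sl]; apply/permP => m.
    by rewrite permE /u lift_perm_lift lift_perm_id liftK.
  case: (unliftP ord0 m) => [m'|] ->; last by rewrite lift_perm_id.
  by rewrite lift_perm_lift permE -sl uK.
by apply: eq_bigl => s; rewrite lift_perm_id eqxx.
Qed.

(* The array of d w, where D a J stands for the a-th derivative of w_J. *)
Definition exterior k (D : 'I_n -> array k) : array k.+1 :=
  fun I => \sum_(l < k.+1) (-1) ^+ l * D (I l) (omit l I).

(* The antisymmetrized form makes the cancellations below an involution. *)
Lemma exterior_perm k (D : 'I_n -> array k) I : (forall a, alternating (D a)) ->
  k`!%:R * exterior D I =
  \sum_(s : 'S_k.+1) (-1) ^+ s * D (I (s ord0)) (omit ord0 (permute s I)).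
Proof.
move=> aD; rewrite sum_lift_perm mulr_sumr; apply: eq_bigr => l _.
rewrite (eq_bigr (fun=> (-1) ^+ l * D (I l) (omit l I))) => [|s _].
  by rewrite sumr_const card_Sn mulr_natl.
rewrite lift_perm_id omit_permute aD odd_lift_perm /= signr_addb signr_odd.
by rewrite -mulrA signrMK.
Qed.

(** Reindexing by the odd permutation [t] turns the sum into its opposite. *)
Lemma sign_reversing k (F : 'S_k -> R) (t : 'S_k) :
  odd_perm t ->
  (forall s, F (t * s)%g = F s) -> \sum_(s : 'S_k) (-1) ^+ s * F s = 0.
Proof.
move=> ot Ft; set S := \sum_s _.
have E : S = - S.
  rewrite {1}/S (reindex_inj (mulgI t)) /= -sumrN; apply: eq_bigr => s _.
  by rewrite Ft odd_permM ot addTb signrN mulNr.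
have /eqP : S *+ 2 = 0 by rewrite mulr2n {2}E subrr.
by rewrite mulrn_eq0 => /eqP.
Qed.

End arrays.

Lemma invmx_left {R : fieldType} n (A B : 'M[R]_n) : B *m A = 1%:M -> invmx A = B.
Proof.
move=> BA; have [_ Au] := mulmx1_unit BA.
by rewrite -[LHS]mul1mx -BA mulmxK.
Qed.

(** * Positive definite forms and norm estimates *)

Section positive_forms.
Context {R : rcfType}.

(* Induction on the dimension by the Schur complement. *)
Lemma posdef_factor n (G : 'M[R]_n) : G^T = G ->
  (forall v : 'rV[R]_n, v != 0 -> 0 < (v *m G *m v^T) 0 0) ->
  exists2 Q, Q \in unitmx & G = Q *m Q^T.
Proof.
elim: n G => [|n IH] G GT Gpos.
  by exists 1%:M; [exact: unitmx1|apply/matrixP => -[]].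
pose G' : 'M[R]_(1 + n) := G.
pose a := G' 0 0; pose b : 'rV_n := ursubmx G'; pose D := drsubmx G'.
have ul : ulsubmx G' = a%:M.
  by apply/matrixP => x y; rewrite !ord1 !mxE eqxx mulr1n; congr (G' _ _); apply/val_inj.
have GE : G' = block_mx a%:M b b^T D.
  by rewrite -[G' in LHS]submxK ul /b trmx_ursub /G' GT.
have DT : D^T = D by rewrite /D trmx_drsub /G' GT.
have vG (t : R) (w : 'rV_n) : ((row_mx t%:M w : 'rV[R]_(1 + n)) *m G' *m (row_mx t%:M w)^T) =
   (t * t * a)%:M + t *: (b *m w^T) + t *: (w *m b^T) + w *m D *m w^T.
  rewrite GE mul_row_block tr_row_mx mul_row_col !mulmxDl tr_scalar_mx.
  rewrite -!scalar_mxM mul_mx_scalar mul_scalar_mx -scalemxAl.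
  have -> : t * a * t = t * t * a by ring.
  by rewrite addrA; congr (_ + _); rewrite addrAC.
have a0 : 0 < a.
  have n0 : (row_mx 1%:M 0 : 'rV[R]_(1 + n)) != 0.
    apply/eqP => /(congr1 (fun u : 'rV_(1 + n) => u 0 (lshift n 0))).
    by rewrite row_mxEl !mxE eqxx => /eqP; rewrite oner_eq0.
  by have := Gpos _ n0; rewrite vG trmx0 !mulmx0 mul0mx !scaler0 !addr0 !mul1r mxE eqxx mulr1n.
pose S := D - a^-1 *: (b^T *m b).
have ST : S^T = S by rewrite /S linearB linearZ /= DT trmx_mul trmxK.
have Spos (w : 'rV[R]_n) : w != 0 -> 0 < (w *m S *m w^T) 0 0.
  (* This [t] minimizes the form over the first coordinate; the minimum is the Schur complement
     evaluated at [w]. *)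
  move=> w0; pose c := (w *m b^T) 0 0; pose t := - (a^-1 * c).
  have n0 : (row_mx t%:M w : 'rV[R]_(1 + n)) != 0.
    by apply: contraNneq w0 => E; rewrite -(row_mxKr (t%:M : 'rV_1) w) E linear0.
  have := Gpos _ n0; rewrite vG.
  have bw : b *m w^T = w *m b^T.
    by apply/matrixP => x y; rewrite !ord1 !mxE; apply: eq_bigr => l _; rewrite !mxE mulrC.
  have cM : w *m b^T = c%:M by exact: mx11_scalar.
  have SwE : (w *m S *m w^T) 0 0 = (w *m D *m w^T) 0 0 - a^-1 * (c * c).
    rewrite /S mulmxBr mulmxBl -scalemxAr -scalemxAl mulmxA -[w *m b^T *m b *m w^T]mulmxA bw cM.
    by rewrite -scalar_mxM scale_scalar_mx [LHS]mxE [X in _ + X]mxE [X in - X]mxE eqxx mulr1n.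
  have tE : (t * t * a)%:M + t *: (b *m w^T) + t *: (w *m b^T) = (- (a^-1 * (c * c)))%:M.
    rewrite bw cM !scale_scalar_mx -!raddfD /=; congr (_%:M); rewrite /t; field.
    by rewrite lt0r_neq0.
  by rewrite tE [X in 0 < X -> _]mxE [X in X + _]mxE eqxx mulr1n SwE addrC.
have [Q Qu SE] := IH S ST Spos.
have sa0 : Num.sqrt a != 0 by rewrite lt0r_neq0 // sqrtr_gt0.
(* One step of a block Cholesky factorization. *)
pose B : 'M[R]_(1 + n) := block_mx (Num.sqrt a)%:M 0 ((Num.sqrt a)^-1 *: b^T) Q.
have detB : \det B = \det ((Num.sqrt a)%:M : 'M[R]_1) * \det Q by exact: det_lblock.
have Bu : B \in unitmx.
  by rewrite unitmxE detB det_scalar expr1 unitrM unitfE sa0 -unitmxE.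
suff BE : G' = B *m B^T by exists B; [exact: Bu|exact: BE].
rewrite GE /B tr_block_mx mulmx_block tr_scalar_mx trmx0 linearZ /= trmxK.
rewrite !mulmx0 !mul0mx !addr0 -scalar_mxM -expr2 sqr_sqrtr ?ltW //.
rewrite mul_scalar_mx scalerA mulfV // scale1r mul_mx_scalar scalerA mulfV // scale1r.
rewrite -scalemxAl -scalemxAr scalerA -invfM -expr2 sqr_sqrtr ?ltW // -SE /S.
by rewrite addrC subrK.
Qed.

Lemma sum_Cauchy_Schwarz (I : finType) (x y : I -> R) :
  (\sum_l x l * y l) ^+ 2 <= (\sum_l x l ^+ 2) * (\sum_l y l ^+ 2).
Proof.
set X := \sum_l x l ^+ 2; set Y := \sum_l y l ^+ 2; set Z := \sum_l x l * y l.
have Y0 : 0 <= Y by apply: sumr_ge0 => l _; exact: sqr_ge0.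
(* A sum of squares, free of division; the case [Y = 0], where it gives nothing, is settled
   separately by [y = 0]. *)
have H : 0 <= Y * (X * Y - Z ^+ 2).
  have -> : Y * (X * Y - Z ^+ 2) = \sum_l (Y * x l - Z * y l) ^+ 2.
    rewrite (eq_bigr (fun l => Y ^+ 2 * x l ^+ 2 - (2 * Y * Z) * (x l * y l) + Z ^+ 2 * y l ^+ 2)).
      by rewrite big_split /= sumrB -!mulr_sumr -/X -/Y -/Z; ring.
    by move=> l _; ring.
  by apply: sumr_ge0 => l _; exact: sqr_ge0.
have [Ypos|] := ltP 0 Y.
  by move: H; rewrite pmulr_rge0 // subr_ge0.
move=> Yle; have Y00 : Y = 0 by apply/eqP; rewrite eq_le Yle Y0.
have y0 l : y l = 0.
  have /eqP := Y00; rewrite psumr_eq0 => [|m _]; last exact: sqr_ge0.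
  by move=> /allP/(_ l); rewrite mem_index_enum sqrf_eq0 => /(_ isT)/eqP.
by rewrite /Z big1 ?expr0n ?mulr_ge0 ?sumr_ge0 // => l _; rewrite ?y0 ?mulr0 ?sqr_ge0.
Qed.

Lemma row_square n (y : 'rV[R]_n) : (y *m y^T) 0 0 = \sum_c y 0 c ^+ 2.
Proof. by rewrite mxE; apply: eq_bigr => c _; rewrite mxE expr2. Qed.

Context {n : nat} (G Q : 'M[R]_n) (Qu : Q \in unitmx) (GE : G = Q *m Q^T).

Lemma tdot_ge0 k (v : array k) : 0 <= tdot G v v.
Proof. by rewrite GE tdot_square sumr_ge0 // => I _; rewrite -expr2 sqr_ge0. Qed.

Lemma tdot_eq0 k (v : array k) : tdot G v v = 0 -> v = (fun=> 0).
Proof.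
rewrite GE tdot_square => /eqP; rewrite psumr_eq0 => [/allP H|I _]; last by rewrite -expr2 sqr_ge0.
have z : tact Q^T v = (fun=> 0).
  apply/funext => I; have := H I; rewrite mem_index_enum -expr2 sqrf_eq0.
  by move=> /(_ isT)/eqP.
rewrite -(tact1 v) -(mulVmx (_ : Q^T \in unitmx)) ?unitmx_tr // -tact_mul z.
by apply/funext => I; rewrite /tact big1 // => J _; rewrite mul0r.
Qed.

(** The difference of the two sides is half the square of [v + 2 w]. *)
Lemma tdot_Young k (v w : array k) :
  tdot G v v / 2 - 2 * tdot G w w <= tdot G v v + 2 * tdot G v w.
Proof.
rewrite GE !tdot_square !mulr_sumr mulr_suml -sumrB -big_split /=.
apply: ler_sum => I _; set x := tact _ v I; set y := tact _ w I.
have := sqr_ge0 (x + 2 * y); rewrite expr2; lra.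
Qed.

(** Here [G] is the inverse metric, so the first factor is the squared length of [X]. In an
    orthonormal frame the estimate is Cauchy-Schwarz over the contracted index. *)
Lemma contract_le (X : 'rV[R]_n) k (w : array k.+1) :
  tdot G (contract X w) (contract X w) <= (X *m invmx G *m X^T) 0 0 * tdot G w w.
Proof.
have QTu : Q^T \in unitmx by rewrite unitmx_tr.
pose X' := X *m invmx Q^T.
have XE : X = X' *m Q^T by rewrite /X' mulmxKV.
have -> : (X *m invmx G *m X^T) 0 0 = \sum_c X' 0 c ^+ 2.
  have -> : X *m invmx G *m X^T = X' *m X'^T.
    have GXE : X^T = G *m (invmx Q^T *m X'^T).
      by rewrite GE -mulmxA mulKVmx // XE trmx_mul trmxK.
    have Gu : G \in unitmx by rewrite GE unitmx_mul Qu.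
    by rewrite -mulmxA GXE mulKmx // XE mulmxA -[_ *m Q^T *m _]mulmxA mulmxV // mulmx1.
  exact: row_square.
rewrite GE !tdot_square {1 2}XE -contract_tact.
rewrite [X in _ <= _ * X](big_insert _ ord0) exchange_big /= mulr_sumr.
apply: ler_sum => K _; rewrite -expr2 /contract.
apply: le_trans (sum_Cauchy_Schwarz _ _) _.
by under [X in _ <= _ * X]eq_bigr do rewrite -expr2.
Qed.

(** One factor [k.+1] comes from Cauchy-Schwarz over the positions of the index of [xi], the other
    from the [k.+1] sums, one for each position, which all have the same bound. *)
Lemma wedge1_le (xi : 'I_n -> R) k (b : array k) :
  tdot G (wedge1 xi b) (wedge1 xi b) <=
  k.+1%:R ^+ 2 * (\sum_a \sum_c xi a * G a c * xi c) * tdot G b b.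
Proof.
pose xi' a := \sum_c Q^T a c * xi c.
have -> : \sum_a \sum_c xi a * G a c * xi c = \sum_a xi' a ^+ 2.
  rewrite /xi'; transitivity (\sum_a \sum_c \sum_e Q a e * Q c e * (xi a * xi c)).
    apply: eq_bigr => a _; apply: eq_bigr => c _; rewrite GE mxE mulr_sumr mulr_suml.
    by apply: eq_bigr => e _; rewrite mxE; ring.
  rewrite exchange_big /= (eq_bigr (fun c => \sum_e \sum_a Q a e * Q c e * (xi a * xi c))); last first.
    by move=> c _; rewrite exchange_big.
  rewrite exchange_big /=; apply: eq_bigr => e _; rewrite expr2 mulr_suml.
  apply: eq_bigr => c _; rewrite mulr_sumr; apply: eq_bigr => a _.
  by rewrite !mxE; ring.
rewrite GE !tdot_square tact_wedge1 -/xi'.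
apply: (@le_trans _ _ (\sum_(I : {ffun 'I_k.+1 -> 'I_n}) k.+1%:R * \sum_(l < k.+1) (xi' (I l) * tact Q^T b (omit l I)) ^+ 2)).
  apply: ler_sum => I _; rewrite -expr2 /wedge1.
  apply: le_trans (sum_Cauchy_Schwarz _ _) _.
  rewrite ler_wpM2r ?sumr_ge0 // => [l _|]; first exact: sqr_ge0.
  rewrite (eq_bigr (fun=> 1)) ?sumr_const ?card_ord // => l _.
  by rewrite -exprM mulnC exprM sqrrN expr1n expr1n.
rewrite -mulr_sumr exchange_big /= expr2 -!mulrA ler_wpM2l //.
apply: (@le_trans _ _ (\sum_(l < k.+1) (\sum_a xi' a ^+ 2) * (\sum_K tact Q^T b K * tact Q^T b K))); last first.
  by rewrite sumr_const card_ord mulr_natl.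
apply: ler_sum => l _; rewrite (big_insert _ l) mulr_suml; apply: ler_sum => c _ /=.
rewrite mulr_sumr; apply: ler_sum => K _.
by rewrite insert_at omit_insert exprMn !expr2.
Qed.

End positive_forms.

(** * Algebraic identities behind d, Cartan's formula and the Leibniz rule *)

Section exterior_algebra.
Context {R : numFieldType} {n : nat}.
Implicit Types (P G B : 'M[R]_n).
Notation array := (@array R n).

Lemma exterior_cancel k (D : 'I_n -> array k) (I : {ffun 'I_k.+1 -> 'I_n}) : (forall a, alternating (D a)) ->
  \sum_(s : 'S_k.+1) (-1) ^+ s * D (I (s ord0)) (omit ord0 (permute s I)) = 0 ->
  exterior D I = 0.
Proof.
move=> aD; rewrite -(exterior_perm _ aD) => /eqP.
by rewrite mulf_eq0 pnatr_eq0 (gtn_eqF (fact_gt0 k)) => /eqP.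
Qed.

Lemma alternating_exterior k (D : 'I_n -> array k) :
  (forall a, alternating (D a)) -> alternating (exterior D).
Proof.
move=> aD I t.
have k0 : k`!%:R != 0 :> R by rewrite pnatr_eq0 (gtn_eqF (fact_gt0 k)).
apply: (mulfI k0); rewrite mulrCA !exterior_perm // mulr_sumr.
rewrite (reindex_inj (mulIg t^-1%g)) /=; apply: eq_bigr => s _.
rewrite permuteM mulgKV odd_permM odd_permV signr_addb ffunE !permM permKV.
by rewrite [(-1) ^+ s * _]mulrC mulrA.
Qed.

Lemma exterior_add k (D E : 'I_n -> array k) :
  exterior (fun a J => D a J + E a J) = fun I => exterior D I + exterior E I.
Proof.
apply/funext => I; rewrite /exterior -big_split; apply: eq_bigr => l _.
by rewrite mulrDr.
Qed.

Lemma tact_exterior P k (D : 'I_n -> array k) :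
  exterior (fun a J => \sum_b P a b * tact P (D b) J) = tact P (exterior D).
Proof.
apply/funext => I; rewrite /tact /exterior.
under [RHS]eq_bigr do rewrite mulr_suml.
rewrite [RHS]exchange_big /=; apply: eq_bigr => l _.
rewrite [RHS](big_insert _ l) mulr_sumr; apply: eq_bigr => b _.
rewrite mulrCA mulrA mulrC mulr_suml; apply: eq_bigr => K _.
rewrite insert_at omit_insert (big_ord_lift _ l) /= insert_at.
under [X in _ = _ * (_ * X)]eq_bigr do rewrite insert_lift.
rewrite (eq_bigr (fun m => P (I (lift l m)) (K m))); last by move=> m _; rewrite ffunE.
by ring.
Qed.

(* Second derivatives of a change of coordinates drop out of d. *)
Lemma exterior_transition k (w : array k) P (S : 'I_n -> 'I_n -> 'I_n -> R) :
  (forall a b c, S a b c = S b a c) -> alternating w ->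
  exterior (fun a J => \sum_K w K * \sum_m S a (J m) (K m) *
     \prod_(l | l != m) P (J l) (K l)) = fun=> 0.
Proof.
move=> SC aw; apply/funext => I; apply: exterior_cancel => [a J s|].
  rewrite mulr_sumr (reindex_inj (h := permute s)) /=; last first.
    by move=> J' K /ffunP JK; apply/ffunP => l; have := JK (s^-1%g l); rewrite !ffunE permKV.
  apply: eq_bigr => K _; rewrite aw -mulrA; congr (_ * (_ * _)).
  rewrite [RHS](reindex_inj (@perm_inj _ s)) /=; apply: eq_bigr => m _.
  rewrite !ffunE; congr (_ * _); rewrite [RHS](reindex_inj (@perm_inj _ s)) /=.
  by apply: eq_big => l; [rewrite (inj_eq (@perm_inj _ s))|rewrite !ffunE].
under eq_bigr do rewrite mulr_sumr; rewrite exchange_big /= big1 // => K _.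
under eq_bigr do rewrite mulrCA mulr_sumr mulr_sumr; rewrite exchange_big /= big1 // => m _.
under eq_bigr do rewrite mulrCA.
(* The transposition exchanges the differentiation index with the index whose Jacobian factor is
   differentiated; symmetry of [S] makes the summand invariant. *)
apply: (sign_reversing (t := tperm ord0 (lift ord0 m))) => [|s].
  by rewrite odd_tperm neq_lift.
rewrite !ffunE !permM tpermL tpermR SC; congr (_ * (_ * _)).
apply: eq_bigr => l lm; rewrite !ffunE permM tpermD ?neq_lift //.
by rewrite (inj_eq lift_inj) eq_sym.
Qed.

(** The algebra of [d d = 0]: exchanging the two differentiation indices is an odd transposition
    that leaves [H] unchanged. *)
Lemma exterior_exterior k (H : 'I_n -> 'I_n -> array k) :
  (forall a b J, H a b J = H b a J) -> (forall a b, alternating (H a b)) ->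
  exterior (fun a => exterior (H a)) = fun=> 0.
Proof.
move=> HC aH; apply/funext => I; apply: exterior_cancel => [a|].
  exact: alternating_exterior.
under eq_bigr do rewrite mulr_sumr; rewrite exchange_big /= big1 // => l _.
under eq_bigr do rewrite mulrCA; rewrite -mulr_sumr.
rewrite (sign_reversing (t := tperm ord0 (lift ord0 l))) ?mulr0 // => [|s].
  by rewrite odd_tperm neq_lift.
rewrite !ffunE !permM tpermL tpermR HC; congr (H _ _ _).
by apply/ffunP => m; rewrite !ffunE permM tpermD ?neq_lift ?(inj_eq lift_inj) ?neq_lift.
Qed.

Lemma alternating_insert k (w : array k.+1) (l : 'I_k.+1) c K : alternating w ->
  w (insert ord0 c K) = (-1) ^+ l * w (insert l c K).
Proof.
move=> aw; have -> : insert ord0 c K = permute (lift_perm ord0 l 1) (insert l c K).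
  apply/ffunP => m; rewrite [RHS]ffunE.
  case: (unliftP ord0 m) => [m' ->|->].
    by rewrite lift_perm_lift perm1 !insert_lift.
  by rewrite lift_perm_id !insert_at.
by rewrite aw odd_lift_perm odd_perm1 addbF /= signr_odd.
Qed.

(** The endomorphism [B] acting on covariant tensors by the Leibniz rule. For [B] the matrix of
    derivatives of [X] it is the part of order zero of the Lie derivative. *)
Definition derivation B k (w : array k) : array k :=
  fun I => \sum_l \sum_c B (I l) c * w [ffun m => if m == l then c else I m].

Lemma replaceE k (l : 'I_k.+1) c (I : {ffun 'I_k.+1 -> 'I_n}) :
  [ffun m => if m == l then c else I m] = insert l c (omit l I).
Proof.
apply/ffunP => m; rewrite ffunE; case: (unliftP l m) => [m' ->|->].
  by rewrite eq_sym (negbTE (neq_lift _ _)) insert_lift ffunE.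
by rewrite eqxx insert_at.
Qed.

(** Cartan's formula at one point: [D] stands for the derivatives of [w] and [B] for those of [X].
    The terms in which a derivative index is taken from [I] while [X] fills the first slot occur
    twice, with opposite signs; alternation moves the contracted index back into its position. *)
Lemma cartan k (w : array k.+1) (D : 'I_n -> array k.+1) (X : 'rV[R]_n) B I :
  alternating w ->
  contract X (exterior D) I +
  exterior (fun a K => \sum_c (B a c * w (insert ord0 c K) + X 0 c * D a (insert ord0 c K))) I
  = \sum_c X 0 c * D c I + derivation B w I.
Proof.
move=> aw; rewrite /contract /exterior /derivation.
have -> : \sum_c X 0 c * (\sum_(l < k.+2) (-1) ^+ l * D (insert ord0 c I l) (omit l (insert ord0 c I)))
   = \sum_c X 0 c * D c I - \sum_(l < k.+1) (-1) ^+ l * \sum_c X 0 c * D (I l) (insert ord0 c (omit l I)).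
  under [in X in _ = _ - X]eq_bigr do rewrite mulr_sumr.
  rewrite [X in _ = _ - X]exchange_big /= -sumrB; apply: eq_bigr => c _.
  rewrite big_ord_recl expr0 mul1r insert_at omit_insert mulrDr; congr (_ + _).
  rewrite mulr_sumr -sumrN; apply: eq_bigr => l _.
  rewrite insert_lift exprS mulN1r mulNr mulrN mulrCA; congr (- (_ * (_ * D _ _))).
  apply/ffunP => m; rewrite ffunE; case: (unliftP ord0 m) => [m' ->|->].
    have -> : lift (lift ord0 l) (lift ord0 m') = lift ord0 (lift l m').
      by apply/val_inj; rewrite /= /bump /=; lia.
    by rewrite !insert_lift ffunE.
  have -> : lift (lift ord0 l) ord0 = ord0 :> 'I_k.+2 by apply/val_inj.
  by rewrite !insert_at.
rewrite -addrA; congr (_ + _); apply/eqP; rewrite addrC subr_eq; apply/eqP.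
rewrite -big_split /=; apply: eq_bigr => l _.
rewrite big_split /= mulrDr; congr (_ + _); rewrite mulr_sumr; apply: eq_bigr => c _.
by rewrite mulrCA (alternating_insert l) // signrMK replaceE.
Qed.

Lemma tdot_derivation_l G B k (v w : array k) :
  \sum_I \sum_J v I * w J * \sum_l (\sum_c B c (I l) * G c (J l)) * \prod_(m | m != l) G (I m) (J m)
  = tdot G (derivation B v) w.
Proof.
case: k v w => [|k] v w.
  rewrite /tdot /derivation big1 => [|I _].
    by rewrite big1 // => I _; rewrite big1 // => J _; rewrite big_ord0 !mul0r.
  by rewrite big1 // => J _; rewrite big_ord0 mulr0.
rewrite /tdot; under eq_bigr => I _ do under eq_bigr => J _ do rewrite mulr_sumr.
under [RHS]eq_bigr => I _ do under eq_bigr => J _ do rewrite /derivation !mulr_suml.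
rewrite exchange_big /= [RHS]exchange_big /=; apply: eq_bigr => J _.
rewrite exchange_big /= [RHS]exchange_big /=; apply: eq_bigr => l _.
rewrite (big_insert _ l) [RHS](big_insert _ l) exchange_big /= [RHS]exchange_big /=.
apply: eq_bigr => K _.
have E a : \prod_(m | m != l) G (insert l a K m) (J m) = \prod_m G (K m) (J (lift l m)).
  transitivity (\prod_(m | true && (m != l)) G (insert l a K m) (J m)) => //.
  rewrite (reindex_omap (lift l) (unlift l)) /= => [|m ml]; last first.
    by case: unliftP ml => [m' ->|->] //=; rewrite eqxx.
  apply: eq_big => m; first by rewrite liftK eqxx andbT eq_sym neq_lift.
  by rewrite insert_lift.
transitivity (\sum_a \sum_c v (insert l a K) * w J * (B c a * G c (J l)) *
      \prod_m G (K m) (J (lift l m))).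
  apply: eq_bigr => a _; rewrite E mulrA mulr_sumr mulr_suml.
  by apply: eq_bigr => c _; rewrite insert_at.
rewrite exchange_big /=; apply: eq_bigr => a _; rewrite !mulr_suml.
apply: eq_bigr => c _; rewrite insert_at replaceE omit_insert.
rewrite (big_ord_lift _ l) /= insert_at.
under [X in _ = _ * (_ * X)]eq_bigr do rewrite insert_lift.
by ring.
Qed.

(** By the Killing equation the inverse metric varies along [X] exactly by the matrix on the left.
    Its variation can then be charged to the two arguments, where it completes the Lie
    derivatives. *)
Lemma tdot_derivation G B k (v w : array k) : G^T = G ->
  \sum_I \sum_J v I * w J *
     \sum_l (B^T *m G + G *m B) (I l) (J l) * \prod_(m | m != l) G (I m) (J m)
  = tdot G (derivation B v) w + tdot G v (derivation B w).
Proof.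
move=> GT; rewrite [X in _ = _ + X]tdotC // -!tdot_derivation_l [X in _ = _ + X]exchange_big /=.
rewrite -big_split /=; apply: eq_bigr => I _; rewrite -big_split /=; apply: eq_bigr => J _.
have GS a b : G a b = G b a by rewrite -[in LHS]GT mxE.
rewrite [w J * v I]mulrC -mulrDr -big_split /=; congr (_ * _); apply: eq_bigr => l _.
rewrite [X in _ = _ + _ * X](eq_bigr (fun m => G (I m) (J m))) // -mulrDl.
congr (_ * _); rewrite !mxE; congr (_ + _); apply: eq_bigr => c _.
  by rewrite mxE.
by rewrite mulrC GS.
Qed.

End exterior_algebra.

(** * Differential forms *)

Section forms_on_manifolds.
Context {R : realType} {n : nat} {M : ptopologicalType}.
Variable A : smooth_manifold R n M.

Local Notation chart := (chart A).
Local Notation dom := (@dom _ _ _ A).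
Local Notation jac := (@jac _ _ _ A).
Local Notation components := (components A).

Implicit Types (i j : chart) (p q : M) (u : M -> R) (W : set M).

Lemma domO i : open (dom i). Proof. exact: dom_open. Qed.

Lemma sm_pderiv_dom i a u : sm A (dom i) u -> sm A (dom i) (pderiv i a u).
Proof. by move=> us; have := @sm_pderiv _ _ _ A _ i a _ (domO i) us; rewrite setIid. Qed.

Lemma Omega_out k (w : components k) i p : Omega w -> ~ dom i p -> w i p = fun=> 0.
Proof. by case=> H _ _ _ ip; apply/funext => I; exact: H. Qed.

Lemma Omega_sm k (w : components k) i I : Omega w -> sm A (dom i) (fun p => w i p I).
Proof. by case=> _ H _ _; apply: smooth_in_sm; exact: H. Qed.

Lemma Omega_alt k (w : components k) i p : Omega w -> alternating (w i p).
Proof. by case=> _ _ H _ I s; exact: H. Qed.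

Lemma Omega_trans k (w : components k) i j p : Omega w -> dom i p -> dom j p ->
  w i p = tact (jac i j p) (w j p).
Proof. by case=> _ _ _ H ip jp; apply/funext => I; exact: H. Qed.

Lemma Omega_intro k (w : components k) :
  (forall i p, ~ dom i p -> w i p = fun=> 0) ->
  (forall i I, sm A (dom i) (fun p => w i p I)) ->
  (forall i p, dom i p -> alternating (w i p)) ->
  (forall i j p, dom i p -> dom j p -> w i p = tact (jac i j p) (w j p)) ->
  Omega w.
Proof.
move=> H1 H2 H3 H4; split.
- by move=> i p I ip; rewrite H1.
- by move=> i I; apply: sm_smooth_in; exact: H2.
- move=> i p I s; have [ip|ip] := pselect (dom i p); first exact: H3.
  by rewrite H1 // mulr0.
- by move=> i j p I ip jp; rewrite (H4 i j).
Qed.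

Lemma Omega_zero k : Omega (@zero_form _ _ _ A k).
Proof.
apply: Omega_intro => //.
- by move=> i I; exact: (sm_cst A (dom i) 0).
- by move=> i p _ I s; rewrite /zero_form mulr0.
- move=> i j p _ _; apply/funext => I; rewrite /tact /zero_form big1 // => J _.
  by rewrite mul0r.
Qed.

Lemma Omega_scale k (u : M -> R) (w : components k) : sm A setT u -> Omega w ->
  Omega (fun i p I => u p * w i p I).
Proof.
move=> us Ow; apply: Omega_intro.
- by move=> i p ip; apply/funext => I; rewrite (Omega_out Ow ip) mulr0.
- move=> i I; apply: sm_mul (domO i) (sm_sub _ us) (Omega_sm i I Ow) => //.
- by move=> i p ip I s; rewrite (Omega_alt i p Ow) mulrCA.
- move=> i j p ip jp; apply/funext => I; rewrite (Omega_trans Ow ip jp) /tact mulr_sumr.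
  by apply: eq_bigr => J _; rewrite mulrA.
Qed.

Lemma ext_derivE k (w : components k) i p I : dom i p ->
  ext_deriv w i p I = exterior (fun a J => pderiv i a (fun q => w i q J) p) I.
Proof. by move=> ip; rewrite /ext_deriv mem_set. Qed.

Lemma pderiv_alternating k (w : components k) i a p : Omega w -> dom i p ->
  alternating (fun J => pderiv i a (fun q => w i q J) p).
Proof.
move=> Ow ip J s.
rewrite -(pderivZ a ((-1) ^+ s) (Omega_sm i J Ow) ip ip); congr (pderiv i a _ p).
by apply/funext => q; rewrite (Omega_alt i q Ow).
Qed.

Lemma Omega_ext_deriv k (w : components k) : Omega w -> Omega (ext_deriv w).
Proof.
move=> Ow; apply: Omega_intro.
- by move=> i p ip; apply/funext => I; rewrite /ext_deriv memNset.
- move=> i I; apply: (@sm_eq _ _ _ A _ (fun p => exterior (fun a J => pderiv i a (fun q => w i q J) p) I)).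
  + exact: domO.
  + by move=> p ip; rewrite ext_derivE.
  + apply: sm_sum => [|l _]; first exact: domO.
    apply: (sm_mul (domO i) (sm_cst A _ _)).
    exact/sm_pderiv_dom/(Omega_sm i _ Ow).
- move=> i p ip I s; rewrite !ext_derivE //; apply: alternating_exterior => a.
  exact: pderiv_alternating.
- move=> i j p ip jp; apply/funext => I; rewrite ext_derivE //.
  have Wo : open (dom i `&` dom j) by apply: openI; exact: domO.
  have -> : ext_deriv w j p = exterior (fun a J => pderiv j a (fun q => w j q J) p).
    by apply/funext => K; rewrite ext_derivE.
  rewrite -tact_exterior; set D1 := fun a J => \sum_b _.
  (* Differentiating the transformation law gives the expected tensor [D1] and this term, where the
     derivative hits a Jacobian; its antisymmetrization vanishes. *)
  pose E a (J : {ffun 'I_k -> 'I_n}) := \sum_(K : {ffun 'I_k -> 'I_n}) w j p K * \sum_m pderiv i a (fun q => jac i j q (J m) (K m)) p *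
     \prod_(l | l != m) jac i j p (J l) (K l).
  have -> : (fun a J => pderiv i a (fun q => w i q J) p) = fun a J => D1 a J + E a J.
    apply/funext => a; apply/funext => J.
    rewrite (@pderiv_eq _ _ _ _ _ _ _ _ (fun q => \sum_K w j q K * \prod_l jac i j q (J l) (K l)) p Wo) //; last first.
      by move=> q [iq jq]; rewrite (Omega_trans Ow iq jq).
    have sj K : sm A (dom i `&` dom j) (fun q => w j q K).
      by apply: sm_sub (Omega_sm j K Ow) => q [].
    have sp K : sm A (dom i `&` dom j) (fun q => \prod_l jac i j q (J l) (K l)).
      by apply: (sm_prod _ Wo) => l _; exact: sm_jac.
    rewrite (pderiv_sum _ _ Wo (fun K _ => sm_mul Wo (sj K) (sp K)) (conj ip jp) ip).
    rewrite /D1 /E.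
    under eq_bigr do rewrite (pderivM _ (sj _) (sp _) (conj ip jp) ip).
    rewrite big_split /=; congr (_ + _).
      under [RHS]eq_bigr do rewrite /tact mulr_sumr.
      rewrite [RHS]exchange_big /=; apply: eq_bigr => K _.
      rewrite (pderiv_chain a (domO j) (Omega_sm j K Ow) jp ip jp) mulr_suml.
      by apply: eq_bigr => b _; rewrite mulrA.
    apply: eq_bigr => K _; congr (_ * _).
    by rewrite (pderiv_prod _ Wo (fun l => sm_jac i j (J l) (K l)) (conj ip jp) ip).
  have E0 : exterior E = fun=> 0.
    apply: (@exterior_transition _ _ _ _ _ (fun a b c => pderiv i a (fun q => jac i j q b c) p)).
      by move=> a b c; exact: pderiv_jacC.
    exact: Omega_alt.
  by rewrite exterior_add E0 addr0.
Qed.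

Lemma ext_deriv_ext_deriv k (w : components k) i p I : Omega w -> dom i p ->
  ext_deriv (ext_deriv w) i p I = 0.
Proof.
move=> Ow ip; rewrite ext_derivE //.
have -> : (fun a J => pderiv i a (fun q => ext_deriv w i q J) p) =
   fun a => exterior (fun b K => pderiv i a (pderiv i b (fun q => w i q K)) p).
  apply/funext => a; apply/funext => J.
  rewrite (@pderiv_eq _ _ _ _ (dom i) _ _ _ (fun q => exterior (fun a J => pderiv i a (fun q => w i q J) q) J)) //; last first.
  - by move=> q iq; rewrite ext_derivE.
  - exact: domO.
  have s1 b K : sm A (dom i) (pderiv i b (fun q => w i q K)).
    exact/sm_pderiv_dom/(Omega_sm i K Ow).
  rewrite /exterior (pderiv_sum _ _ (domO i) (fun l _ => sm_mul (domO i) (sm_cst A _ _) (s1 _ _)) ip ip).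
  by apply: eq_bigr => l _; rewrite (pderivZ _ _ (s1 _ _) ip ip).
have HC a b J : pderiv i a (pderiv i b (fun q => w i q J)) p
              = pderiv i b (pderiv i a (fun q => w i q J)) p.
  exact: (pderivC a b (domO i) (Omega_sm i J Ow) ip ip).
have HA a b : alternating (fun J => pderiv i a (pderiv i b (fun q => w i q J)) p).
  move=> J s; have s1 : sm A (dom i) (pderiv i b (fun q => w i q J)).
    exact/sm_pderiv_dom/(Omega_sm i J Ow).
  rewrite -(pderivZ a _ s1 ip ip).
  apply: (@pderiv_eq _ _ _ _ (dom i) _ _ _ _ _ (domO i)) => [q iq||//].
    exact: pderiv_alternating Ow iq J s.
  exact: ip.
by rewrite (exterior_exterior HC HA).
Qed.

Lemma compactly_supported_ext_deriv k (w : components k) :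
  compactly_supported w -> compactly_supported (ext_deriv w).
Proof.
move=> [K Kc w0]; exists K => // i p I Kp; rewrite /ext_deriv; case: ifPn => // /set_mem ip.
rewrite big1 // => l _.
have Ko : open (~` K) by apply: closed_openC; exact: (manifold_compact_closed A).
rewrite (@pderiv_eq _ _ _ _ _ _ _ _ (cst 0) p Ko) ?pderiv_cst ?mulr0 //.
by move=> q Kq; rewrite w0.
Qed.

End forms_on_manifolds.

(** * Riemannian metrics and the pointwise inner product of forms *)

Section metrics.
Context {R : realType} {n : nat} {M : ptopologicalType}.
Variable A : smooth_manifold R n M.

Local Notation chart := (chart A).
Local Notation dom := (@dom _ _ _ A).
Local Notation chart_at := (@chart_at _ _ _ A).
Local Notation jac := (@jac _ _ _ A).
Local Notation components := (components A).

Implicit Types (i j : chart) (p q : M) (u : M -> R) (W : set M).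

Lemma in_chart_at p : dom (chart_at p) p.
Proof. exact: mem_chart_at. Qed.

Lemma sm_det W k (F : M -> 'M[R]_k) : open W ->
  (forall a b, sm A W (fun p => F p a b)) -> sm A W (fun p => \det (F p)).
Proof.
move=> Wo FW; apply: (sm_sum _ Wo) => s _.
by apply: (sm_mul Wo (sm_cst A W _)); apply: (sm_prod _ Wo).
Qed.

Lemma sm_invmx W k (F : M -> 'M[R]_k) a b : open W ->
  (forall p, W p -> F p \in unitmx) ->
  (forall a b, sm A W (fun p => F p a b)) -> sm A W (fun p => invmx (F p) a b).
Proof.
move=> Wo Fu FW.
apply: (@sm_eq _ _ _ A W (fun p => (\det (F p))^-1 * ((-1) ^+ (b + a) * \det (row' b (col' a (F p)))))) => //.
  by move=> p Wp; rewrite /invmx Fu // !mxE.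
apply: (sm_mul Wo).
  apply: (sm_inv Wo _ (sm_det Wo FW)) => p Wp.
  by rewrite -unitfE -unitmxE Fu.
apply: (sm_mul Wo (sm_cst A W _)); apply: (sm_det Wo) => c d.
by apply: (sm_eq Wo _ (FW (lift b c) (lift a d))) => p _; rewrite !mxE.
Qed.

Variable g : chart -> M -> 'M[R]_n.
Hypothesis hg : riemannian_metric g.

Lemma sm_metric i a b : sm A (dom i) (fun p => g i p a b).
Proof. by have [H _ _ _] := hg; exact: smooth_in_sm. Qed.

Lemma metric_sym i p : dom i p -> (g i p)^T = g i p.
Proof. by have [_ H _ _] := hg; exact: H. Qed.

Lemma metric_trans i j p : dom i p -> dom j p ->
  g i p = jac i j p *m g j p *m (jac i j p)^T.
Proof. by have [_ _ _ H] := hg; exact: H. Qed.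

Lemma metric_factor i p : dom i p -> exists2 Q, Q \in unitmx & g i p = Q *m Q^T.
Proof.
move=> ip; apply: posdef_factor; first exact: metric_sym.
by have [_ _ H _] := hg => v; exact: H.
Qed.

Lemma metric_unit i p : dom i p -> g i p \in unitmx.
Proof. by move=> /metric_factor[Q Qu ->]; rewrite unitmx_mul Qu unitmx_tr. Qed.

Lemma det_metric_gt0 i p : dom i p -> 0 < \det (g i p).
Proof.
move=> /metric_factor[Q Qu ->]; rewrite det_mulmx det_tr -expr2 lt_neqAle sqr_ge0 andbT.
by rewrite eq_sym expf_neq0 // -unitfE -unitmxE.
Qed.

Lemma invmx_metric_factor i p : dom i p ->
  exists2 Q, Q \in unitmx & invmx (g i p) = Q *m Q^T.
Proof.
move=> ip; have [Q Qu gE] := metric_factor ip.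
exists (invmx Q^T); first by rewrite unitmx_inv unitmx_tr.
have gu := metric_unit ip.
by apply: invmx_left; rewrite gE trmx_inv trmxK mulmxA -[_ *m Q]mulmxA mulVmx // mulmx1 mulVmx // unitmx_tr.
Qed.

Lemma invmx_metric_sym i p : dom i p -> (invmx (g i p))^T = invmx (g i p).
Proof. by move=> ip; rewrite trmx_inv metric_sym. Qed.

Lemma jac_unit i j p : dom i p -> dom j p -> jac i j p \in unitmx.
Proof.
move=> ip jp; have : jac i j p *m jac j i p = 1%:M.
  by rewrite (jac_mul ip jp ip) jac_id.
by case/mulmx1_unit.
Qed.

Lemma invmx_metric_trans i j p : dom i p -> dom j p ->
  invmx (g j p) = (jac i j p)^T *m invmx (g i p) *m jac i j p.
Proof.
move=> ip jp; have Pu := jac_unit ip jp; set P := jac i j p in Pu *.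
have gju := metric_unit jp; have giu := metric_unit ip.
apply: invmx_left; have PE : P *m g j p = g i p *m invmx P^T.
  by rewrite (metric_trans ip jp) -/P mulmxK // unitmx_tr.
by rewrite -(mulmxA _ P) PE -mulmxA mulKmx // mulmxV // unitmx_tr.
Qed.

Lemma sm_invmx_metric i a b : sm A (dom i) (fun p => invmx (g i p) a b).
Proof.
apply: sm_invmx; [exact: domO|exact: metric_unit|exact: sm_metric].
Qed.

(** The right-hand side does not change from chart to chart, which frees [form_dot] from the choice
    [chart_at] in its definition and allows differentiation in a fixed chart. *)
Lemma form_dotE k (v w : components k) i p : Omega v -> Omega w -> dom i p ->
  form_dot g v w p = (k`!%:R)^-1 * tdot (invmx (g i p)) (v i p) (w i p).
Proof.
move=> Ov Ow ip; rewrite /form_dot; set j := chart_at p.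
have jp : dom j p := in_chart_at p.
rewrite -/(tdot (invmx (g j p)) (v j p) (w j p)).
rewrite (Omega_trans Ov jp ip) (Omega_trans Ow jp ip) tdot_tact.
by rewrite (invmx_metric_trans jp ip).
Qed.

Lemma sm_tdot W k (G : M -> 'M[R]_n) (v w : M -> array k) : open W ->
  (forall a b, sm A W (fun p => G p a b)) ->
  (forall I, sm A W (fun p => v p I)) -> (forall I, sm A W (fun p => w p I)) ->
  sm A W (fun p => tdot (G p) (v p) (w p)).
Proof.
move=> Wo GW vW wW; apply: (sm_sum _ Wo) => I _; apply: (sm_sum _ Wo) => J _.
by apply: (sm_mul Wo (sm_mul Wo (vW I) (wW J))); apply: (sm_prod _ Wo).
Qed.

Lemma sm_form_dot k (v w : components k) : Omega v -> Omega w ->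
  sm A setT (fun p => form_dot g v w p).
Proof.
move=> Ov Ow; apply: sm_local => p _; exists (dom (chart_at p)); first exact: in_chart_at.
set i := chart_at p.
apply: (@sm_eq _ _ _ A _ (fun q => (k`!%:R)^-1 * tdot (invmx (g i q)) (v i q) (w i q))).
- exact: domO.
- by move=> q iq; rewrite (form_dotE Ov Ow iq).
- apply: (sm_mul (domO i) (sm_cst A _ _)); apply: (sm_tdot (domO i)).
  + exact: sm_invmx_metric.
  + by move=> I; exact: Omega_sm.
  + by move=> I; exact: Omega_sm.
Qed.

Lemma form_dot_ge0 k (w : components k) p : 0 <= form_dot g w w p.
Proof.
have [Q _ GE] := invmx_metric_factor (in_chart_at p).
by rewrite mulr_ge0 ?invr_ge0 //; exact: (tdot_ge0 GE).
Qed.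

Lemma form_dot_eq0 k (w : components k) i p : Omega w -> dom i p ->
  form_dot g w w p = 0 -> w i p = fun=> 0.
Proof.
move=> Ow ip; rewrite (form_dotE Ow Ow ip) => /eqP.
rewrite mulf_eq0 invr_eq0 pnatr_eq0 (gtn_eqF (fact_gt0 k)) /= => /eqP.
by have [Q Qu GE] := invmx_metric_factor ip; exact: (tdot_eq0 Qu GE).
Qed.

(** * The vector field dual to a 1-form *)

Variable eta : components 1.

Definition eta_row i p : 'rV[R]_n := \row_b eta i p [ffun=> b].

Definition dual_field i p : 'rV[R]_n := eta_row i p *m invmx (g i p).

Definition derX i u p : R := \sum_c dual_field i p 0 c * pderiv i c u p.

Definition interior k (w : components k.+1) : components k :=
  fun i p => contract (dual_field i p) (w i p).

Hypothesis heta : Omega eta.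

Lemma sm_eta i b : sm A (dom i) (fun p => eta_row i p 0 b).
Proof.
apply: (sm_eq (domO i) _ (Omega_sm i [ffun=> b] heta)) => p _.
by rewrite mxE.
Qed.

Lemma sm_dual_field i c : sm A (dom i) (fun p => dual_field i p 0 c).
Proof.
apply: (@sm_eq _ _ _ A _ (fun p => \sum_b eta_row i p 0 b * invmx (g i p) b c)).
- exact: domO.
- by move=> p _; rewrite [RHS]mxE.
- apply: (sm_sum _ (domO i)) => b _.
  exact: (sm_mul (domO i) (sm_eta i b) (sm_invmx_metric i b c)).
Qed.

Lemma eta_row_trans i j p : dom i p -> dom j p ->
  eta_row i p = eta_row j p *m (jac i j p)^T.
Proof.
move=> ip jp; apply/rowP => b; rewrite !mxE (Omega_trans heta ip jp) /tact.
rewrite (big_insert _ ord0) /=; apply: eq_bigr => c _.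
rewrite (big_pred1 [ffun m : 'I_0 => c]); last first.
  by move=> K; rewrite /=; apply/esym/eqP/ffunP => -[].
rewrite big_ord1 insert_at !mxE ffunE; congr (eta j p _ * _).
apply/ffunP => m; rewrite !ffunE (ord1 m).
by case: (unlift _ _) => [x|] /=; rewrite ?ffunE.
Qed.

Lemma dual_field_trans i j p : dom i p -> dom j p ->
  dual_field j p = dual_field i p *m jac i j p.
Proof.
move=> ip jp; rewrite /dual_field (eta_row_trans ip jp) (invmx_metric_trans ip jp).
by rewrite !mulmxA.
Qed.

Lemma derX_chart W i j u p : open W -> sm A W u -> W p -> dom i p -> dom j p ->
  derX i u p = derX j u p.
Proof.
move=> Wo us Wp ip jp; rewrite /derX (dual_field_trans ip jp).
under eq_bigr do rewrite (pderiv_chain _ Wo us Wp ip jp) mulr_sumr.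
rewrite exchange_big /=; apply: eq_bigr => b _; rewrite mxE mulr_suml.
by apply: eq_bigr => c _; rewrite mulrA.
Qed.

Lemma derXD W i u v p : sm A W u -> sm A W v -> W p -> dom i p ->
  derX i (fun q => u q + v q) p = derX i u p + derX i v p.
Proof.
move=> us vs Wp ip; rewrite /derX -big_split; apply: eq_bigr => c _.
by rewrite (pderivD _ us vs Wp ip) mulrDr.
Qed.

Lemma derXM W i u v p : sm A W u -> sm A W v -> W p -> dom i p ->
  derX i (fun q => u q * v q) p = derX i u p * v p + u p * derX i v p.
Proof.
move=> us vs Wp ip; rewrite /derX mulr_suml mulr_sumr -big_split; apply: eq_bigr => c _.
by rewrite (pderivM _ us vs Wp ip) /=; ring.
Qed.

Lemma derX_eq W i u v p : open W -> (forall q, W q -> u q = v q) ->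
  dom i p -> W p -> derX i u p = derX i v p.
Proof.
by move=> Wo uv ip Wp; apply: eq_bigr => c _; rewrite (pderiv_eq c Wo uv ip Wp).
Qed.

Lemma sm_derX i u : sm A (dom i) u -> sm A (dom i) (derX i u).
Proof.
move=> us; apply: (sm_sum _ (domO i)) => c _.
exact: (sm_mul (domO i) (sm_dual_field i c) (sm_pderiv_dom c us)).
Qed.

Lemma Omega_interior k (w : components k.+1) : Omega w -> Omega (interior w).
Proof.
move=> Ow; apply: Omega_intro.
- move=> i p ip; apply/funext => K; rewrite /interior /contract big1 // => c _.
  by rewrite (Omega_out Ow ip) mulr0.
- move=> i K; apply: (sm_sum _ (domO i)) => c _.
  exact: (sm_mul (domO i) (sm_dual_field i c) (Omega_sm i _ Ow)).
- by move=> i p ip; apply: alternating_contract; exact: Omega_alt.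
- move=> i j p ip jp; rewrite /interior (Omega_trans Ow ip jp) contract_tact.
  by rewrite (dual_field_trans ip jp).
Qed.

Lemma compactly_supported_interior k (w : components k.+1) :
  compactly_supported w -> compactly_supported (interior w).
Proof.
move=> [K Kc w0]; exists K => // i p I Kp.
by rewrite /interior /contract big1 // => c _; rewrite w0 ?mulr0.
Qed.

End metrics.

(** * Parallel 1-forms *)

Section parallel_forms.
Context {R : realType} {n : nat} {M : ptopologicalType}.
Variable A : smooth_manifold R n M.
Local Notation chart := (chart A).
Local Notation dom := (@dom _ _ _ A).
Local Notation components := (components A).
Implicit Types (i j : chart) (p q : M) (u : M -> R) (W : set M).

(** Jacobi's formula: the [a]-th part of the sum is the determinant of [F] with row [a] replaced by
    that of [D], expanded along this row. *)
Lemma sum_det_derivation k (F D : 'M[R]_k) :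
  \sum_(s : 'S_k) (-1) ^+ s * \sum_a D a (s a) * \prod_(m | m != a) F m (s m)
  = \tr (D *m \adj F).
Proof.
under eq_bigr do rewrite mulr_sumr.
rewrite exchange_big /=; apply: eq_bigr => a _; rewrite mxE.
pose E : 'M[R]_k := \matrix_(b, c) if b == a then D b c else F b c.
transitivity (\det E).
  apply: eq_bigr => s _; congr (_ * _); rewrite [in RHS](bigD1 a) //= mxE eqxx; congr (_ * _).
  by apply: eq_bigr => m /negbTE ma; rewrite mxE ma.
rewrite (expand_det_row E a); apply: eq_bigr => b _; rewrite mxE eqxx [RHS]mulrC [LHS]mulrC.
congr (_ * _); rewrite mxE /cofactor; congr (_ * \det _).
by apply/matrixP => x y; rewrite !mxE eq_sym (negbTE (neq_lift _ _)).
Qed.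

Lemma pderiv_det W i a k (F : M -> 'M[R]_k) p : open W ->
  (forall b c, sm A W (fun p => F p b c)) -> W p -> dom i p ->
  pderiv i a (fun q => \det (F q)) p =
  \tr ((\matrix_(b, c) pderiv i a (fun q => F q b c) p) *m \adj (F p)).
Proof.
move=> Wo Fs Wp ip; rewrite -sum_det_derivation /determinant.
have s1 (s : 'S_k) : sm A W (fun q => \prod_m F q m (s m)) by apply: (sm_prod _ Wo).
rewrite (pderiv_sum _ _ Wo (fun s _ => sm_mul Wo (sm_cst A W _) (s1 s)) Wp ip).
apply: eq_bigr => s _; rewrite (pderivZ _ _ (s1 s) Wp ip); congr (_ * _).
rewrite (pderiv_prod _ Wo (fun m => Fs m (s m)) Wp ip).
by apply: eq_bigr => m _; rewrite mxE.
Qed.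

Variable g : chart -> M -> 'M[R]_n.
Hypothesis hg : riemannian_metric g.
Variable eta : components 1.
Hypothesis heta : Omega eta.

Local Notation X := (dual_field g eta).
Local Notation derX := (derX g eta).

Definition dual_jac i p : 'M[R]_n := \matrix_(a, c) pderiv i a (fun q => X i q 0 c) p.
Definition mderX m k i (F : M -> 'M[R]_(m, k)) p : 'M[R]_(m, k) :=
  \matrix_(a, c) derX i (fun q => F q a c) p.

Lemma derX_sum W i (I : Type) (r : seq I) (P : pred I) (F : I -> M -> R) p :
  open W -> (forall l, P l -> sm A W (F l)) -> W p -> dom i p ->
  derX i (fun q => \sum_(l <- r | P l) F l q) p =
  \sum_(l <- r | P l) derX i (F l) p.
Proof.
move=> Wo Fs Wp ip; rewrite /derX.
under eq_bigr do rewrite (pderiv_sum _ _ Wo Fs Wp ip) mulr_sumr.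
by rewrite exchange_big.
Qed.

Lemma derX_prod W i (I : finType) (F : I -> M -> R) p :
  open W -> (forall l, sm A W (F l)) -> W p -> dom i p ->
  derX i (fun q => \prod_l F l q) p =
  \sum_l derX i (F l) p * \prod_(m | m != l) F m p.
Proof.
move=> Wo Fs Wp ip; rewrite /derX.
under eq_bigr do rewrite (pderiv_prod _ Wo Fs Wp ip) mulr_sumr.
rewrite exchange_big; apply: eq_bigr => l _; rewrite mulr_suml.
by apply: eq_bigr => c _; rewrite mulrA.
Qed.

Lemma derX_cst i c p : derX i (fun=> c) p = 0.
Proof. by rewrite /derX big1 // => a _; rewrite pderiv_cst mulr0. Qed.

Lemma derXZ W i c u p : open W -> sm A W u -> W p -> dom i p ->
  derX i (fun q => c * u q) p = c * derX i u p.
Proof.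
move=> Wo us Wp ip; rewrite (derXM g eta (sm_cst A W c) us Wp ip).
by rewrite (derX_cst i c) mul0r add0r.
Qed.

Lemma mderXM W m k l i (F : M -> 'M[R]_(m, k)) (G : M -> 'M[R]_(k, l)) p : open W ->
  (forall a b, sm A W (fun q => F q a b)) -> (forall a b, sm A W (fun q => G q a b)) ->
  W p -> dom i p ->
  mderX i (fun q => F q *m G q) p = mderX i F p *m G p + F p *m mderX i G p.
Proof.
move=> Wo Fs Gs Wp ip; apply/matrixP => a b; rewrite !mxE.
rewrite (@derX_eq _ _ _ _ _ _ W _ _ (fun q => \sum_c F q a c * G q c b)) //; last first.
  by move=> q _; rewrite mxE.
rewrite (derX_sum _ Wo (fun c _ => sm_mul Wo (Fs a c) (Gs c b)) Wp ip) -big_split.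
by apply: eq_bigr => c _; rewrite (derXM g eta (Fs a c) (Gs c b) Wp ip) /= !mxE.
Qed.

Lemma eta_rowE i p : dom i p -> eta_row eta i p = X i p *m g i p.
Proof. by move=> ip; rewrite /dual_field mulmxKV // (metric_unit hg ip). Qed.

Lemma pderiv_metric_sym i a b c p : dom i p ->
  pderiv i a (fun q => g i q b c) p = pderiv i a (fun q => g i q c b) p.
Proof.
move=> ip; apply: (pderiv_eq a (domO i) _ ip ip) => q iq.
by rewrite -[in LHS](metric_sym hg iq) mxE.
Qed.

Hypothesis heta_parallel : parallel g eta.

(** The equation [nabla eta = 0] solved for the first derivatives; in the Christoffel term the
    inverse metric raises the index of [eta], which produces [X]. *)
Lemma parallel_eta i a b p : dom i p ->
  pderiv i a (fun q => eta_row eta i q 0 b) p =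
  2^-1 * \sum_e X i p 0 e * (pderiv i a (fun q => g i q b e) p
     + pderiv i b (fun q => g i q a e) p - pderiv i e (fun q => g i q a b) p).
Proof.
move=> ip.
have -> : (fun q => eta_row eta i q 0 b) = (fun q => eta i q [ffun=> b]).
  by apply/funext => q; rewrite mxE.
have /eqP := heta_parallel a b ip; rewrite subr_eq0 => /eqP ->.
under eq_bigr do rewrite /christoffel -mulrA mulr_suml.
rewrite -mulr_sumr exchange_big /=; congr (_ * _); apply: eq_bigr => e _.
rewrite [X i p 0 e]mxE mulr_suml; apply: eq_bigr => c _; rewrite [eta_row _ _ _ _ _]mxE.
by rewrite [LHS]mulrC mulrA.
Qed.

(** Product rule for [eta = X g] combined with [parallel_eta]. The first two terms together are
    antisymmetric in [a] and [b] and the third is symmetric, so only the third survives in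
    [killing]. *)
Lemma dual_jac_metric i a b p : dom i p ->
  (dual_jac i p *m g i p) a b =
  2^-1 * \sum_e X i p 0 e * (pderiv i b (fun q => g i q a e) p
     - pderiv i a (fun q => g i q b e) p - pderiv i e (fun q => g i q a b) p).
Proof.
move=> ip; have := parallel_eta a b ip.
rewrite (@pderiv_eq _ _ _ _ (dom i) _ _ _ (fun q => \sum_c X i q 0 c * g i q c b) _ (domO i) _ ip ip); last first.
  by move=> q iq; rewrite eta_rowE // mxE.
rewrite (pderiv_sum _ _ (domO i) (fun c _ => sm_mul (domO i) (sm_dual_field hg heta i c) (sm_metric hg i c b)) ip ip).
under eq_bigr do rewrite (pderivM _ (sm_dual_field hg heta _ _) (sm_metric hg _ _ _) ip ip).
rewrite big_split /=.
have -> : (dual_jac i p *m g i p) a b = \sum_c pderiv i a (fun q => X i q 0 c) p * g i p c b.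
  by rewrite mxE; apply: eq_bigr => c _; rewrite mxE.
move=> /(canRL (addrK _)) ->.
rewrite !mulr_sumr -sumrB; apply: eq_bigr => e _.
by rewrite (pderiv_metric_sym a e b ip); field.
Qed.

(** The equation [L_X g = 0] in coordinates: the symmetric part of [dual_jac_metric]. *)
Lemma killing i p : dom i p ->
  mderX i (g i) p = - (dual_jac i p *m g i p + g i p *m (dual_jac i p)^T).
Proof.
move=> ip; apply/matrixP => a b.
have -> : g i p *m (dual_jac i p)^T = (dual_jac i p *m g i p)^T.
  by rewrite trmx_mul (metric_sym hg ip).
rewrite mxE [RHS]mxE [in RHS]mxE [_^T _ _]mxE !dual_jac_metric // -mulrDr -big_split /=.
rewrite mulr_sumr -sumrN; apply: eq_bigr => e _.
by rewrite (pderiv_metric_sym e b a ip); field.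
Qed.

(** Obtained by differentiating the constant product of the metric with its inverse. *)
Lemma mderX_invmx i p : dom i p ->
  mderX i (fun q => invmx (g i q)) p =
  (dual_jac i p)^T *m invmx (g i p) + invmx (g i p) *m dual_jac i p.
Proof.
move=> ip; have gu := metric_unit hg ip.
have E : mderX i (fun q => g i q *m invmx (g i q)) p = 0.
  apply/matrixP => a b; rewrite !mxE -(derX_cst i ((1%:M : 'M[R]_n) a b) p).
  by apply: (derX_eq g eta (domO i) _ ip ip) => q iq; rewrite (mulmxV (metric_unit hg iq)).
move: E; rewrite (mderXM (domO i) (sm_metric hg i) (sm_invmx_metric hg i) ip ip).
rewrite (killing ip) => /(congr1 (mulmx (invmx (g i p)))); rewrite mulmx0 mulmxDr mulKmx //.
move/eqP; rewrite addrC addr_eq0 => /eqP ->.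
rewrite mulNmx mulmxN opprK mulmxDl mulmxDr addrC; congr (_ + _).
  by rewrite !mulmxA mulVmx // mul1mx.
by rewrite -mulmxA mulmxV // mulmx1.
Qed.

(** Trace of the Killing equation, through Jacobi's formula. Up to the factor [2 * sqrt_det] this is
    the divergence of [X] multiplied by the volume density. *)
Lemma divergence_free i p : dom i p ->
  derX i (fun q => \det (g i q)) p + 2 * \det (g i p) * \tr (dual_jac i p) = 0.
Proof.
move=> ip.
have -> : derX i (fun q => \det (g i q)) p = \tr (mderX i (g i) p *m \adj (g i p)).
  rewrite /derX.
  under eq_bigr do rewrite (pderiv_det _ (domO i) (sm_metric hg i) ip ip).
  have -> : mderX i (g i) p = \sum_c X i p 0 c *: (\matrix_(a, b) pderiv i c (fun q => g i q a b) p).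
    by apply/matrixP => a b; rewrite mxE summxE; apply: eq_bigr => c _; rewrite !mxE.
  rewrite mulmx_suml raddf_sum /=; apply: eq_bigr => c _.
  by rewrite -scalemxAl mxtraceZ.
rewrite (killing ip) mulNmx raddfN /= mulmxDl mxtraceD -mulmxA mul_mx_adj.
rewrite [\tr (g i p *m _ *m _)]mxtrace_mulC mulmxA mul_adj_mx.
rewrite mul_mx_scalar mul_scalar_mx !mxtraceZ mxtrace_tr.
by ring.
Qed.

Lemma norm_eta_derivative i a p : dom i p ->
  pderiv i a (fun q => \sum_b eta_row eta i q 0 b * X i q 0 b) p = 0.
Proof.
move=> ip.
rewrite (pderiv_sum _ _ (domO i) (fun c _ => sm_mul (domO i) (sm_eta heta i c) (sm_dual_field hg heta i c)) ip ip).
under eq_bigr do rewrite (pderivM _ (sm_eta heta _ _) (sm_dual_field hg heta _ _) ip ip) (parallel_eta _ _ ip).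
rewrite big_split /=.
have -> : \sum_b eta_row eta i p 0 b * pderiv i a (fun q => X i q 0 b) p
    = \sum_b (dual_jac i p *m g i p) a b * X i p 0 b.
  transitivity (((dual_jac i p *m g i p) *m (X i p)^T) a 0).
    rewrite -mulmxA -[g i p *m _]trmxK trmx_mul trmxK (metric_sym hg ip) -eta_rowE // mxE.
    by apply: eq_bigr => b _; rewrite !mxE mulrC.
  by rewrite mxE; apply: eq_bigr => b _; rewrite [_^T _ _]mxE.
under [X in _ + X]eq_bigr do rewrite (dual_jac_metric _ _ ip).
rewrite -big_split /=.
(* What remains of the metric derivatives is antisymmetric in the two summation indices. *)
pose E b e := X i p 0 e * X i p 0 b * pderiv i b (fun q => g i q a e) p.
transitivity (\sum_b \sum_e (E b e - E e b)).
  apply: eq_bigr => b _; rewrite -mulrDl -mulrDr -big_split /= mulr_sumr mulr_suml.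
  by apply: eq_bigr => e _; rewrite /E; field.
under eq_bigr do rewrite sumrB.
by rewrite sumrB [X in _ - X]exchange_big subrr.
Qed.

(** In Cartan's formula the term [i_X d w] drops out, so [d i_X w] is [L_X w]; the right-hand side
    is [L_X] in coordinates. *)
Lemma lie_closed k (w : components k.+1) i p I : Omega w ->
  ext_deriv w = @zero_form _ _ _ A k.+2 -> dom i p ->
  ext_deriv (interior g eta w) i p I =
  derX i (fun q => w i q I) p + derivation (dual_jac i p) (w i p) I.
Proof.
move=> Ow dw ip.
rewrite -(cartan (fun a J => pderiv i a (fun q => w i q J) p) (X i p) (dual_jac i p) I (Omega_alt i p Ow)).
have -> : exterior (fun a J => pderiv i a (fun q => w i q J) p) = fun=> 0.
  apply/funext => J; rewrite -(ext_derivE _ _ ip) dw; by [].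
have -> : contract (X i p) (fun=> 0) I = 0.
  by rewrite /contract big1 // => c _; rewrite mulr0.
rewrite add0r (ext_derivE _ _ ip); congr (exterior _ I).
apply/funext => a; apply/funext => K; rewrite /interior /contract.
have s1 c : sm A (dom i) (fun q => X i q 0 c * w i q (insert ord0 c K)).
  exact: (sm_mul (domO i) (sm_dual_field hg heta i c) (Omega_sm i _ Ow)).
rewrite (pderiv_sum _ _ (domO i) (fun c _ => s1 c) ip ip); apply: eq_bigr => c _.
by rewrite (pderivM _ (sm_dual_field hg heta i c) (Omega_sm i _ Ow) ip ip) [dual_jac _ _ _ _]mxE.
Qed.

(** Leibniz rule for the Lie derivative. The derivative of the inverse metric is distributed over
    the two arguments by [mderX_invmx] and [tdot_derivation]; this is where the Killing equation
    enters. *)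
Lemma derX_tdot k (v w : M -> array k) i p : dom i p ->
  (forall I, sm A (dom i) (fun q => v q I)) ->
  (forall I, sm A (dom i) (fun q => w q I)) ->
  derX i (fun q => tdot (invmx (g i q)) (v q) (w q)) p =
  tdot (invmx (g i p)) (fun I => derX i (fun q => v q I) p + derivation (dual_jac i p) (v p) I) (w p) +
  tdot (invmx (g i p)) (v p) (fun I => derX i (fun q => w q I) p + derivation (dual_jac i p) (w p) I).
Proof.
move=> ip vs ws; have Wo := domO i; have Hs := sm_invmx_metric hg i.
have Ps (I J : {ffun 'I_k -> 'I_n}) : sm A (dom i) (fun q => \prod_l invmx (g i q) (I l) (J l)).
  by apply: (sm_prod _ Wo).
have s1 I J := sm_mul Wo (vs I) (ws J).
have s2 I J := sm_mul Wo (s1 I J) (Ps I J).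
rewrite /tdot (derX_sum _ Wo (fun I _ => sm_sum _ Wo (fun J _ => s2 I J)) ip ip).
transitivity (\sum_I \sum_J ((derX i (fun q => v q I) p * w p J + v p I * derX i (fun q => w q J) p)
    * \prod_l invmx (g i p) (I l) (J l) + v p I * w p J *
    \sum_l (mderX i (fun q => invmx (g i q)) p) (I l) (J l) * \prod_(m | m != l) invmx (g i p) (I m) (J m))).
  apply: eq_bigr => I _; rewrite (derX_sum _ Wo (fun J _ => s2 I J) ip ip).
  apply: eq_bigr => J _.
  rewrite (derXM g eta (s1 I J) (Ps I J) ip ip) (derXM g eta (vs I) (ws J) ip ip).
  congr (_ + _ * _); rewrite (derX_prod _ (fun l => Hs (I l) (J l))) //.
  by apply: eq_bigr => l _; rewrite [mderX _ _ _ _ _]mxE.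
under eq_bigr do rewrite big_split /=.
rewrite big_split /= (mderX_invmx ip).
rewrite (tdot_derivation (dual_jac i p) (v p) (w p) (invmx_metric_sym hg ip)).
rewrite -/(tdot (invmx (g i p)) (fun I => derX i (fun q => v q I) p + derivation (dual_jac i p) (v p) I) (w p)).
rewrite -/(tdot (invmx (g i p)) (v p) (fun I => derX i (fun q => w q I) p + derivation (dual_jac i p) (w p) I)).
have Hsym := invmx_metric_sym hg ip.
rewrite tdotDl [in RHS](tdotC (v p) _ Hsym) tdotDl.
rewrite (tdotC _ (v p) Hsym) (tdotC (derivation _ (w p)) _ Hsym).
rewrite addrACA; congr (_ + _); rewrite /tdot -big_split; apply: eq_bigr => I _ /=.
by rewrite -big_split; apply: eq_bigr => J _ /=; rewrite !mulrDl.
Qed.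

(** Closedness of both forms is what identifies the two Lie derivatives with [d i_X]. *)
Lemma derX_form_dot k (v w : components k.+1) i p : Omega v -> Omega w ->
  ext_deriv v = @zero_form _ _ _ A k.+2 -> ext_deriv w = @zero_form _ _ _ A k.+2 ->
  dom i p ->
  derX i (form_dot g v w) p =
  form_dot g (ext_deriv (interior g eta v)) w p +
  form_dot g v (ext_deriv (interior g eta w)) p.
Proof.
move=> Ov Ow dv dw ip.
have Oiv := Omega_ext_deriv (Omega_interior hg heta Ov).
have Oiw := Omega_ext_deriv (Omega_interior hg heta Ow).
rewrite (form_dotE hg Oiv Ow ip) (form_dotE hg Ov Oiw ip) -mulrDr.
rewrite (@derX_eq _ _ _ _ _ _ (dom i) i _ (fun q => (k.+1`!%:R)^-1 * tdot (invmx (g i q)) (v i q) (w i q)) p (domO i) _ ip ip); last first.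
  by move=> q iq; rewrite (form_dotE hg Ov Ow iq).
have ts : sm A (dom i) (fun q => tdot (invmx (g i q)) (v i q) (w i q)).
  apply: (sm_tdot (domO i) (sm_invmx_metric hg i)) => I; exact: Omega_sm.
rewrite (derXZ _ (domO i) ts ip ip) derX_tdot //; last first.
- by move=> I; exact: Omega_sm.
- by move=> I; exact: Omega_sm.
congr (_ * _); congr (_ + _).
  by congr (tdot _ _ _); apply/funext => I; rewrite (lie_closed I Ov dv ip).
by congr (tdot _ _ _); apply/funext => I; rewrite (lie_closed I Ow dw ip).
Qed.

End parallel_forms.

(** * Lebesgue measure on R^n *)

Notation borel S := (g_sigma_algebraType (@open S)).

Section borel_functions.
Context {R : realType}.

Lemma borel_open (S : ptopologicalType) (U : set S) :
  open U -> measurable (U : set (borel S)).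
Proof. exact: sub_sigma_algebra. Qed.

Lemma borel_closed (S : ptopologicalType) (U : set S) :
  closed U -> measurable (U : set (borel S)).
Proof.
move=> Uc; rewrite -[U]setCK; apply: measurableC; apply: borel_open.
exact: closed_openC.
Qed.

Lemma measurable_fun_borel d (T : measurableType d) (S : ptopologicalType)
    (f : T -> borel S) :
  (forall U : set S, open U -> measurable (f @^-1` U)) -> measurable_fun setT f.
Proof.
move=> h; apply: (@measurability _ _ T (borel S) setT f (@open S)) => // _ [U oU <-].
by rewrite setTI; exact: h.
Qed.

Lemma continuous_borel (S : ptopologicalType) (f : S -> R) : continuous f ->
  measurable_fun setT (f : borel S -> R).
Proof.
move=> /continuousP cf; apply: (measurability _ (RGenOpens.measurableE R)) => _ [_ [a [b ->] <-]].
by rewrite setTI; apply: borel_open; apply: cf; exact: interval_open.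
Qed.

Lemma bounded_support_integrable d (T : measurableType d)
    (m : {measure set T -> \bar R}) (f : T -> R) (B : set T) (C : R) :
  measurable B -> (m B < +oo)%E -> measurable_fun setT f ->
  (forall x, `|f x| <= C) -> (forall x, ~ B x -> f x = 0) ->
  m.-integrable setT (EFin \o f).
Proof.
move=> mB Bfin mf fC f0.
have -> : EFin \o f = (EFin \o f) \_ B.
  apply/funext => x; rewrite patchE; case: ifPn => // /negP xB /=.
  by rewrite f0 // => Bx; apply: xB; exact: mem_set.
apply/(integrable_mkcond _ mB); apply: measurable_bounded_integrable => //.
  exact: measurable_funTS.
exists C; split; [exact: num_real|move=> y Cy x Bx].
exact: le_trans (fC x) (ltW Cy).
Qed.

Lemma integral_derive_eq0 (w dw : R -> R) (r : R) :
  (forall t, is_derive t (1 : R) w (dw t)) -> continuous dw ->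
  (forall t, r < `|t| -> w t = 0) ->
  (\int[lebesgue_measure]_t (dw t)%:E = 0)%E.
Proof.
(* The radius [r] may be negative; [b] is positive and larger than [r], so [w] vanishes at both ends
   of the interval. *)
move=> wd cdw w0; pose b : R := `|r| + 1.
have b0 : 0 < b by rewrite ltr_wpDl.
have rb : r < b by rewrite ltr_pwDr // ler_norm.
have dw0 t : r < `|t| -> dw t = 0.
  move=> rt; have [_ <-] := wd t.
  rewrite (@near_eq_derive _ _ _ w (cst 0)) ?derive_cst //.
  have : nbhs t [set s | r < `|s|].
    apply: (@open_nbhs_nbhs _ t [set s | r < `|s|]); split => //.
    apply: (@open_comp _ _ (fun s : R => `|s|) [set s | r < s]); last exact: open_gt.
    by move=> s _; exact: norm_continuous.
  by apply: filterS => s /= rs; rewrite w0.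
transitivity (\int[lebesgue_measure]_(t in `[(- b)%R, b]) (dw t)%:E)%E.
  rewrite [RHS]integral_mkcond; apply: eq_integral => t _; rewrite patchE.
  case: ifPn => // /negP tb; congr EFin; apply: dw0.
  rewrite ltNge; apply/negP => tr; apply: tb; apply/mem_set => /=.
  by rewrite in_itv /= -ler_norml (le_trans tr) // ltW.
have wc : continuous w.
  move=> t; apply: differentiable_continuous; apply/derivable1_diffP.
  by have [] := wd t.
rewrite (@continuous_FTC2 _ dw w).
- by rewrite !w0 ?normrN ?(gtr0_norm b0) // subee.
- by rewrite gtrN.
- by apply: continuous_subspaceT.
- split => [t _||]; first by have [] := wd t.
  + by apply: cvg_at_right_filter; exact: wc.
  + by apply: cvg_at_left_filter; exact: wc.
- by move=> t _; rewrite derive1E; have [_ ->] := wd t.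
Qed.

End borel_functions.

Section lebesgue_measure_Rn.
Context {R : realType}.

Lemma derive_transport (V W : normedModType R) (f : V -> R) (h : W -> R) x v y w :
  (forall s : R, f (s *: v + x) = h (s *: w + y)) ->
  'D_v f x = 'D_w h y /\ (derivable f x v -> derivable h y w).
Proof.
move=> fh.
suff H : (fun s : R => s^-1 *: ((f \o shift x) (s *: v) - f x)) =
         (fun s : R => s^-1 *: ((h \o shift y) (s *: w) - h y)).
  by rewrite /derive /derivable H.
have fx : f x = h y by have := fh 0; rewrite !scale0r !add0r.
by apply/funext => s /=; rewrite fh fx.
Qed.

(** The same [row_mx] as in the recursion of [integral_Rn], so that the iterated integral unfolds
    along it. *)
Definition consr n (z : R * 'rV[R]_n) : 'rV[R]_n.+1 :=
  row_mx (z.1%:M : 'rV[R]_1) z.2.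

Lemma consr0 n (z : R * 'rV[R]_n) : consr z 0 ord0 = z.1.
Proof.
have -> : ord0 = lshift n ord0 :> 'I_(1 + n) by apply/val_inj.
by rewrite /consr (@row_mxEl _ 1 1 n) mxE eqxx.
Qed.

Lemma consrS n (z : R * 'rV[R]_n) j : consr z 0 (lift ord0 j) = z.2 0 j.
Proof.
have -> : lift ord0 j = rshift 1 j :> 'I_(1 + n) by apply/val_inj.
by rewrite /consr (@row_mxEr _ 1 1 n).
Qed.

Lemma consrP n (x y : 'rV[R]_n.+1) : x 0 ord0 = y 0 ord0 ->
  (forall j, x 0 (lift ord0 j) = y 0 (lift ord0 j)) -> x = y.
Proof. by move=> h0 hS; apply/rowP => l; case: (unliftP ord0 l) => [j|] ->. Qed.

Lemma consr_surj n (x : 'rV[R]_n.+1) : exists t y, x = consr (t, y).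
Proof.
exists (x 0 ord0), (\row_j x 0 (lift ord0 j)).
by apply: consrP => [|j]; rewrite ?consr0 // consrS mxE.
Qed.

Lemma consr_norm n (t : R) (y : 'rV[R]_n) : `|consr (t, y)| = Num.max `|t| `|y|.
Proof.
apply/le_anti/andP; split.
  apply: rV_norm_le => [|l]; first by rewrite le_max normr_ge0.
  rewrite le_max; case: (unliftP ord0 l) => [j|] ->; first by rewrite consrS rV_coord_le orbT.
  by rewrite consr0 lexx.
rewrite ge_max; apply/andP; split.
  by have := rV_coord_le (consr (t, y)) ord0; rewrite consr0.
apply: rV_norm_le => // l.
by have := rV_coord_le (consr (t, y)) (lift ord0 l); rewrite consrS.
Qed.

Lemma rV_ball_open n (y : 'rV[R]_n) (r : R) : open [set z | `|z - y| < r].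
Proof.
rewrite openE => x /= xy; apply/nbhs_rVP; exists (r - `|x - y|); first by rewrite subr_gt0.
move=> z zx /=; have -> : z - y = (z - x) + (x - y) by rewrite addrA subrK.
by rewrite (le_lt_trans (ler_normD _ _)) // -ltrBrDr.
Qed.

Lemma rV_addE n (x y : 'rV[R]_n) l : (x + y) 0 l = x 0 l + y 0 l.
Proof. by rewrite mxE. Qed.

Lemma rV_oppE n (x : 'rV[R]_n) l : (- x) 0 l = - x 0 l.
Proof. by rewrite mxE. Qed.

Lemma rV_scaleE n (c : R) (x : 'rV[R]_n) l : (c *: x) 0 l = c * x 0 l.
Proof. by rewrite mxE. Qed.

Lemma consrB n (t s : R) (y z : 'rV[R]_n) :
  consr (t, y) - consr (s, z) = consr (t - s, y - z).
Proof. by apply: consrP => [|j]; rewrite rV_addE rV_oppE ?consr0 // !consrS rV_addE rV_oppE. Qed.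

Lemma consr_step0 n (h t : R) (y : 'rV[R]_n) :
  consr (h *: (1 : R) + t, y) = h *: delta_mx 0 ord0 + consr (t, y).
Proof.
apply: consrP => [|j]; rewrite rV_addE rV_scaleE delta_mx_coord ?consr0 ?eqxx //.
by rewrite !consrS [lift _ _ == _]negbTE ?mulr0 ?add0r // eq_sym neq_lift.
Qed.

Lemma consr_stepS n (j : 'I_n) (h t : R) (y : 'rV[R]_n) :
  consr (t, h *: delta_mx 0 j + y) = h *: delta_mx 0 (lift ord0 j) + consr (t, y).
Proof.
apply: consrP => [|i]; rewrite rV_addE rV_scaleE delta_mx_coord ?consr0.
  by rewrite [ord0 == _]negbTE ?mulr0 ?add0r // neq_lift.
by rewrite !consrS rV_addE rV_scaleE delta_mx_coord (inj_eq (@lift_inj _ ord0)).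
Qed.

Lemma consr_continuous n : continuous (@consr n).
Proof.
move=> [t y]; apply: rV_cvg => l; case: (unliftP ord0 l) => [j|] ->.
  under eq_fun do rewrite consrS.
  rewrite consrS.
  apply: (@continuous_comp _ _ _ snd (fun z : 'rV[R]_n => z 0 j)); first exact: cvg_snd.
  exact: matrix_normedtype.coord_continuous.
under eq_fun do rewrite consr0.
by rewrite consr0; exact: cvg_fst.
Qed.

(** The source carries the product of two Borel structures, so continuity alone is not enough: an
    open set is written as a countable union of rational cubes, whose preimages are products of open
    sets. *)
Lemma consr_measurable n :
  measurable_fun setT (@consr n : measurableTypeR R * borel 'rV[R]_n -> borel 'rV[R]_n.+1).
Proof.
apply: measurable_fun_borel => U oU.
(* Rational cubes that are not contained in [U] are replaced by the empty set, so that the union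
   runs over a fixed countable type. *)
pose box (c : 'rV[rat]_n.+1 * rat) : set (measurableTypeR R * borel 'rV[R]_n) :=
  if `[< forall z, `|z - map_mx ratr c.1| < ratr c.2 -> U z >]
  then @consr n @^-1` [set z | `|z - map_mx ratr c.1| < ratr c.2] else set0.
have -> : @consr n @^-1` U = \bigcup_c box c.
  apply/seteqP; split => [z Uz|z [c _]]; last first.
    by rewrite /box; case: asboolP => // h /h.
  have /nbhs_rVP[d d0 dU] : nbhs (consr z) U by exact: open_nbhs_nbhs.
  have [q /andP[q0 qd]] : exists q : rat, (0 < (ratr q : R)) && ((ratr q : R) < d / 2).
    have [|q] := @rat_in_itvoo _ 0 (d / 2); first by rewrite divr_gt0.
    by rewrite in_itv /=; exists q.
  have rat_near (s : R) : exists a : rat, `|s - ratr a| <= ratr q / 2.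
    have [|a] := @rat_in_itvoo _ (s - ratr q / 2) (s + ratr q / 2); first by rewrite ltrD2l; lra.
    rewrite in_itv /= => /andP[a1 a2]; exists a; rewrite ler_norml; apply/andP; split; lra.
  pose c l := sval (cid (rat_near (consr z 0 l))).
  have cz : `|consr z - map_mx ratr (\row_l c l)| < ratr q.
    apply: (@le_lt_trans _ _ (ratr q / 2)); last lra.
    apply: rV_norm_le => [|l]; first lra.
    by rewrite rV_addE rV_oppE [map_mx _ _ _ _]mxE [(\row_l c l) _ _]mxE; exact: (svalP (cid (rat_near (consr z 0 l)))).
  exists (\row_l c l, q) => //; rewrite /box /=; case: asboolP => //= H; exfalso; apply: H.
  move=> y yc; apply: dU; have -> : y - consr z = (y - map_mx ratr (\row_l c l)) + (map_mx ratr (\row_l c l) - consr z).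
    by rewrite addrA subrK.
  rewrite (le_lt_trans (ler_normD _ _)) // [X in _ + X]distrC; lra.
apply: countable_bigcupT_measurable; first exact: countableP.
move=> c; rewrite /box; case: ifP => // _.
have [s [y cE]] := consr_surj (map_mx ratr c.1 : 'rV[R]_n.+1).
rewrite (_ : _ @^-1` _ = [set t | `|t - s| < ratr c.2] `*` [set z : 'rV[R]_n | `|z - y| < ratr c.2]).
  apply: measurableX.
    have -> : [set t | `|t - s| < ratr c.2] = ball s (ratr c.2).
      by apply/seteqP; split => t; rewrite /ball /= distrC.
    exact: measurable_ball.
  apply: borel_open; exact: rV_ball_open.
apply/seteqP; split => -[t z] /=; rewrite cE consrB consr_norm gt_max.
  by move/andP.
by move=> [-> ->].
Qed.

Lemma consr_section_measurable n (t : R) :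
  measurable_fun setT ((fun y => @consr n (t, y)) : borel 'rV[R]_n -> borel 'rV[R]_n.+1).
Proof.
apply: (@measurableT_comp _ _ _ _ _ _ (@consr n : measurableTypeR R * borel 'rV[R]_n -> borel 'rV[R]_n.+1) _ (pair t)).
  exact: consr_measurable.
exact: measurable_pair1.
Qed.

Lemma closed_cube_borel n (r : R) : measurable ([set x | `|x| <= r] : set (borel 'rV[R]_n)).
Proof.
have -> : [set x : 'rV[R]_n | `|x| <= r] = [set x | `|x - 0| <= r].
  by apply/seteqP; split => x /=; rewrite subr0.
apply: borel_closed; apply: compact_closed; last exact: closed_cube_compact.
exact: norm_hausdorff.
Qed.

Lemma partial_support n c (v : 'rV[R]_n -> R) (r : R) :
  (forall x, r < `|x| -> v x = 0) -> forall x, r < `|x| -> partial c v x = 0.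
Proof.
move=> v0 x rx; rewrite /partial (@near_eq_derive _ _ _ v (cst 0)) ?derive_cst //.
apply/nbhs_rVP; exists (`|x| - r); first by rewrite subr_gt0.
move=> y yx; apply: v0; have := ler_distD y x 0; rewrite !subr0 [`|x - y|]distrC; lra.
Qed.

Lemma cube_support_bounded n (f : 'rV[R]_n -> R) (r : R) : continuous f ->
  (forall x, r < `|x| -> f x = 0) -> exists C, forall x, `|f x| <= C.
Proof.
move=> cf f0.
have cK : compact [set x : 'rV[R]_n | `|x - 0| <= r] by exact: closed_cube_compact.
have := @compact_bounded R _ (f @` [set x : 'rV[R]_n | `|x - 0| <= r]).
case; first by apply: continuous_compact => //; exact: continuous_subspaceT.
move=> C [_ HC]; exists (`|C| + 1) => x.
have [rx|xr] := ltP r `|x|; first by rewrite f0 // normr0 addr_ge0.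
apply: HC; first by rewrite (le_lt_trans (ler_norm C)) // ltrDl.
by exists x => //=; rewrite subr0.
Qed.

(** All that the volume arguments take from Lebesgue measure, stated so that each clause passes from
    [n] to [n.+1]. The first clause ties the measure to the iterated integral in
    [riemannian_volume]. *)
Record lebesgue_Rn n (m : {measure set (borel 'rV[R]_n) -> \bar R}) : Prop := LebesgueRn {
  lebesgue_Rn_integral : forall f : borel 'rV[R]_n -> \bar R, measurable_fun setT f ->
    (forall x, 0 <= f x)%E -> (\int[m]_x f x = integral_Rn f)%E;
  lebesgue_Rn_cube : forall r : R, (m [set x : 'rV[R]_n | (`|x| <= r)%R] < +oo)%E;
  lebesgue_Rn_ball : forall (x : 'rV[R]_n) (r : R), 0 < r -> (0 < m [set y | (`|y - x| < r)%R])%E;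
  lebesgue_Rn_partial : forall c (v : 'rV[R]_n -> R) r,
    (forall x, derivable v x (delta_mx 0 c)) -> continuous (partial c v) ->
    (forall x, r < `|x| -> v x = 0) -> (\int[m]_x (partial c v x)%:E = 0)%E }.

Definition consr_borel n : measurableTypeR R * borel 'rV[R]_n -> borel 'rV[R]_n.+1 := @consr n.

HB.instance Definition _ n :=
  isMeasurableFun.Build _ _ _ _ (@consr_borel n) (@consr_measurable n).

Section induction_step.
Context {n : nat} (m : {sigma_finite_measure set (borel 'rV[R]_n) -> \bar R}).
Hypothesis hm : lebesgue_Rn m.

Definition lebesgue_consr : set (borel 'rV[R]_n.+1) -> \bar R :=
  pushforward (lebesgue_measure \x m)%E (@consr_borel n).

Let lebesgue_consr0 : lebesgue_consr set0 = 0%E.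
Proof. exact: measure0. Qed.

Let lebesgue_consr_ge0 B : (0 <= lebesgue_consr B)%E.
Proof. exact: measure_ge0. Qed.

Let lebesgue_consr_sigma_additive : semi_sigma_additive lebesgue_consr.
Proof. exact: measure_semi_sigma_additive. Qed.

HB.instance Definition _ := isMeasure.Build _ _ _ lebesgue_consr
  lebesgue_consr0 lebesgue_consr_ge0 lebesgue_consr_sigma_additive.

Lemma lebesgue_consr_cube r : (lebesgue_consr [set x : 'rV[R]_n.+1 | (`|x| <= r)%R] < +oo)%E.
Proof.
rewrite /lebesgue_consr /pushforward.
rewrite (_ : _ @^-1` _ = `[(- r), r] `*` [set y : 'rV[R]_n | `|y| <= r]); last first.
  apply/seteqP; split => -[t y] /=; rewrite consr_norm ge_max in_itv /= ler_norml; first by move/andP.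
  by move=> [-> ->].
rewrite product_measure1E //; last exact: closed_cube_borel.
have fin : (lebesgue_measure `[(- r)%R, r]%classic < +oo)%E.
  by rewrite lebesgue_measure_itv; case: ifP; rewrite ?ltry.
rewrite lte_mul_pinfty //; first by rewrite ge0_fin_numE ?measure_ge0 //; exact: fin.
exact: (lebesgue_Rn_cube hm).
Qed.

Let lebesgue_consr_sigma_finite : sigma_finite setT lebesgue_consr.
Proof.
exists (fun k => [set x : 'rV[R]_n.+1 | (`|x| <= k%:R)%R]).
  apply/seteqP; split => // x _; exists (Num.bound `|x|) => //=.
  by rewrite ltW // archi_boundP.
by move=> k; split; [exact: closed_cube_borel|exact: lebesgue_consr_cube].
Qed.

HB.instance Definition _ := @Measure_isSigmaFinite.Build _ _ _ lebesgue_consr lebesgue_consr_sigma_finite.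

Lemma lebesgue_consr_integral (f : borel 'rV[R]_n.+1 -> \bar R) : measurable_fun setT f ->
  (forall x, 0 <= f x)%E -> (\int[lebesgue_consr]_x f x = integral_Rn f)%E.
Proof.
move=> mf f0; rewrite ge0_integral_pushforward //=.
rewrite preimage_setT (@fubini_tonelli1 _ _ _ _ _ _ _  (f \o @consr_borel n)) //=; last first.
  by apply: measurableT_comp => //; exact: consr_measurable.
apply: eq_integral => t _; rewrite /fubini_F /=.
apply: (lebesgue_Rn_integral hm) => //.
by apply: (measurableT_comp mf); exact: consr_section_measurable.
Qed.

Lemma lebesgue_consr_ball (x : 'rV[R]_n.+1) (r : R) : 0 < r ->
  (0 < lebesgue_consr [set y | (`|y - x| < r)%R])%E.
Proof.
move=> r0; have [t [y ->]] := consr_surj x.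
rewrite /lebesgue_consr /pushforward.
rewrite (_ : _ @^-1` _ = ball t r `*` [set z : 'rV[R]_n | `|z - y| < r]); last first.
  apply/seteqP; split => -[s z] /=; rewrite consrB consr_norm gt_max /ball /= distrC; first by move/andP.
  by move=> [-> ->].
rewrite product_measure1E //.
- have pos : (0 < lebesgue_measure (ball t r))%E.
    by rewrite lebesgue_measure_ball ?ltW // lte_fin mulrn_wgt0.
  apply: mule_gt0; first exact: pos.
  exact: (lebesgue_Rn_ball hm).
- exact: measurable_ball.
- by apply: borel_open; exact: rV_ball_open.
Qed.

(** Fubini, with the coordinate [c] integrated innermost: over [m] and by induction if [c] is a
    lifted index, over the line and by [integral_derive_eq0] if it is [ord0]. *)
Lemma lebesgue_consr_partial c (v : 'rV[R]_n.+1 -> R) r :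
  (forall x, derivable v x (delta_mx 0 c)) -> continuous (partial c v) ->
  (forall x, r < `|x| -> v x = 0) -> (\int[lebesgue_consr]_x (partial c v x)%:E = 0)%E.
Proof.
move=> vd cv v0.
have dv0 := partial_support c v0.
have [C dvC] := cube_support_bounded cv dv0.
have mdv : measurable_fun setT (partial c v : borel 'rV[R]_n.+1 -> R) by exact: continuous_borel.
have mphi := @consr_measurable n.
have mw : measurable_fun setT (fun z : measurableTypeR R * borel 'rV[R]_n => partial c v (consr z)).
  exact: (measurableT_comp mdv mphi).
have mK := @closed_cube_borel n.+1 r.
have iw : (lebesgue_measure \x m)%E.-integrable setT (EFin \o (fun z : measurableTypeR R * borel 'rV[R]_n => partial c v (consr z))).
  apply: (@bounded_support_integrable _ _ _ _ _ (@consr_borel n @^-1` [set x | `|x| <= r]) C) => //.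
  - by rewrite -[X in measurable X]setTI; exact: mphi.
  - exact: lebesgue_consr_cube.
  - by move=> z /negP; rewrite -ltNge => /dv0.
rewrite (@integral_pushforward _ _ _ _ _ (@consr_borel n)) //; last exact/measurable_EFinP.
rewrite preimage_setT.
case: (unliftP ord0 c) => [j|] cE.
  rewrite -(integral12_prod_meas1 iw); apply: integral0_eq => t _; rewrite /fubini_F /=.
  have E y := @derive_transport _ _ v (fun y => v (consr (t, y))) (consr (t, y)) (delta_mx 0 c)
    y (delta_mx 0 j) (fun h => congr1 v (esym (etrans (consr_stepS j h t y) (congr1 (fun c => h *: delta_mx 0 c + _) (esym cE))))).
  have dE y : partial c v (consr (t, y)) = partial j (fun y => v (consr (t, y))) y := (E y).1.
  under eq_integral do rewrite dE.
  apply: (@lebesgue_Rn_partial _ _ hm j (fun y => v (consr (t, y))) r).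
  - by move=> y; exact: (E y).2 (vd _).
  - have -> : partial j (fun y => v (consr (t, y))) = (fun y => partial c v (consr (t, y))).
      by apply/funext => y; rewrite dE.
    move=> y; apply: (@continuous_comp _ _ _ (fun y => consr (t, y)) (partial c v)); last exact: cv.
    apply: (@continuous_comp _ _ _ (fun y : 'rV[R]_n => ((t : R), y)) (@consr n)); last exact: consr_continuous.
    apply: (@cvg_pair _ _ _ (nbhs y) (nbhs (t : R)) (nbhs y) _ _ _ (fun=> t : R) id).
      exact: cvg_cst.
    exact: cvg_id.
  - by move=> y ry; apply: v0; rewrite consr_norm lt_max ry orbT.
rewrite -(integral21_prod_meas1 iw); apply: integral0_eq => y _; rewrite /fubini_G /=.
have E t := @derive_transport _ _ v (fun t => v (consr (t, y))) (consr (t, y)) (delta_mx 0 c)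
  t 1 (fun h => congr1 v (esym (etrans (consr_step0 h t y) (congr1 (fun c => h *: delta_mx 0 c + _) (esym cE))))).
apply: (@integral_derive_eq0 _ (fun t => v (consr (t, y))) _ r).
- by move=> t; split; [exact: (E t).2 (vd _)|exact: esym (E t).1].
- move=> t; apply: (@continuous_comp _ _ _ (fun t => consr (t, y)) (partial c v)); last exact: cv.
  apply: (@continuous_comp _ _ _ (fun t => (t, y)) (@consr n)); last exact: consr_continuous.
  apply: (@cvg_pair _ _ _ (nbhs t) (nbhs (t : R)) (nbhs y) _ _ _ id (fun=> y)).
    exact: cvg_id.
  exact: cvg_cst.
- by move=> t rt; apply: v0; rewrite consr_norm lt_max rt.
Qed.

Lemma lebesgue_Rn_step :
  exists m' : {sigma_finite_measure set (borel 'rV[R]_n.+1) -> \bar R}, lebesgue_Rn m'.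
Proof.
exists lebesgue_consr; split; [exact: lebesgue_consr_integral|exact: lebesgue_consr_cube|
  exact: lebesgue_consr_ball|exact: lebesgue_consr_partial].
Qed.

End induction_step.

Lemma lebesgue_Rn_exists n :
  exists m : {sigma_finite_measure set (borel 'rV[R]_n) -> \bar R}, lebesgue_Rn m.
Proof.
elim: n => [|n [m hm]]; last exact: (lebesgue_Rn_step hm).
have x0 (x : 'rV[R]_0) : x = 0 by apply/rowP => -[].
(* The space of dimension 0 is a point, and [integral_Rn] evaluates there. *)
exists (@dirac _ (borel 'rV[R]_0) (0 : 'rV[R]_0) R); split.
- by move=> f mf f0; rewrite integral_dirac // diracT mul1e.
- by move=> r; rewrite /= diracE; exact: ltry.
- by move=> x r r0; rewrite /= diracE mem_set /= ?lte_fin // (x0 x) subr0 normr0.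
- by move=> [].
Qed.

End lebesgue_measure_Rn.

(** * The Riemannian volume *)

Section integration_with_density.
Import HBNNSimple.
Context d1 d2 (T1 : measurableType d1) (T2 : measurableType d2) (R : realType).
Variables (m1 : {measure set T1 -> \bar R}) (m2 : {measure set T2 -> \bar R}).
Variables (phi : T2 -> T1) (h : T2 -> R) (D : set T1).
Hypotheses (mphi : measurable_fun setT phi) (mh : measurable_fun setT h)
  (h_ge0 : forall x, 0 <= h x) (h_out : forall x, ~ D (phi x) -> h x = 0)
  (mD : measurable D)
  (m1E : forall B, measurable B -> B `<=` D ->
     m1 B = (\int[m2]_x (h x * \1_B (phi x))%:E)%E).

Lemma ge0_integral_density (f : T1 -> \bar R) : measurable_fun setT f ->
  (forall x, 0 <= f x)%E ->
  (\int[m1]_(x in D) f x = \int[m2]_x ((h x)%:E * f (phi x)))%E.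
Proof.
move=> mf f0; have mfD := measurable_funTS mf : measurable_fun D f.
pose u := nnsfun_approx measurableT mf.
have u_cvg x : ((u k x)%:E @[k --> \oo] --> f x)%classic.
  by apply: (cvg_nnsfun_approx measurableT mf) => // y _; exact: f0.
have u_nd x : {homo (fun k => (u k x)%:E) : a b / (a <= b)%N >-> (a <= b)%E}.
  by move=> a b ab; rewrite lee_fin; exact/lefP/nd_nnsfun_approx.
transitivity (limn (fun k => \int[m1]_(x in D) (u k x)%:E))%E.
  rewrite -monotone_convergence //.
  - by apply: eq_integral => x _; apply/esym/cvg_lim => //; exact: u_cvg.
  - by move=> k; apply/measurable_EFinP/measurable_funTS.
  - by move=> k x _; rewrite lee_fin.
transitivity (limn (fun k => \int[m2]_x ((h x)%:E * (u k (phi x))%:E)))%E; last first.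
  rewrite -monotone_convergence //.
  - apply: eq_integral => x _; apply/cvg_lim => //.
    by apply: cvgeZl => //; exact: u_cvg.
  - move=> k; apply: emeasurable_funM; first exact/measurable_EFinP.
    by apply/measurable_EFinP; exact: (measurableT_comp _ mphi).
  - by move=> k x _; rewrite mule_ge0 // lee_fin.
  - by move=> x _ a b ab; rewrite lee_wpmul2l ?lee_fin //; have := u_nd (phi x) _ _ ab; rewrite lee_fin.
congr (limn _); apply/funext => k.
have mA r : measurable (u k @^-1` [set r]) by [].
have m1A r : m1 (u k @^-1` [set r] `&` D) = (\int[m2]_x (h x * \1_(u k @^-1` [set r]) (phi x))%:E)%E.
  rewrite m1E; [|exact: measurableI|by move=> x []].
  apply: eq_integral => x _; congr EFin.
  have [xD|xD] := pselect (D (phi x)); last by rewrite h_out // !mul0r.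
  by rewrite !indicE in_setI [_ \in D]mem_set // andbT.
have mind r : measurable_fun setT (fun x => h x * \1_(u k @^-1` [set r]) (phi x)).
  apply: measurable_funM => //.
  by apply: (@measurableT_comp _ _ _ _ _ _ (\1_(u k @^-1` [set r]) : T1 -> R) _ phi).
have rng_ge0 r : r \in range (u k) -> 0 <= r by move=> /set_mem [x _ <-].
transitivity (\sum_(r \in range (u k)) (r%:E * m1 (u k @^-1` [set r] `&` D)))%E.
  under eq_integral do rewrite fimfunE -fsumEFin//.
  rewrite ge0_integral_fsum //.
  - apply: eq_fsbigr => r /rng_ge0 r0; under eq_integral do rewrite EFinM.
    rewrite ge0_integralZl // ?integral_indic //.
    exact/measurable_EFinP.
  - by move=> r; apply/measurable_EFinP/measurable_funM.
  - by move=> r x _; rewrite EFinM nnfun_muleindic_ge0.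
transitivity (\sum_(r \in range (u k)) \int[m2]_x (r * (h x * \1_(u k @^-1` [set r]) (phi x)))%:E)%E.
  apply: eq_fsbigr => r /rng_ge0 r0; rewrite m1A.
  under [RHS]eq_integral do rewrite EFinM.
  rewrite ge0_integralZl //; first exact/measurable_EFinP.
  by move=> x _; rewrite lee_fin mulr_ge0.
rewrite -ge0_integral_fsum //.
- apply: eq_integral => x _; rewrite -EFinM fsumEFin // fimfunE; congr EFin.
  by rewrite mulr_fsumr; apply: eq_fsbigr => r _; rewrite mulrCA.
- by move=> r; apply/measurable_EFinP/measurable_funM.
- by move=> r x _; rewrite lee_fin mulrCA mulr_ge0 // -lee_fin EFinM nnfun_muleindic_ge0.
Qed.

End integration_with_density.

Section volume.
Context {R : realType} {n : nat} {M : ptopologicalType}.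
Variable A : smooth_manifold R n M.
Local Notation chart := (chart A).
Local Notation dom := (@dom _ _ _ A).
Local Notation coord := (@coord _ _ _ A).
Local Notation param := (@param _ _ _ A).
Local Notation chart_at := (@chart_at _ _ _ A).
Implicit Types (i j : chart) (p q : M) (u : M -> R) (W : set M).

Lemma measurable_preimage_open (S : ptopologicalType) (S' : topologicalType) (W : set S)
    (f : S -> S') (c : S') (V : set S') : open W ->
  (forall x, W x -> {for x, continuous f}) -> (forall x, ~ W x -> f x = c) ->
  open V -> measurable (f @^-1` V : set (borel S)).
Proof.
move=> Wo fc fW Vo.
have -> : f @^-1` V = (W `&` f @^-1` V) `|` (~` W `&` [set x | V c]).
  apply/seteqP; split => x /=.
    by have [Wx|Wx] := pselect (W x) => fx; [left|right; rewrite -(fW _ Wx)].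
  by move=> [[]//|[Wx Vc]]; rewrite fW.
apply: measurableU.
  apply: borel_open; rewrite openE => x [Wx Vx].
  apply: filterI; first exact: open_nbhs_nbhs.
  by apply: fc => //; exact: open_nbhs_nbhs.
apply: measurableI; first by apply: measurableC; exact: borel_open.
have [Vc|Vc] := pselect (V c).
  by rewrite (_ : [set _ | _] = setT) //; apply/seteqP; split.
by rewrite (_ : [set _ | _] = set0) //; apply/seteqP; split.
Qed.

Variable g : chart -> M -> 'M[R]_n.
Hypothesis hg : riemannian_metric g.
Variable vol : {measure set (borel M) -> \bar R}.
Hypothesis hvol : riemannian_volume g vol.
Variable m : {sigma_finite_measure set (borel 'rV[R]_n) -> \bar R}.
Hypothesis hm : lebesgue_Rn m.

Definition sqrt_det i p : R := Num.sqrt (\det (g i p)).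

Lemma is_derive_negpow k (t : R) : t != 0 ->
  is_derive t (1 : R) (fun t : R => t ^- k) (- k%:R * t ^- k.+1).
Proof.
move=> t0; have tk0 : t ^+ k != 0 by rewrite expf_neq0.
have dX : is_derive t (1 : R) (fun t : R => t ^+ k) (k%:R * t ^+ k.-1).
  apply: DeriveDef; first exact: exprn_derivable.
  by rewrite exp_derive /GRing.scale /= mulr1.
have dV := @realfun.is_deriveV R (fun t => t ^+ k) t _ 1 tk0 dX.
apply: (is_derive_eq dV); rewrite /GRing.scale /=.
case: k tk0 {dX dV} => [|k] tk0; first by rewrite !mul0r oppr0 mulr0 mul0r.
by rewrite !exprS /=; field; rewrite t0 expf_neq0.
Qed.

(** The functions [c * (sqrt t * t ^- k)] form a family stable under derivation on the positive
    half-line: the derivative multiplies [c] by [1/2 - k] and raises [k] by one. *)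
Lemma sm_sqrt W u : open W -> (forall p, W p -> 0 < u p) -> sm A W u ->
  sm A W (fun p => Num.sqrt (u p)).
Proof.
move=> Wo u0 us; split => i.
pose S := [set a : R -> R | exists c k, a = fun t => c * (Num.sqrt t * t ^- k)].
apply: (@Cinf_comp1 _ _ [set t | 0 < t] S _ (u \o param i) Num.sqrt).
- move=> _ [c [k ->]].
  exists (fun t => (c * (2^-1 - k%:R)) * (Num.sqrt t * t ^- k.+1)); first by exists (c * (2^-1 - k%:R)), k.+1.
  move=> t /= t0; have tn0 : t != 0 by rewrite gt_eqF.
  have sn0 : Num.sqrt t != 0 by rewrite gt_eqF // sqrtr_gt0.
  have d1 : is_derive t (1 : R) Num.sqrt (2 * Num.sqrt t)^-1 := is_derive1_sqrt t0.
  have d2 := is_derive_negpow k tn0.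
  have dM := is_deriveM d1 d2.
  have dZ : is_derive t (1 : R) (fun t => c * (Num.sqrt t * t ^- k)) _ := is_deriveZ c dM.
  apply: (is_derive_eq dZ); rewrite /GRing.scale /= -[RHS]mulrA; congr (_ * _).
  have -> : t ^- k = Num.sqrt t ^+ 2 * t ^- k.+1.
    by rewrite sqr_sqrtr ?ltW // exprS invfM mulrA divff // mul1r.
  by field; rewrite sn0 expf_neq0.
- exact: coord_image_open.
- by move=> _ [p [ip Wp] <-] /=; rewrite coordK //; exact: u0.
- exact: (sm_Cinf us).
- by exists 1, 0%N; apply/funext => t; rewrite expr0 invr1 mulr1 mul1r.
Qed.

Lemma sqrt_det_gt0 i p : dom i p -> 0 < sqrt_det i p.
Proof. by move=> ip; rewrite sqrtr_gt0 (det_metric_gt0 hg ip). Qed.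

Lemma sm_sqrt_det i : sm A (dom i) (sqrt_det i).
Proof.
apply: (sm_sqrt (domO i)); first by move=> p ip; exact: (det_metric_gt0 hg ip).
by apply: (sm_det (domO i)); exact: sm_metric.
Qed.

(* Extensions of param i and of the density by constants, so as to have total Borel maps. *)
Definition chart_map i (x : borel 'rV[R]_n) : borel M :=
  if x \in codom i then param i x else point.

Definition chart_density i (x : borel 'rV[R]_n) : R :=
  if x \in codom i then sqrt_det i (param i x) else 0.

Lemma chart_map_in i x : codom i x -> chart_map i x = param i x.
Proof. by move=> ix; rewrite /chart_map mem_set. Qed.

Lemma chart_map_out i x : ~ codom i x -> chart_map i x = point.
Proof. by move=> ix; rewrite /chart_map memNset. Qed.

Lemma chart_density_in i x : codom i x -> chart_density i x = sqrt_det i (param i x).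
Proof. by move=> ix; rewrite /chart_density mem_set. Qed.

Lemma chart_density_out i x : ~ codom i x -> chart_density i x = 0.
Proof. by move=> ix; rewrite /chart_density memNset. Qed.

Lemma codomO i : open (codom i).
Proof. exact: image_open. Qed.

Lemma measurable_chart_map i : measurable_fun setT (chart_map i).
Proof.
apply: measurable_fun_borel => U Uo.
have H := @measurable_preimage_open 'rV[R]_n M (codom i) (chart_map i) point U (@codomO i).
apply: H Uo; last exact: chart_map_out.
move=> x ix; apply: (@continuous_eq_on _ _ (codom i) (param i) _ _ (@codomO i) _ ix (param_cont ix)).
by move=> y iy; rewrite chart_map_in.
Qed.

Lemma chart_density_continuous i x : codom i x -> {for x : 'rV[R]_n, continuous (chart_density i : 'rV[R]_n -> R)}.
Proof.
move=> ix; apply: (@continuous_eq_on _ _ (codom i) (fun x => sqrt_det i (param i x)) _ _ (@codomO i) _ ix).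
  by move=> y iy; rewrite chart_density_in.
apply: (@continuous_comp _ _ _ (param i) (sqrt_det i)); first exact: param_cont.
by apply: (sm_continuous (sm_sqrt_det i)); exact: dom_param.
Qed.

Lemma measurable_chart_density i : measurable_fun setT (chart_density i).
Proof.
apply: (measurability _ (RGenOpens.measurableE R)) => _ [_ [a [b ->] <-]].
rewrite setTI.
have H := @measurable_preimage_open 'rV[R]_n R (codom i) (chart_density i) 0 _ (@codomO i).
apply: H; [exact: chart_density_continuous|exact: chart_density_out|exact: interval_open].
Qed.

Lemma chart_density_ge0 i x : 0 <= chart_density i x.
Proof.
have [ix|ix] := pselect (codom i x); last by rewrite chart_density_out.
by rewrite chart_density_in // sqrtr_ge0.
Qed.

Lemma volume_chart i (B : set (borel M)) : measurable B -> B `<=` dom i ->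
  vol B = (\int[m]_x (chart_density i x * \1_B (chart_map i x))%:E)%E.
Proof.
move=> mB Bi; have E : (fun x : 'rV[R]_n => if x \in coord i @` B then (Num.sqrt (\det (g i (param i x))))%:E else 0%E)
  = (fun x => (chart_density i x * \1_B (chart_map i x))%:E).
  apply/funext => x; rewrite indicE; case: ifPn => [/set_mem [p Bp <-]|xB].
    have ip := Bi _ Bp; have ix := codom_coord ip.
    by rewrite chart_density_in // chart_map_in // coordK // mem_set // mulr1 /sqrt_det.
  have [ix|ix] := pselect (codom i x); last by rewrite chart_density_out // mul0r.
  rewrite chart_map_in // memNset ?mulr0 // => Bx; move/negP: xB; apply; apply/mem_set.
  by exists (param i x) => //; exact: paramK.
rewrite (hvol mB Bi) E (lebesgue_Rn_integral hm) //.
  apply/measurable_EFinP; apply: measurable_funM; first exact: measurable_chart_density.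
  apply: (@measurableT_comp _ _ _ _ _ _ (\1_B : borel M -> R) _ (chart_map i)) => //.
  exact: measurable_chart_map.
by move=> x; rewrite lee_fin mulr_ge0 ?chart_density_ge0.
Qed.

Lemma integral_chart_ge0 i (f : borel M -> \bar R) : measurable_fun setT f ->
  (forall p, 0 <= f p)%E ->
  (\int[vol]_(p in dom i) f p = \int[m]_x ((chart_density i x)%:E * f (chart_map i x)))%E.
Proof.
move=> mf f0; apply: ge0_integral_density => //.
- exact: measurable_chart_map.
- exact: measurable_chart_density.
- exact: chart_density_ge0.
- move=> x; have [ix|ix] := pselect (codom i x); last by rewrite chart_density_out.
  by rewrite chart_map_in // => /(_ (dom_param ix)).
- by apply: borel_open; exact: domO.
- exact: volume_chart.
Qed.

Lemma integral_chart i (F : borel M -> R) : measurable_fun setT F ->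
  (forall p, ~ dom i p -> F p = 0) ->
  (\int[vol]_p (F p)%:E = \int[m]_x (chart_density i x * F (chart_map i x))%:E)%E.
Proof.
move=> mF F0.
have -> : (\int[vol]_p (F p)%:E = \int[vol]_(p in dom i) (F p)%:E)%E.
  rewrite [RHS]integral_mkcond; apply: eq_integral => p _; rewrite patchE.
  by case: ifPn => // /negP ip; rewrite F0 // => ip'; apply: ip; exact: mem_set.
have mE : measurable_fun setT (EFin \o F) by exact/measurable_EFinP.
rewrite integralE (integral_chart_ge0 i (measurable_funepos mE)) // (integral_chart_ge0 i (measurable_funeneg mE)) //.
rewrite [RHS]integralE; congr (_ - _)%E; apply: eq_integral => x _.
  by rewrite !funeposE /= maxe_pMr ?lee_fin ?chart_density_ge0 // mule0 EFinM.
by rewrite !funenegE /= maxe_pMr ?lee_fin ?chart_density_ge0 // mule0 -EFinM mulrN.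
Qed.

(** * Sets of finite and of positive volume *)

Lemma compact_borel (K : set M) : compact K -> measurable (K : set (borel M)).
Proof. by move=> Kc; apply: borel_closed; exact: (manifold_compact_closed A). Qed.

Lemma coord_image_compact i (K : set M) : compact K -> K `<=` dom i ->
  compact (coord i @` K).
Proof.
move=> Kc Ki; apply: continuous_compact => //.
apply: (continuous_subspaceW Ki); exact: coord_continuous.
Qed.

Lemma compact_bounded_rV (K : set 'rV[R]_n) : compact K -> exists r, forall x, K x -> `|x| <= r.
Proof.
move=> /compact_bounded [r [_ Kr]]; exists (`|r| + 1) => x Kx.
by apply: Kr => //; rewrite (le_lt_trans (ler_norm r)) // ltrDl.
Qed.

Lemma compact_finite_volume_chart i (K : set M) : compact K -> K `<=` dom i ->
  (vol K < +oo)%E.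
Proof.
move=> Kc Ki; have mK := compact_borel Kc.
have [r Kr] := compact_bounded_rV (coord_image_compact Kc Ki).
have [C HC] : exists C, forall p, K p -> `|sqrt_det i p| <= C.
  have c : compact (sqrt_det i @` K).
    apply: continuous_compact => //; apply: continuous_in_subspaceT => p /set_mem Kp.
    exact: (sm_continuous (sm_sqrt_det i) (Ki _ Kp)).
  have /compact_bounded [C [_ hC]] := c; exists (`|C| + 1) => p Kp.
  by apply: hC; [rewrite (le_lt_trans (ler_norm C)) // ltrDl|exists p].
rewrite (volume_chart mK Ki).
have H x : chart_density i x * \1_K (chart_map i x) != 0 -> `|x| <= r /\ `|chart_density i x * \1_K (chart_map i x)| <= `|C|.
  have [ix|ix] := pselect (codom i x); last by rewrite chart_density_out // mul0r eqxx.
  rewrite chart_density_in // chart_map_in // indicE; case: (boolP (_ \in K)) => [/set_mem Kx _|_]; last by rewrite mulr0 eqxx.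
  rewrite mulr1; split; last by rewrite (le_trans (HC _ Kx)) // ler_norm.
  by apply: Kr; exists (param i x) => //; exact: paramK.
have I : m.-integrable setT (EFin \o (fun x => chart_density i x * \1_K (chart_map i x))).
  apply: (@bounded_support_integrable R _ _ m (fun x => chart_density i x * \1_K (chart_map i x)) [set x : 'rV[R]_n | `|x| <= r] `|C|).
  - exact: closed_cube_borel.
  - exact: (lebesgue_Rn_cube hm).
  - apply: measurable_funM; first exact: measurable_chart_density.
    apply: (@measurableT_comp _ _ _ _ _ _ (\1_K : borel M -> R) _ (chart_map i)) => //.
    exact: measurable_chart_map.
  - move=> x; have [->|/H[]//] := eqVneq (chart_density i x * \1_K (chart_map i x)) 0.
    by rewrite normr0.
  - by move=> x /= xr; apply/eqP; apply/negPn/negP => /H [].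
exact: (integrable_lty measurableT I).
Qed.

Lemma compact_finite_volume (K : set M) : compact K -> (vol K < +oo)%E.
Proof.
move=> Kc.
have H p : exists WK : set M * set M, [/\ open WK.1, WK.1 p, WK.1 `<=` WK.2, compact WK.2 & WK.2 `<=` dom (chart_at p)].
  have [psi [_ _ [W' [W'o W'p psi1]] [K' [K'c _ K'i psi0]]]] := bump_exists A (domO (chart_at p)) (in_chart_at A p).
  exists (W', K'); split => //= q W'q; apply: contrapT => /psi0 /eqP.
  by rewrite psi1 // oner_eq0.
pose U p := sval (cid (H p)).
have HU p : [/\ open (U p).1, (U p).1 p, (U p).1 `<=` (U p).2, compact (U p).2 & (U p).2 `<=` dom (chart_at p)] := svalP (cid (H p)).
have [s [_ Ks]] := finite_cover (U := fun p => (U p).1) Kc (fun p _ => conj (let: And5 a _ _ _ _ := HU p in a) (let: And5 _ a _ _ _ := HU p in a)).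
have mU q : measurable ((U q).2 : set (borel M)) by case: (HU q) => _ _ _ c _; exact: compact_borel.
have {Ks} KU : K `<=` \big[setU/set0]_(q <- s) (U q).2.
  by move=> p /Ks [q qs Uq]; rewrite -bigcup_seq; exists q => //; case: (HU q) => _ _ h _ _; exact: h.
have mS : measurable (\big[setU/set0]_(q <- s) ((U q).2 : set (borel M))) by apply: bigsetU_measurable.
have mK := compact_borel Kc.
apply: (@le_lt_trans _ _ (vol (\big[setU/set0]_(q <- s) ((U q).2 : set (borel M))))).
  by apply: le_measure => //; rewrite inE.
elim: s {KU mS} => [|q s IHs]; first by rewrite big_nil measure0.
rewrite big_cons; apply: (@le_lt_trans _ _ (vol (U q).2 + vol (\big[setU/set0]_(q <- s) ((U q).2 : set (borel M))))).
  by apply: measureU2 => //; apply: bigsetU_measurable.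
apply: lte_add_pinfty => //; case: (HU q) => _ _ _ c i; exact: (compact_finite_volume_chart c i).
Qed.

(** In a chart around [p] some ball is mapped into [W], and there the density exceeds half of its
    value at the centre. *)
Lemma open_positive_volume (W : set M) p : open W -> W p -> (0 < vol W)%E.
Proof.
move=> Wo Wp; set i := chart_at p; have ip : dom i p := in_chart_at A p.
pose B := dom i `&` W.
have Bo : open B by apply: openI => //; exact: domO.
have mB : measurable (B : set (borel M)) := borel_open Bo.
apply: (@lt_le_trans _ _ (vol B)); last first.
  by apply: le_measure; rewrite ?inE //; [exact: borel_open|move=> q []].
rewrite (volume_chart mB (fun q h => h.1)).
have cB : nbhs (coord i p) (coord i @` B) by apply: open_nbhs_nbhs; split; [exact: coord_image_open|exists p].
have ix := codom_coord ip.
have h0 : 0 < chart_density i (coord i p).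
  by rewrite chart_density_in // coordK //; exact: sqrt_det_gt0.
have dB : nbhs (coord i p) [set x | chart_density i (coord i p) / 2 < chart_density i x].
  apply: (@chart_density_continuous i _ ix [set t | chart_density i (coord i p) / 2 < t]).
  by apply: (@open_nbhs_nbhs _ _ [set t | _ < t]); split; [exact: open_gt|rewrite /= ltr_pdivrMr // ltr_pMr // ltr1n].
have /nbhs_rVP [d d0 dH] := @filterI _ _ (nbhs_filter (coord i p)) _ _ cB dB.
pose E := [set y : 'rV[R]_n | `|y - coord i p| < d].
have mE : measurable (E : set (borel 'rV[R]_n)) by apply: borel_open; exact: rV_ball_open.
apply: (@lt_le_trans _ _ (\int[m]_x ((chart_density i (coord i p) / 2)%:E * (\1_E x)%:E))%E).
  rewrite ge0_integralZl // ?lee_fin ?divr_ge0 ?ltW //; last exact/measurable_EFinP.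
  rewrite mule_gt0 ?lte_fin ?divr_gt0 // integral_indic // setIT.
  exact: (lebesgue_Rn_ball hm).
apply: ge0_le_integral => //.
- by move=> x _; rewrite mule_ge0 // lee_fin ?divr_ge0 // ltW.
- by apply: emeasurable_funM => //; exact/measurable_EFinP.
- apply/measurable_EFinP; apply: measurable_funM; first exact: measurable_chart_density.
  apply: (@measurableT_comp _ _ _ _ _ _ (\1_B : borel M -> R) _ (chart_map i)) => //.
  exact: measurable_chart_map.
move=> x _; rewrite -EFinM lee_fin !indicE; case: (boolP (x \in E)) => [/set_mem /dH [[q Bq qx] /= dx]|_]; last by rewrite mulr0 mulr_ge0 ?chart_density_ge0.
have iq : dom i q := Bq.1.
rewrite mulr1 -qx chart_map_in ?coordK //; last exact: codom_coord.
by rewrite mem_set // mulr1 qx ltW.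
Qed.

End volume.

(** * The divergence theorem along X *)

Section divergence_theorem.
Context {R : realType} {n : nat} {M : ptopologicalType}.
Variable A : smooth_manifold R n M.
Local Notation chart := (chart A).
Local Notation dom := (@dom _ _ _ A).
Local Notation coord := (@coord _ _ _ A).
Local Notation param := (@param _ _ _ A).
Local Notation chart_at := (@chart_at _ _ _ A).
Local Notation components := (components A).
Implicit Types (i j : chart) (p q : M) (u F : M -> R) (W K : set M).

Lemma Cinf_extend (U K : set 'rV[R]_n) f : open U -> closed K -> K `<=` U -> Cinf U f ->
  (forall x, ~ K x -> f x = 0) -> Cinf setT f.
Proof.
move=> Uo Kc KU fU f0; split => s x _.
have [Ux|Ux] := pselect (U x); first exact: (smooth_of_Cinf fU s Ux).
have Kx : (~` K) x by move=> /KU.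
suff : Cinf (~` K) f by move=> /smooth_of_Cinf /(_ s _ Kx).
apply: (@Cinf_eq _ _ _ (cst 0)); first exact: closed_openC.
  by move=> y Ky; rewrite f0.
exact: Cinf_cst.
Qed.

Variable g : chart -> M -> 'M[R]_n.
Hypothesis hg : riemannian_metric g.
Variable vol : {measure set (borel M) -> \bar R}.
Hypothesis hvol : riemannian_volume g vol.

Lemma compact_volume_lty K : compact K -> (vol K < +oo)%E.
Proof.
by have [m hm] := @lebesgue_Rn_exists R n; exact: (compact_finite_volume hg hvol hm).
Qed.

Lemma compact_support_integrable F K : continuous F -> compact K ->
  (forall p, ~ K p -> F p = 0) -> vol.-integrable setT (EFin \o F).
Proof.
move=> Fc Kc F0.
have [C HC] : exists C, forall p, `|F p| <= C.
  have /compact_bounded [C [_ hC]] : compact (F @` K).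
    by apply: continuous_compact => //; exact: continuous_subspaceT.
  exists (`|C| + 1) => p; have [Kp|Kp] := pselect (K p); last by rewrite F0 // normr0 addr_ge0.
  by apply: hC; [rewrite (le_lt_trans (ler_norm C)) // ltrDl|exists p].
apply: (@bounded_support_integrable R _ _ vol F K C) => //.
- exact: (compact_borel A).
- exact: compact_volume_lty.
- exact: continuous_borel.
Qed.

Variable eta : components 1.
Hypothesis heta : Omega eta.
Hypothesis heta_parallel : parallel g eta.

Local Notation X := (dual_field g eta).

Definition lieX F p : R := derX g eta (chart_at p) F p.

Lemma lieXE W F i p : open W -> sm A W F -> W p -> dom i p -> lieX F p = derX g eta i F p.
Proof.
move=> Wo Fs Wp ip; apply: (derX_chart hg heta Wo Fs Wp) => //; exact: in_chart_at.
Qed.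

Lemma lieX_support F K : closed K -> (forall p, ~ K p -> F p = 0) ->
  forall p, ~ K p -> lieX F p = 0.
Proof.
move=> Kc F0 p Kp; rewrite /lieX -(derX_cst g eta (chart_at p) 0 p).
apply: (derX_eq g eta (closed_openC Kc) _ (in_chart_at A p) Kp) => q Kq.
by rewrite F0.
Qed.

Lemma sm_lieX F : sm A setT F -> sm A setT (lieX F).
Proof.
move=> Fs; apply: sm_local => p _; exists (dom (chart_at p)); first exact: in_chart_at.
have Fi : sm A (dom (chart_at p)) F by apply: (sm_sub _ Fs).
apply: (sm_eq (domO _) _ (sm_derX hg heta Fi)) => q iq.
by rewrite (lieXE openT Fs _ iq).
Qed.

(** The terms in which [X] or the density is differentiated add up to zero because [X] is divergence
    free. Thus [X(F)] times the density is a Euclidean divergence. *)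
Lemma divergence_density i F p : sm A (dom i) F -> dom i p ->
  \sum_c pderiv i c (fun q => F q * (X i q 0 c * sqrt_det g i q)) p =
  sqrt_det g i p * derX g eta i F p.
Proof.
move=> Fs ip; have Xs c := sm_dual_field hg heta i c; have ss := sm_sqrt_det hg i.
have s0 := sqrt_det_gt0 hg ip.
under eq_bigr do rewrite (pderivM _ Fs (sm_mul (domO i) (Xs _) ss) ip ip) (pderivM _ (Xs _) ss ip ip).
rewrite big_split /= -mulr_sumr.
have -> : \sum_c (pderiv i c (fun q => X i q 0 c) p * sqrt_det g i p + X i p 0 c * pderiv i c (sqrt_det g i) p) = 0.
  rewrite big_split /= -mulr_suml.
  have -> : \sum_c pderiv i c (fun q => X i q 0 c) p = \tr (dual_jac g eta i p).
    by apply: eq_bigr => c _; rewrite mxE.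
  have := divergence_free hg heta heta_parallel ip.
  rewrite (@derX_eq _ _ _ _ _ _ (dom i) i _ (fun q => sqrt_det g i q * sqrt_det g i q) p (domO i) _ ip ip); last first.
    by move=> q iq; rewrite -expr2 sqr_sqrtr // ltW // (det_metric_gt0 hg iq).
  rewrite (derXM g eta ss ss ip ip).
  have <- : sqrt_det g i p ^+ 2 = \det (g i p).
    by rewrite sqr_sqrtr // ltW // (det_metric_gt0 hg ip).
  rewrite -/(derX g eta i (sqrt_det g i) p) => E; apply/eqP.
  have : (2 * sqrt_det g i p) * (\tr (dual_jac g eta i p) * sqrt_det g i p + derX g eta i (sqrt_det g i) p) = 0.
    by rewrite -[RHS]E; ring.
  by move/eqP; rewrite mulf_eq0 [_ * _ == 0]gt_eqF // mulr_gt0.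
rewrite mulr0 addr0 /derX mulr_sumr; by apply: eq_bigr => c _; ring.
Qed.

(** The components of [F X] times the density, extended by 0, are smooth with compact support on the
    whole space, so each partial derivative integrates to 0. *)
Lemma integral_lieX_chart i F K : sm A setT F -> compact K -> K `<=` dom i ->
  (forall p, ~ K p -> F p = 0) -> (\int[vol]_p (lieX F p)%:E = 0)%E.
Proof.
move=> Fs Kc Ki F0; have [m hm] := @lebesgue_Rn_exists R n.
have Kcl := manifold_compact_closed A Kc.
have Fi : sm A (dom i) F by apply: (sm_sub _ Fs).
have cL : continuous (lieX F) by move=> p; apply: (sm_continuous (sm_lieX Fs)).
rewrite (integral_chart hg hvol hm (i := i) (continuous_borel cL)); last first.
  by move=> p ip; rewrite (lieX_support Kcl F0) // => /Ki.
pose V c q := F q * (X i q 0 c * sqrt_det g i q).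
have Vs c : sm A (dom i) (V c).
  exact: (sm_mul (domO i) Fi (sm_mul (domO i) (sm_dual_field hg heta i c) (sm_sqrt_det hg i))).
pose v c (x : 'rV[R]_n) := if x \in codom i then V c (param i x) else 0.
have cK := coord_image_compact Kc Ki.
have v0 c x : ~ (coord i @` K) x -> v c x = 0.
  rewrite /v; case: ifPn => // /set_mem ix Kx; rewrite /V F0 ?mul0r // => Kp.
  by apply: Kx; exists (param i x) => //; exact: paramK.
have vin c x : codom i x -> v c x = V c (param i x) by move=> ix; rewrite /v mem_set.
have vs c : Cinf setT (v c).
  apply: (@Cinf_extend (codom i) (coord i @` K)) => //.
  - exact: codomO.
  - exact: compact_closed.
  - by move=> _ [p Kp <-]; exact: codom_coord (Ki _ Kp).
  - apply: (Cinf_eq _ _ (Cinf_sub _ (sm_Cinf (Vs c) i))); first exact: codomO.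
      by move=> x ix; rewrite vin.
    by move=> x ix; exists (param i x); [split; exact: dom_param|exact: paramK].
  - exact: v0.
have [r Kr] := compact_bounded_rV cK.
have vr c x : r < `|x| -> v c x = 0.
  by move=> rx; apply: v0 => /Kr; rewrite leNgt rx.
have E x : chart_density g i x * lieX F (chart_map i x) = \sum_c partial c (v c) x.
  have [ix|ix] := pselect (codom i x).
    have ip := dom_param ix.
    rewrite chart_density_in // chart_map_in // (lieXE openT Fs _ ip) // -divergence_density //.
    apply: eq_bigr => c _; rewrite /pderiv paramK //.
    by apply: (@partial_eq _ _ (codom i)) => //; [exact: codomO|move=> y iy; rewrite /= vin].
  rewrite chart_density_out // mul0r; apply/esym; apply: big1 => c _.
  have xK : (~` (coord i @` K)) x by move=> [p Kp px]; apply: ix; rewrite -px; exact: codom_coord (Ki _ Kp).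
  rewrite (@partial_eq _ _ (~` (coord i @` K)) _ (cst 0)) //; first by rewrite /partial derive_cst.
  - by apply: closed_openC; exact: compact_closed.
  - by move=> y; exact: v0.
have pc c : continuous (partial c (v c)).
  by move=> x; apply: (Cinf_continuous (Cinf_partial c (vs c))).
under eq_integral do rewrite E -sumEFin.
rewrite integral_sum //; last first.
  move=> c; have [C hC] := cube_support_bounded (pc c) (partial_support c (vr c)).
  apply: (@bounded_support_integrable R _ _ m (partial c (v c)) [set x : 'rV[R]_n | `|x| <= r] C) => //.
  - exact: closed_cube_borel.
  - exact: (lebesgue_Rn_cube hm).
  - exact: continuous_borel.
  - by move=> x /negP; rewrite -ltNge; exact: (partial_support c (vr c)).
apply: big1 => c _; apply: (lebesgue_Rn_partial hm) (pc c) (vr c) => x.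
exact: (@Cinf_derivable _ _ setT (v c) x c (vs c) I).
Qed.

(** Induction on the number of charts covering [K], in place of a partition of unity: a bump [psi]
    splits off a part supported in one chart. *)
Lemma integral_lieX F K : sm A setT F -> compact K ->
  (forall p, ~ K p -> F p = 0) -> (\int[vol]_p (lieX F p)%:E = 0)%E.
Proof.
have H p : exists T : (M -> R) * (set M * set M), [/\ sm A setT T.1, open T.2.1 /\ T.2.1 p,
    (forall q, T.2.1 q -> T.1 q = 1), compact T.2.2 /\ T.2.2 `<=` dom (chart_at p) &
    forall q, ~ T.2.2 q -> T.1 q = 0].
  have [psi [psis _ [W' [W'o W'p psi1]] [K' [K'c _ K'i psi0]]]] := bump_exists A (domO (chart_at p)) (in_chart_at A p).
  by exists (psi, (W', K')).
pose T p := sval (cid (H p)).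
have HT p : [/\ sm A setT (T p).1, open (T p).2.1 /\ (T p).2.1 p,
    (forall q, (T p).2.1 q -> (T p).1 q = 1), compact (T p).2.2 /\ (T p).2.2 `<=` dom (chart_at p) &
    forall q, ~ (T p).2.2 q -> (T p).1 q = 0] := svalP (cid (H p)).
move=> Fs Kc F0.
have [s [_ Ks]] := finite_cover (U := fun p => (T p).2.1) Kc
  (fun p _ => let: And5 _ a _ _ _ := HT p in a).
elim: s => [|q s IHs] in F K Fs Kc F0 Ks *.
  have -> : lieX F = cst 0; last exact: integral0.
  apply/funext => p; apply: (lieX_support (manifold_compact_closed A Kc) F0).
  by move=> /Ks [].
have [psis [Wo _] psi1 [Cc Ci] psi0] := HT q.
set psi := (T q).1 in psis psi1 psi0.
pose F1 p := psi p * F p; pose F2 p := (1 - psi p) * F p.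
have F1s : sm A setT F1 := sm_mul openT psis Fs.
have F2s : sm A setT F2 := sm_mul openT (sm_subr openT (sm_cst A setT 1) psis) Fs.
have F10 p : ~ (T q).2.2 p -> F1 p = 0 by move=> h; rewrite /F1 psi0 ?mul0r.
(* The remaining part vanishes where [psi = 1], so its support is covered by one set fewer. *)
pose K2 := K `&` ~` (T q).2.1.
have K2c : compact K2.
  by apply: (@subclosed_compact _ _ K) => //; [apply: closedI; [exact: (manifold_compact_closed A)|exact: open_closedC]|move=> x []].
have F20 p : ~ K2 p -> F2 p = 0.
  move=> h; rewrite /F2; have [Kp|Kp] := pselect (K p); last by rewrite F0 ?mulr0.
  by rewrite psi1 ?subrr ?mul0r //; apply: contrapT => h'; apply: h.
have E p : lieX F p = lieX F1 p + lieX F2 p.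
  rewrite /lieX -(derXD g eta F1s F2s) //; last exact: in_chart_at.
  by congr derX; apply/funext => x; rewrite /F1 /F2; ring.
have ii (G : M -> R) (C : set M) : sm A setT G -> compact C -> (forall p, ~ C p -> G p = 0) ->
    vol.-integrable setT (EFin \o lieX G).
  move=> Gs Cc' G0; apply: (compact_support_integrable _ Cc').
    by move=> p; apply: (sm_continuous (sm_lieX Gs)).
  exact: (lieX_support (manifold_compact_closed A Cc') G0).
under eq_integral do rewrite E EFinD.
rewrite integralD //; [|exact: ii F1s Cc F10|exact: ii F2s K2c F20].
rewrite (integral_lieX_chart F1s Cc Ci F10) (IHs F2 K2) ?adde0 // => p [Kp Wp].
have [q' + Wq'] := Ks p Kp; rewrite inE => /orP[/eqP q'q|q's]; last by exists q'.
by rewrite q'q in Wq'.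
Qed.

End divergence_theorem.

(** * Curves *)

Section curves.
Context {R : realType} {n : nat} {M : ptopologicalType}.
Variable A : smooth_manifold R n M.
Local Notation chart := (chart A).
Local Notation dom := (@dom _ _ _ A).
Local Notation coord := (@coord _ _ _ A).
Local Notation param := (@param _ _ _ A).
Local Notation chart_at := (@chart_at _ _ _ A).
Implicit Types (i j : chart) (p q : M) (u : M -> R) (W K : set M).

Lemma is_derive_cvg (f : R -> R) (t l : R) :
  (forall e, 0 < e -> exists2 d, 0 < d & forall h, `|h| < d ->
    `|f (h + t) - f t - h * l| <= e * `|h|) -> is_derive t (1 : R) f l.
Proof.
move=> H.
suff C : (h^-1 *: ((f \o shift t) (h *: (1 : R)) - f t) @[h --> 0^'] --> l)%classic.
  by apply: DeriveDef; [apply/cvg_ex; exists l|exact: cvg_lim].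
apply/cvgrPdist_le => e e0; have [d d0 dH] := H e e0.
near=> h.
have h0 : h != 0 by near: h; exact: nbhs_dnbhs_neq.
have hd : `|h| < d.
  near: h; apply: dnbhs0_lt; exact: d0.
rewrite /= /GRing.scale /= mulr1.
have -> : l - h^-1 * (f (h + t) - f t) = - (h^-1 * (f (h + t) - f t - h * l)).
  by field.
rewrite normrN normrM normfV ler_pdivrMl ?normr_gt0 // [_ * e]mulrC; exact: dH.
Unshelve. all: by end_near.
Qed.

(** A primitive of the positive part. It is only C^1, which is what reparametrizing C^1 curves
    requires. *)
Definition ramp (t : R) : R := Num.max t 0 ^+ 2 / 2.

Lemma is_derive_ramp t : is_derive t (1 : R) ramp (Num.max t 0).
Proof.
apply: is_derive_cvg => e e0; exists e => // h he.
have H : `|ramp (h + t) - ramp t - h * Num.max t 0| <= `|h| ^+ 2.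
  rewrite real_normK ?num_real // ler_norml /ramp /Num.max.
  by case: ltP => h1; case: ltP => h2; apply/andP; split; nra.
by rewrite (le_trans H) // expr2 ler_wpM2r // ltW.
Qed.

Lemma ramp_eq0 t : t <= 0 -> ramp t = 0.
Proof. by move=> t0; rewrite /ramp max_r // expr0n mul0r. Qed.

Lemma ramp_pos t : 0 <= t -> ramp t = t ^+ 2 / 2.
Proof. by move=> t0; rewrite /ramp max_l. Qed.

(* C^1, of slope in [0, 1], the identity up to a and constant from a + b on. *)
Definition slow_down (a b t : R) : R := t - b^-1 * ramp (t - a) + b^-1 * ramp (t - a - b).
Definition slow_down' (a b t : R) : R :=
  1 - b^-1 * Num.max (t - a) 0 + b^-1 * Num.max (t - a - b) 0.

Lemma is_derive_shift (f : R -> R) df a t : is_derive (t - a) (1 : R) f df ->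
  is_derive t (1 : R) (fun t => f (t - a)) df.
Proof.
move=> fd; have d1 : is_derive t (1 : R) (fun t : R => t - a) 1.
  by apply: is_derive_eq; rewrite subr0.
by have := @is_derive1_comp _ f (fun t : R => t - a) t _ _ fd d1; rewrite mulr1.
Qed.

Lemma is_derive_slow_down a b t : is_derive t (1 : R) (slow_down a b) (slow_down' a b t).
Proof.
have d1 := is_derive_shift (is_derive_ramp (t - a)).
have d2 : is_derive t (1 : R) (fun t => ramp (t - a - b)) (Num.max (t - a - b) 0).
  exact: (is_derive_shift (is_derive_shift (is_derive_ramp (t - a - b)))).
have d3 := is_deriveB (is_derive_id t (1 : R)) (is_deriveZ b^-1 d1).
exact: (is_deriveD d3 (is_deriveZ b^-1 d2)).
Qed.

Lemma continuous_slow_down' a b : continuous (slow_down' a b).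
Proof.
have c1 : continuous (fun t : R => Num.max (t - a) 0).
  move=> t; apply: (@continuous_max _ _ (fun t : R => t - a) (fun=> 0)); last exact: cvg_cst.
  by apply: cvgB; [exact: cvg_id|exact: cvg_cst].
have c2 : continuous (fun t : R => Num.max (t - a - b) 0).
  move=> t; apply: (@continuous_max _ _ (fun t : R => t - a - b) (fun=> 0)); last exact: cvg_cst.
  by apply: cvgB; [apply: cvgB; [exact: cvg_id|exact: cvg_cst]|exact: cvg_cst].
move=> t; apply: cvgD; last by apply: cvgM; [exact: cvg_cst|exact: c2].
by apply: cvgB; [exact: cvg_cst|apply: cvgM; [exact: cvg_cst|exact: c1]].
Qed.

Lemma slow_down'_bound a b t : 0 < b -> `|slow_down' a b t| <= 1.
Proof.
move=> b0; rewrite /slow_down' /Num.max.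
case: ltP => h1; case: ltP => h2; rewrite ?mulr0 ?subr0 ?addr0 ?normr1 //.
- lra.
- have -> : 1 - b^-1 * (t - a) = (a + b - t) / b by field; rewrite gt_eqF.
  by rewrite normrM normfV (gtr0_norm b0) ler_pdivrMr // mul1r ler_norml; apply/andP; split; lra.
- have -> : 1 - b^-1 * (t - a) + b^-1 * (t - a - b) = 0 by field; rewrite gt_eqF.
  by rewrite normr0.
Qed.

Lemma slow_down_start a b t : 0 < b -> t <= a -> slow_down a b t = t.
Proof.
by move=> b0 ta; rewrite /slow_down !ramp_eq0; [rewrite !mulr0 subr0 addr0|lra|lra].
Qed.

Lemma slow_down_end a b t : 0 < b -> a + b <= t -> slow_down a b t = a + b / 2.
Proof.
by move=> b0 ta; rewrite /slow_down !ramp_pos; [field; rewrite gt_eqF|lra|lra].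
Qed.

Lemma coord_curve_is_derive (c : R -> M) i t l : C1_curve A c -> dom i (c t) ->
  is_derive t (1 : R) (fun s => coord i (c s) 0 l) (velocity c i t 0 l).
Proof.
move=> [_ cC] ip; have [d _] := cC i t l ip.
by rewrite /velocity mxE derive1E; exact: derivableP.
Qed.

Lemma is_derive_chart_curve W (c : R -> M) i t u (v : 'I_n -> R) : open W -> sm A W u -> W (c t) ->
  dom i (c t) -> {for t, continuous c} ->
  (forall b, is_derive t (1 : R) (fun s => coord i (c s) 0 b) (v b)) ->
  is_derive t (1 : R) (fun s => u (c s)) (\sum_b v b * pderiv i b u (c t)).
Proof.
move=> Wo us Wt it cc vd.
have ui : Cinf (coord i @` (dom i `&` W)) (u \o param i) := sm_Cinf us i.
have Np : nbhs (coord i (c t)) (coord i @` (dom i `&` W)).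
  by apply: open_nbhs_nbhs; split; [exact: coord_image_open|exists (c t)].
have D := @is_derive_rV_comp _ _ _ (u \o param i) (fun s => coord i (c s)) t 1 v.
apply: (@near_eq_is_derive _ _ _ (fun s => (u \o param i) (coord i (c s)))).
  have : nbhs t (c @^-1` dom i) by apply: cc; apply: open_nbhs_nbhs; split; [exact: domO|].
  by apply: filterS => s is_; rewrite /= coordK.
apply: D => //.
- by move=> b; apply: filterS Np => y; exact: Cinf_derivable ui.
- by move=> b; apply: Cinf_continuous (Cinf_partial b ui) _; exists (c t).
Qed.

Lemma is_derive_curve W (c : R -> M) i t u : C1_curve A c -> open W -> sm A W u -> W (c t) ->
  dom i (c t) -> is_derive t (1 : R) (fun s => u (c s)) (\sum_b velocity c i t 0 b * pderiv i b u (c t)).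
Proof.
move=> cC Wo us Wt it; apply: (is_derive_chart_curve Wo us Wt it); first exact: cC.1.
by move=> b; exact: coord_curve_is_derive.
Qed.

Lemma velocity_chart (c : R -> M) i j t : C1_curve A c -> dom i (c t) -> dom j (c t) ->
  velocity c j t = velocity c i t *m jac i j (c t).
Proof.
move=> cC it jt; apply/rowP => l; rewrite [RHS]mxE [LHS]mxE derive1E.
have [_ ->] := is_derive_curve cC (domO j) (sm_coord j l) jt it.
by apply: eq_bigr => b _; rewrite [jac _ _ _ _ _]mxE.
Qed.

Lemma C1_curve_comp (c : R -> M) (mu dmu : R -> R) : C1_curve A c ->
  (forall t, is_derive t (1 : R) mu (dmu t)) -> continuous dmu ->
  C1_curve A (c \o mu) /\
  forall i t, dom i (c (mu t)) -> velocity (c \o mu) i t = dmu t *: velocity c i (mu t).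
Proof.
move=> cC mud dmuc.
have muc : continuous mu.
  by move=> t; apply/differentiable_continuous/derivable1_diffP; have [] := mud t.
have H i t l : dom i (c (mu t)) ->
    is_derive t (1 : R) (fun s => coord i (c (mu s)) 0 l) (dmu t * velocity c i (mu t) 0 l).
  move=> it; rewrite mulrC.
  exact: (@is_derive1_comp _ (fun s => coord i (c s) 0 l) mu t _ _ (coord_curve_is_derive l cC it) (mud t)).
have V i t : dom i (c (mu t)) -> velocity (c \o mu) i t = dmu t *: velocity c i (mu t).
  move=> it; apply/rowP => l; rewrite [LHS]mxE derive1E /=.
  by have [_ ->] := H i t l it; rewrite rV_scaleE.
split => //; split.
  by move=> t; apply: continuous_comp; [exact: muc|exact: cC.1].
move=> i t l it; split; first by have [] := H i t l it.
apply: (@continuous_eq_on _ _ [set s | dom i (c (mu s))] (fun s => dmu s * velocity c i (mu s) 0 l)) => //.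
- apply: (@open_comp _ _ (c \o mu) (dom i)); last exact: domO.
  by move=> s _; apply: continuous_comp; [exact: muc|exact: cC.1].
- by move=> s is_; rewrite V // rV_scaleE.
apply: cvgM; first exact: dmuc.
apply: (@continuous_comp _ _ _ mu (fun s => velocity c i s 0 l)); first exact: muc.
by have [_] := cC.2 i (mu t) l it.
Qed.

Variable g : chart -> M -> 'M[R]_n.
Hypothesis hg : riemannian_metric g.

Definition chart_speed i (c : R -> M) (t : R) : R :=
  Num.sqrt ((velocity c i t *m g i (c t) *m (velocity c i t)^T) 0 0).

Lemma speedE (c : R -> M) i t : C1_curve A c -> dom i (c t) -> speed g c t = chart_speed i c t.
Proof.
move=> cC it; rewrite /speed /chart_speed; set j := chart_at (c t).
have jt : dom j (c t) by exact: in_chart_at.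
rewrite (velocity_chart cC it jt) (metric_trans hg it jt) trmx_mul !mulmxA.
by [].
Qed.

Lemma speed_comp (c : R -> M) (mu dmu : R -> R) t : C1_curve A c ->
  (forall t, is_derive t (1 : R) mu (dmu t)) -> continuous dmu ->
  speed g (c \o mu) t = `|dmu t| * speed g c (mu t).
Proof.
move=> cC mud dmuc; have [_ V] := C1_curve_comp cC mud dmuc.
rewrite /speed /= V; last exact: in_chart_at.
rewrite linearZ /= -!scalemxAl -scalemxAr scalerA rV_scaleE -expr2 sqrtrM ?sqr_ge0 //.
by rewrite sqrtr_sqr.
Qed.

Lemma speed_continuous (c : R -> M) : C1_curve A c -> continuous (speed g c).
Proof.
move=> cC t; set i := chart_at (c t); have it : dom i (c t) by exact: in_chart_at.
have Uo : open [set s | dom i (c s)].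
  by apply: (@open_comp _ _ c (dom i)); [move=> s _; exact: cC.1|exact: domO].
have E s : dom i (c s) -> chart_speed i c s = speed g c s by move=> is_; rewrite (speedE cC is_).
apply: (@continuous_eq_on _ _ [set s | dom i (c s)] (chart_speed i c) _ _ Uo E it).
apply: continuous_comp; last exact: sqrt_continuous.
have -> : (fun s => (velocity c i s *m g i (c s) *m (velocity c i s)^T) 0 0) =
    (fun s => \sum_a \sum_b velocity c i s 0 b * g i (c s) b a * velocity c i s 0 a).
  apply/funext => s; rewrite mxE; apply: eq_bigr => a _; rewrite [_^T _ _]mxE mxE mulr_suml.
  by [].
apply: (@cvg_sumr _ _ (nbhs t)) => a _; apply: (@cvg_sumr _ _ (nbhs t)) => b _.
have vc l : {for t, continuous (fun s => velocity c i s 0 l)} by have [] := cC.2 i t l it.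
apply: cvgM; last exact: vc.
apply: cvgM; first exact: vc.
apply: (@continuous_comp _ _ _ c (fun q => g i q b a)); first exact: cC.1.
exact: (sm_continuous (sm_metric hg i b a)).
Qed.

(** * Gradients *)

Definition gradient_row i u p : 'rV[R]_n := \row_a pderiv i a u p.

Definition gradient_square i u p : R :=
  (gradient_row i u p *m invmx (g i p) *m (gradient_row i u p)^T) 0 0.

Lemma gradient_square_chart W i j u p : open W -> sm A W u -> W p -> dom i p -> dom j p ->
  gradient_square i u p = gradient_square j u p.
Proof.
move=> Wo us Wp ip jp; rewrite /gradient_square (invmx_metric_trans hg ip jp).
have -> : gradient_row i u p = gradient_row j u p *m (jac i j p)^T.
  apply/rowP => a; rewrite [LHS]mxE (pderiv_chain _ Wo us Wp ip jp) [RHS]mxE.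
  by apply: eq_bigr => b _; rewrite [_^T _ _]mxE [gradient_row _ _ _ _ _]mxE mulrC.
by rewrite trmx_mul trmxK !mulmxA.
Qed.

(** Cauchy-Schwarz after writing [g = Q Q^T]: the velocity is multiplied by [Q] and the differential
    by its inverse transpose, which leaves their pairing unchanged. *)
Lemma curve_derivative_le W (c : R -> M) i t u : open W -> sm A W u -> W (c t) -> dom i (c t) ->
  C1_curve A c ->
  `|\sum_b velocity c i t 0 b * pderiv i b u (c t)| <= Num.sqrt (gradient_square i u (c t)) * speed g c t.
Proof.
move=> Wo us Wt it cC; rewrite (speedE cC it) /chart_speed /gradient_square.
have [Q Qu GE] := metric_factor hg it.
set v := velocity c i t; set xi := gradient_row i u (c t).
pose a := v *m Q; pose b := xi *m (invmx Q)^T.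
have -> : v *m g i (c t) *m v^T = a *m a^T by rewrite GE /a trmx_mul !mulmxA.
have -> : xi *m invmx (g i (c t)) *m xi^T = b *m b^T.
  rewrite /b trmx_mul trmxK !mulmxA -[_ *m _ *m invmx Q]mulmxA.
  by congr (_ *m _ *m _); apply: invmx_left; rewrite GE mulmxA -[_ *m Q]mulmxA mulVmx // mulmx1 -trmx_mul mulmxV // trmx1.
have -> : \sum_b v 0 b * pderiv i b u (c t) = \sum_l a 0 l * b 0 l.
  have -> : \sum_l a 0 l * b 0 l = (a *m b^T) 0 0.
    by rewrite [RHS]mxE; apply: eq_bigr => l _; rewrite [_^T _ _]mxE.
  rewrite /a /b trmx_mul trmxK mulmxA -[_ *m Q *m _]mulmxA mulmxV // mulmx1 mxE.
  by apply: eq_bigr => l _; rewrite [_^T _ _]mxE [xi _ _]mxE.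
rewrite !row_square -sqrtrM ?sumr_ge0 // => [|l _]; last exact: sqr_ge0.
rewrite -sqrtr_sqr ler_sqrt ?mulr_ge0 ?sumr_ge0 // => [|l _|l _]; rewrite ?sqr_ge0 // mulrC.
exact: sum_Cauchy_Schwarz.
Qed.

(** * Paths of speed at most one *)

(** Stands for the distance from [p] to [q] being at most [T], without an infimum. Resting near both
    ends makes concatenations C^1, and the bound on the speed turns parameters into lengths. *)
Definition reach p q (T : R) : Prop := exists c e, [/\ C1_curve A c, 0 < e,
  forall t, speed g c t <= 1, forall t, t < e -> c t = p & forall t, T - e < t -> c t = q].

Lemma is_derive_affine (a b t : R) : is_derive t (1 : R) (fun s => a * s + b) a.
Proof.
have d := is_deriveD (is_deriveZ a (is_derive_id t (1 : R))) (is_derive_cst b t (1 : R)).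
by apply: (is_derive_eq d); rewrite /GRing.scale /= mulr1 addr0.
Qed.

Lemma curve_affine (c : R -> M) (a b : R) : C1_curve A c ->
  C1_curve A (fun t => c (a * t + b)) /\
  forall t, speed g (fun t => c (a * t + b)) t = `|a| * speed g c (a * t + b).
Proof.
move=> cC; have ac : continuous (fun _ : R => a) by move=> t; exact: cvg_cst.
split; first by have [] := C1_curve_comp cC (is_derive_affine a b) ac.
by move=> t; exact: (speed_comp t cC (is_derive_affine a b) ac).
Qed.

Lemma reach_sym p q T : reach p q T -> reach q p T.
Proof.
move=> [c [e [cC e0 s1 c0 cT]]]; have [C S] := curve_affine (-1) T cC.
exists (fun t => c (-1 * t + T)), e; split; [exact: C|exact: e0|..].
- by move=> t; rewrite S normrN normr1 mul1r; exact: s1.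
- by move=> t te; apply: cT; lra.
- by move=> t te; apply: c0; lra.
Qed.

Lemma C1_curve_eq (U : set R) (b c : R -> M) t : open U -> (forall s, U s -> b s = c s) -> U t ->
  C1_curve A b -> [/\ {for t, continuous c},
   forall i l, dom i (c t) -> derivable (fun s => coord i (c s) 0 l) t 1 /\
     {for t, continuous (fun s => velocity c i s 0 l)} & speed g c t = speed g b t].
Proof.
move=> Uo bc Ut [bcont bC].
have V i s : U s -> velocity c i s = velocity b i s.
  move=> Us; apply/rowP => l; rewrite !mxE !derive1E; apply: near_eq_derive.
  by apply: filterS (open_nbhs_nbhs (conj Uo Us)) => x Ux; rewrite bc.
split.
- by apply: (continuous_eq_on Uo bc Ut); exact: bcont.
- move=> i l; rewrite -bc // => it; have [d v] := bC i t l it; split.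
    apply: near_eq_derivable d.
    by apply: filterS (open_nbhs_nbhs (conj Uo Ut)) => x Ux; rewrite bc.
  by apply: (continuous_eq_on Uo _ Ut v) => s Us; rewrite V.
- by rewrite /speed -(bc _ Ut) (V _ _ Ut).
Qed.

Lemma reach_trans p q r T T' : 0 <= T -> 0 <= T' -> reach p q T -> reach q r T' -> reach p r (T + T').
Proof.
move=> T0 T'0 [c [e [cC e0 s1 c0 cT]]] [b [d [bC d0 r1 b0 bT]]].
have [bC' S'] := curve_affine 1 (- T) bC.
have [k [k0 ke kd]] : exists k, [/\ 0 < k, k <= e & k <= d].
  by exists (Num.min e d); split; [rewrite lt_min e0 d0|rewrite ge_min lexx|rewrite ge_min lexx orbT].
(* Both branches are at rest at [q] on the overlap from [T - k] to [T + k], so near every time [a]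
   agrees with one of the two C^1 curves. *)
pose a t := if t < T then c t else b (1 * t + - T).
have E1 t : t < T + k -> c t = a t.
  by rewrite /a => h; case: ltP => // tT; rewrite cT ?b0 //; lra.
have E2 t : T - k < t -> b (1 * t + - T) = a t.
  by rewrite /a => h; case: ltP => // tT; rewrite cT ?b0 //; lra.
have H t : [/\ {for t, continuous a},
   forall i l, dom i (a t) -> derivable (fun s => coord i (a s) 0 l) t 1 /\
     {for t, continuous (fun s => velocity a i s 0 l)} & speed g a t <= 1].
  have [h|h] := ltP t (T + k).
    have [h1 h2 ->] := @C1_curve_eq [set t | t < T + k] c a t (@open_lt _ _) E1 h cC.
    by split.
  have h' : T - k < t by lra.
  have [h1 h2 ->] := @C1_curve_eq [set t | T - k < t] _ a t (@open_gt _ _) E2 h' bC'.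
  by split => //; rewrite S' normr1 mul1r.
exists a, k; split; [|exact: k0|..].
- by split => [t|i t l]; [have [] := H t|have [_ h _] := H t; exact: h].
- by move=> t; have [] := H t.
- move=> t tk; rewrite -E1; last lra.
  by apply: c0; lra.
- move=> t tk; rewrite -E2; last lra.
  by apply: bT; lra.
Qed.

(** Coming to rest at the midpoint without exceeding speed one costs extra time, whence two thirds
    of [T] rather than one half. *)
Lemma reach_first_half (c : R -> M) p (e T : R) : C1_curve A c -> 0 < e -> (forall t, speed g c t <= 1) ->
  (forall t, t < e -> c t = p) -> 0 < T -> reach p (c (T / 2)) (2 * T / 3).
Proof.
(* These values give [a + b / 2 = T / 2], so the slowed curve stops at [c (T / 2)], and
   [a + b = 7 T / 12], which is [T / 12] before the end [2 T / 3]. *)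
move=> cC e0 s1 c0 T0; pose b := T / 6; pose a := T / 2 - b / 2.
have b0 : 0 < b by rewrite /b; lra.
have a0 : 0 < a by rewrite /a /b; lra.
have [C _] := C1_curve_comp cC (is_derive_slow_down a b) (@continuous_slow_down' a b).
pose k := Num.min e (T / 12).
exists (c \o slow_down a b), (Num.min (Num.min e a) (T / 12)); split; [exact: C|..].
- by rewrite !lt_min e0 a0 /=; lra.
- move=> t; rewrite (speed_comp t cC (is_derive_slow_down a b) (@continuous_slow_down' a b)).
  have := slow_down'_bound a t b0; have := s1 (slow_down a b t).
  have : 0 <= speed g c (slow_down a b t) by exact: sqrtr_ge0.
  by move=> *; rewrite -[leRHS]mulr1; apply: ler_pM.
- move=> t; rewrite !lt_min => /andP[/andP[te ta] _] /=.
  by rewrite slow_down_start ?ltW // c0.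
- move=> t h /=; rewrite slow_down_end //; first by congr c; rewrite /a; lra.
  move: h; rewrite /a /b; have : Num.min (Num.min e a) (T / 12) <= T / 12 by rewrite ge_min lexx orbT.
  lra.
Qed.

(** A substitute for midpoints; the factor only has to leave some room below [3 / 4] in
    [bounded_ball_step]. The second half is the first half of the reversed curve. *)
Lemma reach_half p q T : 0 < T -> reach p q T -> exists w, reach p w (2 * T / 3) /\ reach w q (2 * T / 3).
Proof.
move=> T0 [c [e [cC e0 s1 c0 cT]]]; exists (c (T / 2)); split.
  exact: (reach_first_half cC e0 s1 c0 T0).
apply: reach_sym; have [C S] := curve_affine (-1) T cC.
have -> : c (T / 2) = (fun t => c (-1 * t + T)) (T / 2) by congr c; lra.
apply: (reach_first_half C e0) T0.
  by move=> t; rewrite S normrN normr1 mul1r; exact: s1.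
by move=> t te; apply: cT; lra.
Qed.

Lemma C1_curve_cst p : C1_curve A (fun=> p) /\ forall t, speed g (fun=> p) t = 0.
Proof.
have V i t : velocity (fun=> p) i t = 0.
  by apply/rowP => l; rewrite !mxE derive1E derive_cst.
split; last by move=> t; rewrite /speed V !mul0mx mxE sqrtr0.
split; first by move=> t; exact: cvg_cst.
move=> i t l _; split; first exact: derivable_cst.
have -> : (fun s => velocity (fun=> p) i s 0 l) = (fun=> 0).
  by apply/funext => s; rewrite V mxE.
exact: cvg_cst.
Qed.

Lemma reach_refl p T : reach p p T.
Proof.
have [C S] := C1_curve_cst p.
by exists (fun=> p), 1; split => // t; rewrite S.
Qed.

Lemma continuous_EFin_measurable (f : R -> R) : continuous f ->
  measurable_fun (`[0, 1]%classic : set (measurableTypeR R)) (fun t => (f t)%:E).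
Proof.
move=> fc; apply/measurable_EFinP; apply: measurable_funTS.
exact: continuous_measurable_fun.
Qed.

(** Together with [dist_Lipschitz] this is the bridge between [reach] and [riemannian_dist], in
    terms of which completeness is stated. The path is rescaled to the unit interval, where its
    speed is at most [T]. *)
Lemma reach_dist p q T : 0 < T -> reach p q T -> (riemannian_dist g p q <= T%:E)%E.
Proof.
move=> T0 [c [e [cC e0 s1 c0 cT]]]; have [C S] := curve_affine T 0 cC.
apply: (@le_trans _ _ (length g (fun t => c (T * t + 0)))).
  apply: ereal_inf_lbound; exists (fun t => c (T * t + 0)) => //.
  by split => //; [apply: c0; lra|apply: cT; lra].
rewrite /length; apply: (@le_trans _ _ (\int[lebesgue_measure]_(t in `[0%R, 1%R]) (cst T%:E) t)%E).
  apply: ge0_le_integral => //.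
  - by move=> t _; rewrite lee_fin sqrtr_ge0.
  - exact: continuous_EFin_measurable (speed_continuous C).
  by move=> t _; rewrite lee_fin S gtr0_norm // ler_piMr // ltW.
have l1 : lebesgue_measure `[0%R, 1%R]%classic = 1%E :> \bar R.
  by rewrite lebesgue_measure_itv /= lte_fin ltr01 -EFinB subr0.
rewrite integral_cst //; have -> : (T%:E = T%:E * 1)%E by rewrite mule1.
by rewrite {1}mule1 -l1.
Qed.

Lemma reach_Lipschitz psi C p q T : sm A setT psi -> 0 <= C ->
  (forall i z, dom i z -> gradient_square i psi z <= C ^+ 2) -> 0 <= T ->
  reach p q T -> `|psi q - psi p| <= C * T.
Proof.
move=> ps C0 pC T0 [c [e [cC e0 s1 c0 cT]]].
pose D t := \sum_b velocity c (chart_at (c t)) t 0 b * pderiv (chart_at (c t)) b psi (c t).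
have dD t : is_derive t (1 : R) (fun s => psi (c s)) (D t).
  by apply: (is_derive_curve cC openT ps) => //; exact: in_chart_at.
have Dle t : `|D t| <= C.
  have it := in_chart_at A (c t).
  apply: (le_trans (curve_derivative_le openT ps I it cC)).
  rewrite -[leRHS]mulr1; apply: ler_pM; rewrite ?sqrtr_ge0 //.
  by rewrite -[leRHS](ger0_norm C0) -sqrtr_sqr ler_sqrt ?sqr_ge0 //; exact: pC.
have <- : c 0 = p by exact: c0.
have <- : c T = q by apply: cT; lra.
have cF : continuous (fun s => psi (c s)).
  by move=> t; apply/differentiable_continuous/derivable1_diffP; have [] := dD t.
have [s _ ->] := @MVT_segment _ (fun s => psi (c s)) D 0 T T0 (fun t _ => dD t) (continuous_subspaceT cF).
by rewrite subr0 normrM (ger0_norm T0) ler_wpM2r.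
Qed.

(** A curve that nearly realizes the distance is bounded in length but not in speed, so the
    increment of [psi] is integrated along it instead of being estimated by the mean value
    theorem. *)
Lemma dist_Lipschitz psi C p q (e : R) : sm A setT psi -> 0 <= C ->
  (forall i z, dom i z -> gradient_square i psi z <= C ^+ 2) ->
  (riemannian_dist g p q < e%:E)%E -> `|psi q - psi p| <= C * e.
Proof.
move=> ps C0 pC /ereal_inf_lt [_ [c [cC c0 c1] <-]] ce.
pose D t := \sum_b velocity c (chart_at (c t)) t 0 b * pderiv (chart_at (c t)) b psi (c t).
have dD t : is_derive t (1 : R) (fun s => psi (c s)) (D t).
  by apply: (is_derive_curve cC openT ps) => //; exact: in_chart_at.
have Dle t : `|D t| <= C * speed g c t.
  have it := in_chart_at A (c t).
  apply: (le_trans (curve_derivative_le openT ps I it cC)).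
  apply: ler_wpM2r; first exact: sqrtr_ge0.
  by rewrite -[leRHS](ger0_norm C0) -sqrtr_sqr ler_sqrt ?sqr_ge0 //; exact: pC.
have cD : continuous D.
  move=> t; set i := chart_at (c t); have it : dom i (c t) by exact: in_chart_at.
  have Uo : open [set s | dom i (c s)].
    by apply: (@open_comp _ _ c (dom i)); [move=> s _; exact: cC.1|exact: domO].
  apply: (@continuous_eq_on _ _ _ (fun s => \sum_b velocity c i s 0 b * pderiv i b psi (c s)) _ _ Uo _ it).
    move=> s is_; have [_ <-] := is_derive_curve cC openT ps I is_.
    by have [_ <-] := dD s.
  apply: (@cvg_sumr _ _ (nbhs t)) => b _; apply: cvgM; first by have [] := cC.2 i t b it.
  apply: (@continuous_comp _ _ _ c (pderiv i b psi)); first exact: cC.1.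
  by apply: (sm_continuous (sm_pderiv i b openT ps)).
have cF : continuous (fun s => psi (c s)).
  by move=> t; apply/differentiable_continuous/derivable1_diffP; have [] := dD t.
have E : (\int[lebesgue_measure]_(t in `[0%R, 1%R]) (D t)%:E = (psi q - psi p)%:E)%E.
  rewrite (@continuous_FTC2 _ D (fun s => psi (c s))) //.
  - by rewrite c0 c1.
  - exact: continuous_subspaceT.
  - split => [t _||]; first by have [] := dD t.
    + by apply: cvg_at_right_filter; exact: cF.
    + by apply: cvg_at_left_filter; exact: cF.
  - by move=> t _; rewrite derive1E; have [_ ->] := dD t.
have mD := continuous_EFin_measurable cD.
have mS := continuous_EFin_measurable (speed_continuous cC).
rewrite -lee_fin EFinM -abse_EFin -E.
apply: (le_trans (le_abse_integral _ _ _)) => //.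
apply: (@le_trans _ _ (C%:E * length g c)%E); last by rewrite lee_wpmul2l ?lee_fin // ltW.
rewrite /length -ge0_integralZl //; last by move=> t _; rewrite lee_fin sqrtr_ge0.
apply: ge0_le_integral => //.
- by apply: measurableT_comp.
- by apply: emeasurable_funM.
- by move=> t _; rewrite abse_EFin -EFinM lee_fin.
Qed.

End curves.

(** * Completeness and compact balls *)

Section local_frames.
Context {R : realType} {n : nat} {M : ptopologicalType}.
Variable A : smooth_manifold R n M.
Local Notation chart := (chart A).
Local Notation dom := (@dom _ _ _ A).
Local Notation coord := (@coord _ _ _ A).
Local Notation param := (@param _ _ _ A).
Local Notation chart_at := (@chart_at _ _ _ A).
Implicit Types (i j : chart) (p q : M) (u : M -> R) (W K : set M).

Lemma quadratic_form_le (E : 'M[R]_n) (y : 'rV[R]_n) (C : R) : (forall a b, `|E a b| <= C) ->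
  (y *m E *m y^T) 0 0 <= C * n%:R ^+ 2 * `|y| ^+ 2.
Proof.
move=> EC; rewrite mxE; under eq_bigr do rewrite mxE mulr_suml.
apply: (@le_trans _ _ (\sum_(a < n) \sum_(b < n) C * `|y| ^+ 2)).
  apply: ler_sum => a _; apply: ler_sum => b _; rewrite [_^T _ _]mxE.
  rewrite (le_trans (ler_norm _)) // 2!normrM mulrAC mulrC expr2.
  apply: ler_pM; rewrite ?mulr_ge0 //.
  by apply: ler_pM => //; exact: rV_coord_le.
have -> : \sum_(a < n) \sum_(b < n) C * `|y| ^+ 2 = C * `|y| ^+ 2 * n%:R * n%:R.
  by rewrite !sumr_const card_ord !mulr_natr.
have -> // : C * `|y| ^+ 2 * n%:R * n%:R = C * n%:R ^+ 2 * `|y| ^+ 2 by ring.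
Qed.

Lemma mulmx_norm_le (Q : 'M[R]_n) : exists2 C, 0 < C & forall y : 'rV[R]_n, `|y *m Q| <= C * `|y|.
Proof.
exists (\sum_a \sum_b `|Q a b| + 1).
  by rewrite ltr_wpDl // sumr_ge0 // => a _; rewrite sumr_ge0.
move=> y; apply: rV_norm_le => [|b].
  by rewrite mulr_ge0 // addr_ge0 // sumr_ge0 // => a _; rewrite sumr_ge0.
rewrite mxE (le_trans (ler_norm_sum _ _ _)) // mulrDl mul1r.
apply: (@le_trans _ _ ((\sum_a \sum_b `|Q a b|) * `|y|)); last by rewrite lerDl.
rewrite mulr_suml; apply: ler_sum => a _; rewrite normrM mulrC.
apply: ler_pM => //; last exact: rV_coord_le.
by rewrite (bigD1 b) //= lerDl sumr_ge0.
Qed.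

Lemma C1_curve_of_chart (c : R -> M) i (v : R -> 'rV[R]_n) : continuous c ->
  (forall t, dom i (c t)) ->
  (forall t b, is_derive t (1 : R) (fun s => coord i (c s) 0 b) (v t 0 b)) ->
  (forall b, continuous (fun s => v s 0 b)) ->
  C1_curve A c /\ forall t, velocity c i t = v t.
Proof.
move=> cc ci vd vc.
have H j t l : dom j (c t) ->
    is_derive t (1 : R) (fun s => coord j (c s) 0 l) (\sum_b v t 0 b * jac i j (c t) b l).
  move=> jt; have := is_derive_chart_curve (domO j) (sm_coord j l) jt (ci t) (cc t) (vd t).
  by move=> D; apply: (is_derive_eq D); apply: eq_bigr => b _; rewrite mxE.
split; last first.
  by move=> t; apply/rowP => b; rewrite mxE derive1E; have [_ ->] := vd t b.
split => // j t l jt; split; first by have [] := H j t l jt.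
have Uo : open [set s | dom j (c s)].
  by apply: (@open_comp _ _ c (dom j)); [move=> s _; exact: cc|exact: domO].
apply: (@continuous_eq_on _ _ _ (fun s => \sum_b v s 0 b * jac i j (c s) b l) _ _ Uo _ jt).
  by move=> s js; rewrite [RHS]mxE derive1E; have [_ ->] := H j s l js.
apply: (@cvg_sumr _ _ (nbhs t)) => b _; apply: cvgM; first exact: vc.
apply: (@continuous_comp _ _ _ c (fun q => jac i j q b l)); first exact: cc.
exact: (sm_continuous (sm_jac i j b l) (conj (ci t) jt)).
Qed.

Lemma sm_mulmx W a b c (F : M -> 'M[R]_(a, b)) (G : M -> 'M[R]_(b, c)) : open W ->
  (forall x y, sm A W (fun q => F q x y)) -> (forall x y, sm A W (fun q => G q x y)) ->
  forall x y, sm A W (fun q => (F q *m G q) x y).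
Proof.
move=> Wo Fs Gs x y.
apply: (@sm_eq _ _ _ A W (fun q => \sum_l F q x l * G q l y)) => // [q _|]; first by rewrite mxE.
by apply: (sm_sum _ Wo) => l _; apply: (sm_mul Wo).
Qed.

Variable g : chart -> M -> 'M[R]_n.
Hypothesis hg : riemannian_metric g.

Lemma nbhs_matrix_bounded i p (E : M -> 'M[R]_n) : dom i p ->
  (forall a b, sm A (dom i) (fun q => E q a b)) -> E p = 1%:M ->
  \forall x \near coord i p, forall a b, `|E (param i x) a b| <= 2.
Proof.
move=> ip Es E1.
apply: (@near_forall _ _ (nbhs (coord i p)) _ (fun a x => forall b, `|E (param i x) a b| <= 2)) => a.
apply: (@near_forall _ _ (nbhs (coord i p)) _ (fun b x => `|E (param i x) a b| <= 2)) => b.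
have c : {for coord i p, continuous (fun x => E (param i x) a b)}.
  apply: (@continuous_comp _ _ _ (param i) (fun q => E q a b)).
    exact: param_cont (codom_coord ip).
  by rewrite coordK //; exact: (sm_continuous (Es a b)).
have : nbhs (E (param i (coord i p)) a b) [set t : R | `|t| < 2].
  apply: open_nbhs_nbhs; split.
    apply: (@open_comp _ _ (fun s : R => `|s|) [set s | s < 2]); last exact: open_lt.
    by move=> s _; exact: norm_continuous.
  rewrite /= coordK // E1 mxE; case: (a == b); rewrite ?normr1 ?normr0 //.
  by rewrite ltr1n.
move=> /c N; apply: (@filterS _ _ (nbhs_filter (coord i p)) _ _ _ N) => x /= h.
exact: ltW h.
Qed.

(* Q maps coordinate displacements at q0 to components in an orthonormal frame. *)
Definition frame (kappa : R) q0 (Q : 'M[R]_n) (rho : R) : Prop :=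
  let i := chart_at q0 in let x0 := coord i q0 in
  [/\ Q \in unitmx, 0 < rho, forall x, `|x - x0| < rho -> codom i x,
    forall x (z : 'rV[R]_n), `|x - x0| < rho ->
      (z *m Q^T *m invmx (g i (param i x)) *m (z *m Q^T)^T) 0 0 <= 2 * n%:R ^+ 2 * `|z| ^+ 2 &
    forall x y T, `|x - x0| < rho -> `|y - x0| < rho -> 0 < T ->
      kappa * `|(y - x) *m Q| <= T -> reach g (param i x) (param i y) T].

(** The constant [kappa] is chosen before the point. In a frame orthonormal at [q0] the metric and
    its inverse are the identity there, so nearby their entries are at most 2 in absolute value; how
    near is left to [rho], which depends on the point. *)
Lemma frame_exists : exists2 kappa, 0 < kappa & forall q0, exists Q rho, frame kappa q0 Q rho.
Proof.
have [S S0 [ds dds [dsc dsS _]]] := @smooth_step_derive R.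
(* The path below has speed at most [2 / T * S] times [2 * n] times the displacement in the frame;
   the successor makes the constant positive in dimension 0. *)
exists (4 * S * n.+1%:R) => [|q0]; first by rewrite !mulr_gt0.
set i := chart_at q0; have iq0 : dom i q0 := in_chart_at A q0.
have [Q Qu gE] := metric_factor hg iq0.
exists Q.
have giE : invmx (g i q0) = (invmx Q)^T *m invmx Q.
  apply: invmx_left; rewrite gE mulmxA -[_ *m Q]mulmxA mulVmx // mulmx1.
  by rewrite -trmx_mul mulmxV // trmx1.
have cst_sm (B : 'M[R]_n) a b : sm A (dom i) (fun=> B a b) by exact: sm_cst.
have E1 : \forall x \near coord i q0, forall a b, `|(Q^T *m invmx (g i (param i x)) *m Q) a b| <= 2.
  apply: (@nbhs_matrix_bounded i q0 (fun q => Q^T *m invmx (g i q) *m Q)) => //.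
    apply: (sm_mulmx (domO i)) => //; apply: (sm_mulmx (domO i)) => //.
    exact: sm_invmx_metric.
  by rewrite giE mulmxA -trmx_mul mulVmx // trmx1 mul1mx mulVmx.
have E2 : \forall x \near coord i q0, forall a b, `|(invmx Q *m g i (param i x) *m (invmx Q)^T) a b| <= 2.
  apply: (@nbhs_matrix_bounded i q0 (fun q => invmx Q *m g i q *m (invmx Q)^T)) => //.
    apply: (sm_mulmx (domO i)) => //; apply: (sm_mulmx (domO i)) => //.
    exact: sm_metric.
  by rewrite gE mulmxA mulVmx // mul1mx -trmx_mul mulVmx // trmx1.
have E3 : nbhs (coord i q0) (codom i).
  by apply: open_nbhs_nbhs; split; [exact: codomO|exact: codom_coord].
have /nbhs_rVP [rho rho0 H] := @filterI _ _ (nbhs_filter (coord i q0)) _ _ E3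
  (@filterI _ _ (nbhs_filter (coord i q0)) _ _ E1 E2).
exists rho; split => //.
- by move=> x /H [].
- move=> x z /H [_ [h _]].
  have -> : z *m Q^T *m invmx (g i (param i x)) *m (z *m Q^T)^T =
      z *m (Q^T *m invmx (g i (param i x)) *m Q) *m z^T by rewrite trmx_mul trmxK !mulmxA.
  exact: quadratic_form_le.
move=> x y T xr yr T0 hT.
(* The segment from [x] to [y], traversed between the times [T / 4] and [3 T / 4] and at rest
   outside, as [reach] demands. *)
pose z (t : R) : 'rV[R]_n := x + smooth_step (2 / T * t + (- 2^-1)) *: (y - x).
have zr t : `|z t - coord i q0| < rho.
  set s := smooth_step (2 / T * t + (- 2^-1)).
  have -> : z t - coord i q0 = (1 - s) *: (x - coord i q0) + s *: (y - coord i q0).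
    by apply/rowP => l; rewrite /z -/s !(rV_addE, rV_oppE, rV_scaleE); ring.
  have s0 : 0 <= s := smooth_step_ge0 _; have s1 : s <= 1 := smooth_step_le1 _.
  have nz (k : R) (w : 'rV[R]_n) : `|k *: w| = `|k| * `|w| := normrZ k w.
  apply: (le_lt_trans (ler_normD _ _)); rewrite !nz (ger0_norm s0) ger0_norm ?subr_ge0 //.
  have [->|sn] := eqVneq s 0; first by rewrite mul0r addr0 subr0 mul1r.
  have sp : 0 < s by rewrite lt_neqAle eq_sym sn.
  by nra.
have zc t : codom i (z t) by have [] := H _ (zr t).
have dsig t : is_derive t (1 : R) (fun t => smooth_step (2 / T * t + (- 2^-1))) (2 / T * ds (2 / T * t + (- 2^-1))).
  have D := @is_derive1_comp _ smooth_step (fun t => 2 / T * t + (- 2^-1)) t _ _ (dds _) (is_derive_affine (2 / T) (- 2^-1) t).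
  by apply: (is_derive_eq D); rewrite [LHS]mulrC.
pose v t : 'rV[R]_n := (2 / T * ds (2 / T * t + (- 2^-1))) *: (y - x).
have ca : continuous (fun t : R => 2 / T * t + (- 2^-1)).
  by move=> t; apply/differentiable_continuous/derivable1_diffP; have [] := is_derive_affine (2 / T) (- 2^-1) t.
have zl t l : is_derive t (1 : R) (fun s => z s 0 l) (v t 0 l).
  have -> : (fun s => z s 0 l) = (fun s => x 0 l + smooth_step (2 / T * s + (- 2^-1)) * (y - x) 0 l).
    by apply/funext => s; rewrite /z rV_addE rV_scaleE.
  rewrite /v rV_scaleE.
  have d := is_deriveD (is_derive_cst (x 0 l) t (1 : R)) (is_deriveM (dsig t) (is_derive_cst ((y - x) 0 l) t (1 : R))).
  by apply: (is_derive_eq d); rewrite add0r /GRing.scale /= mulr0 add0r mulrC.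
have zcont : continuous z.
  move=> t; apply: rV_cvg => l; apply/differentiable_continuous/derivable1_diffP.
  by have [] := zl t l.
have [C V] : C1_curve A (param i \o z) /\ forall t, velocity (param i \o z) i t = v t.
  apply: C1_curve_of_chart.
  - by move=> t; apply: continuous_comp; [exact: zcont|exact: param_cont].
  - by move=> t; exact: dom_param.
  - move=> t b; have -> : (fun s => coord i ((param i \o z) s) 0 b) = (fun s => z s 0 b).
      by apply/funext => s; rewrite /= paramK.
    exact: zl.
  - move=> b t; have -> : (fun s => v s 0 b) = (fun s => 2 / T * ds (2 / T * s + (- 2^-1)) * (y - x) 0 b).
      by apply/funext => s; rewrite /v rV_scaleE.
    apply: cvgM; last exact: cvg_cst.
    apply: cvgM; first exact: cvg_cst.
    by apply: (@continuous_comp _ _ _ (fun t : R => 2 / T * t + (- 2^-1)) ds); [exact: ca|exact: dsc].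
have T4 : 0 < T / 4 by rewrite divr_gt0.
exists (param i \o z), (T / 4); split; [exact: C|exact: T4|move=> t|move=> t tT|move=> t tT].
- rewrite (speedE hg C (i := i)); last exact: dom_param.
  rewrite /chart_speed V /v linearZ /= -!scalemxAl -scalemxAr scalerA rV_scaleE -expr2.
  rewrite sqrtrM ?sqr_ge0 // sqrtr_sqr.
  set E := invmx Q *m g i (param i (z t)) *m (invmx Q)^T.
  have -> : (y - x) *m g i (param i (z t)) *m (y - x)^T = ((y - x) *m Q) *m E *m ((y - x) *m Q)^T.
    rewrite /E trmx_mul !mulmxA -[(y - x) *m Q *m invmx Q]mulmxA mulmxV // mulmx1.
    by rewrite -[_ *m (invmx Q)^T *m Q^T]mulmxA -trmx_mul mulmxV // trmx1 mulmx1.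
  have hE a b : `|E a b| <= 2 by have [_ [_ h]] := H _ (zr t); exact: h.
  have F1 := quadratic_form_le ((y - x) *m Q) hE.
  set N := `|(y - x) *m Q| in F1 hT; have N0 : 0 <= N := normr_ge0 _.
  have F2 : Num.sqrt (((y - x) *m Q *m E *m ((y - x) *m Q)^T) 0 0) <= 2 * n%:R * N.
    have r0 : 0 <= 2 * n%:R * N by rewrite !mulr_ge0.
    rewrite -[leRHS](ger0_norm r0) -sqrtr_sqr ler_sqrt ?sqr_ge0 // (le_trans F1) //.
    rewrite !exprMn; have : 0 <= n%:R ^+ 2 * N ^+ 2 by rewrite mulr_ge0 ?sqr_ge0.
    lra.
  have F3 : `|2 / T * ds (2 / T * t + (- 2^-1))| <= 2 / T * S.
    by rewrite normrM gtr0_norm ?divr_gt0 // ler_wpM2l ?dsS // ltW // divr_gt0.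
  apply: (@le_trans _ _ (2 / T * S * (2 * n%:R * N))).
    by apply: ler_pM; rewrite ?sqrtr_ge0.
  have -> : 2 / T * S * (2 * n%:R * N) = (4 * S * n%:R * N) / T by rewrite mulrC; ring.
  rewrite ler_pdivrMr // mul1r (le_trans _ hT) // ler_wpM2r // ler_wpM2l ?mulr_ge0 ?ltW //.
  by rewrite ltr_nat.
- rewrite /= /z smooth_step0 ?scale0r ?addr0 //.
  have : 2 / T * t <= 2 / T * (T / 4) by rewrite ler_wpM2l ?divr_ge0 // ltW.
  have -> : 2 / T * (T / 4) = 2^-1 by field; rewrite gt_eqF.
  by lra.
- rewrite /= /z smooth_step1 ?scale1r.
  by rewrite addrC subrK.
have : 2 / T * (T - T / 4) <= 2 / T * t by rewrite ler_wpM2l ?divr_ge0 // ltW.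
have -> : 2 / T * (T - T / 4) = 3 / 2 by field; rewrite gt_eqF.
by lra.
Qed.

End local_frames.

(** * The Hopf-Rinow theorem for reach balls *)

Section hopf_rinow.
Context {R : realType} {n : nat} {M : ptopologicalType}.
Variable A : smooth_manifold R n M.
Local Notation chart := (chart A).
Local Notation dom := (@dom _ _ _ A).
Local Notation coord := (@coord _ _ _ A).
Local Notation chart_at := (@chart_at _ _ _ A).
Implicit Types (i j : chart) (p q : M) (u : M -> R) (W K : set M).
Variable g : chart -> M -> 'M[R]_n.
Hypothesis hg : riemannian_metric g.

Lemma sm_gradient_square i W u : open W -> sm A W u ->
  sm A (dom i `&` W) (gradient_square g i u).
Proof.
move=> Wo us; have Uo : open (dom i `&` W) by apply: openI => //; exact: domO.
have gs a b : sm A (dom i `&` W) (fun q => gradient_row i u q a b).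
  apply: (sm_eq Uo _ (sm_pderiv i b Wo us)) => q _.
  by rewrite mxE.
apply: (sm_mulmx Uo); last by move=> a b; apply: (sm_eq Uo _ (gs b a)) => q _; rewrite [RHS]mxE.
apply: (sm_mulmx Uo) => // a b; apply: (sm_sub _ (sm_invmx_metric hg i a b)) => q [].
by [].
Qed.

Lemma gradient_square_cst (c : R) i p : gradient_square g i (cst c) p = 0.
Proof.
rewrite /gradient_square (_ : gradient_row i (cst c) p = 0) ?mul0mx ?mxE //.
by apply/rowP => a; rewrite !mxE pderiv_cst.
Qed.

Lemma gradient_square_eq W i u v p : open W -> (forall q, W q -> u q = v q) -> dom i p -> W p ->
  gradient_square g i u p = gradient_square g i v p.
Proof.
move=> Wo uv ip Wp; rewrite /gradient_square (_ : gradient_row i u p = gradient_row i v p) //.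
by apply/rowP => a; rewrite !mxE (pderiv_eq a Wo uv ip Wp).
Qed.

Lemma gradient_bounded u K : sm A setT u -> compact K -> (forall p, ~ K p -> u p = 0) ->
  exists2 C, 0 <= C & forall i p, dom i p -> gradient_square g i u p <= C ^+ 2.
Proof.
move=> us Kc u0; pose G p := gradient_square g (chart_at p) u p.
have GE i p : dom i p -> gradient_square g i u p = G p.
  by move=> ip; apply: (gradient_square_chart hg openT us) => //; exact: in_chart_at.
have Gs : sm A setT G.
  apply: sm_local => p _; exists (dom (chart_at p)); first exact: in_chart_at.
  apply: (sm_eq (domO _) _ (sm_sub _ (sm_gradient_square (chart_at p) openT us))); last by move=> q.
  by move=> q iq; rewrite GE.
have G0 p : ~ K p -> G p = 0.
  move=> Kp; rewrite /G -(gradient_square_cst 0 (chart_at p) p).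
  apply: (gradient_square_eq (closed_openC (manifold_compact_closed A Kc)) _ (in_chart_at A p) Kp) => q Kq.
  by rewrite u0.
have /compact_bounded [C [_ hC]] : compact (G @` K).
  by apply: continuous_compact => //; apply: continuous_subspaceT => p; exact: (sm_continuous Gs).
exists (`|C| + 1) => [|i p ip]; first by rewrite addr_ge0.
rewrite (GE _ _ ip); have C0 : 0 <= `|C| := normr_ge0 C.
have [Kp|Kp] := pselect (K p); last by rewrite G0 ?sqr_ge0.
have : `|G p| <= `|C| + 1 by apply: hC; [rewrite (le_lt_trans (ler_norm C)) // ltrDl|exists p].
by move=> h; have := le_trans (ler_norm _) h; nra.
Qed.

Lemma reach_mono p q T T' : 0 <= T -> T <= T' -> reach g p q T -> reach g p q T'.
Proof.
move=> T0 TT' pq; rewrite -(subrKC T T').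
by apply: (reach_trans T0 _ pq); [rewrite subr_ge0|exact: reach_refl].
Qed.

Lemma reach_near p T : 0 < T -> exists N, [/\ open N, N p & forall q, N q -> reach g p q T].
Proof.
move=> T0; have [kappa k0 /(_ p) [Q [rho [Qu rho0 rc _ hr]]]] := frame_exists hg.
have [C C0 hC] := mulmx_norm_le Q.
set i := chart_at p in rc hr *; set x0 := coord i p in rc hr *.
have ip : dom i p := in_chart_at A p.
pose d := Num.min rho (T / (kappa * C)).
have d0 : 0 < d by rewrite lt_min rho0 divr_gt0 // mulr_gt0.
exists (dom i `&` coord i @^-1` [set x | `|x - x0| < d]); split.
- by apply: coord_preimage_open; exact: rV_ball_open.
- by split => //=; rewrite subrr normr0.
move=> q [iq /=]; rewrite lt_min => /andP[qr qT].
have := hr x0 (coord i q) T; rewrite !coordK //; apply => //; first by rewrite subrr normr0.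
rewrite (le_trans (ler_wpM2l (ltW k0) (hC _))) // mulrA mulrC -ler_pdivlMr ?mulr_gt0 //.
exact: ltW.
Qed.

Definition reach_ball p (r : R) : set M := [set q | exists T, [/\ 0 < T, T < r & reach g p q T]].

Definition bounded_ball p r : Prop := exists2 K, compact K & reach_ball p r `<=` K.

(** The ball of radius [2 r / 3] has compact closure by the hypothesis at [p], so finitely many
    small neighbourhoods cover it. Halving a path of time less than [r] shows that its end is within
    [3 r / 4] of one of their centres, and the hypothesis at these centres finishes. *)
Lemma bounded_ball_step p r : 0 < r ->
  (forall y, reach_ball p (3 / 4 * r) y -> bounded_ball y (3 / 4 * r)) -> bounded_ball p r.
Proof.
move=> r0 H; pose D := reach_ball p (2 / 3 * r).
have pp : reach_ball p (3 / 4 * r) p.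
  by exists (r / 2); split; [lra|lra|exact: reach_refl].
have [K1 K1c K1D] := H _ pp.
have Kc : compact (closure D).
  apply: (@subclosed_compact _ _ K1) => //; first exact: closed_closure.
  have K1cl := manifold_compact_closed A K1c.
  rewrite closureE => x; apply; split => // z [T [T0 Tr pz]]; apply: K1D.
  by exists T; split => //; lra.
(* A slack that keeps [2 r / 3 + r / 24] below [3 r / 4]; it is used once to place the centres
   within [3 r / 4] of [p] and once to reach the ends of paths from the centres. *)
have r24 : 0 < r / 24 by lra.
pose N y := sval (cid (reach_near y r24)).
have HN y : [/\ open (N y), N y y & forall q, N y q -> reach g y q (r / 24)] := svalP (cid (reach_near y r24)).
have HB y : closure D y -> bounded_ball y (3 / 4 * r).
  have [No Ny Nr] := HN y.
  move=> /(_ _ (open_nbhs_nbhs (conj No Ny))) [z [[T [T0 Tr pz]] /Nr yz]]; apply: H.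
  by exists (T + r / 24); split; [lra|lra|apply: (reach_trans _ _ pz (reach_sym yz)); lra].
have [s [sK sN]] := finite_cover (U := N) Kc (fun y _ => let: And3 a b _ := HN y in conj a b).
have {sK HB} [K' K'c sK'] : exists2 K', compact K' & forall y, y \in s -> reach_ball y (3 / 4 * r) `<=` K'.
  elim: s {sN} sK => [|y s IHs] sK; first by exists set0; [exact: compact0|].
  have [K2 K2c h2] : bounded_ball y (3 / 4 * r) by apply/HB/sK; rewrite inE eqxx.
  have [|K3 K3c h3] := IHs; first by move=> z zs; apply: sK; rewrite inE zs orbT.
  exists (K2 `|` K3); first exact: compactU.
  move=> z; rewrite inE => /orP[/eqP ->|zs] x hx; [left; exact: h2|right; exact: (h3 z)].
exists K' => // z [T [T0 Tr pz]].
have [w [pw wz]] := reach_half T0 pz.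
have Dw : closure D w.
  by apply: subset_closure; exists (2 * T / 3); split; [lra|lra|].
have [y ys Nyw] := sN _ Dw; have [_ _ /(_ _ Nyw) yw] := HN y.
apply: (sK' y ys); exists (r / 24 + 2 * T / 3); split; [lra|lra|].
by apply: (reach_trans _ _ yw wz); lra.
Qed.

Hypothesis hcomplete : complete_metric g.

(** If the claim fails, [bounded_ball_step] yields unbounded balls with radii shrinking by [3 / 4]
    and each centre inside the previous ball. The centres form a Cauchy sequence, and a compact
    neighbourhood of the limit contains one of these balls. *)
Lemma reach_ball_bounded p r : bounded_ball p r.
Proof.
apply: contrapT => nb.
have r0 : 0 < r.
  rewrite ltNge; apply/negP => r0; apply: nb; exists set0; first exact: compact0.
  by move=> z [T [T0 Tr _]]; lra.
pose rk k : R := (3 / 4) ^+ k * r.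
have rk0 k : 0 < rk k by rewrite mulr_gt0 // exprn_gt0 // divr_gt0.
have rkS k : rk k.+1 = 3 / 4 * rk k by rewrite /rk exprS mulrA.
have step x k : ~ bounded_ball x (rk k) ->
    exists y, reach_ball x (3 / 4 * rk k) y /\ ~ bounded_ball y (rk k.+1).
  move=> xb; apply: contrapT => ne; apply: xb; apply: bounded_ball_step => // y xy.
  by apply: contrapT => yb; apply: ne; exists y; split => //; rewrite rkS.
pose nxt k x := if pselect (exists y, reach_ball x (3 / 4 * rk k) y /\ ~ bounded_ball y (rk k.+1))
  is left h then sval (cid h) else x.
pose x := fix x k := if k is k'.+1 then nxt k' (x k') else p.
have xb k : ~ bounded_ball (x k) (rk k).
  elim: k => [|k IHk]; first by rewrite /rk expr0 mul1r.
  by rewrite /= /nxt; case: pselect => [h|/(_ (step _ _ IHk)) //]; have [_] := svalP (cid h).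
have xS k : reach_ball (x k) (3 / 4 * rk k) (x k.+1).
  by rewrite /= /nxt; case: pselect => [h|/(_ (step _ _ (xb k))) //]; have [] := svalP (cid h).
have rk_decr k m : rk (k + m)%N <= rk k.
  elim: m => [|m IHm]; first by rewrite addn0.
  by rewrite addnS rkS; have := rk0 (k + m)%N; lra.
(* Each step takes less than [3 / 4 * rk k], which is [3 * (rk k - rk k.+1)], so the times
   telescope. *)
have xkm k m : reach g (x k) (x (k + m)%N) (3 * (rk k - rk (k + m)%N)).
  elim: m => [|m IHm]; first by rewrite addn0; exact: reach_refl.
  have [T [T0 Tr xT]] := xS (k + m)%N.
  have h1 := rk_decr k m; have h2 := rk0 (k + m)%N.
  apply: (@reach_mono _ _ (3 * (rk k - rk (k + m)%N) + T)); [lra|rewrite addnS rkS; lra|].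
  by rewrite addnS; apply: (reach_trans _ _ IHm xT); lra.
have xkm' k m : reach g (x k) (x (k + m)%N) (3 * rk k).
  have h1 := rk_decr k m; have h2 := rk0 (k + m)%N.
  by apply: (reach_mono _ _ (xkm k m)); lra.
have rk_small e : 0 < e -> exists N, rk N < e.
  move=> e0; have c34 : `|3 / 4 : R| < 1 by rewrite gtr0_norm; lra.
  have er0 : 0 < e / r by rewrite divr_gt0.
  have /cvgrPdist_lt /(_ _ er0) [N _ hN] := cvg_expr c34.
  exists N; have := hN N (leqnn N); rewrite /= sub0r normrN gtr0_norm ?exprn_gt0 ?divr_gt0 //.
  by rewrite /rk ltr_pdivlMr.
have dist_le N k : (N <= k)%N -> reach g (x N) (x k) (3 * rk N) by move=> /subnKC <-; exact: xkm'.
have [y xy] : exists y, forall e : R, 0 < e -> exists N, forall k, (N <= k)%N -> (riemannian_dist g (x k) y < e%:E)%E.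
  apply: hcomplete => e e0; have [|N hN] := rk_small (e / 7); first lra.
  exists N => k m Nk Nm; apply: (@le_lt_trans _ _ (3 * rk N + 3 * rk N)%:E).
    have h := rk0 N; apply: (reach_dist hg); first lra.
    by apply: (reach_trans _ _ (reach_sym (dist_le _ _ Nk)) (dist_le _ _ Nm)); lra.
  by rewrite lte_fin; lra.
(* The bump function relates the distance to the topology. With [4 * (C + 1)] as below, [psi] varies
   by at most [1 / 4] from [y] to [x k] and again from there to a point of the ball, hence stays
   positive and the ball lies in [K]. *)
have [psi [psis psi01 [W' [W'o W'y psi1]] [K [Kc _ _ psi0]]]] := bump_exists A (domO (chart_at y)) (in_chart_at A y).
have [C C0 hC] := gradient_bounded psis Kc psi0.
have [|N1 hN1] := xy (4 * (C + 1))^-1; first by rewrite invr_gt0 mulr_gt0 // ltr_wpDl.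
have [|N2 hN2] := rk_small (4 * (C + 1))^-1; first by rewrite invr_gt0 mulr_gt0 // ltr_wpDl.
pose k := (N1 + N2)%N.
have kd : (riemannian_dist g (x k) y < ((4 * (C + 1))^-1)%:E)%E by apply: hN1; rewrite leq_addr.
have kr : rk k < (4 * (C + 1))^-1 by rewrite /k addnC (le_lt_trans (rk_decr _ _)).
have Ce : C * (4 * (C + 1))^-1 <= 1 / 4.
  by rewrite ler_pdivrMr ?mulr_gt0 ?ltr_wpDl //; lra.
apply: (xb k); exists K => // z [T [T0 Tr kz]]; apply: contrapT => Kz.
have L1 := reach_Lipschitz hg psis C0 hC (ltW T0) kz.
have L2 := dist_Lipschitz hg psis C0 hC kd.
have h1 : C * T <= C * (4 * (C + 1))^-1 by rewrite ler_wpM2l //; lra.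
move: L1 L2; rewrite (psi0 _ Kz) (psi1 _ W'y) sub0r normrN => L1 L2.
have := ler_norm (psi (x k)); have := ler_norm (1 - psi (x k)); lra.
Qed.

End hopf_rinow.

(** * Cutoff functions *)

Section lattice_hat.
Context {R : realType}.
Implicit Types (t a : R).

Lemma telescope_unit (F : R -> R) a m :
  \sum_(j < m) (F (a - j%:R + 1) - F (a - j%:R)) = F (a + 1) - F (a - m%:R + 1).
Proof.
elim: m => [|m IHm]; first by rewrite big_ord0 subr0 subrr.
rewrite big_ord_recr IHm /=.
have -> : a - m.+1%:R + 1 = a - m%:R by rewrite -natr1; ring.
by rewrite addrA subrK.
Qed.

Lemma unit_interval_unique a (i j : nat) : 0 < a - i%:R < 1 -> 0 < a - j%:R < 1 -> i = j.
Proof.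
move=> /andP[i0 i1] /andP[j0 j1]; case: (ltngtP i j) => // ij.
  have h : (i.+1%:R : R) <= j%:R by rewrite ler_nat.
  by exfalso; rewrite -natr1 in h; lra.
have h : (j.+1%:R : R) <= i%:R by rewrite ler_nat.
by exfalso; rewrite -natr1 in h; lra.
Qed.

(** The translates of the open unit interval by integers are disjoint, so at most one term is
    nonzero. *)
Lemma sum_unit_support_le (F : R -> R) (C : R) a m : 0 <= C -> (forall t, `|F t| <= C) ->
  (forall t, t <= 0 \/ 1 <= t -> F t = 0) -> \sum_(j < m) `|F (a - j%:R)| <= C.
Proof.
move=> C0 FC F0.
have [/existsP [j0 j0F]|/existsPn h] := boolP [exists j : 'I_m, F (a - j%:R) != 0]; last first.
  by rewrite big1 // => j _; have /negPn/eqP -> := h j; rewrite normr0.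
have inside j : F (a - j%:R) != 0 -> 0 < a - j%:R < 1.
  move=> Fj; rewrite !ltNge -negb_or; apply: contra Fj => /orP Fj; apply/eqP/F0.
  by case: Fj; [left|right].
rewrite (bigD1 j0) //= big1 ?addr0 // => j jj0.
have [->|Fj] := eqVneq (F (a - j%:R)) 0; first by rewrite normr0.
by move/eqP: jj0; case; apply/val_inj/(@unit_interval_unique a); exact: inside.
Qed.

(** As a difference of two translates of the step, its own integer translates telescope to 1: a
    partition of unity on the line. *)
Definition hat t : R := smooth_step (t + 1) - smooth_step t.

Lemma hat_ge0 t : 0 <= hat t.
Proof. by rewrite subr_ge0; apply: smooth_step_homo; rewrite lerDl. Qed.

Lemma hat_eq0 t : 1 <= `|t| -> hat t = 0.
Proof.
rewrite /hat; have [t0|t0] := lerP 0 t; rewrite ?(ger0_norm t0) ?(ltr0_norm t0) => t1.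
  by rewrite !smooth_step1 ?subrr //; lra.
by rewrite !smooth_step0 ?subrr //; lra.
Qed.

(* Node number j sits at j - N. *)
Definition node N (j : nat) : R := j%:R - N%:R.

Lemma nodeE N t j : t - node N j = t + N%:R - j%:R.
Proof. by rewrite /node; ring. Qed.

Lemma sum_hat N t : `|t| <= N%:R -> \sum_(j < N.*2.+1) hat (t - node N j) = 1.
Proof.
rewrite ler_norml => /andP[t1 t2]; under eq_bigr do rewrite nodeE /hat.
rewrite telescope_unit smooth_step1; last lra.
have -> : t + N%:R - N.*2.+1%:R + 1 = t - N%:R by rewrite -natr1 -addnn natrD; ring.
by rewrite smooth_step0 ?subr0; lra.
Qed.

(** What matters is a bound for the sum of absolute values that does not depend on the number of
    nodes. Each of the two shifted steps contributes at most one nonzero term, whence [2 * S]. *)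
Lemma hat_derive : exists2 S : R, 0 < S & exists dh : R -> R,
  [/\ forall t, is_derive t (1 : R) hat (dh t), forall t, 1 <= `|t| -> dh t = 0,
    forall N t, `|t| <= N%:R -> \sum_(j < N.*2.+1) dh (t - node N j) = 0 &
    forall N t, \sum_(j < N.*2.+1) `|dh (t - node N j)| <= S].
Proof.
have [S S0 [ds dds [dsc dsS ds0]]] := @smooth_step_derive R.
exists (2 * S); first by rewrite mulr_gt0.
exists (fun t => ds (t + 1) - ds t); split.
- move=> t; have d1 : is_derive t (1 : R) (fun t => smooth_step (t + 1)) (ds (t + 1)).
    by have := is_derive_shift (dds (t - - 1)); rewrite opprK.
  exact: is_deriveB.
- move=> t; have [t0|t0] := lerP 0 t; rewrite ?(ger0_norm t0) ?(ltr0_norm t0) => t1.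
    by rewrite !ds0 ?subrr //; right; lra.
  by rewrite !ds0 ?subrr //; left; lra.
- move=> N t; rewrite ler_norml => /andP[t1 t2]; under eq_bigr do rewrite nodeE.
  rewrite telescope_unit.
  have -> : t + N%:R - N.*2.+1%:R + 1 = t - N%:R by rewrite -natr1 -addnn natrD; ring.
  by rewrite !ds0 ?subrr //; [left|right]; lra.
- move=> N t; apply: (@le_trans _ _ (\sum_(j < N.*2.+1) (`|ds (t + N%:R + 1 - j%:R)| + `|ds (t + N%:R - j%:R)|))).
    apply: ler_sum => j _; rewrite nodeE.
    have -> : t + N%:R - j%:R + 1 = t + N%:R + 1 - j%:R by ring.
    exact: ler_normB.
  rewrite big_split /= mulr_natl mulr2n; have S0' := ltW S0.
  by apply: lerD; apply: sum_unit_support_le.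
Qed.

End lattice_hat.

Section cutoffs.
Context {R : realType} {n : nat} {M : ptopologicalType}.
Variable A : smooth_manifold R n M.
Local Notation chart := (chart A).
Local Notation dom := (@dom _ _ _ A).
Local Notation coord := (@coord _ _ _ A).
Local Notation param := (@param _ _ _ A).
Local Notation chart_at := (@chart_at _ _ _ A).
Implicit Types (i j : chart) (p q : M) (u h : M -> R) (W K : set M).
Variable g : chart -> M -> 'M[R]_n.
Hypothesis hg : riemannian_metric g.

(** The supremum is max(0, 1 - d/L), with d the infimum of the times [T]. The value 0 gives the
    truncation and keeps the set nonempty where [q] is not reached. *)
Definition tent_values p (L : R) q : set R :=
  [set 0] `|` [set s | exists T, [/\ 0 < T, reach g p q T & s = 1 - T / L]].

Definition tent p (L : R) q : R := sup (tent_values p L q).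

Lemma tent_values_ub p L q : 0 < L -> ubound (tent_values p L q) 1.
Proof.
move=> L0 s [->|[T [T0 _ ->]]]; first exact: ler01.
by rewrite lerBlDr lerDl divr_ge0 // ltW.
Qed.

Lemma tent_has_ub p L q : 0 < L -> has_ubound (tent_values p L q).
Proof. by move=> L0; exists 1; exact: tent_values_ub. Qed.

Lemma tent_ge0 p L q : 0 < L -> 0 <= tent p L q.
Proof. by move=> L0; apply: ub_le_sup; [exact: tent_has_ub|left]. Qed.

Lemma tent_reach p L q T : 0 < L -> 0 < T -> reach g p q T -> 1 - T / L <= tent p L q.
Proof. by move=> L0 T0 pq; apply: ub_le_sup; [exact: tent_has_ub|right; exists T]. Qed.

Lemma tent_out p L q : 0 < L -> ~ reach_ball g p L q -> tent p L q = 0.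
Proof.
move=> L0 pq; apply/le_anti; rewrite tent_ge0 // andbT; apply: ge_sup; first by exists 0; left.
move=> s [->|[T [T0 pqT ->]]] //; rewrite subr_le0 ler_pdivlMr // mul1r leNgt; apply/negP => TL.
by apply: pq; exists T.
Qed.

Lemma tent_Lipschitz p L q z S : 0 < L -> 0 < S -> reach g q z S ->
  `|tent p L z - tent p L q| <= S / L.
Proof.
move=> L0 S0.
have H q' z' : reach g q' z' S -> tent p L q' <= tent p L z' + S / L.
  move=> qz; apply: ge_sup; first by exists 0; left.
  have SL : 0 < S / L by rewrite divr_gt0.
  move=> s [->|[T [T0 pq ->]]]; first by rewrite addr_ge0 ?tent_ge0 // ltW.
  rewrite -lerBlDr -addrA -opprD -mulrDl; apply: tent_reach => //; first by rewrite addr_gt0.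
  by apply: (reach_trans _ _ pq qz); exact: ltW.
move=> qz; rewrite ler_norml; apply/andP; split.
  by have := H _ _ qz; lra.
by have := H _ _ (reach_sym qz); lra.
Qed.

(* Interpolation of h on a lattice of small mesh in an orthonormal frame; the
   bound on the gradient must not depend on the point q0. *)
Lemma lattice_approximation : exists2 C, 0 < C & forall (L : R) (h : M -> R), 0 < L ->
  (forall q z S, 0 < S -> reach g q z S -> `|h z - h q| <= S / L) ->
  forall q0, exists W, [/\ open W, W q0 & forall tau, 0 < tau -> exists B,
    [/\ sm A W B, forall q, W q -> `|B q - h q| <= tau &
        forall i q, dom i q -> W q -> gradient_square g i B q <= (C / L) ^+ 2]].
Proof.
have [kappa k0 HF] := frame_exists hg.
have [S S0 [dh [dhat dh0 sdh0 sdh]]] := @hat_derive R.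
(* The interpolant has frame derivatives at most [kappa * S / L], and [frame] bounds its squared
   gradient by [2 * n ^+ 2] times their square. *)
exists (2 * n.+1%:R * (kappa * S)) => [|L h L0 hL q0]; first by rewrite !mulr_gt0.
have [Q [rho [Qu rho0 rc gr rr]]] := HF q0.
set i := chart_at q0 in rc gr rr; set x0 := coord i q0 in rc gr rr.
have iq0 : dom i q0 := in_chart_at A q0.
have r20 : 0 < rho / 2 by rewrite divr_gt0.
pose W := dom i `&` coord i @^-1` [set x | `|x - x0| < rho / 2].
have Wo : open W by apply: coord_preimage_open; exact: rV_ball_open.
exists W; split => //; first by split => //=; rewrite subrr normr0.
move=> tau tau0.
have [C1 C10 hC1] := mulmx_norm_le Q; have [C2 C20 hC2] := mulmx_norm_le (invmx Q).
(* The mesh. The first bound makes the interpolation error at most [tau]; the second keeps all nodes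
   of nonzero weight inside the ball where [frame] applies. *)
pose r := Num.min (tau * L / kappa) (rho / 2 / C2).
have r0 : 0 < r by rewrite lt_min !divr_gt0 // mulr_gt0.
have rt : kappa * r / L <= tau.
  rewrite ler_pdivrMr // mulrC -ler_pdivlMr //.
  by rewrite ge_min lexx.
have rC : C2 * r <= rho / 2 by rewrite mulrC -ler_pdivlMr // ge_min lexx orbT.
(* Enough nodes in each direction for the lattice to cover [W]. *)
pose N := Num.bound (C1 * (rho / 2) / r).
have Nb : C1 * (rho / 2) / r <= N%:R.
  by rewrite ltW // archi_boundP // divr_ge0 ?mulr_ge0 // ltW.
pose t c q : R := ((coord i q - x0) *m Q) 0 c / r.
pose T := {ffun 'I_n -> 'I_N.*2.+1}.
pose X (k : T) : 'rV[R]_n := x0 + (r *: \row_c node N (k c)) *m invmx Q.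
pose w q (k : T) := \prod_c hat (t c q - node N (k c)).
(* The weights [w q k] are products of hats, a partition of unity on [W], so this averages values of
   [h] at nodes near [q]. *)
pose B q := \sum_(k : T) h (param i (X k)) * w q k.
have tN q c : W q -> `|t c q| <= N%:R.
  move=> [iq /= qr]; rewrite /t normrM normfV (gtr0_norm r0) (le_trans _ Nb) //.
  rewrite ler_wpM2r ?invr_ge0 ?(ltW r0) // (le_trans (rV_coord_le _ _)) // (le_trans (hC1 _)) //.
  by rewrite ler_wpM2l // ltW.
have close q (k : T) : W q -> (forall c, `|t c q - node N (k c)| < 1) ->
    `|h (param i (X k)) - h q| <= kappa * r / L.
  move=> [iq /= qr] hk.
  pose y : 'rV[R]_n := r *: \row_c (node N (k c) - t c q).
  have yr : `|y| <= r.
    apply: rV_norm_le => [|c]; first exact: ltW.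
    rewrite rV_scaleE mxE normrM (gtr0_norm r0) -[leRHS]mulr1 ler_wpM2l ?(ltW r0) // distrC ltW //.
  have Xq : X k - coord i q = y *m invmx Q.
    have E : coord i q - x0 = (r *: \row_c t c q) *m invmx Q.
      rewrite -[LHS](mulmxK Qu); congr (_ *m _); apply/rowP => c.
      by rewrite rV_scaleE mxE /t mulrCA divff ?mulr1 // gt_eqF.
    have -> : X k - coord i q = (X k - x0) - (coord i q - x0) by rewrite opprB addrA subrK.
    have XE : X k - x0 = (r *: \row_c node N (k c)) *m invmx Q by rewrite /X addrC addKr.
    rewrite E XE -mulmxBl; congr (_ *m _).
    by apply/rowP => c; rewrite rV_addE rV_oppE !rV_scaleE !mxE; ring.
  have Xr : `|X k - x0| < rho.
    have -> : X k - x0 = (X k - coord i q) + (coord i q - x0) by rewrite addrA subrK.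
    rewrite (le_lt_trans (ler_normD _ _)) // [rho]splitr ler_ltD //.
    rewrite Xq (le_trans (hC2 _)) // (le_trans _ rC) // ler_wpM2l //; exact: ltW.
  apply: hL; first by rewrite mulr_gt0.
  have := rr (coord i q) (X k) (kappa * r); rewrite coordK //; apply => //.
  - by rewrite (lt_trans qr) //; lra.
  - by rewrite mulr_gt0.
  - by rewrite Xq mulmxKV // ler_wpM2l // ltW.
have sumw q : W q -> \sum_k w q k = 1.
  move=> Wq; rewrite /w -(bigA_distr_bigA (fun c (j : 'I_N.*2.+1) => hat (t c q - node N j))) /=.
  by rewrite big1 // => c _; apply: sum_hat; exact: tN.
have ts c : sm A (dom i) (t c).
  apply: (@sm_eq _ _ _ A _ (fun q => \sum_b (coord i q 0 b - x0 0 b) * (Q b c / r))).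
  - exact: domO.
  - move=> q iq; rewrite /t mxE mulr_suml; apply: eq_bigr => b _.
    by rewrite rV_addE rV_oppE mulrA.
  - apply: (sm_sum _ (domO i)) => b _; apply: (sm_mul (domO i)); last exact: sm_cst.
    exact: (sm_subr (domO i) (sm_coord i b) (sm_cst A _ _)).
have hs c (j : nat) : sm A (dom i) (fun q => hat (t c q - node N j)).
  have ts' : sm A (dom i) (fun q => t c q - node N j) by exact: (sm_subr (domO i) (ts c) (sm_cst A _ _)).
  apply: (sm_subr (domO i)); apply: (sm_step (domO i)) => //.
  exact: (sm_add (domO i) ts' (sm_cst A _ 1)).
have ws k : sm A (dom i) (fun q => w q k) by apply: (sm_prod _ (domO i)).
have Bs : sm A (dom i) B by apply: (sm_sum _ (domO i)) => k _; exact: (sm_mul (domO i) (sm_cst A _ _)).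
have krL : 0 <= kappa * r / L by rewrite divr_ge0 ?mulr_ge0 // ltW.
exists B; split.
- by apply: (sm_sub _ Bs) => q [].
- move=> q Wq; have -> : B q - h q = \sum_k (h (param i (X k)) - h q) * w q k.
    by under [RHS]eq_bigr do rewrite mulrBl; rewrite sumrB -mulr_sumr sumw // mulr1.
  rewrite (le_trans (ler_norm_sum _ _ _)) // (le_trans _ rt) //.
  rewrite -[leRHS]mulr1 -(sumw q Wq) mulr_sumr; apply: ler_sum => k _.
  have w0 : 0 <= w q k by apply: prodr_ge0 => c _; exact: hat_ge0.
  rewrite normrM (ger0_norm w0); have [wk|wk] := eqVneq (w q k) 0; first by rewrite wk !mulr0.
  rewrite ler_wpM2r //; apply: close => // c; rewrite ltNge; apply: contra wk => /hat_eq0 e0.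
  by rewrite /w (bigD1 c) //= e0 mul0r.
move=> j q jq Wq; have iq : dom i q := Wq.1.
have Bw : sm A W B by apply: (sm_sub _ Bs) => z [].
rewrite -(gradient_square_chart hg Wo Bw Wq iq jq).
(* In the derivative along the frame direction [a] only the factor of index [a] is
   differentiated. *)
pose F a c (l : 'I_N.*2.+1) := if c == a then dh (t c q - node N l) else hat (t c q - node N l).
pose om a (k : T) := \prod_c F a c (k c).
pose D a := \sum_k h (param i (X k)) * om a k.
have omE a k : om a k = dh (t a q - node N (k a)) * \prod_(c | c != a) hat (t c q - node N (k c)).
  rewrite /om (bigD1 a) //= /F eqxx; congr (_ * _).
  by apply: eq_bigr => c /negbTE ->.
have dt a b : pderiv i b (t a) q = Q b a / r.
  rewrite (@pderiv_eq _ _ _ _ (dom i) _ _ _ (fun q => \sum_b' (coord i q 0 b' - x0 0 b') * (Q b' a / r)) _ (domO i) _ iq iq); last first.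
    move=> z iz; rewrite /t mxE mulr_suml; apply: eq_bigr => b' _.
    by rewrite rV_addE rV_oppE mulrA.
  have s1 b' : sm A (dom i) (fun q => coord i q 0 b' - x0 0 b').
    exact: (sm_subr (domO i) (sm_coord i b') (sm_cst A _ _)).
  have s2 b' : sm A (dom i) (fun=> Q b' a / r) by exact: sm_cst.
  rewrite (pderiv_sum _ _ (domO i) (fun b' _ => sm_mul (domO i) (s1 b') (s2 b')) iq iq).
  have E b' : pderiv i b (fun q => (coord i q 0 b' - x0 0 b') * (Q b' a / r)) q = (b' == b)%:R * (Q b' a / r).
    have z1 : pderiv i b (fun=> Q b' a / r) q = 0 := pderiv_cst i b _ q.
    have z2 : pderiv i b (fun=> x0 0 b') q = 0 := pderiv_cst i b _ q.
    rewrite (pderivM b (s1 b') (s2 b') iq iq) z1 mulr0 addr0.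
    rewrite (pderivB b (sm_coord i b') (sm_cst A (dom i) (x0 0 b')) iq iq).
    by rewrite [X in _ - X]z2 subr0 pderiv_coord.
  under eq_bigr do rewrite E.
  rewrite (bigD1 b) //= eqxx mul1r big1 ?addr0 // => b' /negbTE ->.
  by rewrite mul0r.
have dhatE a b (l : nat) : pderiv i b (fun q => hat (t a q - node N l)) q = dh (t a q - node N l) * (Q b a / r).
  rewrite (pderiv_comp1 b (h := fun x => hat (x - node N l)) (ts a) iq iq (is_derive_shift (dhat (t a q - node N l)))).
  by rewrite dt.
have grad : gradient_row i B q = (r^-1 *: \row_a D a) *m Q^T.
  apply/rowP => b; rewrite [LHS]mxE [RHS]mxE.
  rewrite (pderiv_sum _ _ (domO i) (fun k _ => sm_mul (domO i) (sm_cst A _ _) (ws k)) iq iq).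
  transitivity (\sum_k \sum_a h (param i (X k)) * om a k * (Q b a / r)).
    apply: eq_bigr => k _; rewrite (pderivZ _ _ (ws k) iq iq) (pderiv_prod b (domO i) (fun c => hs c (k c)) iq iq) mulr_sumr.
    by apply: eq_bigr => a _; rewrite dhatE omE; ring.
  rewrite exchange_big /=; apply: eq_bigr => a _; rewrite rV_scaleE [(\row_a D a) _ _]mxE [_^T _ _]mxE /D.
  by rewrite mulr_sumr mulr_suml; apply: eq_bigr => k _; ring.
(* The differentiated weights sum to 0, so [h] may be replaced by [h - h q] in [D]. This gains a
   factor [r / L], and its [r] cancels the [r^-1] from differentiating at mesh [r]: the gradient
   bound does not feel the mesh. *)
have om0 a : \sum_k om a k = 0.
  rewrite /om -(bigA_distr_bigA (F a)) /= (bigD1 a) //= [X in X * _](_ : _ = 0) ?mul0r //.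
  by rewrite /F eqxx; apply: sdh0; exact: tN.
have omS a : \sum_k `|om a k| <= S.
  have -> : \sum_k `|om a k| = \prod_c \sum_l `|F a c l|.
    by rewrite (bigA_distr_bigA (fun c l => `|F a c l|)); apply: eq_bigr => k _; rewrite normr_prod.
  rewrite (bigD1 a) //= [X in _ * X]big1 ?mulr1; first by rewrite /F eqxx; exact: sdh.
  move=> c /negbTE ca; rewrite /F ca -[RHS](sum_hat (tN q c Wq)); apply: eq_bigr => l _.
  by rewrite ger0_norm // hat_ge0.
have DS a : `|D a| <= kappa * r / L * S.
  have -> : D a = \sum_k (h (param i (X k)) - h q) * om a k.
    by under [RHS]eq_bigr do rewrite mulrBl; rewrite sumrB -mulr_sumr om0 mulr0 subr0.
  rewrite (le_trans (ler_norm_sum _ _ _)) // (@le_trans _ _ (\sum_k kappa * r / L * `|om a k|)) //; last first.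
    by rewrite -mulr_sumr ler_wpM2l.
  apply: ler_sum => k _; rewrite normrM; have [ok|ok] := eqVneq (om a k) 0; first by rewrite ok normr0 !mulr0.
  rewrite ler_wpM2r //; apply: close => // c; rewrite ltNge; apply: contra ok => c1.
  rewrite /om (bigD1 c) //= /F; case: (c == a); first by rewrite dh0 // mul0r.
  by rewrite hat_eq0 // mul0r.
set z : 'rV[R]_n := r^-1 *: \row_a D a in grad.
have zle : `|z| <= kappa * S / L.
  apply: rV_norm_le => [|a]; first by rewrite divr_ge0 ?mulr_ge0 // ltW.
  rewrite rV_scaleE mxE normrM normfV (gtr0_norm r0) ler_pdivrMl //.
  by rewrite (le_trans (DS a)) // le_eqVlt; apply/orP; left; apply/eqP; ring.
rewrite /gradient_square grad.
have := gr (coord i q) z; rewrite coordK // => G.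
have qr : `|coord i q - x0| < rho by have [_ /= h1] := Wq; rewrite (lt_trans h1) //; lra.
apply: (le_trans (G qr)).
have -> : 2 * n.+1%:R * (kappa * S) / L = 2 * n.+1%:R * (kappa * S / L) by ring.
rewrite [leRHS]exprMn; apply: ler_pM; rewrite ?sqr_ge0 ?mulr_ge0 ?sqr_ge0 //.
  by rewrite exprMn -natr1; have : 0 <= n%:R :> R by []; nra.
by rewrite lerXn2r // nnegrE // divr_ge0 ?mulr_ge0 // ltW.
Qed.

Definition gradient_norm i u p : R := Num.sqrt (gradient_square g i u p).

Lemma gradient_norm_le i u p C : 0 <= C ->
  (gradient_norm i u p <= C) = (gradient_square g i u p <= C ^+ 2).
Proof.
move=> C0; rewrite /gradient_norm -{1}(ger0_norm C0) -sqrtr_sqr ler_sqrt //.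
exact: sqr_ge0.
Qed.

Lemma row_norm_triangle k (x y : 'rV[R]_k) :
  Num.sqrt (((x + y) *m (x + y)^T) 0 0) <= Num.sqrt ((x *m x^T) 0 0) + Num.sqrt ((y *m y^T) 0 0).
Proof.
rewrite !row_square; set a := \sum_c x 0 c ^+ 2; set b := \sum_c y 0 c ^+ 2.
have a0 : 0 <= a by apply: sumr_ge0 => c _; exact: sqr_ge0.
have b0 : 0 <= b by apply: sumr_ge0 => c _; exact: sqr_ge0.
pose s := \sum_c x 0 c * y 0 c.
have -> : \sum_c (x + y) 0 c ^+ 2 = a + 2 * s + b.
  rewrite /a /b /s mulr_sumr -!big_split; apply: eq_bigr => c _ /=.
  by rewrite rV_addE; ring.
have sab : s <= Num.sqrt a * Num.sqrt b.
  rewrite -sqrtrM // (le_trans (ler_norm _)) // -sqrtr_sqr ler_sqrt ?mulr_ge0 //.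
  exact: sum_Cauchy_Schwarz.
have r0 : 0 <= Num.sqrt a + Num.sqrt b by rewrite addr_ge0 ?sqrtr_ge0.
rewrite -[leRHS](ger0_norm r0) -sqrtr_sqr ler_sqrt ?sqr_ge0 //.
rewrite sqrrD !sqr_sqrtr //; lra.
Qed.

(** The differential of the combination is (B - chi) d psi + psi dB + (1 - psi) d chi. The first
    term is the cost of gluing, small when [B] and [chi] approximate the same function. *)
Lemma gradient_norm_combine W i (B psi chi : M -> R) p : open W -> sm A W B -> sm A W psi ->
  sm A W chi -> W p -> dom i p -> 0 <= psi p <= 1 ->
  gradient_norm i (fun q => psi q * B q + (1 - psi q) * chi q) p <=
  `|B p - chi p| * gradient_norm i psi p + psi p * gradient_norm i B p + (1 - psi p) * gradient_norm i chi p.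
Proof.
move=> Wo Bs ps cs Wp ip /andP[p0 p1].
have [Q Qu GE] := invmx_metric_factor hg ip.
have NE u : gradient_norm i u p = Num.sqrt (((gradient_row i u p *m Q) *m (gradient_row i u p *m Q)^T) 0 0).
  by rewrite /gradient_norm /gradient_square GE trmx_mul !mulmxA.
have NZ (c : R) (x : 'rV[R]_n) : Num.sqrt (((c *: x) *m (c *: x)^T) 0 0) = `|c| * Num.sqrt ((x *m x^T) 0 0).
  by rewrite linearZ /= -scalemxAl -scalemxAr scalerA rV_scaleE -expr2 sqrtrM ?sqr_ge0 // sqrtr_sqr.
have s1 : sm A W (fun q => psi q * B q) := sm_mul Wo ps Bs.
have s2 : sm A W (fun q => 1 - psi q) := sm_subr Wo (sm_cst A W 1) ps.
have s3 : sm A W (fun q => (1 - psi q) * chi q) := sm_mul Wo s2 cs.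
have rowE : gradient_row i (fun q => psi q * B q + (1 - psi q) * chi q) p =
    (B p - chi p) *: gradient_row i psi p + psi p *: gradient_row i B p + (1 - psi p) *: gradient_row i chi p.
  apply/rowP => a; rewrite !rV_addE !rV_scaleE [LHS]mxE ![gradient_row _ _ _ _ _]mxE.
  have z1 : pderiv i a (fun=> 1) p = 0 := pderiv_cst i a _ p.
  have z2 : pderiv i a (fun q => 1 - psi q) p = - pderiv i a psi p.
    by rewrite (pderivB a (sm_cst A W 1) ps Wp ip) [X in X - _]z1 sub0r.
  by rewrite (pderivD a s1 s3 Wp ip) (pderivM a ps Bs Wp ip) (pderivM a s2 cs Wp ip) z2; ring.
have xE : gradient_row i (fun q => psi q * B q + (1 - psi q) * chi q) p *m Q =
    (B p - chi p) *: (gradient_row i psi p *m Q) + psi p *: (gradient_row i B p *m Q) +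
    (1 - psi p) *: (gradient_row i chi p *m Q).
  by rewrite rowE !mulmxDl -!scalemxAl.
rewrite !NE xE.
move: (gradient_row i psi p *m Q) (gradient_row i B p *m Q) (gradient_row i chi p *m Q) => x y z.
have q0 : 0 <= 1 - psi p by rewrite subr_ge0.
apply: (le_trans (row_norm_triangle _ _)).
rewrite (NZ (1 - psi p)) (ger0_norm q0) lerD2r.
apply: (le_trans (row_norm_triangle _ _)).
rewrite (NZ (psi p)) (NZ (B p - chi p)) (ger0_norm p0); exact: lexx.
Qed.

Lemma gradient_norm_eq W i u v p : open W -> (forall q, W q -> u q = v q) -> dom i p -> W p ->
  gradient_norm i u p = gradient_norm i v p.
Proof. by move=> Wo uv ip Wp; rewrite /gradient_norm (gradient_square_eq g Wo uv ip Wp). Qed.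

Lemma convex_norm_le (s a b t : R) : 0 <= s <= 1 -> `|a| <= t -> `|b| <= t ->
  `|s * a + (1 - s) * b| <= t.
Proof.
move=> /andP[s0 s1]; rewrite !ler_norml => /andP[a1 a2] /andP[b1 b2].
by apply/andP; split; nra.
Qed.

Lemma combine_le (s a b c d x t C c0 : R) : 0 <= s <= 1 -> 0 <= a -> `|b - x| <= t -> `|c - x| <= t ->
  a <= C -> d <= c0 -> forall e, e <= c0 + t -> 0 <= t ->
  `|b - c| * a + s * d + (1 - s) * e <= c0 + (C * (2 * t) + t).
Proof.
move=> /andP[s0 s1] a0; rewrite !ler_norml => /andP[b1 b2] /andP[c1 c2] aC dc e ec t0.
have h1 : `|b - c| <= 2 * t by rewrite ler_norml; apply/andP; split; lra.
have h2 : `|b - c| * a <= 2 * t * C by apply: ler_pM.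
by nra.
Qed.

(** Induction on a finite cover of [K], adding one local approximation at a time with a bump [psi].
    The cover and the bumps are fixed before [tau], so the approximations can be made fine compared
    with the gradient of each [psi]. *)
Lemma glue_approximations (h : M -> R) (c0 : R) (K : set M) : 0 <= c0 ->
  (forall q0, exists W, [/\ open W, W q0 & forall tau, 0 < tau -> exists B,
    [/\ sm A W B, forall q, W q -> `|B q - h q| <= tau &
        forall i q, dom i q -> W q -> gradient_norm i B q <= c0]]) ->
  compact K -> exists U, [/\ open U, K `<=` U & forall tau, 0 < tau -> exists chi,
    [/\ sm A U chi, forall q, U q -> `|chi q - h q| <= tau &
        forall i q, dom i q -> U q -> gradient_norm i chi q <= c0 + tau]].
Proof.
move=> c00 H Kc.
have H' q0 : exists T : set M * (M -> R) * (set M * set M),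
    [/\ open T.1.1 /\ (forall tau, 0 < tau -> exists B,
    [/\ sm A T.1.1 B, forall q, T.1.1 q -> `|B q - h q| <= tau &
        forall i q, dom i q -> T.1.1 q -> gradient_norm i B q <= c0]),
    sm A setT T.1.2 /\ (forall q, 0 <= T.1.2 q <= 1), open T.2.1 /\ T.2.1 q0,
    forall q, T.2.1 q -> T.1.2 q = 1 &
    [/\ compact T.2.2, T.2.2 `<=` T.1.1 & forall q, ~ T.2.2 q -> T.1.2 q = 0]].
  have [W [Wo Wq0 HB]] := H q0.
  have [psi [psis psi01 [W' [W'o W'q psi1]] [K' [K'c K'W _ psi0]]]] := bump_exists A Wo Wq0.
  by exists (W, psi, (W', K')); split.
pose T q0 := sval (cid (H' q0)).
have HT q0 := svalP (cid (H' q0)); rewrite -/(T _) in HT.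
have [s [_ Ks]] := finite_cover (U := fun p => (T p).2.1) Kc
  (fun p _ => let: And5 _ _ a _ _ := HT p in a).
exists (\bigcup_(q in [set` s]) (T q).2.1); split.
- by apply: bigcup_open => q _; case: (HT q) => _ _ [].
- by move=> p /Ks [q qs Tq]; exists q.
elim: s {Ks} => [|q s IHs] tau tau0.
  by exists (fun=> 0); split; [split => i; exact: Cinf_cst|move=> q []|move=> i q _ []].
have [[Wo HB] [psis psi01] [W'o W'q] psi1 [K'c K'W psi0]] := HT q.
set W := (T q).1.1 in Wo HB K'W; set psi := (T q).1.2 in psis psi01 psi1 psi0.
set W' := (T q).2.1 in W'o W'q psi1; set K' := (T q).2.2 in K'c K'W psi0.
pose U := \bigcup_(q in [set` s]) (T q).2.1.
have Uo : open U by apply: bigcup_open => z _; case: (HT z) => _ _ [].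
have [C C0 hC] := gradient_bounded hg psis K'c psi0.
(* The gluing adds at most [2 * t] times the gradient bound [C] of [psi], plus the loss [t]
   inherited from [chi]: in total [tau]. *)
pose t := tau / (2 * C + 1).
have C1 : 0 < 2 * C + 1 by rewrite ltr_wpDl // mulr_ge0.
have t0 : 0 < t by rewrite divr_gt0.
have tE : C * (2 * t) + t = tau by rewrite /t; field; rewrite gt_eqF.
have tt : t <= tau by rewrite -tE lerDr mulr_ge0 // mulr_ge0 // ltW.
have [chi [chis chih chig]] := IHs t t0; have [B [Bs Bh Bg]] := HB t t0.
have W'W : W' `<=` W by move=> z /psi1 z1; apply: K'W; apply: contrapT => /psi0 /eqP; rewrite z1 oner_eq0.
have K'cl := manifold_compact_closed A K'c.
pose chi' z := psi z * B z + (1 - psi z) * chi z.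
have e1 z : W' z -> B z = chi' z by move=> Wz; rewrite /chi' psi1 // subrr mul0r addr0 mul1r.
have e2 z : (~` K') z -> chi z = chi' z by move=> Kz; rewrite /chi' psi0 // mul0r add0r subr0 mul1r.
have UWo : open (U `&` W) by exact: openI.
have UKo : open (U `&` ~` K') by apply: openI => //; exact: closed_openC.
(* Three open regions: [psi = 1], where only [B] counts; the common domain; and the complement of
   the support of [psi], where only [chi] counts. *)
have E : \bigcup_(z in [set` q :: s]) (T z).2.1 `<=` W' `|` ((U `&` W) `|` (U `&` ~` K')).
  move=> z [y /= + Ty]; rewrite inE => /orP[/eqP yq|ys]; first by left; move: Ty; rewrite yq.
  right; have Uz : U z by exists y.
  by have [Wz|Wz] := pselect (W z); [left|right; split => // /K'W].
have psW : sm A (U `&` W) psi by exact: (sm_sub _ psis).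
have BW : sm A (U `&` W) B by apply: (sm_sub _ Bs) => z [].
have chW : sm A (U `&` W) chi by apply: (sm_sub _ chis) => z [].
exists chi'; split.
- apply: (sm_sub E); apply: sm_union; first by apply: (sm_eq W'o e1); exact: (sm_sub W'W).
  apply: sm_union.
    exact: (sm_add UWo (sm_mul UWo psW BW) (sm_mul UWo (sm_subr UWo (sm_cst A _ 1) psW) chW)).
  apply: (sm_eq UKo (u := chi)) => [z [_ Kz]|]; first exact: e2.
  by apply: (sm_sub _ chis) => z [].
- move=> z /E [Wz|[[Uz Wz]|[Uz Kz]]].
  + by rewrite -e1 // (le_trans (Bh _ (W'W _ Wz))).
  + have -> : chi' z - h z = psi z * (B z - h z) + (1 - psi z) * (chi z - h z) by rewrite /chi'; ring.
    apply: (le_trans (convex_norm_le (psi01 z) (Bh _ Wz) (chih _ Uz))); exact: tt.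
  + by rewrite -e2 // (le_trans (chih _ Uz)).
move=> i z iz /E [Wz|[[Uz Wz]|[Uz Kz]]].
- rewrite -(gradient_norm_eq W'o e1 iz Wz) (le_trans (Bg _ _ iz (W'W _ Wz))) // lerDl ltW //.
- apply: (le_trans (gradient_norm_combine UWo BW psW chW (conj Uz Wz) iz (psi01 z))).
  have g1 : gradient_norm i psi z <= C by rewrite gradient_norm_le //; exact: hC.
  rewrite -tE; apply: (combine_le (psi01 z) _ (Bh _ Wz) (chih _ Uz) g1 (Bg _ _ iz Wz) (chig _ _ iz Uz) (ltW t0)).
  exact: sqrtr_ge0.
- by rewrite -(gradient_norm_eq (closed_openC K'cl) e2 iz Kz) (le_trans (chig _ _ iz Uz)) // lerD2l.
Qed.

Hypothesis hcomplete : complete_metric g.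

(** A tent of large width, smoothed near a compact set containing its support and then flattened by
    a step. The neighbourhood [W] is chosen before [e], because [cutoff_vanishing] lets [e] tend to
    0 over a fixed set. *)
Lemma cutoff_exists p : exists W, [/\ open W, W p & forall e, 0 < e -> exists chi : M -> R,
  [/\ sm A setT chi, forall q, 0 <= chi q <= 1, forall q, W q -> chi q = 1,
      exists2 K, compact K & forall q, ~ K q -> chi q = 0 &
      forall i q, dom i q -> gradient_square g i chi q <= e ^+ 2]].
Proof.
have [W [Wo Wp Wr]] := reach_near hg p (@ltr01 R).
have [C C0 HC] := lattice_approximation.
have [S S0 [ds dds [dsc dsS ds0]]] := @smooth_step_derive R.
exists W; split => // e e0.
(* The summand 8 makes the tent at least [7 / 8] on [W]; the other one gives [C / L <= e / (4 * S)].
   Half of the gradient budget [e / (2 * S)] is thus left for the error [tau]. *)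
pose L := 8 + 4 * S * C / e.
have SCe : 0 < 4 * S * C / e by rewrite divr_gt0 // !mulr_gt0.
have L0 : 0 < L by rewrite addr_gt0.
have L8 : 8 <= L by rewrite lerDl ltW.
have CL : C / L <= e / (4 * S).
  rewrite ler_pdivrMr // mulrAC ler_pdivlMr ?mulr_gt0 // mulrDr.
  have -> : e * (4 * S * C / e) = 4 * S * C by field; rewrite gt_eqF.
  by rewrite mulrC lerDr mulr_ge0 // ltW.
have [K Kc Kr] := reach_ball_bounded hg hcomplete p L.
have Kcl := manifold_compact_closed A Kc.
pose h := tent p L.
have hL q z T : 0 < T -> reach g q z T -> `|h z - h q| <= T / L by exact: tent_Lipschitz.
have CL0 : 0 <= C / L by rewrite divr_ge0 // ltW.
have [|U [Uo KU HU]] := @glue_approximations h (C / L) K CL0 _ Kc.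
  move=> q0; have [V [Vo Vq HV]] := HC L h L0 hL q0; exists V; split => // tau tau0.
  have [B [Bs Bh Bg]] := HV tau tau0; exists B; split => // i q iq Vq'.
  by rewrite gradient_norm_le //; exact: Bg.
pose tau := Num.min (1 / 8) (e / (4 * S)).
have tau0 : 0 < tau by rewrite lt_min !divr_gt0 // mulr_gt0.
have tau8 : tau <= 1 / 8 by rewrite ge_min lexx.
have taue : tau <= e / (4 * S) by rewrite ge_min lexx orbT.
have [chi [chis chih chig]] := HU tau tau0.
(* Vanishes up to [1 / 4] and is 1 from [3 / 4] on, so an error of [1 / 8] affects neither the
   region where the tent is 0 nor [W]. Its slope is at most [2 * S]. *)
pose f x : R := smooth_step (2 * x + (- 2^-1)).
pose F q := if q \in U then f (chi q) else 0.
have FU q : U q -> F q = f (chi q) by move=> Uq; rewrite /F mem_set.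
have FK q : ~ K q -> F q = 0.
  rewrite /F; case: ifPn => // /set_mem Uq Kq; have := chih _ Uq.
  rewrite /h tent_out //; last by move=> /Kr.
  rewrite subr0 ler_norml => /andP[_ h1].
  by rewrite /f smooth_step0 //; lra.
have fs : sm A U F.
  apply: (sm_eq Uo (u := fun q => smooth_step (2 * chi q + (- 2^-1)))) => [q Uq|]; first by rewrite FU.
  exact: (sm_step Uo (sm_add Uo (sm_mul Uo (sm_cst A U 2) chis) (sm_cst A U _))).
exists F; split.
- exact: (sm_extend Kcl KU fs FK).
- by move=> q; rewrite /F; case: ifP; rewrite ?lexx ?ler01 // smooth_step_ge0 smooth_step_le1.
- move=> q Wq; have pq := Wr _ Wq.
  have Kq : K q by apply: Kr; exists 1; split => //; lra.
  have Uq := KU _ Kq; have := chih _ Uq; have := tent_reach L0 ltr01 pq.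
  have : 1 / L <= 1 / 8 by rewrite ler_pdivrMr // mulrAC ler_pdivlMr // !mul1r.
  rewrite -/(h q) ler_norml => h1 h2 /andP[h3 h4].
  by rewrite FU // /f smooth_step1 //; lra.
- by exists K.
move=> i q iq; have [Kq|Kq] := pselect (K q); last first.
  have e2 z : (~` K) z -> F z = cst 0 z by move=> /FK.
  by rewrite (gradient_square_eq g (closed_openC Kcl) e2 iq Kq) gradient_square_cst sqr_ge0.
have Uq := KU _ Kq.
have df t : is_derive t (1 : R) f (2 * ds (2 * t + (- 2^-1))).
  have D := @is_derive1_comp _ smooth_step (fun t => 2 * t + (- 2^-1)) t _ _ (dds _) (is_derive_affine 2 (- 2^-1) t).
  by apply: (is_derive_eq D); rewrite mulrC.
rewrite -gradient_norm_le ?(ltW e0) //.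
have -> : gradient_norm i F q = `|2 * ds (2 * chi q + (- 2^-1))| * gradient_norm i chi q.
  rewrite (gradient_norm_eq Uo FU iq Uq) /gradient_norm /gradient_square.
  have -> : gradient_row i (fun q => f (chi q)) q = (2 * ds (2 * chi q + (- 2^-1))) *: gradient_row i chi q.
    apply/rowP => a; rewrite rV_scaleE !mxE.
    by rewrite (pderiv_comp1 a (h := f) chis Uq iq (df (chi q))).
  by rewrite linearZ /= -!scalemxAl -scalemxAr scalerA rV_scaleE -expr2 sqrtrM ?sqr_ge0 // sqrtr_sqr.
have g1 := chig _ _ iq Uq.
apply: (@le_trans _ _ (2 * S * (e / (2 * S)))); last first.
  by rewrite mulrC divfK // gt_eqF // mulr_gt0.
apply: ler_pM; rewrite ?sqrtr_ge0 //.
  by rewrite normrM ger0_norm // ler_wpM2l.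
have -> : e / (2 * S) = e / (4 * S) + e / (4 * S) by field; rewrite gt_eqF.
by lra.
Qed.

End cutoffs.

(** * Primitives of closed 1-forms *)

Section poincare_lemma.
Context {R : realType} {n : nat}.
Variables (x0 : 'rV[R]_n) (r : R) (e : 'I_n -> 'rV[R]_n -> R).
Let B := [set x : 'rV[R]_n | `|x - x0| < r].
Hypothesis e_smooth : forall a, Cinf B (e a).
Hypothesis e_closed : forall a b x, B x -> partial a (e b) x = partial b (e a) x.

Let Bo : open B := @rV_ball_open R n x0 r.

Lemma is_derive_affine_r (t c d : R) : is_derive t (1 : R) (fun s : R => c + s * d) d.
Proof. by under eq_fun do rewrite addrC mulrC; exact: is_derive_affine. Qed.

Definition segment_point (s : R) (x : 'rV[R]_n) := x0 + s *: (x - x0).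

Lemma segment_pointB s x : segment_point s x - x0 = s *: (x - x0).
Proof. by rewrite /segment_point addrC addKr. Qed.

Lemma segment_point_coord s x c :
  segment_point s x 0 c = x0 0 c + s * (x 0 c - x0 0 c).
Proof. by rewrite rV_addE rV_scaleE rV_addE rV_oppE. Qed.

Lemma segment_ball s x : 0 <= s <= 1 -> B x -> B (segment_point s x).
Proof.
move=> /andP[s0 s1] Bx; rewrite /B /= segment_pointB normrZ ger0_norm //.
by apply: le_lt_trans Bx; rewrite ler_piMl.
Qed.

Lemma near_ball_derivable g z a : Cinf B g -> B z ->
  \forall y \near z, derivable g y (delta_mx 0 a).
Proof.
move=> sg Bz; have : nbhs z B by apply: open_nbhs_nbhs; split=> //; exact: Bo.
by apply: filterS => y By; exact: Cinf_derivable sg By.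
Qed.

Lemma is_derive_segment g s x : Cinf B g -> B (segment_point s x) ->
  is_derive s (1 : R) (fun t => g (segment_point t x))
    (\sum_b (x 0 b - x0 0 b) * partial b g (segment_point s x)).
Proof.
move=> sg Bs; apply: (@is_derive_rV_comp R n R g (fun t => segment_point t x) s 1
  (fun b => x 0 b - x0 0 b)) => b.
- exact: near_ball_derivable.
- exact: Cinf_continuous (Cinf_partial b sg) Bs.
- under eq_fun do rewrite segment_point_coord.
  exact: is_derive_affine_r.
Qed.

Lemma shift_coord (h : R) a (x : 'rV[R]_n) c :
  (h *: delta_mx 0 a + x) 0 c = h * (c == a)%:R + x 0 c.
Proof. by rewrite rV_addE rV_scaleE !mxE eqxx. Qed.

Lemma is_derive_segment_end g s x a (h : R) : Cinf B g ->
  B (segment_point s (h *: delta_mx 0 a + x)) ->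
  is_derive h (1 : R) (fun t => g (segment_point s (t *: delta_mx 0 a + x)))
    (s * partial a g (segment_point s (h *: delta_mx 0 a + x))).
Proof.
move=> sg Bs.
have := @is_derive_rV_comp R n R g (fun t => segment_point s (t *: delta_mx 0 a + x)) h 1
  (fun b => s * (b == a)%:R) _ _ _.
rewrite (bigD1 a) //= eqxx mulr1 big1 ?addr0; last first.
  by move=> b /negbTE ->; rewrite mulr0 mul0r.
apply=> b.
- exact: near_ball_derivable.
- exact: Cinf_continuous (Cinf_partial b sg) Bs.
- under eq_fun do rewrite segment_point_coord shift_coord.
  rewrite (_ : (fun t => _) = fun t : R => (x0 0 b + s * (x 0 b - x0 0 b)) + t * (s * (b == a)%:R)).
    exact: is_derive_affine_r.
  by apply/funext => t; ring.
Qed.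

(** The integrand of the classical primitive: the 1-form [e] along the segment from [x0] to [x],
    applied to [x - x0]. *)
Definition radial (x : 'rV[R]_n) (s : R) : R :=
  \sum_b (x 0 b - x0 0 b) * e b (segment_point s x).

Definition radial_integral (x : 'rV[R]_n) : R :=
  (\int[lebesgue_measure]_(s in `[0, 1]) radial x s)%R.

Definition radial_derivative a (x : 'rV[R]_n) (s : R) : R :=
  \sum_b ((b == a)%:R * e b (segment_point s x) +
     (x 0 b - x0 0 b) * (s * partial a (e b) (segment_point s x))).

Lemma is_derive_radial a x s (h : R) : B (segment_point s (h *: delta_mx 0 a + x)) ->
  is_derive h (1 : R) (fun t => radial (t *: delta_mx 0 a + x) s)
    (radial_derivative a (h *: delta_mx 0 a + x) s).
Proof.
move=> Bs; rewrite /radial /radial_derivative.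
under eq_fun => t do rewrite -[\sum_b _]/(\sum_(b < n) (fun b (t : R) => ((t *: delta_mx 0 a + x) 0 b - x0 0 b) *
   e b (segment_point s (t *: delta_mx 0 a + x))) b t).
rewrite (_ : (fun t : R => _) = \sum_(b < n) (fun t : R => ((t *: delta_mx 0 a + x) 0 b - x0 0 b) *
   e b (segment_point s (t *: delta_mx 0 a + x)))); last by apply/funext => t; rewrite fct_sumE.
apply: is_derive_sum => b.
have D1 : is_derive h (1 : R) (fun t : R => (t *: delta_mx 0 a + x) 0 b - x0 0 b) (b == a)%:R.
  under eq_fun do rewrite shift_coord -addrA addrC.
  exact: is_derive_affine_r.
have D2 := is_derive_segment_end (e_smooth b) Bs.
apply: (is_derive_eq (is_deriveM D1 D2)).
by rewrite /GRing.scale /= addrC [_ * (b == a)%:R]mulrC.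
Qed.

(** Closedness makes the right-hand side the derivative in [s] of [s * e a (segment_point s x)], so
    that its integral over the unit interval is [e a x]. *)
Lemma radial_derivativeE a x s : B (segment_point s x) ->
  radial_derivative a x s = e a (segment_point s x) +
    s * \sum_b (x 0 b - x0 0 b) * partial b (e a) (segment_point s x).
Proof.
move=> Bs; rewrite /radial_derivative big_split /=; congr (_ + _).
  rewrite (bigD1 a) //= eqxx mul1r big1 ?addr0 // => b /negbTE ->.
  by rewrite mul0r.
by rewrite mulr_sumr; apply: eq_bigr => b _; rewrite (e_closed a b Bs) mulrCA.
Qed.

Lemma segment_continuous g x : Cinf B g -> B x ->
  {within `[0, 1], continuous (fun s => g (segment_point s x))}.
Proof.
move=> sg Bx; apply: derivable_within_continuous => s s01.
by have [] := is_derive_segment sg (segment_ball s01 Bx).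
Qed.

Lemma within_sum (J : finType) (F : J -> R -> R) (D : set R) :
  (forall b, {within D, continuous (F b)}) ->
  {within D, continuous (fun s => \sum_b F b s)}.
Proof.
move=> H s; apply: (@cvg_sumr R (subspace D) _ (@nbhs_filter (subspace D) s) _ _ xpredT F (fun b => F b s)) => b _.
exact: (H b s).
Qed.

Lemma radial_continuous x : B x -> {within `[0, 1], continuous (radial x)}.
Proof.
move=> Bx; apply: within_sum => b s.
by apply: cvgM; [exact: cvg_cst|exact: (segment_continuous (e_smooth b) Bx)].
Qed.

Lemma radial_derivative_continuous a x : B x ->
  {within `[0, 1], continuous (radial_derivative a x)}.
Proof.
move=> Bx; apply: within_sum => b s; apply: cvgD; apply: cvgM.
- exact: cvg_cst.
- exact: (segment_continuous (e_smooth b) Bx).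
- exact: cvg_cst.
- apply: cvgM; first by apply: continuous_subspaceT => t; exact: cvg_id.
  exact: (segment_continuous (Cinf_partial a (e_smooth b)) Bx).
Qed.

Lemma integral_radial_derivative a x : B x ->
  (\int[lebesgue_measure]_(s in `[0, 1]) radial_derivative a x s)%R = e a x.
Proof.
move=> Bx.
have s1 : segment_point 1 x = x by rewrite /segment_point scale1r addrC subrK.
have D (s : R) : 0 <= s <= 1 -> is_derive s (1 : R) (fun t : R => t * e a (segment_point t x))
    (radial_derivative a x s).
  move=> s01; have Bs := segment_ball s01 Bx.
  apply: (is_derive_eq (is_deriveM (is_derive_id s (1 : R)) (is_derive_segment (e_smooth a) Bs))).
  by rewrite radial_derivativeE // /GRing.scale /= mulr1 addrC.
have cF := @derivable_within_continuous R R _ `[0, 1] (fun s s01 => @ex_derive _ _ _ _ _ _ _ (D s s01)).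
rewrite /Rintegral (@continuous_FTC2 _ _ (fun t => t * e a (segment_point t x))).
- by rewrite /= mul1r mul0r subr0 s1.
- exact: ltr01.
- exact: radial_derivative_continuous.
- have [_ c0 c1] := (continuous_within_itvP _ ltr01).1 cF.
  by split=> // s /subset_itv_oo_cc s01; exact: (@ex_derive _ _ _ _ _ _ _ (D s s01)).
- move=> s /subset_itv_oo_cc s01; rewrite derive1E.
  exact: (@derive_val _ _ _ _ _ _ _ (D s s01)).
Qed.

Lemma radial_derivative_bound a rho : rho < r -> exists C, forall x s,
  `|x - x0| <= rho -> 0 <= s <= 1 -> `|radial_derivative a x s| <= C.
Proof.
move=> rr; pose K := [set x : 'rV[R]_n | `|x - x0| <= rho].
have KB x : K x -> B x by move=> Kx; exact: le_lt_trans Kx rr.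
have bd g : Cinf B g -> exists C, forall x, K x -> `|g x| <= C.
  move=> sg; have : compact (g @` K).
    apply: continuous_compact; last exact: closed_cube_compact.
    apply: continuous_in_subspaceT => x /set_mem /KB Bx.
    exact: Cinf_continuous sg Bx.
  move=> /compact_bounded [N [_ HN]]; exists (N + 1) => x Kx.
  by apply: (HN (N + 1)); [rewrite ltrDl|exists x].
have [C1 H1] := choice (fun b => bd _ (e_smooth b)).
have [C2 H2] := choice (fun b => bd _ (Cinf_partial a (e_smooth b))).
exists (\sum_b (C1 b + r * C2 b)) => x s Kx s01.
have Ks : K (segment_point s x).
  have /andP[s0 s1] := s01; rewrite /K /= segment_pointB normrZ ger0_norm //.
  by apply: le_trans Kx; rewrite ler_piMl.
apply: (le_trans (ler_norm_sum _ _ _)); apply: ler_sum => b _.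
apply: (le_trans (ler_normD _ _)); apply: lerD.
  rewrite normrM; apply: le_trans (H1 b _ Ks); rewrite ler_piMl //.
  by case: (b == a); rewrite ?normr1 ?normr0.
rewrite normrM; apply: ler_pM; [exact: normr_ge0|exact: normr_ge0| |].
  have := rV_coord_le (x - x0) b; rewrite rV_addE rV_oppE => h.
  by apply: le_trans h _; apply: ltW; exact: KB.
rewrite normrM; apply: le_trans (H2 b _ Ks); rewrite ler_piMl //.
by have /andP[s0 s1] := s01; rewrite ger0_norm.
Qed.

Lemma is_derive_radial_integral a x : B x ->
  is_derive x (delta_mx 0 a) radial_integral (e a x).
Proof.
(* Half the distance from [x] to the boundary of the ball: the shifted points stay in a smaller
   closed ball, on which the derivative is bounded by a constant that serves as the dominating
   function. *)
move=> Bx; pose d := (r - `|x - x0|) / 2.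
have d0 : 0 < d by rewrite divr_gt0 // subr_gt0.
have sh h : `]- d, d[%classic h -> `|h *: delta_mx 0 a + x - x0| <= `|x - x0| + d.
  rewrite /= in_itv /= => /andP[h1 h2]; rewrite -addrA addrC (le_trans (ler_normD _ _)) // lerD2l.
  apply: rV_norm_le; first exact: ltW.
  move=> l; rewrite rV_scaleE normrM.
  apply: (@le_trans _ _ `|h|).
    by rewrite ler_piMr // !mxE eqxx /=; case: (_ == _); rewrite ?normr1 ?normr0.
  by rewrite ler_norml; apply/andP; split; exact: ltW.
have rd : `|x - x0| + d < r.
  move: Bx; rewrite /B /= /d; lra.
have Bh h : `]- d, d[%classic h -> B (h *: delta_mx 0 a + x).
  by move=> /sh hh; exact: le_lt_trans hh rd.
have [C HC] := radial_derivative_bound a rd.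
pose f h s := radial (h *: delta_mx 0 a + x) s.
have f1 h s : `]- d, d[%classic h -> `[0%R, 1%R]%classic s ->
    is_derive h (1 : R) (f ^~ s) (radial_derivative a (h *: delta_mx 0 a + x) s).
  move=> hd s01; apply: is_derive_radial; apply: segment_ball; [exact: s01|exact: Bh].
have d1E h s : `]- d, d[%classic h -> `[0%R, 1%R]%classic s ->
    partial1of2 f h s = radial_derivative a (h *: delta_mx 0 a + x) s.
  by move=> hd s01; rewrite partial1of2E; exact: (@derive_val _ _ _ _ _ _ _ (f1 _ _ hd s01)).
have I0 : `]- d, d[%classic 0 by rewrite /= in_itv /= oppr_lt0 d0.
have mI : measurable (`[0%R, 1%R]%classic : set (measurableTypeR R)) by exact: measurable_itv.
have cst_int (c : R) : (@lebesgue_measure R).-integrable `[0%R, 1%R]%classic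
    (EFin \o (fun=> c)).
  apply: continuous_compact_integrable; first exact: segment_compact.
  by apply: continuous_subspaceT => t; exact: cvg_cst.
have H1 := @derivable_under_integral R _ (measurableTypeR R) lebesgue_measure f
  `[0%R, 1%R]%classic mI 0 (- d) d I0 _ _ (fun=> `|C|) _ _ _.
have H2 := @differentiation_under_integral R _ (measurableTypeR R) lebesgue_measure f
  `[0%R, 1%R]%classic mI 0 (- d) d I0 _ _ (fun=> `|C|) _ _ _.
have p1 h : `]- d, d[%classic h -> (@lebesgue_measure R).-integrable `[0%R, 1%R]%classic (EFin \o f h).
  move=> hd; apply: continuous_compact_integrable; first exact: segment_compact.
  exact: (radial_continuous (Bh _ hd)).
have p2 h s (hd : `]- d, d[%classic h) (s01 : `[0%R, 1%R]%classic s) : derivable (f ^~ s) h 1.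
  exact: (@ex_derive _ _ _ _ _ _ _ (f1 _ _ hd s01)).
have p3 h s : `]- d, d[%classic h -> `[0%R, 1%R]%classic s -> `|partial1of2 f h s| <= `|C|.
  move=> hd s01; rewrite d1E //; apply: le_trans (ler_norm C).
  by apply: HC; [exact: sh|exact: s01].
have {}H1 := H1 p1 p2 (fun=> normr_ge0 _) (cst_int _) p3.
have {}H2 := H2 p1 p2 (fun=> normr_ge0 _) (cst_int _) p3.
apply/is_derive_lineP; apply: DeriveDef; first exact: H1.
rewrite -derive1E [LHS]H2 -(integral_radial_derivative a Bx).
apply: eq_Rintegral => s /set_mem s01; rewrite d1E // scale0r add0r; reflexivity.
Qed.

Lemma poincare : exists2 phi, Cinf B phi & forall a x, B x -> partial a phi x = e a x.
Proof.
have D a x (Bx : B x) : partial a radial_integral x = e a x.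
  exact: (@derive_val _ _ _ _ _ _ _ (is_derive_radial_integral a Bx)).
exists radial_integral => //; apply/CinfP.
have c0 x : B x -> {for x, continuous radial_integral}.
  move=> Bx; have Bn : nbhs x B by apply: open_nbhs_nbhs; split=> //; exact: Bo.
  apply: (@differentiable_continuous R); apply: (@partials_differential _ _ _ _ _ _).1 => l.
    by apply: filterS Bn => y By; exact: (@ex_derive _ _ _ _ _ _ _ (is_derive_radial_integral l By)).
  apply: (continuous_eq_on Bo _ Bx (Cinf_continuous (e_smooth l) Bx)).
  by move=> y By; rewrite D.
case=> [|k]; first by split.
split=> // l; split=> [x Bx|].
  exact: (@ex_derive _ _ _ _ _ _ _ (is_derive_radial_integral l Bx)).
apply: (Ck_eq Bo _ ((CinfP _ _).1 (e_smooth l) k)).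
by move=> y By; rewrite D.
Qed.

End poincare_lemma.

(** * Locally constant functions, clamped paths and gluing over intervals *)

Section local_constancy.
Context {R : realType} {n : nat} {M : ptopologicalType}.
Variable A : smooth_manifold R n M.
Local Notation chart := (chart A).
Local Notation dom := (@dom _ _ _ A).
Local Notation coord := (@coord _ _ _ A).
Local Notation param := (@param _ _ _ A).
Local Notation chart_at := (@chart_at _ _ _ A).
Implicit Types (i j : chart) (p q : M) (u : M -> R) (W : set M).

Lemma near_dom i p (P : set M) : dom i p ->
  (\forall x \near coord i p, P (param i x)) -> \forall q \near p, P q.
Proof.
move=> ip H; have : nbhs p (fun q => P (param i (coord i q))) by exact: (coord_cont ip) H.
have : nbhs p (dom i) by apply: open_nbhs_nbhs; split=> //; exact: dom_open.
by apply: filterS2 => q iq; rewrite coordK.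
Qed.

Lemma pderiv0_near_constant W u q : open W -> sm A W u -> W q ->
  (forall i a p, dom i p -> W p -> pderiv i a u p = 0) ->
  \forall p \near q, u p = u q.
Proof.
move=> Wo uW Wq H; pose i := chart_at q.
have iq : dom i q by exact: mem_chart_at.
apply: (near_dom iq).
pose V := coord i @` (dom i `&` W).
have : nbhs (coord i q) V.
  by apply: open_nbhs_nbhs; split; [exact: coord_image_open|exists q].
move=> /nbhs_rVP[d d0 dV].
have Du : forall y, `|y - coord i q| < d -> forall l,
    derivable (u \o param i) y (delta_mx 0 l) /\ partial l (u \o param i) y = 0.
  move=> y /dV [p [ip Wp] <-] l; split; first exact: sm_derivable uW Wp ip.
  exact: (H i l p ip Wp).
apply/nbhs_rVP; exists d => // y yd.
have z0 : forall l, partial l (u \o param i) (coord i q) = 0.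
  by move=> l; have [] := Du (coord i q) _ l; rewrite ?subrr ?normr0.
have /= := @partials_increment R n (u \o param i) (coord i q) 0 d (lexx 0) _ (y - coord i q) yd.
rewrite mulr0 mul0r (_ : coord i q + (y - coord i q) = y); last by rewrite addrC subrK.
rewrite coordK // /linear_form big1; last first.
  by move=> l _; rewrite z0 mulr0.
rewrite subr0 normr_le0 subr_eq0 => /(_ _)/eqP; apply=> z zd l.
have [D1 D2] := Du z zd l; split; first exact: D1.
by rewrite D2 z0 subr0 normr0.
Qed.

Lemma near_constant_cst (v : R -> R) :
  (forall t, \forall t' \near t, v t' = v t) -> forall s t, v s = v t.
Proof.
move=> H s t; apply: is_derive_0_is_cst => {s t} t.
apply: is_derive_cvg => e e0; have /nbhs_ballP[d /= d0 Hd] := H t.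
exists d => // h hd; rewrite Hd ?subrr ?mulr0 ?subr0 ?normr0.
  by rewrite mulr_ge0 // ltW.
by rewrite /ball /= opprD addrCA subrr addr0 normrN.
Qed.

(** The retraction of the line onto an interval. It turns maps continuous within a segment or a
    square into maps continuous everywhere, with the same values there. *)
Definition clamp (a b t : R) : R := Num.max a (Num.min b t).

Lemma clamp_continuous a b : continuous (clamp a b).
Proof.
move=> t; apply: (@continuous_max _ _ (fun=> a) (fun t => Num.min b t)); first exact: cvg_cst.
by apply: (@continuous_min _ _ (fun=> b) id); [exact: cvg_cst|exact: cvg_id].
Qed.

Lemma clamp_in a b t : a <= b -> a <= clamp a b t <= b.
Proof.
by move=> ab; rewrite /clamp le_max lexx /= ge_max ab ge_min lexx.
Qed.

Lemma clamp_id a b t : a <= t <= b -> clamp a b t = t.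
Proof. by move=> /andP[at' tb]; rewrite /clamp min_r // max_r. Qed.

Lemma clamp_low a m b t : a <= m -> m <= b -> t <= m -> clamp a b t = clamp a m t.
Proof. by move=> am mb tm; rewrite /clamp !min_r // (le_trans tm). Qed.

Lemma clamp_high a m b t : a <= m -> m <= b -> m <= t -> clamp a b t = clamp m b t.
Proof.
move=> am mb mt; have h : m <= Num.min b t by rewrite le_min mb mt.
by rewrite /clamp (max_r h) max_r // (le_trans am).
Qed.

Lemma clamp_ge a b t : a <= b -> b <= t -> clamp a b t = b.
Proof. by move=> ab bt; rewrite /clamp min_l // max_r. Qed.

Lemma clamp_le a b t : t <= a -> clamp a b t = a.
Proof. by move=> ta; rewrite /clamp max_l // ge_min ta orbT. Qed.

Lemma within_comp_continuous {S T U : topologicalType} (D : set T) (f : T -> U) (h : S -> T) :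
  {within D, continuous f} -> continuous h -> (forall z, D (h z)) -> continuous (f \o h).
Proof.
move=> cf ch hD z B HB; have cz := cf (h z).
have {cz HB} HB : within D (nbhs (h z)) (f @^-1` B).
  by have := cz _ HB; rewrite /= (nbhs_subspace_in (hD z)).
by move: (ch z _ HB); apply: (@filterS _ (nbhs z)) => y; apply; exact: hD.
Qed.

Lemma near_constant_path_connected u : @path_connected R M ->
  (forall q, \forall p \near q, u p = u q) -> forall p q, u p = u q.
Proof.
move=> pc H p q; have [c [cc <- <-]] := pc p q.
have c01 (t : R) : `[0, 1]%classic (clamp 0 1 t) by rewrite /= in_itv /= clamp_in.
have cC : continuous (c \o clamp 0 1) := within_comp_continuous cc (@clamp_continuous 0 1) c01.
have := @near_constant_cst (fun t => u (c (clamp 0 1 t))) _ 0 1.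
rewrite !clamp_id ?lexx ?ler01 //; apply => t.
exact: (cC t _ (H (c (clamp 0 1 t)))).
Qed.

(** The supremum argument for compactness of a segment, for a property of intervals that holds
    locally and can be glued. It is applied in each variable of a square in turn. *)
Lemma interval_gluing (P : R -> R -> Prop) :
  (forall a m b, a <= m -> m <= b -> P a m -> P m b -> P a b) ->
  (forall t, exists2 e, 0 < e & forall a b, t - e < a -> a <= b -> b < t + e -> P a b) ->
  forall a b, a <= b -> P a b.
Proof.
move=> glue loc a b ab; pose S := [set x | a <= x <= b /\ P a x].
have Sa : S a.
  split; first by rewrite lexx.
  by have [e e0 He] := loc a; apply: He; rewrite ?ltrBlDr ?ltrDl.
have ubS : ubound S b by move=> x [/andP[]].
have hs : has_sup S by split; [exists a|exists b].
have [e e0 He] := loc (sup S).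
have [x [/andP[ax xb] Px] xs] := sup_adherent e0 hs.
have xle : x <= sup S by apply: ub_le_sup; [exact: hs.2|split=> //; rewrite ax].
pose y := Num.min b (sup S + e / 2).
have xy : x <= y.
  by rewrite le_min xb (le_trans xle) // lerDl divr_ge0 // ltW.
have Py : P a y.
  apply: (glue _ _ _ ax xy Px); apply: He; [exact: xs|exact: xy|].
  by rewrite gt_min ltrD2l gtr_pMr // invf_lt1 ?ltr1n ?orbT.
have ys : y <= sup S.
  apply: ub_le_sup; first exact: hs.2.
  by split=> //; rewrite (le_trans ax xy) ge_min lexx.
suff yb : y = b by rewrite -yb.
apply/eqP; rewrite eq_le ge_min lexx /= leNgt; apply/negP => yb.
have : y = sup S + e / 2.
  by move: yb; rewrite /y minEle; case: ifP => // _; rewrite ltxx.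
by move=> yE; move: ys; rewrite yE gerDl leNgt divr_gt0.
Qed.

End local_constancy.

Section primitive.
Context {R : realType} {n : nat} {M : ptopologicalType}.
Variable A : smooth_manifold R n M.
Local Notation chart := (chart A).
Local Notation dom := (@dom _ _ _ A).
Local Notation coord := (@coord _ _ _ A).
Local Notation param := (@param _ _ _ A).
Local Notation chart_at := (@chart_at _ _ _ A).
Implicit Types (i j : chart) (p q : M) (u : M -> R) (W V : set M).
Variable eta : components A 1.
Hypothesis heta : Omega eta.
Hypothesis heta_closed : ext_deriv eta = @zero_form R n M A 2.

Definition primitive V phi := [/\ open V, sm A V phi &
  forall i a q, dom i q -> V q -> pderiv i a phi q = eta_row eta i q 0 a].

Lemma eta_symmetric_derivative i a b q : dom i q ->
  pderiv i a (fun p => eta_row eta i p 0 b) q = pderiv i b (fun p => eta_row eta i p 0 a) q.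
Proof.
move=> iq; have := congr1 (fun w => w i q [ffun m : 'I_2 => if m == ord0 then a else b]) heta_closed.
rewrite /ext_deriv mem_set // /zero_form !big_ord_recl big_ord0 addr0 /=.
rewrite expr0 expr1 mul1r mulN1r !ffunE /= => /eqP; rewrite subr_eq0 => /eqP.
have E (l : 'I_2) c : (forall m, [ffun m : 'I_2 => if m == ord0 then a else b] (lift l m) = c) ->
   (fun p => eta i p [ffun m => [ffun m : 'I_2 => if m == ord0 then a else b] (lift l m)])
   = (fun p => eta_row eta i p 0 c).
  move=> H; apply/funext => p; rewrite mxE; congr (eta i p _).
  by apply/ffunP => m; rewrite [LHS]ffunE [RHS]ffunE H.
rewrite (E ord0 b); last by move=> m; rewrite ffunE.
rewrite (E _ a) //.
by move=> m; rewrite ffunE (ord1 m).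
Qed.

(** The Poincare lemma in a coordinate ball. The paths inside [V] to nearby points serve in
    [primitive_exists] to compare the global function with [phi]. *)
Lemma local_primitive q : exists V phi, [/\ V q, primitive V phi &
  \forall p \near q, exists c : R -> M,
    [/\ continuous c, c 0 = q, c 1 = p & forall t, 0 <= t <= 1 -> V (c t)]].
Proof.
pose i := chart_at q; have iq : dom i q by exact: mem_chart_at.
pose x0 := coord i q.
have : nbhs x0 (codom i) by apply: open_nbhs_nbhs; split; [exact: codomO|exact: codom_coord].
move=> /nbhs_rVP[r r0 rU].
pose B := [set x : 'rV[R]_n | `|x - x0| < r].
have Bo : open B by exact: rV_ball_open.
have [|a b x Bx|Phi sPhi dPhi] := @poincare R n x0 r (fun a x => eta_row eta i (param i x) 0 a).
- move=> a; apply: (@Cinf_sub _ _ (coord i @` (dom i `&` dom i))).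
    by rewrite setIid.
  exact: (sm_Cinf (sm_eta heta i a) i).
- have ix := rU _ Bx.
  have := eta_symmetric_derivative a b (dom_param ix).
  by rewrite /pderiv paramK.
pose V := dom i `&` coord i @^-1` B.
have Vo : open V by exact: coord_preimage_open.
have Vi : V `<=` dom i by move=> p [].
have im : coord i @` (dom i `&` V) = B.
  apply/seteqP; split=> [_ [p [_ [_ Bp]] <-] //|x Bx].
  have ix := rU _ Bx; exists (param i x); last by rewrite paramK.
  by split; [exact: dom_param|split; [exact: dom_param|rewrite /= paramK]].
have E x : B x -> Phi x = ((Phi \o coord i) \o param i) x.
  by move=> Bx; rewrite /= paramK //; exact: rU.
have sV : sm A V (Phi \o coord i).
  by apply: (sm_chart Vo Vi); rewrite im; exact: Cinf_eq Bo E sPhi.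
have dV a p : V p -> pderiv i a (Phi \o coord i) p = eta_row eta i p 0 a.
  move=> [ip Bp]; rewrite /pderiv -(partial_eq a Bo E Bp) dPhi // coordK //.
exists V, (Phi \o coord i); split.
- by split=> //; rewrite /B /= subrr normr0.
- split=> // j a p jp Vp; have ip := Vi _ Vp.
  rewrite (pderiv_chain a Vo sV Vp jp ip) (eta_row_trans heta jp ip) mxE.
  by apply: eq_bigr => b _; rewrite dV // [_^T b a]mxE mulrC.
- apply: filterS (open_nbhs_nbhs (conj Vo _)); last first.
    by split=> //; rewrite /B /= subrr normr0.
  move=> p [ip Bp].
  have seg t : B (x0 + clamp 0 1 t *: (coord i p - x0)).
    rewrite /B /= addrC addKr normrZ.
    have /andP[t0 t1] := clamp_in t (@ler01 R).
    by rewrite ger0_norm //; apply: le_lt_trans Bp; rewrite ler_piMl.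
  exists (fun t => param i (x0 + clamp 0 1 t *: (coord i p - x0))); split.
  + move=> t; apply: (@continuous_comp _ _ _ (fun t => x0 + clamp 0 1 t *: (coord i p - x0)) (param i)).
      apply: cvgD; first exact: cvg_cst.
      by apply: cvgZr_tmp; exact: clamp_continuous.
    by apply: param_cont; apply: rU; exact: seg.
  + by rewrite clamp_le // scale0r addr0 coordK.
  + by rewrite clamp_ge // scale1r addrC subrK coordK.
  + move=> t _; split; first by apply: dom_param; apply: rU; exact: seg.
    by rewrite /= paramK; [exact: seg|apply: rU; exact: seg].
Qed.

Lemma primitive_near V phi V' phi' q : primitive V phi -> primitive V' phi' -> V q -> V' q ->
  \forall p \near q, phi p - phi q = phi' p - phi' q.
Proof.
move=> [Vo sV dV] [Vo' sV' dV'] Vq Vq'; pose W := V `&` V'.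
have Wo : open W by exact: openI.
have s1 : sm A W phi by apply: sm_sub sV => ? [].
have s2 : sm A W phi' by apply: sm_sub sV' => ? [].
have := pderiv0_near_constant Wo (sm_subr Wo s1 s2) (conj Vq Vq').
have H i a p : dom i p -> W p -> pderiv i a (fun p => phi p - phi' p) p = 0.
  by move=> ip Wp; rewrite (pderivB a s1 s2 Wp ip) dV ?dV' ?subrr //; case: Wp.
by move=> /(_ H); apply: filterS => p; lra.
Qed.

(** * Lifting maps along a closed 1-form *)

(** A primitive of the pullback of [eta] by [K], phrased through increments of local primitives so
    that it makes sense for a merely continuous [K]. *)
Definition lift {T : topologicalType} (K : T -> M) (u : T -> R) :=
  forall z V phi, primitive V phi -> V (K z) ->
    \forall z' \near z, u z' - u z = phi (K z') - phi (K z).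

Lemma liftI {T : topologicalType} (K : T -> M) (u : T -> R) : continuous K ->
  (forall z, exists V phi, [/\ primitive V phi, V (K z) &
     \forall z' \near z, u z' - u z = phi (K z') - phi (K z)]) -> lift K u.
Proof.
move=> cK H z V phi pV Vz; have [V' [phi' [pV' Vz' Hz]]] := H z.
have := cK z _ (primitive_near pV' pV Vz' Vz).
by apply: filterS2 Hz => z' -> /= ->.
Qed.

Lemma lift_comp {S T : topologicalType} (h : S -> T) (K : T -> M) (u : T -> R) :
  continuous h -> lift K u -> lift (K \o h) (u \o h).
Proof. by move=> ch H z V phi pV Vz; exact: (ch z _ (H _ _ _ pV Vz)). Qed.

Lemma lift_primitive {T : topologicalType} (K : T -> M) V phi : continuous K ->
  primitive V phi -> (forall z, V (K z)) -> lift K (phi \o K).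
Proof.
move=> cK pV VK; apply: liftI => // z; exists V, phi; split => //.
by apply: nearW => z'.
Qed.

Lemma lift_unique (c : R -> M) (v w : R -> R) s t : lift c v -> lift c w ->
  v t - v s = w t - w s.
Proof.
move=> Hv Hw; have := @near_constant_cst R (fun t => v t - w t) _ s t.
suff H r : \forall r' \near r, v r' - w r' = v r - w r by move=> /(_ H); lra.
have [V [phi [Vc pV _]]] := local_primitive (c r).
by apply: filterS2 (Hv _ _ _ pV Vc) (Hw _ _ _ pV Vc) => r'; lra.
Qed.

(** To the left of [m] the maps [K2] and [Km] agree, so [u2 - um] is locally constant there and [u1]
    carries the increments; to the right the roles are exchanged. On the line all maps coincide, and
    both descriptions hold nearby. *)
Lemma lift_glue (K K1 K2 Km : R * R -> M) (u1 u2 um : R * R -> R) (m : R) : continuous K ->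
  (forall z, z.1 <= m -> K z = K1 z /\ K2 z = Km z) ->
  (forall z, m <= z.1 -> K z = K2 z /\ K1 z = Km z) ->
  lift K1 u1 -> lift K2 u2 -> lift Km um -> lift K (fun z => u1 z + u2 z - um z).
Proof.
move=> cK lo hi l1 l2 lm; apply: liftI => // z.
have c1 : continuous (fun z : R * R => z.1) by move=> y; exact: cvg_fst.
have [zm|mz|zm] := ltgtP z.1 m.
- have [V [phi [Vz pV _]]] := local_primitive (K1 z).
  have [V' [phi' [Vz' pV' _]]] := local_primitive (Km z).
  have [E1 E2] := lo z (ltW zm).
  exists V, phi; rewrite E1; split => //.
  have : \forall z' \near z, z'.1 < m.
    have : nbhs z.1 [set s | s < m] by apply: open_nbhs_nbhs; split => //; exact: open_lt.
    by move=> /(c1 z).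
  have h1 := l1 _ _ _ pV Vz; have hm := lm _ _ _ pV' Vz'.
  have h2 := l2 z _ _ pV'; rewrite E2 in h2; have {}h2 := h2 Vz'.
  apply: filterS2 (filterI h1 (filterI h2 hm)) => z' [e1 [e2 em]] /ltW /lo [E3 E4].
  move: e1 e2 em; rewrite E3 E4; lra.
- have [V [phi [Vz pV _]]] := local_primitive (K2 z).
  have [V' [phi' [Vz' pV' _]]] := local_primitive (Km z).
  have [E1 E2] := hi z (ltW mz).
  exists V, phi; rewrite E1; split => //.
  have : \forall z' \near z, m < z'.1.
    have : nbhs z.1 [set s | m < s] by apply: open_nbhs_nbhs; split => //; exact: open_gt.
    by move=> /(c1 z).
  have h2 := l2 _ _ _ pV Vz; have hm := lm _ _ _ pV' Vz'.
  have h1 := l1 z _ _ pV'; rewrite E2 in h1; have {}h1 := h1 Vz'.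
  apply: filterS2 (filterI h1 (filterI h2 hm)) => z' [e1 [e2 em]] /ltW /hi [E3 E4].
  move: e1 e2 em; rewrite E3 E4; lra.
- have [V [phi [Vz pV _]]] := local_primitive (K z).
  have zl : z.1 <= m by rewrite zm.
  have zg : m <= z.1 by rewrite zm.
  have [E1 E2] := lo z zl; have [E3 E4] := hi z zg.
  have h1 := l1 z _ _ pV; have h2 := l2 z _ _ pV; have hm := lm z _ _ pV.
  exists V, phi; split => //.
  rewrite -?E4 -?E1 -?E3 in h1 h2 hm.
  apply: filterS2 (filterI (h1 Vz) (h2 Vz)) (hm Vz) => z' [e1 e2] em.
  have [/lo[E5 E6]|/ltW/hi[E5 E6]] := leP z'.1 m; move: e1 e2 em; rewrite E5 E6; lra.
Qed.

Definition clamp2 (a b c d : R) (z : R * R) := (clamp a b z.1, clamp c d z.2).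

Lemma clamp2_continuous a b c d : continuous (clamp2 a b c d).
Proof.
move=> z; apply: (@cvg_pair _ _ _ (nbhs z) (nbhs (clamp a b z.1)) (nbhs (clamp c d z.2)) _ _ _
  (fun z => clamp a b z.1) (fun z => clamp c d z.2)).
  by apply: (@continuous_comp _ _ _ fst (clamp a b)); [exact: cvg_fst|exact: clamp_continuous].
by apply: (@continuous_comp _ _ _ snd (clamp c d)); [exact: cvg_snd|exact: clamp_continuous].
Qed.

(** Clamping makes the restriction of [H] to a rectangle a map on the whole plane, so lifts need no
    boundary conventions. *)
Definition liftable (H : R * R -> M) a b c d := exists u : R * R -> R, lift (H \o clamp2 a b c d) u.

Definition flip (z : R * R) : R * R := (z.2, z.1).

Lemma flip_continuous : continuous (flip).
Proof.
move=> z; apply: (@cvg_pair _ _ _ (nbhs z) (nbhs z.2) (nbhs z.1) _ _ _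
  (fun z => z.2) (fun z => z.1)); [exact: cvg_snd|exact: cvg_fst].
Qed.

Lemma liftable_flip H a b c d : liftable (H \o flip) a b c d -> liftable H c d a b.
Proof.
case=> u lu; exists (u \o flip).
by have := lift_comp flip_continuous lu; congr lift; apply/funext => -[].
Qed.

Lemma liftable_glue H a m b c d : continuous H -> a <= m -> m <= b ->
  liftable H a m c d -> liftable H m b c d -> liftable H a b c d.
Proof.
move=> cH am mb [u1 l1] [u2 l2].
have cK e f : continuous (H \o clamp2 e f c d).
  move=> z; apply: continuous_comp; [exact: clamp2_continuous|exact: cH].
have ce : continuous (fun z : R * R => (m, z.2)).
  move=> z; apply: (@cvg_pair _ _ _ (nbhs z) (nbhs m) (nbhs z.2) _ _ _ (fun=> m) (fun z => z.2)).
    exact: cvg_cst.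
  exact: cvg_snd.
have lm := lift_comp ce l1.
exists (fun z => u1 z + u2 z - u1 (m, z.2)).
apply: (lift_glue (m := m) (cK a b) _ _ l1 l2 lm) => -[s t] /= sm; rewrite /clamp2 /=.
  by rewrite (clamp_low am mb sm) (clamp_le b sm) (clamp_ge am (lexx m)).
by rewrite (clamp_high am mb sm) (clamp_ge am sm) (clamp_ge am (lexx m)).
Qed.

Lemma liftable_small H (s t : R) : continuous H -> exists2 e, 0 < e &
  forall a b c d, s - e < a -> a <= b -> b < s + e -> t - e < c -> c <= d -> d < t + e ->
    liftable H a b c d.
Proof.
move=> cH; have [V [phi [Vz pV _]]] := local_primitive (H (s, t)).
have Vo : open V by case: pV.
have : nbhs (s, t) (H @^-1` V) by apply: (cH (s, t)); exact: open_nbhs_nbhs.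
move=> /nbhs_ballP[e /= e0 He]; exists e => // a b c d sa ab bs tc cd dt.
exists (phi \o (H \o clamp2 a b c d)); apply: lift_primitive pV _.
  move=> z; apply: continuous_comp; [exact: clamp2_continuous|exact: cH].
move=> z; apply: He.
have /andP[a1 b1] := clamp_in z.1 ab; have /andP[c1 d1] := clamp_in z.2 cd.
split; rewrite /ball /= ltr_distlC; apply/andP; split.
- exact: lt_le_trans sa a1.
- exact: le_lt_trans b1 bs.
- exact: lt_le_trans tc c1.
- exact: le_lt_trans d1 dt.
Qed.

(** Small squares lift by a local primitive. Gluing in the second variable gives a strip around each
    [s], of a width that stays positive as a minimum of two at each gluing; the strips are then
    glued in the first variable. *)
Lemma lift_exists H : continuous H -> liftable H 0 1 0 1.
Proof.
move=> cH; have cHs : continuous (H \o flip).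
  by move=> z; apply: continuous_comp; [exact: flip_continuous|exact: cH].
apply: (@interval_gluing R (fun a b => liftable H a b 0 1)) => //.
  by move=> a m b am mb; exact: liftable_glue.
move=> s.
apply: (@interval_gluing R (fun c d => exists2 e, 0 < e &
   forall a b, s - e < a -> a <= b -> b < s + e -> liftable H a b c d)) => //.
  move=> c m d cm md [e1 e10 H1] [e2 e20 H2].
  exists (Num.min e1 e2); first by rewrite lt_min e10.
  move=> a b; rewrite ltrBlDr -ltrBlDl lt_min => /andP[a1 a2] ab.
  rewrite -ltrBlDl lt_min => /andP[b1 b2].
  apply: liftable_flip; apply: (liftable_glue cHs cm md); apply: liftable_flip.
    have -> : (H \o flip) \o flip = H by apply/funext => -[].
    by apply: H1 => //; lra.
  have -> : (H \o flip) \o flip = H by apply/funext => -[].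
  by apply: H2 => //; lra.
move=> t; have [e e0 He] := liftable_small s t cH; exists e => // c d tc cd dt.
by exists e => // a b sa ab bs; exact: He.
Qed.

(** The integral of [eta] along a continuous path, read off from a lift of the path. *)
Definition increment (c : R -> M) x := exists2 w, lift (c \o clamp 0 1) w & x = w 1 - w 0.

Lemma increment_unique c x y : increment c x -> increment c y -> x = y.
Proof. by case=> w lw ->; case=> v lv ->; exact: lift_unique lw lv. Qed.

Lemma increment_lift (c : R -> M) (w : R -> R) (h : R -> R) d x : continuous h ->
  lift c w -> (forall t, c (h t) = d (clamp 0 1 t)) -> increment d x -> x = w (h 1) - w (h 0).
Proof.
move=> ch lw E Ix; apply: (increment_unique Ix); exists (w \o h) => //.
have := lift_comp ch lw; congr lift; exact/funext.
Qed.

Lemma increment_exists c : continuous c -> exists x, increment c x.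
Proof.
move=> cc; have cH : continuous (fun z : R * R => c z.2).
  by move=> z; apply: (@continuous_comp _ _ _ snd c); [exact: cvg_snd|exact: cc].
have [u lu] := lift_exists cH.
have ch : continuous (fun t : R => ((0, t) : R * R)).
  move=> t; apply: (@cvg_pair _ _ _ (nbhs t) (nbhs (0:R)) (nbhs t) _ _ _ (fun=> 0) id).
    exact: cvg_cst.
  exact: cvg_id.
by exists (u (0, 1) - u (0, 0)), (fun t => u (0, t)) => //; exact: lift_comp ch lu.
Qed.

Lemma increment_cst p x : increment (fun=> p) x -> x = 0.
Proof.
move=> H; apply: (increment_unique H); exists (fun=> 0); last by rewrite subrr.
by move=> z V phi _ _; apply: (@filterS _ (nbhs z) _ setT); [move=> z' _; rewrite !subrr|exact: filterT].
Qed.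

Definition concat (c d : R -> M) (t : R) := if t <= 1 / 2 then c (2 * t) else d (2 * t - 1).

Lemma half_double : 2 * (1 / 2) = 1 :> R. Proof. by field. Qed.

Lemma concat_low c d t : t <= 1 / 2 -> concat c d t = c (2 * t).
Proof. by rewrite /concat => ->. Qed.

Lemma concat_high c d t : c 1 = d 0 -> 1 / 2 <= t -> concat c d t = d (2 * t - 1).
Proof.
move=> cd; rewrite /concat; case: ltgtP => // <- _.
by rewrite half_double subrr.
Qed.

Lemma concat_continuous (c d : R -> M) : continuous c -> continuous d -> c 1 = d 0 -> continuous (concat c d).
Proof.
move=> cc cd E t.
have l1 : continuous (fun t : R => c (2 * t)).
  by move=> s; apply: (@continuous_comp _ _ _ (fun t : R => 2 * t) c); [exact: mulrl_continuous|exact: cc].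
have l2 : continuous (fun t : R => d (2 * t - 1)).
  move=> s; apply: (@continuous_comp _ _ _ (fun t : R => 2 * t - 1) d); last exact: cd.
  by apply: cvgB; [exact: mulrl_continuous|exact: cvg_cst].
have [th|th|th] := ltgtP t (1 / 2).
- apply: (@continuous_eq_on _ _ [set s : R | s < 1 / 2] (fun t : R => c (2 * t)) _ _ _ _ th (l1 t)).
    exact: open_lt.
  by move=> s sh; rewrite concat_low // ltW.
- apply: (@continuous_eq_on _ _ [set s : R | 1 / 2 < s] (fun t : R => d (2 * t - 1)) _ _ _ _ th (l2 t)).
    exact: open_gt.
  by move=> s sh; rewrite concat_high // ltW.
- have tl : t <= 1 / 2 by rewrite th.
  have tg : 1 / 2 <= t by rewrite th.
  move=> B HB; have B1 := l1 t B; have B2 := l2 t B.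
  rewrite -(concat_low c d tl) in B1; rewrite -(concat_high E tg) in B2.
  move: (B1 HB) (B2 HB); apply: (@filterS2 _ (nbhs t)) => s s1 s2.
  by rewrite /= /concat; case: ifP.
Qed.

Lemma increment_concat (c d : R -> M) x y z : continuous c -> continuous d -> c 1 = d 0 ->
  increment c x -> increment d y -> increment (concat c d) z -> z = x + y.
Proof.
move=> cc cd E Ic Id [w lw ->].
have cl t := clamp_in t (@ler01 R).
have k1 : continuous (fun t : R => clamp 0 1 t / 2).
  by move=> t; apply: cvgM; [exact: clamp_continuous|exact: cvg_cst].
have k2 : continuous (fun t : R => (clamp 0 1 t + 1) / 2).
  move=> t; apply: cvgM; last exact: cvg_cst.
  by apply: cvgD; [exact: clamp_continuous|exact: cvg_cst].
have cl0 : clamp 0 1 (0 : R) = 0 by rewrite clamp_le.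
have cl1 : clamp 0 1 (1 : R) = 1 by rewrite clamp_ge.
rewrite (increment_lift k1 lw _ Ic) ?(increment_lift k2 lw _ Id); last 2 first.
- move=> t /=; have /andP[t0 t1] := cl t.
  rewrite clamp_id; last by apply/andP; split; lra.
  rewrite concat_high //; first by congr (d _); field.
  by lra.
- move=> t /=; have /andP[t0 t1] := cl t.
  rewrite clamp_id; last by apply/andP; split; lra.
  rewrite concat_low; first by congr (c _); field.
  by lra.
rewrite cl0 cl1 mul0r add0r (_ : (1 + 1) / 2 = 1 :> R); last by field.
lra.
Qed.

Lemma increment_reverse c x y : increment c x -> increment (fun t => c (1 - t)) y -> y = - x.
Proof.
move=> [w lw ->] Iy.
have k : continuous (fun t : R => 1 - t).
  by move=> t; apply: cvgB; [exact: cvg_cst|exact: cvg_id].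
rewrite (increment_lift k lw _ Iy) ?subrr ?subr0 ?opprB // => t.
rewrite /= /clamp; congr c.
by rewrite !maxEle !minEle; do !case: ifP; lra.
Qed.

(** The null homotopy lifts to the square. Its right, bottom and top sides are constant paths, so
    the lift takes equal values at the two ends of the left side, which is [c]. *)
Lemma increment_loop (c : R -> M) x : @simply_connected R M -> continuous c -> c 0 = c 1 ->
  increment c x -> x = 0.
Proof.
move=> [_ sc] cc c01 Ic.
have [H0 [cH H0c H1c Hs]] := sc c (continuous_subspaceT cc) c01.
have c2 z : (`[0, 1]%classic `*` `[0, 1]%classic) (clamp2 (0:R) 1 0 1 z).
  by split; rewrite /= in_itv /= clamp_in.
have [u lu] := lift_exists (within_comp_continuous cH (@clamp2_continuous 0 1 0 1) c2).
have ct (s : R) : continuous (fun t : R => ((s, t) : R * R)).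
  move=> t; apply: (@cvg_pair _ _ _ (nbhs t) (nbhs s) (nbhs t) _ _ _ (fun=> s) id).
    exact: cvg_cst.
  exact: cvg_id.
have cs (t : R) : continuous (fun s : R => ((s, t) : R * R)).
  move=> s; apply: (@cvg_pair _ _ _ (nbhs s) (nbhs s) (nbhs t) _ _ _ id (fun=> t)).
    exact: cvg_id.
  exact: cvg_cst.
have cl0 : clamp 0 1 (0 : R) = 0 by rewrite clamp_le.
have cl1 : clamp 0 1 (1 : R) = 1 by rewrite clamp_ge.
have ci (t : R) : `[0, 1]%classic (clamp 0 1 t) by rewrite /= in_itv /= clamp_in.
have cc2 (t : R) : clamp 0 1 (clamp 0 1 t) = clamp 0 1 t.
  by rewrite clamp_id // clamp_in.
have left := lift_comp (ct 0) lu; have right := lift_comp (ct 1) lu.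
have bottom := lift_comp (cs 0) lu; have top := lift_comp (cs 1) lu.
have el : lift (c \o clamp 0 1) (fun t => u (0, t)).
  move: left; congr lift; apply/funext => t /=.
  by rewrite /clamp2 /= !cl0 !cc2 H0c.
have cst0 (w : R -> R) : lift (fun=> c 0) w -> w 1 = w 0.
  move=> lw; apply/eqP; rewrite -subr_eq0; apply/eqP.
  by apply: (@increment_cst (c 0)); exists w.
have er : u (1, 1) = u (1, 0).
  apply: (cst0 (fun t => u (1, t))); move: right; congr lift; apply/funext => t /=.
  by rewrite /clamp2 /= !cl1 !cc2 H1c.
have eb : u (1, 0) = u (0, 0).
  apply: (cst0 (fun s => u (s, 0))); move: bottom; congr lift; apply/funext => t /=.
  by rewrite /clamp2 /= !cl0 !cc2 (Hs _ (ci t)).1.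
have et : u (1, 1) = u (0, 1).
  apply: (cst0 (fun s => u (s, 1))); move: top; congr lift; apply/funext => t /=.
  by rewrite /clamp2 /= !cl1 !cc2 (Hs _ (ci t)).2.
have := increment_unique Ic (ex_intro2 _ _ _ el erefl).
by rewrite -et er eb subrr.
Qed.

(** The value of [f] at [q] is the increment along a chosen path from the base point. For [p] near
    [q], the path to [q], a short path [s] inside [V] and the reversed path to [p] form a loop,
    whose increment vanishes; hence [f] and [phi] have the same increment. *)
Lemma primitive_exists : @simply_connected R M -> exists f, primitive setT f.
Proof.
move=> sc; have [pc _] := sc.
have PC q : exists c : R -> M, [/\ continuous c, c 0 = point & c 1 = q].
  have [c [cc c0 c1]] := pc point q.
  have c01 (t : R) : `[0, 1]%classic (clamp 0 1 t) by rewrite /= in_itv /= clamp_in.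
  exists (c \o clamp 0 1); split.
  - exact: within_comp_continuous cc (@clamp_continuous R 0 1) c01.
  - by rewrite /= clamp_le.
  - by rewrite /= clamp_ge.
have [c /all_and3[cc c0 c1]] := choice PC.
have [f If] := choice (fun q => increment_exists (cc q)).
have loc q : exists V phi, [/\ V q, primitive V phi & \forall p \near q, f p - f q = phi p - phi q].
  have [V [phi [Vq pV H]]] := local_primitive q.
  exists V, phi; split => //; apply: filterS H => p [s [cs s0 s1 sV]].
  have rc : continuous (fun t : R => c p (1 - t)).
    move=> t; apply: (@continuous_comp _ _ _ (fun t : R => 1 - t) (c p)); last exact: cc.
    by apply: cvgB; [exact: cvg_cst|exact: cvg_id].
  have j1 : c q 1 = s 0 by rewrite c1 s0.
  have j2 : concat (c q) s 1 = c p (1 - 0).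
    rewrite concat_high //; last by lra.
    by rewrite subr0 c1 mulr1 (_ : 2 - 1 = 1 :> R) ?s1 //; lra.
  have cq := concat_continuous (cc q) cs j1.
  have cr := concat_continuous cq rc j2.
  have [x Ix] := increment_exists cs.
  have [y Iy] := increment_exists rc.
  have [z Iz] := increment_exists cq.
  have [w Iw] := increment_exists cr.
  have Ew := increment_concat cq rc j2 Iz Iy Iw.
  have Ez := increment_concat (cc q) cs j1 (If q) Ix Iz.
  have Ey := increment_reverse (If p) Iy.
  have w0 : w = 0.
    apply: (increment_loop sc cr _ Iw).
    rewrite concat_low; last by lra.
    rewrite mulr0 concat_low; last by lra.
    rewrite mulr0 c0 concat_high //; last by lra.
    by rewrite (_ : 1 - (2 * 1 - 1) = 0 :> R) ?c0 //; lra.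
  have cl : continuous (s \o clamp 0 1).
    by move=> t; apply: continuous_comp; [exact: clamp_continuous|exact: cs].
  have ls : lift (s \o clamp 0 1) (phi \o (s \o clamp 0 1)).
    by apply: lift_primitive cl pV _ => t; apply: sV; exact: clamp_in.
  have := increment_unique Ix (ex_intro2 _ _ _ ls erefl).
  rewrite /= clamp_ge // clamp_le // s0 s1 => xE.
  by rewrite -xE; move: Ew; rewrite w0 Ez Ey; lra.
have near_open q : exists W V phi, [/\ open W, W q, W `<=` V, primitive V phi &
    forall p, W p -> phi p + (f q - phi q) = f p].
  have [V [phi [Vq pV]]] := loc q; rewrite -nbhs_nearE nbhsE => -[W [Wo Wq] HW].
  have Vo : open V by case: pV.
  exists (W `&` V), V, phi; split => //; first exact: openI.
  by move=> p [/HW /= h _]; lra.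
have sf q : exists W phi, [/\ open W, W q, sm A W phi, forall p, W p -> phi p = f p &
    forall i a p, dom i p -> W p -> pderiv i a phi p = eta_row eta i p 0 a].
  have [W [V [phi [Wo Wq WV [Vo sV dV] E]]]] := near_open q.
  have sW := sm_sub WV sV.
  exists W, (fun p => phi p + (f q - phi q)); split => //.
    by apply: sm_add => //; exact: sm_cst.
  move=> i a p ip Wp; rewrite (pderivD a sW (@sm_cst _ _ _ A W _) Wp ip) dV //; last exact: WV.
  by rewrite pderiv_cst addr0.
exists f; split; first exact: openT.
- apply: sm_local => q _; have [W [phi [Wo Wq sW E _]]] := sf q.
  by exists W => //; exact: sm_eq Wo E sW.
- move=> i a q iq _; have [W [phi [Wo Wq sW E dW]]] := sf q.
  by rewrite -(pderiv_eq a Wo E iq Wq) dW.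
Qed.

End primitive.

(** * Vanishing of harmonic forms *)

Section cutoff_argument.
Context {R : realType} {n : nat} {M : ptopologicalType}.
Variable A : smooth_manifold R n M.
Local Notation chart := (chart A).
Local Notation dom := (@dom _ _ _ A).
Variable g : chart -> M -> 'M[R]_n.
Hypothesis hg : riemannian_metric g.
Hypothesis hcomplete : complete_metric g.
Variable vol : {measure set (g_sigma_algebraType (@open M)) -> \bar R}.
Hypothesis hvol : riemannian_volume g vol.

Lemma small_multiple_contradiction (c v d : R) : 0 < c -> 0 < v ->
  (forall e, 0 < e -> e <= 1 -> c * v <= d * e) -> False.
Proof.
move=> c0 v0 H; have d1 : 0 < `|d| + 1 by rewrite ltr_pwDr.
have cv : 0 < c * v by rewrite mulr_gt0.
pose e := Num.min 1 (c * v / (2 * (`|d| + 1))).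
have e0 : 0 < e by rewrite lt_min ltr01 divr_gt0 // mulr_gt0.
have e1 : e <= 1 by rewrite ge_min lexx.
have := H e e0 e1; apply/negP; rewrite -ltNge.
apply: (@le_lt_trans _ _ ((`|d| + 1) * e)).
  by rewrite ler_pM2r // (le_trans (ler_norm d)) // lerDl.
apply: (@le_lt_trans _ _ (c * v / 2)).
  rewrite mulrC -ler_pdivlMr // ge_min; apply/orP; right.
  by rewrite invfM mulrA.
by rewrite gtr_pMr // invf_lt1 // ltr1n.
Qed.

(** The common end of both steps of the proof: [f] is first the squared norm of [L_X alpha], halved,
    then the squared norm of [alpha] times a positive weight. The restriction [e <= 1] lets an error
    quadratic in [e] count as linear. *)
Lemma cutoff_vanishing (f N : M -> R) (C : R) p :
  continuous f -> (forall q, 0 <= f q) ->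
  continuous N -> (forall q, 0 <= N q) -> (\int[vol]_q (N q)%:E < +oo)%E ->
  (forall (chi : M -> R) e, 0 < e -> e <= 1 -> sm A setT chi ->
     (forall q, 0 <= chi q <= 1) ->
     (exists2 K, compact K & forall q, ~ K q -> chi q = 0) ->
     (forall i q, dom i q -> gradient_square g i chi q <= e ^+ 2) ->
     exists G : M -> R, [/\ vol.-integrable setT (EFin \o G), (\int[vol]_q (G q)%:E = 0)%E &
       forall q, chi q * chi q * f q <= G q + C * e * N q]) ->
  f p = 0.
Proof.
move=> cf f0 cN N0 Nfin H.
have [W [Wo Wp HW]] := cutoff_exists hg hcomplete p.
have [m hm] := @lebesgue_Rn_exists R n.
apply: contrapT => fp0.
have fp : 0 < f p by rewrite lt_neqAle f0 eq_sym andbT; apply/eqP.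
pose c := f p / 2; have c0 : 0 < c by rewrite divr_gt0.
(* On this set, of positive volume, [chi = 1] for every [e] while [f] exceeds [c]; hence [c] times
   its volume is at most a constant times [e]. *)
pose W' := W `&` f @^-1` [set t | c < t].
have W'o : open W'.
  apply: openI => //; apply: open_comp; last exact: open_gt.
  by move=> q _; exact: cf.
have W'p : W' p by split=> //=; rewrite /c ltr_pdivrMr // ltr_pMr // ltr1n.
have mW' : measurable (W' : set (borel M)) by exact: borel_open.
have volW' := open_positive_volume hg hvol hm W'o W'p.
have mN := continuous_borel cN.
have iN : vol.-integrable setT (EFin \o N).
  apply/integrableP; split; first exact/measurable_EFinP.
  rewrite (_ : (fun x => _) = fun q => (N q)%:E) //.
  by apply/funext => q /=; rewrite ger0_norm.
have Nf : (\int[vol]_q (N q)%:E)%E \is a fin_num by exact: integrable_fin_num.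
pose a := fine (\int[vol]_q (N q)%:E)%E.
have main e : 0 < e -> e <= 1 -> (c%:E * vol W' <= (C * a * e)%:E)%E.
  move=> e0 e1; have [chi [chis chi01 chi1 [K Kc chi0] gradK]] := HW e e0.
  have [G [iG G0 HG]] := H chi e e0 e1 chis chi01 (ex_intro2 _ _ K Kc chi0) gradK.
  pose F q := chi q * chi q * f q.
  have cF : continuous F.
    move=> q; have cchi : {for q, continuous chi} by exact: (sm_continuous chis).
    exact: (cvgM (cvgM cchi cchi) (cf q)).
  have F0 q : ~ K q -> F q = 0 by move=> /chi0 h; rewrite /F h mul0r mul0r.
  have iF := compact_support_integrable hg hvol cF Kc F0.
  have Fge q : 0 <= F q.
    by rewrite /F mulr_ge0 // mulr_ge0 //; case/andP: (chi01 q).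
  apply: (@le_trans _ _ (\int[vol]_q (F q)%:E)%E).
    rewrite -(setIT W') -(integral_indic vol) // -ge0_integralZl //; last 2 first.
    - exact/measurable_EFinP.
    - by rewrite lee_fin ltW.
    apply: ge0_le_integral => //.
    - by move=> q _; rewrite mule_ge0 // lee_fin ltW.
    - by apply: emeasurable_funM => //; exact/measurable_EFinP.
    - by apply/measurable_EFinP; exact: continuous_borel.
    move=> q _; rewrite -EFinM lee_fin indicE.
    case: (boolP (q \in W')) => [/set_mem [Wq fq]|_]; last by rewrite mulr0.
    by rewrite mulr1 /F chi1 // !mul1r ltW.
  have iCN : vol.-integrable setT (EFin \o (fun q => C * e * N q)).
    have := @integrableZl _ _ _ vol setT measurableT (C * e) _ iN.
    by congr (_.-integrable _ _); apply/funext => q /=; rewrite EFinM.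
  apply: (@le_trans _ _ (\int[vol]_q ((G q)%:E + (C * e * N q)%:E))%E).
    apply: le_integral => //.
    - exact: integrableD.
    - by move=> q _; rewrite -EFinD lee_fin; exact: HG.
  rewrite integralD // G0 add0e.
  have -> : (\int[vol]_q (C * e * N q)%:E = (C * e)%:E * \int[vol]_q (N q)%:E)%E.
    rewrite -(@integralZl _ _ _ vol setT measurableT _ iN).
    by apply: eq_integral => q _; rewrite EFinM.
  by rewrite -(fineK Nf) -EFinM lee_fin -/a mulrAC.
(* Finiteness of the volume comes from the inequality itself at [e = 1]. *)
have vfin : vol W' \is a fin_num.
  rewrite ge0_fin_numE ?ltW //.
  have := le_lt_trans (main 1 ltr01 (lexx 1)) (ltry _).
  by case: (vol W') volW' => [r| |] //= _; rewrite ?ltry // gt0_muley ?lte_fin.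
apply: (@small_multiple_contradiction c (fine (vol W')) (C * a) c0).
  by rewrite fine_gt0 // volW' -ge0_fin_numE ?ltW.
by move=> e e0 e1; have := main e e0 e1; rewrite -(fineK vfin) -EFinM lee_fin.
Qed.

End cutoff_argument.

(** * The constant norm of eta and the two cutoff estimates *)

Section parallel_one_form.
Context {R : realType} {n : nat} {M : ptopologicalType}.
Variable A : smooth_manifold R n M.
Local Notation chart := (chart A).
Local Notation dom := (@dom _ _ _ A).
Local Notation chart_at := (@chart_at _ _ _ A).
Local Notation components k := (components A k).
Variable g : chart -> M -> 'M[R]_n.
Hypothesis hg : riemannian_metric g.
Variable eta : components 1.
Hypothesis heta : Omega eta.
Hypothesis heta_parallel : parallel g eta.
Local Notation X := (dual_field g eta).
Implicit Types (i j : chart) (p q : M).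

Definition eta_square i p : R := (eta_row eta i p *m (X i p)^T) 0 0.

Lemma eta_squareE i p : eta_square i p = \sum_b eta_row eta i p 0 b * X i p 0 b.
Proof. by rewrite /eta_square [LHS]mxE; apply: eq_bigr => b _; rewrite [_^T b 0]mxE. Qed.

Lemma eta_square_chart i j p : dom i p -> dom j p -> eta_square i p = eta_square j p.
Proof.
move=> ip jp; rewrite /eta_square (dual_field_trans hg heta ip jp) [(X i p *m _)^T]trmx_mul.
by rewrite [in LHS](eta_row_trans heta ip jp) mulmxA.
Qed.

Lemma eta_square_metric i p : dom i p -> eta_square i p = (X i p *m g i p *m (X i p)^T) 0 0.
Proof. by move=> ip; rewrite /eta_square (eta_rowE hg eta ip). Qed.

Lemma eta_square_near_constant p : \forall q \near p, eta_square (chart_at q) q = eta_square (chart_at p) p.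
Proof.
have E i : forall q, dom i q ->
    \sum_b eta_row eta i q 0 b * X i q 0 b = eta_square (chart_at q) q.
  by move=> q iq; rewrite -eta_squareE; apply: eta_square_chart => //; exact: in_chart_at.
have s i : sm A (dom i) (fun q => eta_square (chart_at q) q).
  apply: (sm_eq (domO i) (E i)); apply: (sm_sum _ (domO i)) => b _.
  exact: (sm_mul (domO i) (sm_eta heta i b) (sm_dual_field hg heta i b)).
apply: (@pderiv0_near_constant _ _ _ A setT _ p openT) => //.
  by apply: sm_local => q _; exists (dom (chart_at q)); [exact: in_chart_at|exact: s].
move=> i a q iq _; rewrite -(pderiv_eq a (domO i) (E i) iq iq).
exact: norm_eta_derivative.
Qed.

Lemma eta_square_constant : @path_connected R M -> eta <> @zero_form R n M A 1 ->
  exists2 c, 0 < c & forall i p, dom i p -> eta_square i p = c.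
Proof.
move=> pc eta0.
have E := near_constant_path_connected pc eta_square_near_constant.
have Ec i p : dom i p -> eta_square i p = eta_square (chart_at point) point.
  move=> ip; rewrite (eta_square_chart ip (in_chart_at A p)); exact: E.
exists (eta_square (chart_at point) point) => //.
have [_ _ pos _] := hg.
rewrite ltNge; apply/negP => c0; apply: eta0.
have X0 i p : dom i p -> X i p = 0.
  move=> ip; apply/eqP; apply: contraT => /(pos i p _ ip).
  by rewrite -eta_square_metric // Ec // ltNge c0.
apply/funext => i; apply/funext => p; apply/funext => I; rewrite /zero_form.
have [ip|ip] := pselect (dom i p); last by rewrite (Omega_out heta ip).
have : eta_row eta i p = 0 by rewrite (eta_rowE hg eta ip) X0 // mul0mx.
move=> /(congr1 (fun v : 'rV[R]_n => v 0 (I ord0))); rewrite !mxE => <-.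
by congr (eta i p _); apply/ffunP => m; rewrite ffunE (ord1 m).
Qed.

Variable c0 : R.
Hypothesis c0_gt0 : 0 < c0.
Hypothesis eta_square_eq : forall i p, dom i p -> eta_square i p = c0.

Lemma derX_primitive f i p : primitive eta setT f -> dom i p -> derX g eta i f p = c0.
Proof.
move=> [_ _ df] ip; rewrite -(eta_square_eq ip) eta_squareE /derX.
by apply: eq_bigr => c _; rewrite df // mulrC.
Qed.

(* Expand the nonnegative square of the norm of grad u - (X u / c0) X. *)
Lemma derX_gradient_le u i p : dom i p -> derX g eta i u p ^+ 2 <= gradient_square g i u p * c0.
Proof.
move=> ip; set xi := gradient_row i u p; set G := invmx (g i p).
have gu := metric_unit hg ip.
have GT : G^T = G := invmx_metric_sym hg ip.
have XE : X i p *m g i p *m G = X i p by rewrite mulmxK.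
set d := derX g eta i u p.
have dE : d = (xi *m (X i p)^T) 0 0.
  rewrite /d /derX [RHS]mxE; apply: eq_bigr => c _.
  by rewrite [_^T c 0]mxE [xi _ _]mxE mulrC.
have dE' : (X i p *m xi^T) 0 0 = d.
  by rewrite dE -[X i p *m xi^T]trmxK trmx_mul trmxK [LHS]mxE.
have cE : (X i p *m g i p *m (X i p)^T) 0 0 = c0 by rewrite -eta_square_metric // eta_square_eq.
have [Q Qu GE] := invmx_metric_factor hg ip.
pose y := xi - (d / c0) *: (X i p *m g i p).
have : 0 <= (y *m G *m y^T) 0 0.
  rewrite /G GE mulmxA -mulmxA -trmx_mul row_square; apply: sumr_ge0 => l _; exact: sqr_ge0.
set t := d / c0.
have yG : y *m G = xi *m G - t *: X i p by rewrite /y mulmxDl mulNmx -scalemxAl XE.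
have yT : y^T = xi^T - t *: (g i p *m (X i p)^T).
  by rewrite /y linearB /= linearZ /= trmx_mul (metric_sym hg ip).
have xX : xi *m G *m (g i p *m (X i p)^T) = xi *m (X i p)^T.
  by rewrite -mulmxA [G *m _]mulmxA mulVmx // mul1mx.
have -> : (y *m G *m y^T) 0 0 = gradient_square g i u p - t * d - t * d + t * t * c0.
  rewrite yG yT mulmxBr !mulmxBl -!scalemxAl -!scalemxAr xX mulmxA.
  rewrite !rV_addE !rV_oppE !rV_addE !rV_oppE !rV_scaleE -dE dE' cE /gradient_square -/xi -/G.
  by ring.
rewrite /t => H.
have dc : d / c0 * c0 = d by rewrite mulfVK // lt0r_neq0.
have := mulr_ge0 H (ltW c0_gt0).
have -> : (gradient_square g i u p - d / c0 * d - d / c0 * d + d / c0 * (d / c0) * c0) * c0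
  = gradient_square g i u p * c0 - d * (d / c0 * c0) - d * (d / c0 * c0) + d / c0 * c0 * (d / c0 * c0) by ring.
rewrite dc expr2; lra.
Qed.

Lemma form_dot_zero_l k (w : components k) p : form_dot g (@zero_form R n M A k) w p = 0.
Proof. by rewrite /form_dot big1 ?mulr0 // => I _; rewrite big1 // => J _; rewrite !mul0r. Qed.

Lemma form_dot_zero_r k (w : components k) p : form_dot g w (@zero_form R n M A k) p = 0.
Proof. by rewrite /form_dot big1 ?mulr0 // => I _; rewrite big1 // => J _; rewrite mulr0 mul0r. Qed.

Lemma ext_deriv_square_zero k (w : components k) : Omega w ->
  ext_deriv (ext_deriv w) = @zero_form R n M A k.+2.
Proof.
move=> Ow; apply/funext => i; apply/funext => p; apply/funext => I.
have [ip|ip] := pselect (dom i p); first exact: ext_deriv_ext_deriv.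
by rewrite /ext_deriv memNset.
Qed.

Definition scale_form k (u : M -> R) (w : components k) : components k :=
  fun i p I => u p * w i p I.

Lemma ext_deriv_scale_square k (chi : M -> R) (b : components k) i p :
  sm A setT chi -> Omega b -> dom i p ->
  ext_deriv (scale_form (fun q => chi q * chi q) b) i p =
  fun I => 2 * chi p * wedge1 (fun a => pderiv i a chi p) (b i p) I
     + chi p * chi p * ext_deriv b i p I.
Proof.
move=> chis Ob ip; apply/funext => I; rewrite !ext_derivE //.
rewrite /exterior /wedge1 !mulr_sumr -big_split; apply: eq_bigr => l _ /=.
have cs : sm A (dom i) chi by apply: sm_sub chis.
rewrite (pderivM _ (sm_mul (domO i) cs cs) (Omega_sm i _ Ob) ip ip).
rewrite (pderivM _ cs cs ip ip); ring.
Qed.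

Lemma cutoff_form_numeric (x K2 S e2 c tuu twu tww tbb taa : R) :
  0 <= K2 -> S <= e2 -> 0 <= tbb -> 0 <= taa -> 0 <= e2 ->
  x * x * tuu / 2 - 2 * tww <= x * x * tuu + 2 * (x * twu) ->
  tww <= K2 * S * tbb -> tbb <= c * taa ->
  x * x * (tuu / 2) <= 2 * x * twu + x * x * tuu + 2 * K2 * c * e2 * taa.
Proof.
move=> K0 Se b0 a0 e0 H1 H2 H3.
have H4 : tww <= K2 * e2 * (c * taa).
  apply: (le_trans H2); apply: (@le_trans _ _ (K2 * e2 * tbb)).
    by apply: ler_wpM2r => //; apply: ler_wpM2l.
  by apply: ler_wpM2l => //; exact: mulr_ge0.
have -> : x * x * (tuu / 2) = x * x * tuu / 2 by rewrite mulrA.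
have -> : 2 * x * twu = 2 * (x * twu) by rewrite mulrA.
have -> : 2 * K2 * c * e2 * taa = 2 * (K2 * e2 * (c * taa)) by ring.
lra.
Qed.

(** Write [b = i_X alpha] and [u = d b], so that [d(chi^2 b)] is 2 chi (d chi ^ b) + chi^2 u.
    Young's inequality for [chi * u] and d chi ^ b absorbs half of the main term; the square of d
    chi ^ b is controlled by [wedge1_le], and that of [b] by [contract_le], where the squared length
    of [X] is [c0]. *)
Lemma cutoff_form_le k (alpha : components k.+1) (chi : M -> R) (e : R) p :
  Omega alpha -> sm A setT chi ->
  (forall i q, dom i q -> gradient_square g i chi q <= e ^+ 2) ->
  chi p * chi p * (form_dot g (ext_deriv (interior g eta alpha)) (ext_deriv (interior g eta alpha)) p / 2)
  <= form_dot g (ext_deriv (scale_form (fun q => chi q * chi q) (interior g eta alpha)))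
       (ext_deriv (interior g eta alpha)) p
     + 2 * k.+1%:R ^+ 2 * c0 * e ^+ 2 * form_dot g alpha alpha p.
Proof.
move=> Oa chis grade; set b := interior g eta alpha; set u := ext_deriv b.
have Ob : Omega b := Omega_interior hg heta Oa.
have Ou : Omega u := Omega_ext_deriv Ob.
have Ot : Omega (ext_deriv (scale_form (fun q => chi q * chi q) b)).
  exact: Omega_ext_deriv (Omega_scale (sm_mul openT chis chis) Ob).
set i := chart_at p; have ip : dom i p := in_chart_at A p.
rewrite (form_dotE hg Ou Ou ip) (form_dotE hg Oa Oa ip) (form_dotE hg Ot Ou ip).
rewrite (ext_deriv_scale_square chis Ob ip) tdotDl !tdotZl.
have [Q Qu GE] := invmx_metric_factor hg ip; set G := invmx (g i p) in GE *.
have GT : G^T = G := invmx_metric_sym hg ip.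
set w := wedge1 _ _.
have H1 := tdot_Young GE (fun I => chi p * u i p I) w.
rewrite !tdotZl (tdotC _ _ GT) tdotZl (tdotC (u i p) w GT) !(mulrA (chi p) (chi p)) in H1.
have H2 := wedge1_le GE (fun a => pderiv i a chi p) (b i p); rewrite -/w in H2.
have H3 := contract_le Qu GE (X i p) (alpha i p).
rewrite invmxK -(eta_square_metric ip) (eta_square_eq ip) in H3.
have S : \sum_a \sum_c pderiv i a chi p * G a c * pderiv i c chi p <= e ^+ 2.
  have -> : \sum_a \sum_c pderiv i a chi p * G a c * pderiv i c chi p = gradient_square g i chi p.
    rewrite /gradient_square -/G [RHS]mxE exchange_big /=; apply: eq_bigr => c _.
    rewrite [_^T c 0]mxE [gradient_row _ _ _ _ _]mxE [_ 0 c]mxE mulr_suml.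
    by apply: eq_bigr => a _; rewrite [gradient_row _ _ _ _ _]mxE.
  exact: grade.
have := @cutoff_form_numeric (chi p) (k.+1%:R ^+ 2) _ (e ^+ 2) c0 (tdot G (u i p) (u i p)) (tdot G w (u i p))
  (tdot G w w) (tdot G (b i p) (b i p)) (tdot G (alpha i p) (alpha i p)) (sqr_ge0 _) S
  (tdot_ge0 GE _) (tdot_ge0 GE _) (sqr_ge0 _) H1 H2 H3.
(* The estimates were made on components without factorials; all inner products that remain are in
   degree [k.+1] and share this factor. *)
set F := (k.+1`!%:R)^-1; have F0 : 0 <= F by rewrite invr_ge0.
move=> /(ler_wpM2l F0); congr (_ <= _); ring.
Qed.

Section harmonic.
Hypothesis hcomplete : complete_metric g.
Variable vol : {measure set (g_sigma_algebraType (@open M)) -> \bar R}.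
Hypothesis hvol : riemannian_volume g vol.

Lemma form_dot_continuous k (v w : components k) : Omega v -> Omega w ->
  continuous (form_dot g v w).
Proof. by move=> Ov Ow p; exact: (sm_continuous (sm_form_dot hg Ov Ow)). Qed.

Lemma form_dot_supported_integrable k (v w : components k) K : Omega v -> Omega w ->
  compact K -> (forall i p I, ~ K p -> v i p I = 0) ->
  vol.-integrable setT (EFin \o form_dot g v w).
Proof.
move=> Ov Ow Kc v0; apply: (compact_support_integrable hg hvol (form_dot_continuous Ov Ow) Kc).
move=> p Kp; rewrite /form_dot big1 ?mulr0 // => I _; rewrite big1 // => J _.
by rewrite v0 // !mul0r.
Qed.

(* With theta := d(chi^2 i_X alpha), the test form i_X theta gives
   0 = <d i_X theta, alpha> = X<theta, alpha> - <theta, L_X alpha> after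
   integration, and the divergence of X vanishes. *)
Lemma integral_cutoff_form k (alpha : components k.+1) (chi : M -> R) :
  Omega alpha -> ext_deriv alpha = @zero_form R n M A k.+2 -> coclosed g vol alpha ->
  sm A setT chi -> (exists2 K, compact K & forall q, ~ K q -> chi q = 0) ->
  exists theta, [/\ theta = ext_deriv (scale_form (fun q => chi q * chi q) (interior g eta alpha)),
    vol.-integrable setT (EFin \o form_dot g theta (ext_deriv (interior g eta alpha))) &
    (\int[vol]_p (form_dot g theta (ext_deriv (interior g eta alpha)) p)%:E = 0)%E].
Proof.
move=> Oa da [_ cca] chis [K Kc chi0].
set b := interior g eta alpha; set u := ext_deriv b.
set theta := ext_deriv (scale_form (fun q => chi q * chi q) b).
have Ob : Omega b := Omega_interior hg heta Oa.
have Ou : Omega u := Omega_ext_deriv Ob.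
have Os : Omega (scale_form (fun q => chi q * chi q) b) := Omega_scale (sm_mul openT chis chis) Ob.
have Ot : Omega theta := Omega_ext_deriv Os.
have Oit := Omega_interior hg heta Ot.
have dt : ext_deriv theta = @zero_form R n M A k.+2 := ext_deriv_square_zero Os.
have cs : compactly_supported (scale_form (fun q => chi q * chi q) b).
  by exists K => // i p I Kp; rewrite /scale_form chi0 // !mul0r.
have ct : compactly_supported theta := compactly_supported_ext_deriv cs.
have cit := compactly_supported_interior g eta ct.
have cdit := compactly_supported_ext_deriv cit.
have test := cca _ Oit cit.
have [K1 K1c t0] := ct; have [K2 K2c dit0] := cdit.
have I1 := form_dot_supported_integrable Ot Ou K1c t0.
have I2 := form_dot_supported_integrable (Omega_ext_deriv Oit) Oa K2c dit0.
exists theta; split => //.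
have f0 p : ~ K1 p -> form_dot g theta alpha p = 0.
  move=> Kp; rewrite /form_dot big1 ?mulr0 // => I _; rewrite big1 // => J _.
  by rewrite t0 // !mul0r.
have LX := integral_lieX hg hvol heta heta_parallel (sm_form_dot hg Ot Oa) K1c f0.
move: LX; under eq_integral => p _.
  rewrite /lieX (derX_form_dot hg heta heta_parallel Ot Oa dt da (in_chart_at A p)) EFinD.
  over.
rewrite integralD //.
rewrite (_ : (\int[vol]_p (form_dot g (ext_deriv (interior g eta theta)) alpha p)%:E = 0)%E) ?add0e //.
rewrite test; under eq_integral do rewrite form_dot_zero_r.
exact: integral0.
Qed.

Lemma lie_derivative_zero k (alpha : components k.+1) : L2_harmonic g vol alpha ->
  ext_deriv (interior g eta alpha) = @zero_form R n M A k.+1.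
Proof.
move=> [[Oa L2a] da cca]; set u := ext_deriv (interior g eta alpha).
have Ou : Omega u := Omega_ext_deriv (Omega_interior hg heta Oa).
have z p : form_dot g u u p / 2 = 0.
  apply: (@cutoff_vanishing _ _ _ A g hg hcomplete vol hvol (fun p => form_dot g u u p / 2)
    (form_dot g alpha alpha) (2 * k.+1%:R ^+ 2 * c0)).
  - by move=> q; apply: cvgM; [exact: form_dot_continuous|exact: cvg_cst].
  - by move=> q; rewrite divr_ge0 // form_dot_ge0.
  - exact: form_dot_continuous.
  - exact: form_dot_ge0.
  - exact: L2a.
  move=> chi e e0 e1 chis chi01 chi0 grade.
  have [theta [tE It int0]] := integral_cutoff_form Oa da cca chis chi0.
  exists (form_dot g theta u); split; [exact: It|exact: int0|move=> q].
  have := cutoff_form_le q Oa chis grade; rewrite -tE -/u => /le_trans; apply.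
  rewrite lerD2l; apply: ler_wpM2r; first exact: form_dot_ge0.
  apply: ler_wpM2l; first by rewrite !mulr_ge0 // ?sqr_ge0 // ltW.
  (* Here [e <= 1] is used to pass from [e ^+ 2] to [e]. *)
  by rewrite expr2 ler_piMr // ltW.
apply/funext => i; apply/funext => p; apply/funext => I; rewrite /zero_form.
have [ip|ip] := pselect (dom i p); last by rewrite (Omega_out Ou ip).
have := z p => /eqP; rewrite mulf_eq0 invr_eq0 pnatr_eq0 orbF => /eqP.
by move=> /(form_dot_eq0 hg Ou ip) ->.
Qed.

(** In positive degree this is the Leibniz rule with [L_X alpha = 0]. Degree 0 has no interior
    product and is treated apart: a closed function has zero derivatives. *)
Lemma derX_norm_zero k (alpha : components k) i p : L2_harmonic g vol alpha -> dom i p ->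
  derX g eta i (form_dot g alpha alpha) p = 0.
Proof.
case: k alpha => [|k] alpha Ha ip; have [[Oa _] da _] := Ha; last first.
  rewrite (derX_form_dot hg heta heta_parallel Oa Oa da da ip) (lie_derivative_zero Ha).
  by rewrite form_dot_zero_l form_dot_zero_r addr0.
pose I0 : {ffun 'I_0 -> 'I_n} := [ffun m : 'I_0 => False_rect 'I_n (notF (ltn_ord m))].
have only I : I = I0 by apply/ffunP => -[].
have sa := Omega_sm i I0 Oa.
rewrite (derX_eq g eta (v := fun q => alpha i q I0 * alpha i q I0) (domO i) _ ip ip); last first.
  move=> q iq; rewrite (form_dotE hg Oa Oa iq) fact0 invr1 mul1r /tdot.
  by rewrite (big_pred1 I0) ?(big_pred1 I0) ?big_ord0 ?mulr1 // => I; rewrite /= (only I) eqxx.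
have z : derX g eta i (fun q => alpha i q I0) p = 0.
  rewrite /derX big1 // => c _.
  have := congr1 (fun w => w i p [ffun=> c]) da; rewrite /zero_form /ext_deriv mem_set //.
  rewrite big_ord_recl big_ord0 addr0 expr0 mul1r ffunE.
  rewrite (_ : (fun q => _) = fun q => alpha i q I0); last first.
    by apply/funext => q; congr (alpha i q _); exact: only.
  by move=> ->; rewrite mulr0.
by rewrite (derXM g eta sa sa ip ip) z mul0r mulr0 addr0.
Qed.

Lemma cutoff_norm_numeric (d e c l x N : R) : d ^+ 2 <= e ^+ 2 * c -> 0 <= e ->
  0 <= l <= 1 -> 0 <= x <= 1 -> 0 <= N -> - (l * (2 * x * d) * N) <= 2 * Num.sqrt c * e * N.
Proof.
move=> H e0 /andP[l0 l1] /andP[x0 x1] N0.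
have dle : `|d| <= e * Num.sqrt c.
  by have := ler_wsqrtr H; rewrite sqrtr_sqr (sqrtrM _ (sqr_ge0 e)) sqrtr_sqr (ger0_norm e0).
rewrite -mulNr; apply: ler_wpM2r => //.
apply: (@le_trans _ _ (2 * `|d|)); last by rewrite -mulrA ler_wpM2l // mulrC.
apply: (le_trans (ler_norm _)); rewrite normrN normrM (ger0_norm l0) !normrM (ger0_norm x0).
rewrite normr_nat; apply: (@le_trans _ _ (1 * (2 * 1 * `|d|))); last by rewrite mul1r mulr1.
apply: ler_pM => //; first by rewrite !mulr_ge0.
by apply: ler_wpM2r => //; apply: ler_wpM2l.
Qed.

Definition logistic (f : M -> R) p := (1 + expR (- f p))^-1.

Lemma logistic_den (f : M -> R) p : 0 < 1 + expR (- f p).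
Proof. by rewrite addr_gt0 // expR_gt0. Qed.

Lemma sm_exp_opp (f : M -> R) : sm A setT f -> sm A setT (fun p => expR (- f p)).
Proof. by move=> sf; apply: sm_expR openT _; exact: sm_opp openT sf. Qed.

Lemma sm_logistic (f : M -> R) : sm A setT f -> sm A setT (logistic f).
Proof.
move=> sf; apply: (sm_inv openT) => [p _|]; first by rewrite lt0r_neq0 // logistic_den.
by apply: (sm_add openT _ (sm_exp_opp sf)); exact: sm_cst.
Qed.

Lemma derX_logistic (f : M -> R) i p : primitive eta setT f -> dom i p ->
  derX g eta i (logistic f) p = logistic f p * logistic f p * expR (- f p) * c0.
Proof.
move=> pf ip; have [_ sf _] := pf.
have sE := sm_exp_opp sf; have sL := sm_logistic sf.
have s1 : sm A setT (fun q => 1 + expR (- f q)) := sm_add openT (sm_cst A setT 1) sE.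
have dE : derX g eta i (fun q => expR (- f q)) p = - expR (- f p) * c0.
  rewrite -(derX_primitive pf ip) /derX mulr_sumr; apply: eq_bigr => c _.
  have D : is_derive (f p) (1 : R) (fun t : R => expR (- t)) (- expR (- f p)).
    have D0 : is_derive (f p) (1 : R) (fun t : R => - t) (- 1).
      exact: is_deriveN (is_derive_id (f p) (1 : R)).
    by apply: (is_derive_eq (@is_derive1_comp _ expR (fun t : R => - t) (f p) _ _ (is_derive_expR _) D0)); rewrite mulrN1.
  by rewrite (pderiv_comp1 c sf I ip D) mulrCA.
have d1 : derX g eta i (fun q => 1 + expR (- f q)) p = - expR (- f p) * c0.
  by rewrite (derXD g eta (sm_cst A setT 1) sE I ip) dE derX_cst add0r.
have den0 q : 1 + expR (- f q) != 0 by rewrite lt0r_neq0 // logistic_den.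
(* The derivative of the logistic function is obtained by differentiating its product with
   [1 + expR (- f)], which is constantly 1. *)
have := derXM g eta sL s1 I ip.
rewrite (_ : (fun q => _) = fun=> 1); last by apply/funext => q; rewrite /logistic mulVf.
rewrite derX_cst d1 => /esym/eqP; rewrite addr_eq0 => /eqP H.
have -> : derX g eta i (logistic f) p = derX g eta i (logistic f) p * (1 + expR (- f p)) * logistic f p.
  by rewrite /logistic -mulrA mulfV // mulr1.
by rewrite H; ring.
Qed.

(** The flux of [L chi^2 |alpha|^2] along [X] integrates to 0. As [X |alpha|^2 = 0], only two terms
    remain: the derivative of [L], which is positive, and that of [chi ^+ 2], which is of the order
    of the gradient of [chi] because [L] is bounded. *)
Lemma harmonic_norm_zero k (alpha : components k) f p : L2_harmonic g vol alpha ->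
  primitive eta setT f -> form_dot g alpha alpha p = 0.
Proof.
move=> Ha pf; have [[Oa L2a] _ _] := Ha; have [_ sf _] := pf.
set N := form_dot g alpha alpha in L2a *.
have N0 q : 0 <= N q := form_dot_ge0 hg alpha q.
have sN : sm A setT N := sm_form_dot hg Oa Oa.
pose L := logistic f; have sL : sm A setT L := sm_logistic sf.
have L01 q : 0 <= L q <= 1.
  have l0 := logistic_den f q; rewrite /L /logistic invr_ge0 ltW //=.
  by rewrite invf_le1 // lerDl expR_ge0.
(* The derivative of [L] along [X]. It is positive at every point, so vanishing of [D * N] suffices
   even though [D] may have no positive lower bound. *)
pose D q := L q * L q * expR (- f q) * c0.
have sD : sm A setT D.
  by apply: (sm_mul openT (sm_mul openT (sm_mul openT sL sL) (sm_exp_opp sf))); exact: sm_cst.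
have D0 q : 0 < D q.
  have l0 : 0 < L q by rewrite invr_gt0 logistic_den.
  by rewrite /D !mulr_gt0 // expR_gt0.
have z : D p * N p = 0.
  apply: (@cutoff_vanishing _ _ _ A g hg hcomplete vol hvol (fun p => D p * N p) N (2 * Num.sqrt c0)).
  - by move=> q; exact: (sm_continuous (sm_mul openT sD sN)).
  - by move=> q; rewrite mulr_ge0 // ltW.
  - by move=> q; exact: (sm_continuous sN).
  - exact: N0.
  - exact: L2a.
  move=> chi e e0 _ chis chi01 [K Kc chi0] grade.
  have s2 := sm_mul openT chis chis.
  have s3 := sm_mul openT sL s2.
  pose F q := L q * (chi q * chi q) * N q.
  have sF : sm A setT F := sm_mul openT s3 sN.
  have F0 q : ~ K q -> F q = 0 by move=> /chi0 h; rewrite /F h !mulr0 mul0r.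
  exists (lieX g eta F); split.
  - apply: (compact_support_integrable hg hvol _ Kc).
      by move=> q; exact: (sm_continuous (sm_lieX hg heta sF)).
    exact: (lieX_support g eta (manifold_compact_closed A Kc) F0).
  - exact: (integral_lieX hg hvol heta heta_parallel sF Kc F0).
  move=> q; have iq := in_chart_at A q.
  rewrite /lieX /F (derXM g eta s3 sN I iq) (derX_norm_zero Ha iq) mulr0 addr0.
  rewrite (derXM g eta sL s2 I iq) (derX_logistic pf iq) -/L -/(D q).
  rewrite (derXM g eta chis chis I iq).
  have gd : derX g eta (chart_at q) chi q ^+ 2 <= e ^+ 2 * c0.
    apply: (le_trans (derX_gradient_le chi iq)); apply: ler_wpM2r; first exact: ltW.
    exact: grade.
  have := cutoff_norm_numeric gd (ltW e0) (L01 q) (chi01 q) (N0 q).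
  set d := derX g eta (chart_at q) chi q; clear; move=> H.
  have -> : (D q * (chi q * chi q) + L q * (d * chi q + chi q * d)) * N q
    = chi q * chi q * (D q * N q) + L q * (2 * chi q * d) * N q by ring.
  lra.
by move/eqP: z; rewrite mulf_eq0 (gt_eqF (D0 p)) /= => /eqP.
Qed.

End harmonic.

End parallel_one_form.

Theorem theorem1p1 (R : realType) (n : nat) (M : ptopologicalType)
  (A : smooth_manifold R n M)
  (g : chart A -> M -> 'M[R]_n)
  (vol : {measure set (g_sigma_algebraType (@open M)) -> \bar R})
  (eta : components A 1)
  (hM : @simply_connected R M)
  (hg : riemannian_metric g)
  (hcomplete : complete_metric g)
  (hvol : riemannian_volume g vol)
  (heta : Omega eta)
  (heta_closed : ext_deriv eta = @zero_form R n M A 2)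
  (heta_nonzero : eta <> @zero_form R n M A 1)
  (heta_parallel : parallel g eta)
  (k : nat) (hk : (k <= n)%N) :
  @L2_harmonic R n M A g vol k = [set @zero_form R n M A k].
Proof.
apply/seteqP; split=> [alpha Ha|_ ->].
  have [f pf] := primitive_exists heta heta_closed hM.
  have [c c_gt0 cE] := eta_square_constant hg heta heta_parallel hM.1 heta_nonzero.
  have [[Oa _] _ _] := Ha.
  apply/funext => i; apply/funext => p.
  have [ip|ip] := pselect (dom i p); last exact: Omega_out Oa ip.
  apply: (form_dot_eq0 hg Oa ip).
  exact: (harmonic_norm_zero hg heta heta_parallel c_gt0 cE hcomplete hvol p Ha pf).
have zero_deriv m : ext_deriv (@zero_form R n M A m) = @zero_form R n M A m.+1.
  apply/funext => i; apply/funext => p; apply/funext => I.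
  rewrite /ext_deriv /zero_form; case: ifP => // _; rewrite big1 // => l _.
  have -> : pderiv i (I l) (fun=> 0) p = 0 := pderiv_cst i (I l) 0 p.
  by rewrite mulr0.
split; [split; [exact: Omega_zero|] | exact: zero_deriv | ].
  by under eq_integral do rewrite form_dot_zero_l; rewrite integral0 ltry.
case: k {hk} => // k; split; first exact: Omega_zero.
move=> b _ _; apply: eq_integral => p _; by rewrite !form_dot_zero_r.
Qed.
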